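(* Let $\nu>-1$ and $\delta>0$, and let $$p_0(\delta)=\begin{cases}1,& \text{if } \delta>\nu+1/2 \text{ or } -1<\nu\le -1/2,\\ \frac{4(\nu+1)}{2\nu+3+2\delta},& \text{if } \delta\le \nu+1/2 \text{ and } \nu>-1/2.\end{cases}$$ Then there is $C$ independent of $f$ such that $$\|\mathcal{B}^\delta f\|_{L^{p_0(\delta),\infty}((0,1),d\mu_\nu)}\le C\|f\|_{L^{p_0(\delta)}((0,1),d\mu_\nu)}.$$
   Context: Let $J_\nu$ be the Bessel function of order $\nu>-1$, $0<s_1<s_2<\dots$ its successive positive zeros, $d\mu_\nu(x)=x^{2\nu+1}dx$ on $(0,1)$, $\psi_j(x)=\frac{\sqrt2}{|J_{\nu+1}(s_j)|}x^{-\nu}J_\nu(s_jx)$, $a_j(f)=\int_0^1 f\psi_j\,d\mu_\nu$. For $\delta>0$, $R>0$, $\mathcal{B}_R^\delta(f,x)=\sum_{j\ge1}(1-s_j^2/R^2)_+^\delta a_j(f)\psi_j(x)$ with $(1-s^2)_+=\max\{1-s^2,0\}$, and $\mathcal{B}^\delta f(x)=\sup_{R>0}|\mathcal{B}_R^\delta(f,x)|$. For $1\le q<\infty$, $L^{q,\infty}((0,1),d\mu_\nu)$ is the weak $L^q$ space with quasinorm $\|g\|_{L^{q,\infty}}=\sup_{\lambda>0}\lambda\,\mu_\nu(\{x\in(0,1):|g(x)|>\lambda\})^{1/q}$. *)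

(* Defs.v *)
From HB Require Import structures.
From mathcomp Require Import all_boot all_order all_algebra.
From mathcomp Require Import all_classical all_reals all_analysis.
Set Implicit Arguments. Unset Strict Implicit. Unset Printing Implicit Defensive.
Import Order.TTheory GRing.Theory Num.Theory.
Import numFieldNormedType.Exports.
Local Open Scope classical_set_scope.
Local Open Scope ring_scope.

Section BesselDefs.
Variable R : realType.
Local Notation leb := (@lebesgue_measure R).

Definition Gamma (s : R) : R :=
  Rintegral leb `]0%R, +oo[ (fun t => powR t (s - 1) * expR (- t)).

Definition besselJ (nu x : R) : R :=
  limn (series (fun k : nat =>
    (-1) ^+ k / ((k`!)%:R * Gamma (k%:R + nu + 1)) * powR (x / 2) (2 * k%:R + nu))).

(* s is the increasing enumeration (indexed from 0) of the positive zeros of J_nu: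
   s 0 = s_1 < s 1 = s_2 < ... *)
Definition bessel_zeros (nu : R) (s : nat -> R) : Prop :=
  [/\ (forall j, 0 < s j),
      (forall j, besselJ nu (s j) = 0),
      (forall i j, (i < j)%N -> s i < s j) &
      (forall x, 0 < x -> besselJ nu x = 0 -> exists j, s j = x)].

Definition weight (nu x : R) : R := powR x (2 * nu + 1).

Definition psi (nu : R) (s : nat -> R) (j : nat) (x : R) : R :=
  Num.sqrt 2 / `|besselJ (nu + 1) (s j)| * powR x (- nu) * besselJ nu (s j * x).

Definition coef (nu : R) (s : nat -> R) (f : R -> R) (j : nat) : R :=
  Rintegral leb `]0%R, 1%R[ (fun x => f x * psi nu s j x * weight nu x).

Definition BR (nu delta : R) (s : nat -> R) (r : R) (f : R -> R) (x : R) : R :=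
  limn (series (fun j : nat =>
    powR (Num.max (1 - s j ^+ 2 / r ^+ 2) 0) delta * coef nu s f j * psi nu s j x)).

Definition Bmax (nu delta : R) (s : nat -> R) (f : R -> R) (x : R) : \bar R :=
  ereal_sup [set (`|BR nu delta s r f x|)%:E | r in `]0%R, +oo[].

Definition mu_nu (nu : R) (A : set R) : \bar R :=
  (\int[leb]_(x in A `&` `]0%R, 1%R[) (weight nu x)%:E)%E.

Definition Lp_norm (nu p : R) (f : R -> R) : \bar R :=
  poweR (\int[leb]_(x in `]0%R, 1%R[) (powR `|f x| p * weight nu x)%:E)%E p^-1.

Definition weakL_norm (nu q : R) (g : R -> \bar R) : \bar R :=
  ereal_sup [set (lam%:E * poweR (mu_nu nu (`]0%R, 1%R[%classic `&` [set x | (lam%:E < `|g x|)%E])) q^-1)%E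
            | lam in `]0%R, +oo[].

Definition p0 (nu delta : R) : R :=
  if (nu + 1 / 2 < delta) || (nu <= - (1 / 2)) then 1
  else 4 * (nu + 1) / (2 * nu + 3 + 2 * delta).

End BesselDefs.

(* Main.v *)
(* On a suitable half line, [sqrt z * J_nu z] is [B * sqrt p * sin th] with [th' = 1 / p], where
   [p - 1] is a symbol of order [-2] in [1 / z]; the zeros are the points where [th] is a multiple
   of [pi].  Hence the kernel of the Riesz mean of order [d] is a sum over [j] of a smooth function
   of [s_j] times [cos (a * s_j)], and high-order differences in [j] bound it by
       [C r (x y)^-(nu + 1/2) w(r x) w(r y) (1 + r |x - y|)^-(1 + d)],  [w z = min(1, z)^(nu + 1/2)].
   The multiplier [(1 - z)_+^d] is not flat at [0]: one first subtracts a combination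
   [sum_k D_k / (k + 1 + z)] with the same Taylor polynomial at [0] and high decay at infinity.
   The kernels of these resolvents are Green functions, which decay exponentially; identifying the
   resolvent series with the Green function uses the completeness of the [psi_j], obtained by the
   power method for the inverse of the Bessel operator.
   By Young's inequality, the part of the kernel away from [x / 2 < y < 2 x] maps [f] to a function
   bounded by [C x^(-(2 nu + 2) / p) |f|_p], which lies in weak [L^p]; the remaining part is bounded
   by the Hardy-Littlewood maximal function of [|f|^p] on dyadic blocks, where the weight is
   essentially constant. *)

Require Import Defs.
From HB Require Import structures.
From mathcomp Require Import all_boot all_order all_algebra.
From mathcomp Require Import all_classical all_reals all_analysis.
From mathcomp Require Import measurable_realfun.
From mathcomp Require Import ring lra zify.
From Stdlib Require Import Lia.
Set Implicit Arguments. Unset Strict Implicit. Unset Printing Implicit Defensive.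
Import Order.TTheory GRing.Theory Num.Theory.
Import numFieldNormedType.Exports.
Local Open Scope classical_set_scope.
Local Open Scope ring_scope.

(** * Calculus on the half line *)

(** The step [M] of the differences is about [1 / |x - y|], so that [2 - 2 * cos] of the phase
    increment is at least [1] and no small divisor appears. At the edge [s_j = r] the multiplier has
    only smoothness [d]: about [M] terms of size [(M / r)^d] survive there, and their total
    [M (M / r)^d] is exactly the decay [r (r |x - y|)^-(1 + d)]. Elsewhere differences of high order
    are smaller still. All facts on Bessel functions are drawn from the power series, the
    differential equation and the enumeration of the zeros; even [Gamma (nu + 1) != 0] comes from
    the latter. Write [kap = nu + 1 / 2]. For [0 < d <= kap] the kernel away from the diagonal has
    size [x^-(kap + 1 + d)], and [p] is the exponent with [(2 nu + 2) / p = kap + 1 + d]. For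
    [delta > kap > 0] the bound is used with the weaker decay [d = kap], at which this formula gives
    [p = 1]; for [kap <= 0] the size is [x^-(2 nu + 2)], again with [p = 1]. Thus one argument
    covers all cases of the exponent. *)

Ltac nng_ext := fail.
Ltac nng := solve [repeat first [done | exact: ltW | exact: powR_ge0 | exact: sqr_ge0 | exact: sqrtr_ge0
  | exact: expR_ge0 | exact: expR_gt0 | exact: pi_ge0 | exact: pi_gt0 | nng_ext
  | apply: mulr_gt0 | apply: mulr_ge0 | apply: exprn_gt0 | apply: exprn_ge0 | apply: addr_gt0
  | apply: addr_ge0 | apply: powR_gt0 | rewrite invr_ge0 | rewrite invr_gt0 | rewrite subr_ge0 | rewrite subr_gt0]].

Section Calculus.
Context {R : realType}.
Implicit Types (f g : R -> R) (x y a b e s t l : R).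

(** A relation, so that the derivative computed by the rules can be exchanged for any expression
    equal to it through [der_eq]. *)
Definition der (f : R -> R) (x d : R) : Prop := is_derive x 1 f d.

Lemma der_eq f x a b : der f x a -> a = b -> der f x b.
Proof. by move=> h <-. Qed.

Lemma der_ext f g x a : (forall t, f t = g t) -> der f x a -> der g x a.
Proof. by move=> /funext ->. Qed.

Lemma der_cst (c x : R) : der (fun _ : R => c) x 0.
Proof. exact: is_derive_cst. Qed.

Lemma der_id (x : R) : der (fun t : R => t) x 1.
Proof. exact: is_derive_id. Qed.

Lemma derD f g x a b : der f x a -> der g x b ->
  der (fun t => f t + g t) x (a + b).
Proof. by move=> ? ?; exact: is_deriveD. Qed.

Lemma derN f x a : der f x a -> der (fun t => - f t) x (- a).
Proof. by move=> ?; exact: is_deriveN. Qed.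

Lemma derB f g x a b : der f x a -> der g x b ->
  der (fun t => f t - g t) x (a - b).
Proof. by move=> ? ?; exact: is_deriveB. Qed.

Lemma derM f g x a b : der f x a -> der g x b ->
  der (fun t => f t * g t) x (a * g x + f x * b).
Proof.
move=> hf hg; have h := @is_deriveM R R f g x 1 a b hf hg.
by apply: (der_eq h); rewrite addrC; congr (_ + _); exact: mulrC.
Qed.

Lemma der_comp f g x a b : der f (g x) a -> der g x b ->
  der (fun t => f (g t)) x (a * b).
Proof. by move=> hf hg; exact: (@is_derive1_comp R f g x a b hf hg). Qed.

Lemma derX f n x a : der f x a ->
  der (fun t => f t ^+ n) x (n%:R * f x ^+ n.-1 * a).
Proof.
move=> h; elim: n => [|n ih].
  apply: (@der_ext (fun=> 1)) => [t|]; first by rewrite expr0.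
  by apply: (der_eq (der_cst _ _)); rewrite !mul0r.
apply: (@der_ext (fun t => f t * f t ^+ n)) => [t|]; first by rewrite exprS.
apply: der_eq; first by exact: (derM h ih).
case: n {ih} => [|n] /=; first by rewrite expr0; ring.
by rewrite exprS (natrD _ 1 n.+1); ring.
Qed.

Lemma derV f x a : f x != 0 -> der f x a ->
  der (fun t => (f t)^-1) x (- a / f x ^+ 2).
Proof.
move=> fx h; apply: (der_eq (@is_deriveV R f x a 1 fx h)).
by rewrite /GRing.scale /= mulNr mulNr mulrC.
Qed.

Lemma der_sin f x a : der f x a ->
  der (fun t => sin (f t)) x (cos (f x) * a).
Proof. by move=> h; exact: (der_comp (is_derive_sin (f x)) h). Qed.

Lemma der_cos f x a : der f x a ->
  der (fun t => cos (f t)) x (- sin (f x) * a).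
Proof. by move=> h; exact: (der_comp (is_derive_cos (f x)) h). Qed.

Lemma der_exp f x a : der f x a ->
  der (fun t => expR (f t)) x (expR (f x) * a).
Proof. by move=> h; exact: (der_comp (is_derive_expR (f x)) h). Qed.

Lemma der_powR f (b : R) x a : 0 < f x -> der f x a ->
  der (fun t => powR (f t) b) x (b * powR (f x) (b - 1) * a).
Proof. by move=> h1 h; exact: (der_comp (is_derive1_powR b h1) h). Qed.

Lemma der_sqrt f x a : 0 < f x -> der f x a ->
  der (fun t => Num.sqrt (f t)) x ((2 * Num.sqrt (f x))^-1 * a).
Proof. by move=> h1 h; exact: (der_comp (is_derive1_sqrt h1) h). Qed.

Lemma der_cont f x a : der f x a -> {for x, continuous f}.
Proof. by move=> [h _]; apply: differentiable_continuous; exact/derivable1_diffP. Qed.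

Lemma der_uniq f x a b : der f x a -> der f x b -> a = b.
Proof. by move=> [_ <-] [_ <-]. Qed.

Lemma der_within a b f (df : R -> R) :
  (forall x, a <= x <= b -> der f x (df x)) -> {within `[a, b], continuous f}.
Proof.
move=> h; apply: continuous_in_subspaceT => x.
rewrite inE /= in_itv /= => xab; exact: der_cont (h _ xab).
Qed.

Lemma der_MVTo a b f (df : R -> R) : a < b ->
  (forall x, a <= x <= b -> der f x (df x)) ->
  exists2 c, a < c < b & f b - f a = df c * (b - a).
Proof.
move=> ab h; have hd x : x \in `]a, b[ -> is_derive x 1 f (df x).
  by rewrite in_itv /= => /andP[xa xb]; apply: h; rewrite !ltW.
by have [c cab hc] := MVT ab hd (der_within h); exists c => //; move: cab; rewrite in_itv.
Qed.

Lemma der_MVT a b f (df : R -> R) : a <= b ->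
  (forall x, a <= x <= b -> der f x (df x)) ->
  exists2 c, a <= c <= b & f b - f a = df c * (b - a).
Proof.
rewrite le_eqVlt => /predU1P[-> h|ab h]; first by exists b; rewrite ?lexx// !subrr mulr0.
by have [c /andP[/ltW ac /ltW cb] hc] := der_MVTo ab h; exists c; rewrite ?ac.
Qed.

Lemma der_nondecr a b f (df : R -> R) : a <= b ->
  (forall x, a <= x <= b -> der f x (df x)) ->
  (forall x, a <= x < b -> 0 <= df x) -> f a <= f b.
Proof.
rewrite le_eqVlt => /predU1P[-> //|ab] h h0; have [c /andP[ac cb] hc] := der_MVTo ab h.
by rewrite -subr_ge0 hc mulr_ge0 ?h0 ?(ltW ac)// subr_ge0 ltW.
Qed.

Lemma der_const a b f : a <= b ->
  (forall x, a <= x <= b -> der f x 0) -> f a = f b.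
Proof.
move=> ab h; have [c cab /eqP] := der_MVT ab h.
by rewrite mul0r subr_eq0 => /eqP ->.
Qed.

(** Both [g + f] and [g - f] are nondecreasing. Most integral estimates of the development are such
    comparisons with an explicit antiderivative. *)
Lemma der_dominated a b f g (df dg : R -> R) : a <= b ->
  (forall x, a <= x <= b -> der f x (df x)) ->
  (forall x, a <= x <= b -> der g x (dg x)) ->
  (forall x, a <= x < b -> `|df x| <= dg x) -> `|f b - f a| <= g b - g a.
Proof.
move=> ab hf hg h; have hp x : a <= x < b -> 0 <= df x + dg x /\ 0 <= dg x - df x.
  by move=> xab; have := h x xab; rewrite ler_norml => /andP[? ?]; split; lra.
have := der_nondecr ab (fun x xab => derD (hf x xab) (hg x xab)) (fun x xab => (hp x xab).1).
have := der_nondecr ab (fun x xab => derB (hg x xab) (hf x xab)) (fun x xab => (hp x xab).2).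
by move=> /= h1 h2; rewrite ler_norml; apply/andP; split; lra.
Qed.

Lemma der_lip a b f (df : R -> R) B : a <= b ->
  (forall x, a <= x <= b -> der f x (df x)) ->
  (forall x, a <= x < b -> `|df x| <= B) -> `|f b - f a| <= B * (b - a).
Proof.
move=> ab h h0; rewrite mulrBr; apply: der_dominated ab h _ h0 => x _.
by apply: (der_eq (derM (der_cst B x) (der_id x))); rewrite mul0r add0r mulr1.
Qed.

Lemma der_congr_near f g x a : (\near x, f x = g x) -> der f x a -> der g x a.
Proof. by move=> h; apply: near_eq_is_derive. Qed.

Lemma der_congr_lt f g x a b : b < x -> (forall t, b < t -> f t = g t) ->
  der f x a -> der g x a.
Proof.
move=> bx h; apply: der_congr_near; near=> t; apply: h; near: t.
exact: lt_nbhsr.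
Unshelve. all: by end_near. Qed.

Lemma der_congr_gt f g x a b : x < b -> (forall t, t < b -> f t = g t) ->
  der f x a -> der g x a.
Proof.
move=> bx h; apply: der_congr_near; near=> t; apply: h; near: t.
exact: lt_nbhsl.
Unshelve. all: by end_near. Qed.

Local Notation leb := (@lebesgue_measure R).

Lemma antideriv_itv f a b c : a < b -> c < a ->
  (forall x, c < x -> {for x, continuous f}) ->
  forall x, a < x -> x < b -> der (fun y => \int[leb]_(t in `[a, y]) f t) x (f x).
Proof.
move=> ab ca fc x ax xb.
have hi : leb.-integrable `[a, b] (EFin \o f).
  apply: continuous_compact_integrable; first exact: segment_compact.
  apply: continuous_in_subspaceT => t; rewrite inE/= in_itv/= => /andP[at1 _].
  by apply: fc; exact: lt_le_trans at1.
have [h1 h2] := continuous_FTC1_closed xb hi ax (fc _ (lt_trans ca ax)).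
by split; [exact: h1|rewrite -derive1E; exact: h2].
Qed.

(** Since [f] may fail to be integrable at [0], the base point [Num.min y 1 / 2] moves with [y];
    subtracting the value at [1] removes the dependence on it. *)
Lemma antideriv f : (forall x, 0 < x -> {for x, continuous f}) ->
  exists F : R -> R, forall x, 0 < x -> der F x (f x).
Proof.
move=> fc.
pose H a y := \int[leb]_(t in `[a, y]) f t.
pose F y := H (Num.min y 1 / 2) y - H (Num.min y 1 / 2) 1.
have hH a b x : 0 < a -> a < x -> der (H a) x (f x).
  move=> a0 ax; apply: (@antideriv_itv f a (x + 1) 0) => //; rewrite ?ltrDl//.
  by apply: (lt_trans ax); rewrite ltrDl.
have Hcst a b x y : 0 < a -> a < b -> b < x -> b < y -> H a x - H a y = H b x - H b y.
  move=> a0 ab bx by_.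
  wlog xy : x y bx by_ / x <= y.
    move=> hw; have [xy|yx] := leP x y; first exact: hw.
    by have := hw y x by_ bx (ltW yx); lra.
  have /= := @der_const x y (fun t => H a t - H b t) xy.
  have k : forall t, x <= t <= y -> der (fun t => H a t - H b t) t 0.
    move=> t /andP[xt _]; apply: der_eq.
      apply: derB; apply: hH => //; first (by apply: lt_le_trans xt; exact: lt_trans bx).
      - by exact: lt_trans ab.
      - exact: lt_le_trans xt.
    by rewrite subrr.
  by move=> /(_ k); lra.
exists F => x x0.
have m0 : 0 < Num.min x 1 / 4 by rewrite divr_gt0 // lt_min x0 /=.
set m := Num.min x 1 / 4 in m0.
have mx : m * 4 <= x by rewrite /m divfK // ge_min lexx.
have m1 : m * 4 <= 1 by rewrite /m divfK // ge_min lexx orbT.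
apply: (@der_congr_lt (fun y => H m y - H m 1) F x _ (2 * m)); first by lra.
  move=> t tx; rewrite /F; apply: Hcst => //.
  - rewrite ltr_pdivlMr // lt_min; apply/andP; split; lra.
  - rewrite ltr_pdivrMr // gt_min; apply/orP; left; lra.
  - rewrite ltr_pdivrMr // gt_min; apply/orP; right; lra.
apply: der_eq; first by apply: derB; [apply: hH => //; lra|exact: der_cst].
by rewrite subr0.
Qed.

(** The lower bounds [f s - G s] stay below the upper bounds [f t + G t], and their supremum is the
    limit of [f], with rate [G]. It serves at infinity and, through [t^-1], at [0]. *)
Lemma limit_squeeze f (G : R -> R) a :
  (forall s t, a <= s -> s <= t -> `|f t - f s| <= G s - G t) ->
  (forall e, 0 < e -> forall s, exists2 t, s <= t & `|G t| <= e) ->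
  exists l, forall s, a <= s -> `|f s - l| <= G s.
Proof.
move=> h hG.
have Gge s t : a <= s -> s <= t -> G t <= G s.
  by move=> as_ st; have := le_trans (normr_ge0 _) (h s t as_ st); lra.
have G0 s : a <= s -> 0 <= G s.
  move=> as_; rewrite leNgt; apply/negP => Gs.
  have [t st] := hG (- G s / 2) ltac:(lra) s.
  by have := Gge _ _ as_ st; rewrite ler_norml; lra.
pose S := [set z | exists2 s, a <= s & z = f s - G s].
have hS : has_sup S.
  split; first by exists (f a - G a), a.
  exists (f a + G a) => z [s as_ ->].
  have := h a s (lexx _) as_; rewrite ler_norml => /andP[_].
  by have := G0 s as_; lra.
exists (sup S) => s as_; rewrite ler_norml; apply/andP; split.
- suff : sup S <= f s + G s by lra.
  apply: ge_sup; first by case: hS.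
  move=> z [t at1 ->]; have [ts|st] := leP t s.
    by have := h t s at1 ts; rewrite ler_norml => /andP[h1 h2]; have := G0 s as_; lra.
  by have := h s t as_ (ltW st); rewrite ler_norml => /andP[h1 h2]; have := G0 t at1; lra.
- suff : f s - G s <= sup S by lra.
  by apply: ub_le_sup; [case: hS|exists s].
Qed.

Lemma powR_le (r x y : R) : 0 <= r -> 0 <= x -> x <= y -> powR x r <= powR y r.
Proof. by move=> r0 x0 xy; rewrite ge0_ler_powR// ?nnegrE// (le_trans x0). Qed.

Lemma powR_leN (r x y : R) : r <= 0 -> 0 < x -> x <= y -> powR y r <= powR x r.
Proof.
move=> + x0 xy; have [q ->] : exists q, r = - q by exists (- r); rewrite opprK.
rewrite oppr_le0 => q0.
rewrite !powRN lef_pV2 ?posrE ?powR_gt0 ?(lt_le_trans x0)//.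
by apply: powR_le => //; exact: ltW.
Qed.

End Calculus.

Ltac head_of t := lazymatch t with ?f _ => head_of f | _ => t end.

(** Differentiation by recursion on the head symbol under the binder. [derB] is tried before [derD]
    because a difference is a sum with an opposite. Positivity and nonvanishing conditions are left
    as goals. *)
Ltac deriv :=
  lazymatch goal with
  | |- @der ?R (fun _ => ?c) _ _ => eapply (@der_cst R)
  | |- @der ?R ?F ?y ?d =>
    let h := constr:(fun x : Real.sort R => ltac:(
      let b := eval cbv beta in (F x) in let hd := head_of b in exact hd)) in
    lazymatch h with
    | (fun x => x) => eapply (@der_id R)
    | (fun _ => @Algebra.add) =>
      first [eapply (@derB R) | eapply (@derD R)]; deriv
    | (fun _ => @Algebra.opp) => eapply (@derN R); deriv
    | (fun _ => @GRing.mul) => eapply (@derM R); deriv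
    | (fun _ => @GRing.inv) => eapply (@derV R); [idtac|deriv]
    | (fun _ => @GRing.exp) => eapply (@derX R); deriv
    | (fun _ => @sin) => eapply (@der_sin R); deriv
    | (fun _ => @cos) => eapply (@der_cos R); deriv
    | (fun _ => @expR) => eapply (@der_exp R); deriv
    | (fun _ => @powR) => eapply (@der_powR R); [idtac|deriv]
    | (fun _ => @Num.sqrt) => eapply (@der_sqrt R); [idtac|deriv]
    | (fun _ => ?f) => first [eassumption | change (@der R f y d);
        match goal with H : context [@der R f _ _] |- _ => eapply H end | idtac]
    | _ => idtac
    end
  | _ => idtac
  end.

(** * Integrals over open intervals by exhaustion *)

Section Integrals.
Context {R : realType}.
Local Notation leb := (@lebesgue_measure R).
Implicit Types (f g F : R -> R) (a b : nat -> R) (D : set R) (x d e t : R).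

Lemma der_FTC (x y : R) f F : x < y ->
  (forall t, x <= t <= y -> {for t, continuous f}) ->
  (forall t, x <= t <= y -> der F t (f t)) ->
  (\int[leb]_(t in `[x, y]) (f t)%:E = (F y - F x)%:E)%E.
Proof.
move=> xy cf dF; rewrite EFinB; apply: continuous_FTC2 => //.
- by apply: continuous_in_subspaceT => t; rewrite inE/= in_itv/=; exact: cf.
- split.
  + move=> t; rewrite in_itv/= => /andP[xt ty].
    by have /dF[] : x <= t <= y by rewrite (ltW xt) (ltW ty).
  + by apply: cvg_at_right_filter; apply: (der_cont (dF x _)); rewrite lexx ltW.
  + by apply: cvg_at_left_filter; apply: (der_cont (dF y _)); rewrite lexx ltW.
- move=> t; rewrite in_itv/= => /andP[xt ty]; rewrite derive1E.
  by have /dF[_ ->] : x <= t <= y by rewrite (ltW xt) (ltW ty).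
Qed.

(** Increasing segments filling an open set: a common interface for the interval []0, 1[] and for
    the half line of the Gamma integral. *)
Definition exhaust D a b :=
  [/\ open D, (forall n, a n < b n), (forall n x, a n <= x <= b n -> D x),
      (forall m n, (m <= n)%N -> a n <= a m /\ b m <= b n) &
      (forall x, D x -> exists N, a N <= x <= b N)].

Lemma exhaust_bigcup D a b : exhaust D a b -> \bigcup_n `[a n, b n]%classic = D.
Proof.
move=> [_ _ h1 _ h2]; apply/seteqP; split => x /=.
  by move=> [n _]; rewrite /= in_itv/=; exact: h1.
by move=> /h2[N hN]; exists N => //=; rewrite in_itv.
Qed.

Lemma exhaust_nd D a b : exhaust D a b ->
  nondecreasing_seq (fun n => `[a n, b n]%classic : set R).
Proof.
move=> [_ _ _ h _]; move=> m n mn; rewrite subsetEset => x /=; rewrite !in_itv/=.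
have [h1 h2] := h m n mn; move=> /andP[xa xb].
by rewrite (le_trans h1 xa) (le_trans xb h2).
Qed.

Lemma continuous_on_measurable D f : open D -> (forall x, D x -> {for x, continuous f}) ->
  measurable_fun D f.
Proof. by move=> oD h; apply: open_continuous_measurable_fun => // x; rewrite inE; exact: h. Qed.

(** Monotone convergence: over each segment the integral is a difference of two values of [F], at
    most [2 * B]. *)
Lemma integrable_antideriv D a b f F (B : R) : exhaust D a b ->
  (forall x, D x -> {for x, continuous f}) -> (forall x, D x -> 0 <= f x) ->
  (forall x, D x -> der F x (f x)) -> (forall x, D x -> `|F x| <= B) ->
  leb.-integrable D (EFin \o f).
Proof.
move=> E cf f0 dF FB; have [oD ab aD nd ex] := E.
have mD : measurable D by exact: open_measurable.
have mf : measurable_fun D (EFin \o f).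
  by apply/measurable_EFinP; exact: continuous_on_measurable.
apply/integrableP; split => //.
under eq_integral => x /[1!inE] Dx do rewrite /= ger0_norm ?f0//.
rewrite -(exhaust_bigcup E).
have nnd := exhaust_nd E.
have mA n : measurable (`[a n, b n]%classic : set R) by exact: measurable_itv.
have mfA n : measurable_fun (`[a n, b n]%classic : set R) (EFin \o f).
  by apply: measurable_funS mf => // x; rewrite /= in_itv/=; exact: aD.
have f0A n x : (`[a n, b n]%classic : set R) x -> (0 <= (EFin \o f) x)%E.
  by rewrite /= in_itv/= => h; rewrite lee_fin f0//; exact: aD h.
have /cvg_lim <- // := @ge0_nondecreasing_set_cvg_integral _ (measurableTypeR R) R _ (EFin \o f) (@lebesgue_measure R) nnd mA mfA f0A.
apply: (@le_lt_trans _ _ (2 * B)%:E); last by rewrite ltry.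
apply: lime_le.
  apply: ereal_nondecreasing_is_cvgn.
  exact: (@ge0_nondecreasing_set_nondecreasing_integral _ (measurableTypeR R) R _ (EFin \o f) (@lebesgue_measure R) nnd mA mfA f0A).
apply: nearW => n; rewrite (@der_FTC (a n) (b n) f F)//.
- have ha : `|F (a n)| <= B by apply: FB; apply: (aD n); rewrite lexx ltW.
  have hb : `|F (b n)| <= B by apply: FB; apply: (aD n); rewrite lexx ltW.
  by rewrite lee_fin; move: ha hb; rewrite !ler_norml => /andP[? ?] /andP[? ?]; lra.
- by move=> t ht; exact/cf/(aD n).
- by move=> t ht; exact/dF/(aD n).
Qed.

(** Dominated convergence, [|f|] dominating its restrictions to the segments. *)
Lemma improper_FTC D a b f F (L : R) : exhaust D a b ->
  (forall x, D x -> {for x, continuous f}) -> leb.-integrable D (EFin \o f) ->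
  (forall x, D x -> der F x (f x)) ->
  (forall e, 0 < e -> exists N, forall n, (N <= n)%N -> `|F (b n) - F (a n) - L| <= e) ->
  \int[leb]_(x in D) f x = L.
Proof.
move=> E cf fi dF hL; have [oD ab aD nd ex] := E.
have mD : measurable D by exact: open_measurable.
have mf : measurable_fun D (EFin \o f) by exact: measurable_int fi.
pose f_ n := (EFin \o f) \_ (`[a n, b n]%classic).
have subD n : `[a n, b n] `<=` D by move=> x; rewrite /= in_itv/=; exact: aD.
have h : (\int[leb]_(x in D) f_ n x)%E @[n --> \oo] --> (\int[leb]_(x in D) (f x)%:E)%E.
  apply: (@dominated_cvg _ (measurableTypeR R) R (@lebesgue_measure R) D mD f_ (EFin \o f) (fun x => `|(f x)%:E|)%E) => //.
  - move=> n; rewrite /f_; apply/measurable_restrict => //.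
    by apply: measurable_funS mf => //; exact: subIsetl.
  - move=> x Dx; have [N hN] := ex x Dx.
    apply: (@cvg_near_cst _ _ _ _ \oo); near=> n.
    rewrite /f_ patchE mem_set// /= in_itv/=.
    have Nn : (N <= n)%N by near: n; exact: nbhs_infty_ge.
    by have [h1 h2] := nd _ _ Nn; move/andP: hN => [h3 h4]; rewrite (le_trans h1 h3) (le_trans h4 h2).
  - exact: integrable_abse.
  - move=> n x Dx; rewrite /f_ patchE; case: ifPn => //; first by rewrite abse0 abse_ge0.
have hn n : (\int[leb]_(x in D) f_ n x = (F (b n) - F (a n))%:E)%E.
  rewrite -(@der_FTC (a n) (b n) f F)//.
  - rewrite /f_ -integral_mkcondr setIidr//.
  - by move=> t ht; exact/cf/(aD n).
  - by move=> t ht; exact/dF/(aD n).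
have h2 : (F (b n) - F (a n)) @[n --> \oo] --> L.
  apply/cvgrPdist_le => e e0; have [N hN] := hL e e0.
  by exists N => //= n; rewrite distrC; exact: hN.
have h3 : (\int[leb]_(x in D) f_ n x)%E @[n --> \oo] --> L%:E.
  under eq_fun do rewrite hn.
  exact/cvg_EFin/h2/nearW.
rewrite /Rintegral; have := cvg_unique _ h h3.
by move=> ->.
Unshelve. all: by end_near. Qed.

Lemma exhaust01 : exhaust `]0, 1[%classic (fun n => n.+3%:R^-1) (fun n => 1 - n.+3%:R^-1).
Proof.
have hlt n : n.+3%:R^-1 < 1 / 2 :> R.
  by rewrite -[X in _ < X]invf_div divr1 ltf_pV2 ?posrE// (ltr_nat _ 2 n.+3).
have h0 n : 0 < n.+3%:R^-1 :> R by nng.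
split.
- exact: interval_open.
- by move=> n; move: (hlt n); set e := _^-1 => he; lra.
- move=> n x; rewrite /= in_itv/=; move: (h0 n); set e := _^-1 => he /andP[h1 h2].
  by apply/andP; split; lra.
- move=> m n mn; have : n.+3%:R^-1 <= m.+3%:R^-1 :> R.
    by rewrite lef_pV2 ?posrE// ler_nat.
  by set e := n.+3%:R^-1; set e' := m.+3%:R^-1 => he; split; lra.
- move=> x; rewrite /= in_itv/= => /andP[x0 x1].
  pose e := Num.min x (1 - x); have e0 : 0 < e by rewrite lt_min x0 subr_gt0.
  exists (Num.trunc e^-1); set N := Num.trunc _.
  have : N.+3%:R^-1 <= e.
    rewrite -[leRHS]invrK lef_pV2 ?posrE ?invr_gt0//.
    have h := truncnS_gt e^-1.
    by apply: (le_trans (ltW h)); rewrite ler_nat; apply: leqW; exact: leqnSn.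
  set e' := N.+3%:R^-1.
  by rewrite le_min => /andP[h1 h2]; apply/andP; split; lra.
Qed.

Lemma exhaust0y : exhaust `]0, +oo[%classic (fun n => n.+2%:R^-1) (fun n => n.+2%:R : R).
Proof.
have h0 n : 0 < n.+2%:R^-1 :> R by nng.
split.
- exact: interval_open.
- move=> n; apply: (@lt_trans _ _ 1); last by rewrite (ltr_nat _ 1).
  by rewrite invf_lt1// (ltr_nat _ 1).
- by move=> n x /andP[h1 h2]; rewrite /= in_itv/= andbT; exact: lt_le_trans (h0 n) h1.
- move=> m n mn; split; last by rewrite ler_nat.
  by rewrite lef_pV2 ?posrE// ler_nat.
- move=> x; rewrite /= in_itv/= andbT => x0.
  have xV : 0 < x^-1 by nng.
  exists (Num.trunc (x + x^-1)); set N := Num.trunc _.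
  have h : x + x^-1 <= N.+2%:R.
    have h := truncnS_gt (x + x^-1).
    by apply: (le_trans (ltW h)); rewrite ler_nat; exact: leqnSn.
  apply/andP; split; last by apply: le_trans h; rewrite lerDl ltW.
  by rewrite -[leRHS]invrK lef_pV2 ?posrE//; apply: le_trans h; rewrite lerDr ltW.
Qed.

Lemma FTC01 f F (A B : R) :
  (forall x, 0 < x < 1 -> {for x, continuous f}) ->
  leb.-integrable `]0, 1[ (EFin \o f) ->
  (forall x, 0 < x < 1 -> der F x (f x)) ->
  (forall e, 0 < e -> exists2 d, 0 < d & forall x, 0 < x < d -> `|F x - A| <= e) ->
  (forall e, 0 < e -> exists2 d, 0 < d & forall x, 0 < x < d -> `|F (1 - x) - B| <= e) ->
  \int[leb]_(x in `]0, 1[) f x = B - A.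
Proof.
move=> cf fi dF hA hB; apply: (@improper_FTC _ _ _ f F _ exhaust01) => //.
move=> e e0; have e20 : 0 < e / 2 by lra.
have [d1 d10 h1] := hA _ e20; have [d2 d20 h2] := hB _ e20.
pose d := Num.min d1 d2; have d0 : 0 < d by rewrite lt_min d10.
exists (Num.trunc d^-1) => n hn.
have h0 : 0 < n.+3%:R^-1 :> R by nng.
have hd : n.+3%:R^-1 < d.
  rewrite -[ltRHS]invrK ltf_pV2 ?posrE ?invr_gt0//.
  have h := truncnS_gt d^-1.
  by apply: (lt_le_trans h); rewrite ler_nat ltnS; apply: (leq_trans hn); rewrite leqW.
have [hd1 hd2] : n.+3%:R^-1 < d1 /\ n.+3%:R^-1 < d2.
  by move: hd; rewrite lt_min => /andP[].
have k1 := h1 (n.+3%:R^-1) ltac:(by rewrite h0 hd1); have k2 := h2 (n.+3%:R^-1) ltac:(by rewrite h0 hd2).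
by move: k1 k2; set t := _^-1; rewrite !ler_norml => /andP[? ?] /andP[? ?]; apply/andP; split; lra.
Qed.

Lemma intgZ D f (k : R) : measurable D -> leb.-integrable D (EFin \o f) ->
  leb.-integrable D (EFin \o (fun x => k * f x)).
Proof.
move=> mD h; have := @integrableZl _ (measurableTypeR R) R leb D mD k _ h.
by apply: eq_integrable.
Qed.

Lemma intgD D f g : measurable D -> leb.-integrable D (EFin \o f) ->
  leb.-integrable D (EFin \o g) -> leb.-integrable D (EFin \o (fun x => f x + g x)).
Proof.
move=> mD h1 h2; have := @integrableD _ (measurableTypeR R) R leb D mD _ _ h1 h2.
by apply: eq_integrable.
Qed.

Lemma intgB D f g : measurable D -> leb.-integrable D (EFin \o f) ->
  leb.-integrable D (EFin \o g) -> leb.-integrable D (EFin \o (fun x => f x - g x)).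
Proof.
move=> mD h1 h2; have := @integrableB _ (measurableTypeR R) R leb D mD _ _ h1 h2.
by apply: eq_integrable.
Qed.

Lemma intg_dom D f g : measurable D -> measurable_fun D f ->
  (forall x, D x -> `|f x| <= g x) -> leb.-integrable D (EFin \o g) ->
  leb.-integrable D (EFin \o f).
Proof.
move=> mD mf h hg.
apply: (@le_integrable _ (measurableTypeR R) R leb D mD _ _ _ _ hg).
  exact/measurable_EFinP.
by move=> x Dx /=; rewrite lee_fin (le_trans (h x Dx))// ler_norm.
Qed.

Lemma RintZ D f (k : R) : measurable D -> leb.-integrable D (EFin \o f) ->
  \int[leb]_(x in D) (k * f x) = k * \int[leb]_(x in D) f x.
Proof. by move=> mD h; exact: (@RintegralZl _ (measurableTypeR R) R leb D f k mD h). Qed.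

Lemma RintD D f g : measurable D -> leb.-integrable D (EFin \o f) ->
  leb.-integrable D (EFin \o g) ->
  \int[leb]_(x in D) (f x + g x) = \int[leb]_(x in D) f x + \int[leb]_(x in D) g x.
Proof. by move=> mD h1 h2; exact: (@RintegralD _ (measurableTypeR R) R leb D f g mD h1 h2). Qed.

Lemma RintB D f g : measurable D -> leb.-integrable D (EFin \o f) ->
  leb.-integrable D (EFin \o g) ->
  \int[leb]_(x in D) (f x - g x) = \int[leb]_(x in D) f x - \int[leb]_(x in D) g x.
Proof. by move=> mD h1 h2; exact: (@RintegralB _ (measurableTypeR R) R leb D f g mD h1 h2). Qed.

End Integrals.

(** * Bessel functions *)

Section Bessel.
Context {R : realType}.
Local Notation leb := (@lebesgue_measure R).
Implicit Types (nu z x s t : R).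

Definition pochh nu k : R := \prod_(i < k) (nu + 1 + i%:R).
Definition bcoef nu k : R := (-1) ^+ k / (4 ^+ k * k`!%:R * pochh nu k).
(** The entire function with value [1] at [0] for which [Bes nu (x ^+ 2)] is proportional to
    [x^-nu J_nu x]. Negative arguments give the modified Bessel functions, from which the Green
    functions are built. *)
Definition Bes nu z : R := limn (pseries (bcoef nu) z).

Lemma pochh_gt0 nu k : -1 < nu -> 0 < pochh nu k.
Proof.
move=> h; apply: prodr_gt0 => i _.
by have : 0 <= i%:R :> R by []; move: (i%:R) => t; lra.
Qed.

Lemma pochh_ge nu k : -1 < nu -> (nu + 1) ^+ k <= pochh nu k.
Proof.
move=> h; rewrite /pochh; have -> : (nu + 1) ^+ k = \prod_(i < k) (nu + 1).
  by rewrite prodr_const card_ord.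
apply: ler_prod => i _; have : 0 <= i%:R :> R by [].
by move: (i%:R) => t; lra.
Qed.

Lemma pochhS nu k : pochh nu k.+1 = (nu + 1) * pochh (nu + 1) k.
Proof.
rewrite /pochh big_ord_recl /= addr0; congr (_ * _); apply: eq_bigr => i _.
by rewrite /bump /= natrD; ring.
Qed.

Lemma pochhSr nu k : pochh nu k.+1 = pochh nu k * (nu + 1 + k%:R).
Proof. by rewrite /pochh big_ord_recr. Qed.

Lemma bcoef_norm nu k : -1 < nu ->
  `|bcoef nu k| <= (4 * (nu + 1))^-1 ^+ k / k`!%:R.
Proof.
move=> h; rewrite /bcoef normrM normrX normrN1 expr1n mul1r.
have hp := pochh_gt0 k h; have hf : 0 < k`!%:R :> R by rewrite ltr0n fact_gt0.
have h4 : 0 < 4 ^+ k :> R by nng.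
rewrite normfV gtr0_norm ?mulr_gt0// exprVn -invfM lef_pV2 ?posrE ?mulr_gt0//; last first.
  by rewrite exprn_gt0// mulr_gt0//; lra.
by rewrite exprMn -!mulrA [k`!%:R * _]mulrC ler_pM2l// ler_pM2r//; exact: pochh_ge.
Qed.

Lemma bes_cvg nu z : -1 < nu -> cvgn (pseries (bcoef nu) z).
Proof.
move=> h; apply: normed_cvg.
apply: series_le_cvg; last exact: (is_cvg_series_exp_coeff (`|z| / (4 * (nu + 1)))).
- by move=> n; rewrite normr_ge0.
- by move=> n; rewrite divr_ge0 // exprn_ge0// divr_ge0//; lra.
- move=> n /=; rewrite /exp_coeff /= normrM normrX mulrC expr_div_n mulrAC -mulrA.
  by rewrite -exprVn ler_wpM2l ?exprn_ge0// mulrC; exact: bcoef_norm.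
Qed.

Lemma bcoef_diffs nu : -1 < nu ->
  pseries_diffs (bcoef nu) = (fun k => - (4 * (nu + 1))^-1 * bcoef (nu + 1) k).
Proof.
move=> h; apply/funext => k; rewrite /pseries_diffs /bcoef pochhS factS natrM !exprS.
have h1 : nu + 1 != 0 by lra.
have h2 : pochh (nu + 1) k != 0 by rewrite gt_eqF// pochh_gt0//; lra.
have h3 : k`!%:R != 0 :> R by rewrite pnatr_eq0 -lt0n fact_gt0.
have h4 : 4 ^+ k != 0 :> R by rewrite expf_neq0.
have h5 : k.+1%:R != 0 :> R by rewrite pnatr_eq0.
by field; rewrite h1 h2 h3 h4 addrC natr1 h5.
Qed.

Lemma pseriesZ (c : nat -> R) k z : pseries (fun n => k * c n) z = k *: pseries c z.
Proof.
apply/funext => n; rewrite /pseries /series /= [RHS]/GRing.scale /= /GRing.scale /=.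
by rewrite mulr_sumr; apply: eq_bigr => i _; rewrite mulrA.
Qed.

Lemma bes_diffs_cvg nu z : -1 < nu -> cvgn (pseries (pseries_diffs (bcoef nu)) z).
Proof.
move=> h; rewrite bcoef_diffs// pseriesZ; apply: is_cvgZl_tmp.
by apply: bes_cvg; lra.
Qed.

Lemma bes_der nu z : -1 < nu -> der (Bes nu) z (- (4 * (nu + 1))^-1 * Bes (nu + 1) z).
Proof.
move=> h; have h1 : -1 < nu + 1 by lra.
have -> : - (4 * (nu + 1))^-1 * Bes (nu + 1) z = limn (pseries (pseries_diffs (bcoef nu)) z).
  by rewrite bcoef_diffs// pseriesZ limZl_tmp//; exact: bes_cvg.
apply: (@pseries_snd_diffs _ _ (`|z| + 1)).
- exact: bes_cvg.
- exact: bes_diffs_cvg.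
- rewrite bcoef_diffs//.
  have -> : pseries_diffs (fun k => - (4 * (nu + 1))^-1 * bcoef (nu + 1) k) =
     (fun k => - (4 * (nu + 1))^-1 * pseries_diffs (bcoef (nu + 1)) k).
    by apply/funext => k; rewrite /pseries_diffs mulrCA.
  by rewrite pseriesZ; apply: is_cvgZl_tmp; apply: bes_diffs_cvg.
- by rewrite [ltRHS]ger0_norm ?addr_ge0// ltrDl.
Qed.

Lemma pseriesS (c : nat -> R) z n :
  pseries c z n.+1 = c 0%N + z * pseries (fun k => c k.+1) z n.
Proof.
rewrite /pseries /series /= big_nat_recl //= expr0 mulr1.
by rewrite mulr_sumr; congr (_ + _); apply: eq_bigr => i _; rewrite exprS mulrCA.
Qed.

Lemma pseries_shift_cvg (c : nat -> R) z : cvgn (pseries c z) ->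
  cvgn (pseries (fun k => c k.+1) z).
Proof.
move=> h; have [->|z0] := eqVneq z 0.
  apply: (@cvgP _ _ (c 1%N)); apply: (@cvg_near_cst _ _ _ _ \oo).
  exists 1%N => // n /= n1; rewrite /pseries /series /=; case: n n1 => // n _.
  rewrite big_nat_recl// expr0 mulr1 big1 ?addr0// => i _.
  by rewrite expr0n /= mulr0.
apply: (@cvgP _ _ (z^-1 * (limn (pseries c z) - c 0%N))).
have -> : pseries (fun k => c k.+1) z = (fun n => z^-1 * (pseries c z n.+1 - c 0%N)).
  by apply/funext => n; rewrite pseriesS addrAC subrr add0r mulKf.
apply: cvgM; first exact: cvg_cst.
apply: cvgB; last exact: cvg_cst.
by have := h; rewrite -cvg_shiftS.
Qed.

Lemma pseries_head (c : nat -> R) z : cvgn (pseries c z) ->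
  limn (pseries c z) = c 0%N + z * limn (pseries (fun k => c k.+1) z).
Proof.
move=> h; apply/cvg_lim => //; rewrite -cvg_shiftS /=.
under eq_fun do rewrite pseriesS.
apply: cvgD; first exact: cvg_cst.
by apply: cvgM; [exact: cvg_cst|exact: pseries_shift_cvg].
Qed.

(** The three-term recurrence between [J_nu], [J_(nu+1)] and [J_(nu+2)] in this normalization,
    checked on the coefficients. Together with [bes_der] it gives the Bessel equation. *)
Lemma bes_rec nu z : -1 < nu ->
  Bes nu z = Bes (nu + 1) z - z / (4 * (nu + 1) * (nu + 2)) * Bes (nu + 2) z.
Proof.
move=> h; have h1 : -1 < nu + 1 by lra.
have h2 : -1 < nu + 2 by lra.
have shift mu : -1 < mu -> cvgn (pseries (fun k => bcoef mu k.+1) z).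
  by move=> hm; apply: pseries_shift_cvg; exact: bes_cvg.
rewrite /Bes (pseries_head (@bes_cvg nu z h)) (pseries_head (@bes_cvg (nu + 1) z h1)).
have -> : (fun k => bcoef nu k.+1) =
  (fun k => bcoef (nu + 1) k.+1 + - (4 * (nu + 1) * (nu + 2))^-1 * bcoef (nu + 2) k).
  apply/funext => k; rewrite /bcoef !pochhS.
  rewrite (_ : nu + 1 + 1 = nu + 2); last by ring.
  have e1 : nu + 1 != 0 by lra.
  have e2 : nu + 2 != 0 by lra.
  have e3 : pochh (nu + 1) k != 0 by rewrite gt_eqF// pochh_gt0.
  have e4 : pochh (nu + 2) k != 0 by rewrite gt_eqF// pochh_gt0.
  have e5 : nu + 2 + k%:R != 0 by rewrite gt_eqF//; have : 0 <= k%:R :> R by []; lra.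
  have e6 : k`!%:R != 0 :> R by rewrite pnatr_eq0 -lt0n fact_gt0.
  have e7 : 4 ^+ k != 0 :> R by rewrite expf_neq0.
  have e8 : k.+1%:R != 0 :> R by rewrite pnatr_eq0.
  have : (nu + 2) * pochh (nu + 2) k = pochh (nu + 1) k * (nu + 2 + k%:R).
    rewrite (_ : nu + 2 = nu + 1 + 1); last by ring.
    by rewrite -pochhS pochhSr.
  rewrite factS natrM !exprS => E.
  have -> : pochh (nu + 1) k = (nu + 2) * pochh (nu + 2) k / (nu + 2 + k%:R).
    by rewrite E mulfK.
  rewrite -natr1 in e8 *; field.
  by rewrite e1 e2 e4 e5 e6 e7 /=; move: e8; rewrite addrC => ->.
have -> : pseries (fun k => bcoef (nu + 1) k.+1 +
     - (4 * (nu + 1) * (nu + 2))^-1 * bcoef (nu + 2) k) z =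
   pseries (fun k => bcoef (nu + 1) k.+1) z +
     pseries (fun k => - (4 * (nu + 1) * (nu + 2))^-1 * bcoef (nu + 2) k) z.
  apply/funext => n; rewrite /pseries /series /= [RHS]/GRing.add /= -big_split /=.
  by apply: eq_bigr => i _; rewrite mulrDl.
rewrite pseriesZ limD; [|exact: shift|by apply: is_cvgZl_tmp; exact: bes_cvg].
rewrite limZl_tmp; last exact: bes_cvg.
have -> : bcoef nu 0 = bcoef (nu + 1) 0 by rewrite /bcoef /pochh !big_ord0.
by rewrite /GRing.scale /=; ring.
Qed.

Lemma bes_0 nu : -1 < nu -> Bes nu 0 = 1.
Proof.
move=> h; apply/cvg_lim => //; apply: (@cvg_near_cst _ _ _ _ \oo).
exists 1%N => // n /= n1; rewrite /pseries /series /=; case: n n1 => // n _.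
rewrite big_nat_recl// expr0 mulr1 big1 ?addr0; last by move=> i _; rewrite expr0n /= mulr0.
by rewrite /bcoef /pochh big_ord0 !expr0 fact0 !mul1r invr1.
Qed.

(** For [z <= 0] the alternating signs of the coefficients cancel those of the powers: all terms are
    nonnegative, and the first is [1]. *)
Lemma bes_ge1 nu z : -1 < nu -> z <= 0 -> 1 <= Bes nu z.
Proof.
move=> h z0; rewrite -(bes_0 h) /Bes.
have -> : limn (pseries (bcoef nu) 0) = 1 by exact: bes_0.
apply: limr_ge; first exact: bes_cvg.
exists 1%N => // n /= n1; rewrite /pseries /series /=; case: n n1 => // n _.
rewrite big_nat_recl// expr0 mulr1.
have -> : bcoef nu 0 = 1 by rewrite /bcoef /pochh big_ord0 !expr0 fact0 !mul1r invr1.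
rewrite lerDl.
apply: sumr_ge0 => i _; rewrite /bcoef mulrAC -exprMn mulN1r.
rewrite divr_ge0// ?exprn_ge0//; first by lra.
by rewrite ltW// !mulr_gt0 ?pochh_gt0 ?exprn_gt0 ?ltr0n ?fact_gt0.
Qed.

Lemma bes_cont nu z : -1 < nu -> {for z, continuous (Bes nu)}.
Proof. by move=> h; exact: der_cont (bes_der z h). Qed.

Lemma powR_expR_le s : 0 < s ->
  exists2 C : R, 0 < C & forall t, 0 < t -> (1 + powR t s) ^+ 2 <= C * expR t.
Proof.
move=> s0; pose m := (Num.trunc s).+1.
have sm : s <= m%:R by rewrite ltW// truncnS_gt.
have c1 : 0 < (2 * m)`!%:R :> R by rewrite ltr0n fact_gt0.
exists (8 + 2 * (2 * m)`!%:R); first by nng.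
move=> t t0.
have h1 : powR t s <= 1 + t ^+ m.
  have [t1|t1] := leP t 1.
    apply: (@le_trans _ _ 1); last by rewrite lerDl exprn_ge0// ltW.
    by have := @ge0_ler_powR R s (ltW s0) t 1; rewrite powR1 !nnegrE; apply=> //; exact: ltW.
  apply: (@le_trans _ _ (t ^+ m)); last by rewrite lerDr.
  by rewrite -powR_mulrn ?ler_powR// ltW.
have h2 : t ^+ (2 * m) <= (2 * m)`!%:R * expR t.
  have := @expR_ge1Dxn R t (2 * m).-1 (ltW t0); rewrite prednK ?muln_gt0// => h.
  by rewrite -ler_pdivrMl// mulrC; apply: le_trans h; rewrite lerDr.
have h3 : 1 <= expR t by rewrite ltW// expR_gt1.
have h4 : 0 <= powR t s by exact: powR_ge0.
have h5 : (1 + powR t s) ^+ 2 <= (2 + t ^+ m) ^+ 2.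
  have tm : 0 <= t ^+ m by nng.
  by rewrite lerXn2r ?nnegrE; lra.
apply: (le_trans h5).
move: h2; rewrite mulnC exprM; move: (t ^+ m) => u h2; rewrite mulrDl.
have : (2 + u) ^+ 2 <= 8 + 2 * u ^+ 2.
  by have := sqr_ge0 (2 - u); rewrite -subr_ge0 => h; rewrite -subr_ge0; apply: le_trans h _; nra.
by move: h2; rewrite -mulrA; set A := _ * expR t => h2; nra.
Qed.

(** Up to a constant factor the majorant [g] is the derivative of [- (1 + powR t s)^-1], which is
    bounded; the square in [powR_expR_le] is there for this purpose. *)
Lemma gamma_integrable s : 0 < s ->
  leb.-integrable `]0%R, +oo[ (EFin \o (fun t => powR t (s - 1) * expR (- t))).
Proof.
move=> s0; have [C C0 hC] := powR_expR_le s0.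
have mD : measurable (`]0, +oo[%classic : set R) by exact: measurable_itv.
pose g t := C / s * (s * powR t (s - 1) / (1 + powR t s) ^+ 2).
have P t : 0 < 1 + powR t s by rewrite ltr_pwDl// powR_ge0.
have dP t : 0 < t -> der (fun t => powR t s) t (s * powR t (s - 1)).
  by move=> t0; apply: (der_eq (der_powR s t0 (der_id t))); rewrite mulr1.
have dQ t : 0 < t -> der (fun t => (1 + powR t s)^-1) t (- (s * powR t (s-1)) / (1 + powR t s) ^+ 2).
  move=> t0; have /= hD := derD (der_cst 1 t) (dP t t0).
  have N : 1 + powR t s != 0 by rewrite gt_eqF.
  by apply: (der_eq (@derV _ (fun t => 1 + powR t s) t _ N hD)); rewrite add0r.
have cP (r t : R) : 0 < t -> {for t, continuous (fun u : R => powR u r)}.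
  by move=> t0; exact: (der_cont (der_powR r t0 (der_id t))).
have ig : leb.-integrable `]0%R, +oo[ (EFin \o g).
  apply: (@integrable_antideriv _ _ _ _ g (fun t => - (C / s) * (1 + powR t s)^-1) (C / s) exhaust0y).
  - move=> t; rewrite /= in_itv/= andbT => t0; rewrite /g.
    have N : (1 + powR t s) ^+ 2 != 0 by rewrite expf_neq0// gt_eqF.
    by eapply der_cont; deriv.
  - move=> t _; rewrite /g mulr_ge0 ?divr_ge0 ?mulr_ge0 ?powR_ge0 ?exprn_ge0 ?ltW//.
  - move=> t; rewrite /= in_itv/= andbT => t0; rewrite /g.
    apply: der_eq; first exact: derM (der_cst (- (C / s)) t) (dQ t t0).
    by rewrite /=; ring.
  - move=> t _; have C1 : 0 < C / s by nng.
    rewrite normrM normrN (gtr0_norm C1) gtr0_norm ?invr_gt0// ger_pMr//.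
    by rewrite invf_le1// lerDl powR_ge0.
apply: (intg_dom mD _ _ ig).
  apply: continuous_on_measurable; first exact: interval_open.
  move=> t; rewrite /= in_itv/= andbT => t0.
  have : {for t, continuous (fun x : R => x `^ (s - 1) * expR (- x))} by eapply der_cont; deriv.
  by [].
move=> t; rewrite /= in_itv/= andbT => t0; rewrite ger0_norm; last first.
  by nng.
have -> : g t = powR t (s - 1) * (C / (1 + powR t s) ^+ 2).
  by rewrite /g; field; rewrite !gt_eqF.
rewrite ler_wpM2l ?powR_ge0// ler_pdivlMr ?exprn_gt0//.
by rewrite expRN mulrC ler_pdivrMr ?expR_gt0// hC.
Qed.

Lemma GammaS s : 0 < s -> Gamma (s + 1) = s * Gamma s.
Proof.
move=> s0; have s10 : 0 < s + 1 by lra.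
have i1 := gamma_integrable s10; have i0 := gamma_integrable s0.
have mD : measurable (`]0, +oo[%classic : set R) by exact: measurable_itv.
have i0s : leb.-integrable `]0%R, +oo[ (EFin \o (fun t => s * (powR t (s - 1) * expR (- t)))).
  exact: (intgZ s mD i0).
apply/eqP; rewrite -subr_eq0; apply/eqP.
rewrite /Gamma -RintZ// -RintB//.
apply: (@improper_FTC _ _ _ _ _ (fun t => - (powR t s * expR (- t))) 0 exhaust0y).
- move=> t; rewrite /= in_itv/= andbT => t0.
  have : {for t, continuous (fun x : R => x `^ (s + 1 - 1) * expR (- x) - s * (x `^ (s - 1) * expR (- x)))} by eapply der_cont; deriv.
  by [].
- exact: (intgB mD i1 i0s).
- move=> t; rewrite /= in_itv/= andbT => t0.
  apply: der_eq; first exact: (derN (derM (der_powR s t0 (der_id t)) (der_exp (derN (der_id t))))).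
  by rewrite addrK; ring.
move=> e e0; have [C C0 hC] := powR_expR_le s0.
have bnd t : 0 < t -> powR t s * expR (- t) <= C / (1 + powR t s).
  move=> t0; have P : 0 < 1 + powR t s by rewrite ltr_pwDl// powR_ge0.
  rewrite expRN ler_pdivrMr ?expR_gt0// mulrAC ler_pdivlMr//.
  apply: le_trans (hC t t0); rewrite expr2 ler_pM2r//; lra.
have M0 : 0 < (2 * (C + 1) / e) by rewrite divr_gt0// mulr_gt0//; lra.
pose M := powR (2 * (C + 1) / e) s^-1.
have Mp : 0 < M by nng.
have hM t : M <= t -> C / (1 + powR t s) <= e / 2.
  move=> Mt; have : powR M s <= powR t s.
    by rewrite ge0_ler_powR ?nnegrE// ?ltW// (lt_le_trans Mp Mt).
  rewrite /M -powRrM mulVf ?gt_eqF// powRr1 ?(ltW M0)// => h.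
  have P : 0 < 1 + powR t s by rewrite ltr_pwDl// powR_ge0.
  rewrite ler_pdivrMr//; move: h; rewrite ler_pdivrMr// => h.
  by nra.
pose N := Num.trunc (M + (powR (e / 2) s^-1)^-1).
have e20 : 0 < e / 2 by lra.
have Ep : 0 < powR (e / 2) s^-1 by nng.
exists N => n Nn.
have hn : M + (powR (e / 2) s^-1)^-1 <= n.+2%:R.
  rewrite (le_trans (ltW (truncnS_gt _)))// ler_nat -/N; exact: leq_trans Nn (leqnSn _).
have h1 : powR n.+2%:R s * expR (- n.+2%:R) <= e / 2.
  apply: le_trans (bnd _ _) (hM _ _) => //.
  by apply: le_trans hn; rewrite lerDl invr_ge0 ltW.
have h2 : powR n.+2%:R^-1 s * expR (- n.+2%:R^-1) <= e / 2.
  have V : n.+2%:R^-1 <= powR (e / 2) s^-1.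
    rewrite -[leRHS]invrK lef_pV2 ?posrE ?invr_gt0//; apply: le_trans hn.
    by rewrite lerDr ltW.
  apply: (@le_trans _ _ (powR n.+2%:R^-1 s)).
    by rewrite ger_pMr ?powR_gt0 ?invr_gt0// expR_le1 oppr_le0 invr_ge0.
  apply: (@le_trans _ _ (powR (powR (e / 2) s^-1) s)).
    by apply: powR_le => //; exact: ltW.
  by rewrite -powRrM mulVf ?gt_eqF// powRr1// ltW.
have p1 : 0 <= powR n.+2%:R s * expR (- n.+2%:R) by nng.
have p2 : 0 <= powR n.+2%:R^-1 s * expR (- n.+2%:R^-1) by nng.
have key A B : A <= e / 2 -> B <= e / 2 -> 0 <= A -> 0 <= B -> `|- A - - B - 0| <= e.
  by move=> *; rewrite ler_norml; apply/andP; split; lra.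
exact: key.
Qed.

Lemma Gamma_pochh nu k : -1 < nu -> Gamma (k%:R + nu + 1) = Gamma (nu + 1) * pochh nu k.
Proof.
move=> h; elim: k => [|k ih]; first by rewrite add0r /pochh big_ord0 mulr1.
rewrite pochhSr mulrA -ih -natr1 (_ : k%:R + 1 + nu + 1 = (k%:R + nu + 1) + 1); last by ring.
rewrite GammaS; last by have : 0 <= k%:R :> R by []; lra.
by rewrite mulrC; congr (_ * _); ring.
Qed.

Lemma besselJE nu x : -1 < nu -> 0 < x ->
  besselJ nu x = powR (x / 2) nu / Gamma (nu + 1) * Bes nu (x ^+ 2).
Proof.
move=> h x0; rewrite /besselJ; apply/cvg_lim => //.
have : (fun n => powR (x / 2) nu / Gamma (nu + 1) * pseries (bcoef nu) (x ^+ 2) n) @ \oo -->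
    powR (x / 2) nu / Gamma (nu + 1) * Bes nu (x ^+ 2).
  by apply: cvgM; [exact: cvg_cst|exact: bes_cvg].
set u := series _; suff -> : u = (fun n => powR (x / 2) nu / Gamma (nu + 1) *
  pseries (bcoef nu) (x ^+ 2) n) by [].
rewrite /u; apply/funext => n; rewrite /pseries /series /=.
rewrite mulr_sumr; apply: eq_bigr => k _.
have x20 : 0 < x / 2 by nng.
rewrite Gamma_pochh// powRD; last by rewrite (gt_eqF x20) implybT.
have -> : powR (x / 2) (2 * k%:R) = (x ^+ 2) ^+ k / 4 ^+ k.
  rewrite -[2 * k%:R]natrM powR_mulrn ?ltW// exprM -expr_div_n; congr (_ ^+ _).
  by rewrite expr_div_n; congr (_ / _); ring.
rewrite /bcoef !invfM; ring.
Qed.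

End Bessel.

(** * Symbol classes *)

Section Symbols.
Context {R : realType}.
Implicit Types (D : R -> Prop) (rho w f g h : R -> R) (s t x C B m : R) (n : nat).

(* [sym n D rho w C f]: with the derivation [rho d/ds], all derivatives of [f] of order at
   most [n] are bounded by [C * w] on [D]. *)
Fixpoint sym n D rho w C f : Prop :=
  (forall s, D s -> `|f s| <= C * w s) /\
  if n is n'.+1 then
    exists2 g, (forall s, D s -> der f s (g s / rho s)) & sym n' D rho w C g
  else True.

Definition one_ (s : R) : R := 1.

Lemma sym_bound n D rho w C f : sym n D rho w C f -> forall s, D s -> `|f s| <= C * w s.
Proof. by case: n => [|n] []. Qed.

Lemma sym_low n D rho w C f : sym n.+1 D rho w C f -> sym n D rho w C f.
Proof.
elim: n f => [|n ih] f; first by move=> [].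
by move=> [h1 [g h2 h3]]; split => //; exists g => //; exact: ih.
Qed.

Lemma sym_lower n (m : nat) D rho w C f : (m <= n)%N -> sym n D rho w C f -> sym m D rho w C f.
Proof.
elim: n => [|n ih]; first by rewrite leqn0 => /eqP ->.
by rewrite leq_eqVlt => /orP[/eqP -> //|mn] h; apply: ih => //; exact: sym_low.
Qed.

Lemma sym_weak n D D' rho w w' C C' f : (forall s, D' s -> D s) ->
  (forall s, D' s -> C * w s <= C' * w' s) -> sym n D rho w C f -> sym n D' rho w' C' f.
Proof.
move=> hD hw; elim: n f => [|n ih] f [h1 h2]; split => //.
- by move=> s Ds; apply: le_trans (h1 s _) (hw s Ds); exact: hD.
- by move=> s Ds; apply: le_trans (h1 s _) (hw s Ds); exact: hD.
by case: h2 => g h2 h3; exists g; [move=> s Ds; exact/h2/hD|exact: ih].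
Qed.

Lemma sym_ext n D rho w C f g : (forall s, f s = g s) -> sym n D rho w C f -> sym n D rho w C g.
Proof. by move=> /funext ->. Qed.

Lemma sym_congr n D rho w C f g : open [set s | D s] -> (forall s, D s -> f s = g s) ->
  sym n D rho w C f -> sym n D rho w C g.
Proof.
move=> oD fg; case: n => [|n] [h1 h2]; split => //.
- by move=> s Ds; rewrite -fg// h1.
- by move=> s Ds; rewrite -fg// h1.
case: h2 => k h2 h3; exists k => // s Ds.
apply: (@der_congr_near _ f) (h2 s Ds).
by near=> t; apply: fg; near: t; exact: open_nbhs_nbhs.
Unshelve. all: by end_near. Qed.

Lemma symD n D rho w C C' f g : sym n D rho w C f -> sym n D rho w C' g ->
  sym n D rho w (C + C') (fun s => f s + g s).
Proof.
elim: n f g => [|n ih] f g [h1 h2] [k1 k2]; split => //.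
- by move=> s Ds; rewrite mulrDl (le_trans (ler_normD _ _))// lerD ?h1 ?k1.
- by move=> s Ds; rewrite mulrDl (le_trans (ler_normD _ _))// lerD ?h1 ?k1.
case: h2 => f' h2 h3; case: k2 => g' k2 k3.
exists (fun s => f' s + g' s); last exact: ih.
by move=> s Ds; rewrite mulrDl; exact: derD (h2 s Ds) (k2 s Ds).
Qed.

Lemma symZ n D rho w C f k : sym n D rho w C f -> sym n D rho w (`|k| * C) (fun s => k * f s).
Proof.
elim: n f => [|n ih] f [h1 h2]; split => //.
- by move=> s Ds; rewrite normrM -mulrA ler_wpM2l ?h1.
- by move=> s Ds; rewrite normrM -mulrA ler_wpM2l ?h1.
case: h2 => f' h2 h3; exists (fun s => k * f' s); last exact: ih.
move=> s Ds; apply: der_eq; first exact: derM (der_cst k s) (h2 s Ds).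
by rewrite mul0r add0r mulrA.
Qed.

Lemma symN n D rho w C f : sym n D rho w C f -> sym n D rho w C (fun s => - f s).
Proof.
move=> h; have := symZ (-1) h; rewrite normrN1 mul1r; apply: sym_ext => s.
by rewrite mulN1r.
Qed.

Lemma symB n D rho w C C' f g : sym n D rho w C f -> sym n D rho w C' g ->
  sym n D rho w (C + C') (fun s => f s - g s).
Proof. by move=> h1 h2; exact: symD h1 (symN h2). Qed.

Lemma sym_cst n D rho C k : `|k| <= C -> 0 <= C -> sym n D rho one_ C (fun=> k).
Proof.
elim: n k => [|n ih] k h C0; split => //; try by move=> s _; rewrite mulr1.
exists (fun=> 0); last by apply: ih => //; rewrite normr0.
by move=> s _; rewrite mul0r; exact: der_cst.
Qed.

Lemma sym_zero n D rho w C : (forall s, D s -> 0 <= C * w s) -> sym n D rho w C (fun=> 0).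
Proof.
move=> h; elim: n => [|n ih]; split => //; try by move=> s Ds; rewrite normr0 h.
by exists (fun=> 0) => // s _; rewrite mul0r; exact: der_cst.
Qed.

(** By the Leibniz rule each derivation turns one product into two, which accounts for [2 ^+ n]. *)
Lemma symM n D rho w w' C C' f g : sym n D rho w C f -> sym n D rho w' C' g ->
  sym n D rho (fun s => w s * w' s) (2 ^+ n * (C * C')) (fun s => f s * g s).
Proof.
elim: n f g => [|n ih] f g.
  move=> [h1 _] [k1 _]; split => // s Ds.
  by rewrite expr0 mul1r normrM mulrACA ler_pM ?h1 ?k1.
move=> hf hg; have [h1 [f' h2 h3]] := hf; have [k1 [g' k2 k3]] := hg.
split.
  move=> s Ds; have hs : `|f s * g s| <= C * C' * (w s * w' s).
    by rewrite normrM mulrACA ler_pM ?h1 ?k1.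
  apply: (le_trans hs); rewrite -[leRHS]mulrA ler_peMl ?(le_trans _ hs)//.
    by rewrite exprn_ege1// ler1n.
exists (fun s => f' s * g s + f s * g' s).
  by move=> s Ds; apply: der_eq (derM (h2 s Ds) (k2 s Ds)) _; rewrite mulrDl; ring.
have := symD (ih f' g h3 (sym_low hg)) (ih f g' (sym_low hf) k3).
by apply: sym_weak => // s Ds; rewrite exprS [leRHS](_ : _ = (2 ^+ n * (C * C') + 2 ^+ n * (C * C')) * (w s * w' s))//; ring.
Qed.

Lemma symM1 n D rho w C C' f g : sym n D rho w C f -> sym n D rho one_ C' g ->
  sym n D rho w (2 ^+ n * (C * C')) (fun s => f s * g s).
Proof. by move=> h1 h2; have := symM h1 h2; apply: sym_weak => // s _; rewrite mulr1. Qed.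

(** The constant is fixed before [D], [rho] and [f], as uniformity in the parameters of the kernel
    is the point. The derivative of [f^-1] is a product of [f^-1] twice and [f'], all controlled to
    one order less, so the induction closes. *)
Lemma symV n m C : 0 < m -> exists2 C', 0 < C' & forall D rho f,
  (forall s, D s -> m <= f s) -> sym n D rho one_ C f ->
  sym n D rho one_ C' (fun s => (f s)^-1).
Proof.
move=> m0; elim: n => [|n [C' C'0 ih]].
  exists m^-1; first by nng.
  move=> D rho f hm _; split => // s Ds; rewrite mulr1.
  have fs := hm s Ds; have f0 : 0 < f s by exact: lt_le_trans fs.
  by rewrite gtr0_norm ?invr_gt0// lef_pV2.
pose K := 2 ^+ n * (2 ^+ n * (C' * C') * C).
exists (C' + `|K|); first by rewrite ltr_pwDl.
move=> D rho f hm hf; have [h1 [f' h2 h3]] := hf.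
have iV := ih D rho f hm (sym_low hf).
split.
  move=> s Ds; have := sym_bound iV Ds; rewrite !mulr1 => h.
  by rewrite (le_trans h)// lerDl.
exists (fun s => - ((f s)^-1 * (f s)^-1 * f' s)).
  move=> s Ds; have f0 : f s != 0 by rewrite gt_eqF// (lt_le_trans m0)// hm.
  by apply: (der_eq (derV f0 (h2 s Ds))); rewrite expr2 invfM; ring.
have := symN (symM1 (symM1 iV iV) h3); apply: sym_weak => // s _.
by rewrite !mulr1 (le_trans (ler_norm _))// lerDr ltW.
Qed.

Lemma symsqrt n m C : 0 < m -> exists2 C', 0 < C' & forall D rho f,
  (forall s, D s -> m <= f s) -> sym n D rho one_ C f ->
  sym n D rho one_ C' (fun s => Num.sqrt (f s)).
Proof.
move=> m0; elim: n => [|n [C' C'0 ih]].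
  exists (Num.sqrt (`|C| + 1)); first by rewrite sqrtr_gt0 ltr_wpDl.
  move=> D rho f hm [h1 _]; split => // s Ds; rewrite mulr1.
  rewrite ger0_norm ?sqrtr_ge0// ler_wsqrtr//.
  have := h1 s Ds; rewrite mulr1 => h; rewrite (le_trans (ler_norm _))// (le_trans h)//.
  by rewrite (le_trans (ler_norm _))// lerDl.
have [V V0 hV] := symV n C m0.
pose K := 2 ^+ n * (2 ^+ n * (C' * V) * (`|2^-1| * C)).
exists (C' + `|K|); first by rewrite ltr_pwDl.
move=> D rho f hm hf; have [h1 [f' h2 h3]] := hf.
have iV := ih D rho f hm (sym_low hf).
have jV := hV D rho f hm (sym_low hf).
split.
  move=> s Ds; have := sym_bound iV Ds; rewrite !mulr1 => h.
  by rewrite (le_trans h)// lerDl.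
exists (fun s => Num.sqrt (f s) * (f s)^-1 * (2^-1 * f' s)).
  move=> s Ds; have f0 : 0 < f s by rewrite (lt_le_trans m0)// hm.
  apply: (der_eq (der_sqrt f0 (h2 s Ds))).
  rewrite -{3}(sqr_sqrtr (ltW f0)) expr2 !invfM.
  have : Num.sqrt (f s) != 0 by rewrite gt_eqF// sqrtr_gt0.
  by move: (Num.sqrt _) => y y0; rewrite !mulrA mulfV// mul1r; ring.
have := symM1 (symM1 iV jV) (symZ 2^-1 h3); apply: sym_weak => // s _.
by rewrite !mulr1 (le_trans (ler_norm _))// lerDr ltW.
Qed.

Lemma sym_trig n C B : 0 <= B -> exists2 C', 0 < C' & forall D rho f k, `|k| <= B ->
  sym n D rho one_ C f ->
  sym n D rho one_ C' (fun s => cos (k * f s)) /\ sym n D rho one_ C' (fun s => sin (k * f s)).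
Proof.
move=> B0; elim: n => [|n [C' C'0 ih]].
  exists 1 => // D rho f k _ _.
  by split; split => // s _; rewrite mulr1; [exact: cos_max|exact: sin_max].
pose K := 2 ^+ n * (C' * (B * `|C|)).
have K0 : 0 <= K by nng.
exists (C' + K); first by rewrite ltr_pwDl.
move=> D rho f k kB hf; have [h1 [f' h2 h3]] := hf.
have [ic is_] := ih D rho f k kB (sym_low hf).
have h4 : sym n D rho one_ (B * `|C|) (fun s => k * f' s).
  have := symZ k h3; apply: sym_weak => // s _; rewrite !mulr1.
  rewrite (@le_trans _ _ (`|k| * `|C|))//; first by rewrite ler_wpM2l// ler_norm.
  by rewrite ler_wpM2r.
have hd s : D s -> der (fun s => k * f s) s (k * f' s / rho s).
  move=> Ds; apply: der_eq; first exact: derM (der_cst k s) (h2 s Ds).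
  by rewrite mul0r add0r mulrA.
split; split.
- move=> s Ds; have := sym_bound ic Ds; rewrite !mulr1 => h.
  by rewrite (le_trans h)// lerDl.
- exists (fun s => - (sin (k * f s) * (k * f' s))).
    by move=> s Ds; apply: (der_eq (der_cos (hd s Ds))); rewrite mulNr mulNr mulrA.
  have := symN (symM1 is_ h4); apply: sym_weak => // s _.
  by rewrite !mulr1 lerDr ltW.
- move=> s Ds; have := sym_bound is_ Ds; rewrite !mulr1 => h.
  by rewrite (le_trans h)// lerDl.
- exists (fun s => cos (k * f s) * (k * f' s)).
    by move=> s Ds; apply: (der_eq (der_sin (hd s Ds))); rewrite mulrA.
  have := symM1 ic h4; apply: sym_weak => // s _.
  by rewrite !mulr1 lerDr ltW.
Qed.

Lemma sym_scale n D w C f x : 0 < x -> sym n D id w C f ->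
  sym n (fun s => D (s * x)) id (fun s => w (s * x)) C (fun s => f (s * x)).
Proof.
move=> x0; elim: n f => [|n ih] f [h1 h2]; split => //; try by move=> s Ds; exact: h1.
case: h2 => f' h2 h3; exists (fun s => f' (s * x)); last exact: ih.
move=> s Ds; have hd : der (fun s : R => s * x) s x.
  by apply: (der_eq (derM (der_id s) (der_cst x s))); rewrite mul1r mulr0 addr0.
apply: (der_eq (@der_comp _ f (fun t => t * x) s _ _ (h2 _ Ds) hd)); rewrite /= invfM.
by rewrite -!mulrA mulVf ?mulr1// gt_eqF.
Qed.

(** The derivation [rho' d/ds] is [rho d/ds] multiplied by [rho' / rho], so bounds pass from [rho]
    to [rho'] as soon as this ratio is itself a symbol. *)
Lemma sym_rho n D rho rho' w C C' f : (forall s, D s -> 0 < rho s) ->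
  (forall s, D s -> 0 < rho' s) ->
  sym n D rho' one_ C' (fun s => rho' s / rho s) -> sym n D rho w C f ->
  0 <= C -> 1 <= C' -> (forall s, D s -> 0 <= w s) ->
  sym n D rho' w ((2 ^+ n * C') ^+ n * C) f.
Proof.
move=> r0 r0' hr + C0 C1 w0.
elim: n f hr => [|n ih] f hr; first by move=> [h1 _]; split => //; rewrite expr0 mul1r.
move=> hf; have [h1 [f' h2 h3]] := hf.
have X1 : 1 <= 2 ^+ n * C' by rewrite mulr_ege1// exprn_ege1// ler1n.
have X2 : 2 ^+ n * C' <= 2 ^+ n.+1 * C'.
  by rewrite ler_wpM2r ?(le_trans ler01)// exprS ler_peMl ?exprn_ge0// ler1n.
split.
  move=> s Ds; rewrite (le_trans (h1 s Ds))// -mulrA ler_peMl ?mulr_ge0 ?w0//.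
  by rewrite exprn_ege1// (le_trans X1).
exists (fun s => f' s * (rho' s / rho s)).
  move=> s Ds; apply: (der_eq (h2 s Ds)).
  by field; rewrite !gt_eqF ?r0 ?r0'.
have := symM1 (ih f' (sym_low hr) h3) (sym_low hr).
apply: sym_weak => // s Ds; rewrite ler_wpM2r ?w0//.
rewrite [leLHS](_ : _ = (2 ^+ n * C') ^+ n * (2 ^+ n * C') * C); last by ring.
rewrite -exprSr ler_wpM2r//; rewrite lerXn2r// nnegrE (le_trans ler01)//.
by rewrite (le_trans X1).
Qed.

(** [G] is the derivative of [F] along the field [h]: if [sg' = h sg], the chain rule reads
    [(F sg)' = G sg]. Each such derivative costs a factor [1 / rho] in the weight. *)
Lemma sym_field n D rho w C H V h F : (forall s, D s -> h s != 0) ->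
  sym n.+1 D rho w C F -> sym n D rho one_ H h ->
  sym n D rho (fun s => (rho s)^-1) V (fun s => (rho s)^-1) ->
  exists2 G, (forall s, D s -> der F s (G s / h s)) &
    sym n D rho (fun s => w s * (rho s)^-1) (2 ^+ n * (2 ^+ n * (C * H) * V)) G.
Proof.
move=> h0 [_ [g h1 h2]] hh hr; exists (fun s => g s * h s * (rho s)^-1).
  by move=> s Ds; apply: (der_eq (h1 s Ds)); rewrite mulrAC mulfK ?h0.
by have := symM (symM1 h2 hh) hr.
Qed.

Lemma open_oo (a b : R) : open [set s : R | a < s < b].
Proof.
have -> : [set s : R | a < s < b] = `]a, b[%classic by apply/seteqP; split => x /=; rewrite in_itv.
exact: interval_open.
Qed.

(** The derivative available on [D2] is extended by [0]; on the overlap with [D1] uniqueness of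
    derivatives makes it vanish already. *)
Lemma sym_glue n D (D1 : pred R) D2 w C f : open [set s | D1 s] -> open [set s | D2 s] ->
  (forall s, D2 s -> 0 < s) -> (forall s, D s -> D1 s \/ D2 s) -> (forall s, D s -> 0 <= C * w s) ->
  (forall s, D1 s -> f s = 0) -> sym n D2 id w C f -> sym n D id w C f.
Proof.
move=> o1 o2 D20 D12 hw; elim: n f => [|n ih] f f0 [h1 h2]; split => //;
  try by move=> s Ds; have [/f0->|/h1] := D12 s Ds; rewrite ?normr0 ?hw.
case: h2 => g h2 h3; have z0 s : D1 s -> der f s 0.
  move=> Ds; apply: (@der_congr_near _ (fun=> 0)) (der_cst 0 s).
  by near=> t; rewrite f0//; near: t; exact: open_nbhs_nbhs.
exists (fun s => if D1 s then 0 else g s).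
  move=> s Ds; case: ifPn => [d1|nd]; first by rewrite mul0r; exact: z0.
  by have [d1|] := D12 s Ds; [rewrite d1 in nd|exact: h2].
apply: ih => [s ->//|]; apply: sym_congr h3 => // s Ds; case: ifPn => // d1.
have := der_uniq (z0 s d1) (h2 s Ds) => /esym/eqP; rewrite mulf_eq0 => /orP[/eqP //|].
by rewrite invr_eq0 /= gt_eqF// D20.
Unshelve. all: by end_near. Qed.

End Symbols.

(** * Iterated differences *)

Section OscillatorySums.
Context {R : realType}.
Implicit Types (f g : nat -> R) (a al x M : R).

Definition ndiff (M : nat) g (n : nat) : R := g (n + M)%N - g n.

Lemma sum_shift (g : nat -> R) (phi : nat -> R) k N :
  (forall n, (n < k)%N -> g n = 0) -> (forall n, (N <= n)%N -> g n = 0) ->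
  \sum_(0 <= n < N) g (n + k)%N * phi (n + k)%N = \sum_(0 <= n < N) g n * phi n.
Proof.
move=> g0 gN.
have E : \sum_(0 <= n < N) g (n + k)%N * phi (n + k)%N = \sum_(k <= n < N + k) g n * phi n.
  by rewrite -{2}[k](add0n k) (big_addn 0 _ k) addnK.
have [kN|Nk] := leqP k N.
  rewrite E (big_cat_nat kN) /=; last by rewrite leq_addr.
  rewrite [X in _ + X]big1_seq ?addr0; last first.
    by move=> i /=; rewrite mem_index_iota => /andP[h _]; rewrite gN ?mul0r.
  rewrite [RHS](big_cat_nat (leq0n k) kN) /= [X in _ = X + _]big1_seq ?add0r//.
  by move=> i /=; rewrite mem_index_iota => /andP[_ h]; rewrite g0 ?mul0r.
have gz n : g n = 0.
  have [nk|kn] := ltnP n k; first exact: g0.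
  by apply: gN; apply: leq_trans kn; exact: ltnW.
by rewrite !big1// => i _; rewrite gz mul0r.
Qed.

(** Summation by parts: the centred second difference of step [M] multiplies [cos (a * n%:R + al)]
    by [- (2 - 2 * cos (a * M%:R))]. There are no boundary terms, as [g] vanishes on the first
    [2 * M] indices and from [N] on. *)
Lemma osc_step g N (M : nat) a al :
  (forall n, (n < 2 * M)%N -> g n = 0) -> (forall n, (N <= n)%N -> g n = 0) ->
  (2 - 2 * cos (a * M%:R)) * \sum_(0 <= n < N) g n * cos (a * n%:R + al) =
  - \sum_(0 <= n < N) ndiff M (ndiff M g) n * cos (a * n%:R + (a * M%:R + al)).
Proof.
move=> g0 gN.
have hM n : (n < M)%N -> g n = 0 by move=> h; apply: g0; apply: (leq_trans h); rewrite mul2n -addnn leq_addr.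
have S0 := sum_shift (fun n => cos (a * n%:R + (a * M%:R + al))) (fun n (h : (n < 0)%N) => g0 n (leq_trans h (leq0n _))) gN.
have S1 := sum_shift (fun n => cos (a * n%:R + al)) hM gN.
have S2 := sum_shift (fun n => cos (a * n%:R + (al - a * M%:R))) g0 gN.
have E : \sum_(0 <= n < N) ndiff M (ndiff M g) n * cos (a * n%:R + (a * M%:R + al)) =
  \sum_(0 <= n < N) g (n + 2 * M)%N * cos (a * (n + 2 * M)%:R + (al - a * M%:R)) -
  2 * \sum_(0 <= n < N) g (n + M)%N * cos (a * (n + M)%:R + al) +
  \sum_(0 <= n < N) g n * cos (a * n%:R + (a * M%:R + al)).
  rewrite mulr_sumr -sumrB -big_split /=; apply: eq_bigr => n _.
  rewrite /ndiff -addnA addnn -mul2n.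
  have -> : a * (n + 2 * M)%:R + (al - a * M%:R) = a * n%:R + (a * M%:R + al).
    by rewrite natrD natrM; ring.
  have -> : a * (n + M)%:R + al = a * n%:R + (a * M%:R + al) by rewrite natrD; ring.
  ring.
rewrite E S1 S2 mulr_sumr mulr_sumr -sumrB -big_split /= -sumrN; apply: eq_bigr => n _.
have -> : a * n%:R + (a * M%:R + al) = (a * n%:R + al) + a * M%:R by ring.
have -> : a * n%:R + (al - a * M%:R) = (a * n%:R + al) - a * M%:R by ring.
by rewrite (cosB (a * n%:R + al)) (cosD (a * n%:R + al)); ring.
Qed.

Lemma ndiff_vanish g k (M : nat) : (forall n, (n < k + M)%N -> g n = 0) ->
  forall n, (n < k)%N -> ndiff M g n = 0.
Proof.
by move=> h n nk; rewrite /ndiff !h ?subrr//; lia.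
Qed.

Lemma ndiff_vanish_hi g N (M : nat) : (forall n, (N <= n)%N -> g n = 0) ->
  forall n, (N <= n)%N -> ndiff M g n = 0.
Proof. by move=> h n nk; rewrite /ndiff !h ?subrr// (leq_trans nk)// leq_addr. Qed.

Lemma osc_sum k g N (M : nat) a al :
  (forall n, (n < 2 * k * M)%N -> g n = 0) -> (forall n, (N <= n)%N -> g n = 0) ->
  (2 - 2 * cos (a * M%:R)) ^+ k * `|\sum_(0 <= n < N) g n * cos (a * n%:R + al)|
  <= \sum_(0 <= n < N) `|iter (2 * k) (ndiff M) g n|.
Proof.
elim: k g al => [|k ih] g al g0 gN.
  rewrite expr0 mul1r muln0 /=; apply: (le_trans (ler_norm_sum _ _ _)).
  apply: ler_sum => n _; rewrite normrM ler_piMr//; exact: cos_max.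
have c0 : 0 <= 2 - 2 * cos (a * M%:R) by have := cos_le1 (a * M%:R); lra.
rewrite exprSr -mulrA -{2}(ger0_norm c0) -normrM osc_step//; last first.
  by move=> n h; apply: g0; apply: (leq_trans h); rewrite leq_mul2r leq_pmulr ?orbT.
rewrite normrN.
have -> : (2 * k.+1 = (2 * k).+2)%N by rewrite mulnS.
rewrite 2!iterSr; apply: ih.
  apply: ndiff_vanish; apply: ndiff_vanish => n h; apply: g0; apply: (leq_trans h).
  by lia.
by apply: ndiff_vanish_hi; exact: ndiff_vanish_hi.
Qed.

Definition rdiff M (f : R -> R) (x : R) : R := f (x + M) - f x.

Fixpoint dchain n (I : R -> Prop) (f : R -> R) (B : R) : Prop :=
  if n is n'.+1 then exists2 g, (forall x, I x -> der f x (g x)) & dchain n' I g B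
  else forall x, I x -> `|f x| <= B.

Lemma dchain_diff n (I I' : R -> Prop) (f : R -> R) B M : 0 <= M ->
  (forall x y, I' x -> x <= y <= x + M -> I y) ->
  dchain n.+1 I f B -> dchain n I' (rdiff M f) (M * B).
Proof.
move=> M0 hI; elim: n f => [|n ih] f.
  move=> [g h1 h2] x Ix; have xM : x <= x + M by rewrite lerDl.
  have hh y : x <= y <= x + M -> I y by exact: hI.
  apply: (@le_trans _ _ (B * (x + M - x))); last by rewrite addrAC subrr add0r mulrC.
  apply: (der_lip xM) => y hy; first exact: h1 (hh y hy).
  by have /andP[xy /ltW yM] := hy; apply/h2/hh; rewrite xy.
move=> [g h1 h2]; exists (rdiff M g); last exact: ih.
move=> x Ix; apply: derB; last by apply: h1; apply: (hI x) => //; rewrite lexx lerDl.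
have hd : der (fun t : R => t + M) x 1.
  by apply: (der_eq (derD (der_id x) (der_cst M x))); rewrite addr0.
apply: (der_eq (@der_comp _ f (fun t => t + M) x _ _ (h1 (x + M) _) hd)); last by rewrite mulr1.
by apply: (hI x) => //; rewrite lexx lerDl M0.
Qed.

Lemma rdiff_bound n x (f : R -> R) B M : 0 <= M ->
  dchain n (fun y => x <= y <= x + n%:R * M) f B ->
  `|iter n (rdiff M) f x| <= M ^+ n * B.
Proof.
move=> M0; elim: n f B => [|n ih] f B.
  by move=> h; rewrite expr0 mul1r /=; apply: h; rewrite mul0r addr0 lexx.
move=> h; rewrite iterSr exprSr -mulrA; apply: ih; apply: dchain_diff h => //.
move=> y z /andP[h1 h2] /andP[h3 h4]; rewrite (le_trans h1 h3)/=.
by rewrite -natr1 mulrDl mul1r; lra.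
Qed.

Lemma ndiff_rdiff n (M off : nat) (f : R -> R) (g : nat -> R) k :
  (forall i, (i <= n)%N -> g (k + i * M)%N = f (k%:R + i%:R * M%:R - off%:R)) ->
  iter n (ndiff M) g k = iter n (rdiff M%:R) f (k%:R - off%:R).
Proof.
elim: n f g k => [|n ih] f g k h; first by have := h 0%N isT; rewrite mul0n addn0 mul0r addr0.
rewrite !iterSr; apply: ih => i ik; rewrite /ndiff /rdiff.
rewrite -addnA -{2}[M]mul1n -mulnDl addn1 h// h; last by exact: leqW.
by rewrite -natr1; congr (f _ - f _); ring.
Qed.

Lemma ndiff_triv n (M : nat) (g : nat -> R) k B :
  (forall i, (i <= n)%N -> `|g (k + i * M)%N| <= B) -> `|iter n (ndiff M) g k| <= 2 ^+ n * B.
Proof.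
elim: n g k B => [|n ih] g k B h.
  by rewrite expr0 mul1r /=; have := h 0%N isT; rewrite mul0n addn0.
rewrite iterSr exprSr -mulrA; apply: ih => i ik; rewrite /ndiff.
rewrite -addnA -{2}[M]mul1n -mulnDl addn1 mulrDl mul1r.
by rewrite (le_trans (ler_normB _ _))// lerD// h// leqW.
Qed.

Definition bump (M a x : R) : R := (1 + `|x - a| / M) ^- 2.

(** The function [x / (1 + |x| / M)] is bounded by [M], and four times its increment over a unit
    step dominates the bump, so the sum telescopes. *)
Lemma bump_sum M a N : 1 <= M -> \sum_(0 <= n < N) bump M a n%:R <= 8 * M.
Proof.
move=> M1; have M0 : 0 < M by exact: lt_le_trans M1.
pose psi x := x / (1 + `|x| / M).
have P x : 0 < 1 + `|x| / M by rewrite ltr_pwDl// divr_ge0// ltW.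
have psi_le x : `|psi x| <= M.
  rewrite normrM normfV (gtr0_norm (P x)) ler_pdivrMr//.
  by rewrite mulrDr mulr1 mulrC divfK ?gt_eqF// lerDr ltW.
have key x : (1 + `|x| / M) ^- 2 <= 4 * (psi (x + 1) - psi x).
  have [x0|x0] := leP 0 x.
    have x10 : 0 <= x + 1 by lra.
    rewrite /psi (ger0_norm x0) (ger0_norm x10).
    have p1 : 0 < 1 + x / M by have := P x; rewrite ger0_norm.
    have p2 : 0 < 1 + (x + 1) / M by have := P (x + 1); rewrite ger0_norm.
    have -> : (x + 1) / (1 + (x + 1) / M) - x / (1 + x / M) =
       ((1 + x / M) * (1 + (x + 1) / M))^-1.
      by field; rewrite !gt_eqF//; [move: p1|move: p2]; rewrite -(pmulr_lgt0 _ M0) mulrDl divfK ?gt_eqF// mul1r; lra.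
    rewrite -[4]invrK -invfM lef_pV2 ?posrE ?mulr_gt0 ?exprn_gt0// expr2.
    have : 1 + (x + 1) / M <= 2 * (1 + x / M).
      have : M^-1 <= 1 by rewrite invf_le1.
      have : 0 <= x / M by nng.
      by rewrite mulrDl mul1r; move: (x / M) (M^-1) => y z; lra.
    move: p1 p2; move: (1 + x / M) (1 + (x + 1) / M) => y z y0 z0 h.
    nra.
  have [x1|x1] := leP x (-1).
    have x10 : x + 1 <= 0 by lra.
    rewrite /psi (ltr0_norm x0) (ler0_norm x10).
    have p1 : 0 < 1 + - x / M by have := P x; rewrite ltr0_norm.
    have p2 : 0 < 1 + - (x + 1) / M by have := P (x + 1); rewrite ler0_norm.
    have -> : (x + 1) / (1 + - (x + 1) / M) - x / (1 + - x / M) =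
       ((1 + - x / M) * (1 + - (x + 1) / M))^-1.
      by field; rewrite !gt_eqF//; [move: p1|move: p2]; rewrite -(pmulr_lgt0 _ M0) mulrDl divfK ?gt_eqF// mul1r; lra.
    rewrite -[4]invrK -invfM lef_pV2 ?posrE ?mulr_gt0 ?exprn_gt0// expr2.
    have : 1 + - (x + 1) / M <= 1 + - x / M.
      by rewrite lerD2l ler_pM2r ?invr_gt0//; lra.
    move: p1 p2; move: (1 + - x / M) (1 + - (x + 1) / M) => y z y0 z0 h.
    nra.
  have x10 : 0 < x + 1 by lra.
  rewrite /psi (ltr0_norm x0) (gtr0_norm x10).
  have hh y : 0 < y < 1 -> y / 2 <= y / (1 + y / M).
    move=> /andP[y0 y1]; have yM : 0 < y / M by nng.
    rewrite ler_pM2l// lef_pV2 ?posrE//; last by lra.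
    have : y / M <= y by rewrite ger_pMr// invf_le1.
    by lra.
  have h1 := hh (x + 1) ltac:(lra); have h2 := hh (- x) ltac:(lra).
  have : (1 + - x / M) ^- 2 <= 1.
    rewrite invf_le1 ?exprn_gt0//; last by rewrite ltr_pwDl// divr_ge0//; lra.
    by rewrite exprn_ege1// lerDl divr_ge0//; lra.
  have -> : x / (1 + - x / M) = - (- x / (1 + - x / M)) by rewrite !mulNr opprK.
  by move: h1 h2; move: (_ / (1 + (x + 1) / M)) (- x / (1 + - x / M)) => A B; lra.
have : \sum_(0 <= n < N) bump M a n%:R <= \sum_(0 <= n < N) 4 * (psi (n.+1%:R - a) - psi (n%:R - a)).
  apply: ler_sum => n _; rewrite /bump (le_trans (key _))//.
  by rewrite (_ : n.+1%:R - a = n%:R - a + 1)// -natr1; ring.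
move=> h; apply: (le_trans h); rewrite -mulr_sumr telescope_sumr//.
have := psi_le (N%:R - a); have := psi_le (0%:R - a); rewrite !ler_norml.
by move: (psi _) (psi _) => A B; lra.
Qed.

End OscillatorySums.

(** * Modulus and phase *)

Section Decay.
Context {R : realType}.
Variable a : R.
Hypothesis a0 : 0 < a.
Implicit Types (f g h r : R -> R) (s t K : R) (k m : nat).

Definition isO k f := exists2 K, 0 <= K & forall s, a <= s -> `|f s| <= K * s^-1 ^+ k.

Let pos s : a <= s -> 0 < s. Proof. exact: lt_le_trans. Qed.

Lemma isO_ext k f g : (forall s, f s = g s) -> isO k f -> isO k g.
Proof. by move=> /funext ->. Qed.

Lemma isO_congr k f g : (forall s, a <= s -> f s = g s) -> isO k f -> isO k g.
Proof. by move=> h [K K0 hK]; exists K => // s as_; rewrite -h// hK. Qed.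

Lemma isOD k f g : isO k f -> isO k g -> isO k (fun s => f s + g s).
Proof.
move=> [K K0 h] [L L0 h']; exists (K + L); first exact: addr_ge0.
by move=> s as_; rewrite mulrDl (le_trans (ler_normD _ _))// lerD ?h ?h'.
Qed.

Lemma isON k f : isO k f -> isO k (fun s => - f s).
Proof. by move=> [K K0 h]; exists K => // s as_; rewrite normrN h. Qed.

Lemma isOB k f g : isO k f -> isO k g -> isO k (fun s => f s - g s).
Proof. by move=> h1 h2; exact: isOD h1 (isON h2). Qed.

Lemma isOM k m f g : isO k f -> isO m g -> isO (k + m) (fun s => f s * g s).
Proof.
move=> [K K0 h] [L L0 h']; exists (K * L); first exact: mulr_ge0.
by move=> s as_; rewrite normrM exprD mulrACA ler_pM ?h ?h'.
Qed.

Lemma isO10 k f g : isO k f -> isO 0 g -> isO k (fun s => f s * g s).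
Proof. by move=> h1 h2; have := isOM h1 h2; rewrite addn0. Qed.

Lemma isO_cst K : isO 0 (fun=> K).
Proof. by exists `|K| => // s _; rewrite mulr1. Qed.

Lemma isO_inv k : isO k (fun s => s^-1 ^+ k).
Proof.
exists 1 => // s /pos s0; rewrite mul1r ger0_norm// exprn_ge0// invr_ge0 ltW//.
Qed.

Lemma isO_low k m f : (k <= m)%N -> isO m f -> isO k f.
Proof.
move=> km [K K0 h]; exists (K * a^-1 ^+ (m - k)); first by nng.
move=> s as_; rewrite (le_trans (h s as_))// -{1}(subnK km) exprD mulrA.
have s0 := pos as_.
rewrite ler_wpM2r ?exprn_ge0 ?invr_ge0 ?(ltW s0)// ler_wpM2l// lerXn2r ?nnegrE ?invr_ge0 ?(ltW s0) ?(ltW a0)//.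
by rewrite lef_pV2.
Qed.

Lemma der_invX m s : 0 < s -> der (fun s => s^-1 ^+ m) s (- m%:R * s^-1 ^+ m.+1).
Proof.
move=> s0; have s1 : s != 0 by rewrite gt_eqF.
apply: (der_eq (derX m (derV s1 (der_id s)))); case: m => [|m] /=; first by rewrite !mul0r oppr0 mul0r.
by rewrite !exprS expr0; field.
Qed.

Lemma isO_integrate m f f' : (forall s, a <= s -> der f s (f' s)) -> isO m.+2 f' ->
  exists l, isO m.+1 (fun s => f s - l).
Proof.
move=> df [K K0 h]; pose L := K / m.+1%:R.
have L0 : 0 <= L by nng.
have q1 s t : a <= s -> s <= t -> `|f t - f s| <= L * s^-1 ^+ m.+1 - L * t^-1 ^+ m.+1.
  move=> as_ st; have as2 x : s <= x <= t -> a <= x.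
    by move=> /andP[sx _]; exact: le_trans sx.
  have hg x : s <= x <= t -> der (fun x => - (L * x^-1 ^+ m.+1)) x (K * x^-1 ^+ m.+2).
    move=> /as2/pos x0; apply: (der_eq (derN (derM (der_cst L x) (der_invX m.+1 x0)))).
    by rewrite mul0r add0r /L; field; rewrite addrC natr1 pnatr_eq0.
  have := der_dominated st (fun x hx => df x (as2 x hx)) hg (fun x hx => h x (le_trans as_ (andP hx).1)).
  by rewrite opprK [in leRHS]addrC.
have q2 (e : R) : 0 < e -> forall s, exists2 t, s <= t & `|L * t^-1 ^+ m.+1| <= e.
  move=> e0 s; pose t := Num.max (Num.max s 1) (L / e).
  have t1 : 1 <= t by rewrite /t !le_max lexx orbT.
  have t0 : 0 < t by exact: lt_le_trans t1.
  exists t; first by rewrite /t !le_max lexx.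
  have tV : 0 <= t^-1 by nng.
  rewrite ger0_norm; last by nng.
  apply: (@le_trans _ _ (L * t^-1)).
    by rewrite ler_wpM2l// exprS ger_pMr ?invr_gt0// exprn_ile1// invf_le1.
  rewrite ler_pdivrMr// mulrC -ler_pdivrMr//.
  by rewrite /t le_max lexx orbT.
have [l hl] := limit_squeeze q1 q2.
by exists l; exists L.
Qed.

Lemma isO_lim0 f (l : R) : isO 1 f -> isO 1 (fun s => f s - l) -> l = 0.
Proof.
move=> h1 h2; have [K K0 h] : isO 1 (fun=> l).
  by have := isOB h1 h2; apply: isO_ext => s; ring.
apply/eqP; rewrite -normr_eq0; apply/negP => /negP l0.
have lp : 0 < `|l| by rewrite lt_neqAle eq_sym l0 normr_ge0.
pose s := Num.max a ((K + 1) / `|l|).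
have as_ : a <= s by rewrite le_max lexx.
have s0 := pos as_.
have := h s as_; rewrite expr1 ler_pdivlMr// => hh.
have : (K + 1) / `|l| <= s by rewrite le_max lexx orbT.
by rewrite ler_pdivrMr// mulrC => h3; lra.
Qed.

Lemma isO_integrate0 m f f' : (forall s, a <= s -> der f s (f' s)) -> isO m.+2 f' ->
  isO 1 f -> isO m.+1 f.
Proof.
move=> df h h1; have [l hl] := isO_integrate df h.
have l0 : l = 0 by apply: (isO_lim0 h1); exact: isO_low hl.
by move: hl; rewrite l0; apply: isO_ext => s; rewrite subr0.
Qed.

Lemma isO_bounded m f g : (forall s, `|f s| <= 1) -> isO m g -> isO m (fun s => g s * f s).
Proof.
move=> h [K K0 hK]; exists K => // s as_; rewrite normrM (le_trans _ (hK s as_))//.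
by rewrite ler_piMr.
Qed.

(* Writing [r'' + 4 r = h] in the rotating frame makes [r] an integral of [h]. *)
Lemma oscillator m r r1 h : (forall s, a <= s -> der r s (r1 s)) ->
  (forall s, a <= s -> der r1 s (- 4 * r s + h s)) -> isO m.+2 h -> isO 1 r -> isO 1 r1 ->
  isO m.+1 r /\ isO m.+1 r1.
Proof.
move=> dr dr1 hh hr hr1.
have d2 s : der (fun s : R => 2 * s) s 2.
  by apply: (der_eq (derM (der_cst 2 s) (der_id s))); ring.
pose X s := r1 s * cos (2 * s) + r s * sin (2 * s) * 2.
pose Y s := r1 s * sin (2 * s) - r s * cos (2 * s) * 2.
have cb s : `|cos (2 * s)| <= 1 by exact: cos_max.
have sb s : `|sin (2 * s)| <= 1 by exact: sin_max.
have two : isO 0 (fun=> 2) by exact: isO_cst.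
have rot C S : (forall s, der C s (- (2 * S s))) -> (forall s, der S s (2 * C s)) ->
    (forall s, `|C s| <= 1) -> (forall s, `|S s| <= 1) -> isO m.+1 (fun s => r1 s * C s + r s * S s * 2).
  move=> dC dS C1 S1; apply: (@isO_integrate0 m _ (fun s => h s * C s)); last 1 first.
  - apply: isOD; first exact: isO_bounded.
    by apply: isO10 => //; exact: isO_bounded.
  - move=> s as_; apply: der_eq; first exact: derD (derM (dr1 s as_) (dC s)) (derM (derM (dr s as_) (dS s)) (der_cst 2 s)).
    by rewrite /=; ring.
  - exact: isO_bounded.
have hX : isO m.+1 X.
  by apply: rot => // s; [apply: (der_eq (der_cos (d2 s)))|apply: (der_eq (der_sin (d2 s)))]; ring.
have hY : isO m.+1 Y.
  have : isO m.+1 (fun s => r1 s * sin (2 * s) + r s * - cos (2 * s) * 2).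
    apply: rot => // s; last by rewrite normrN.
      by apply: (der_eq (der_sin (d2 s))); ring.
    by apply: (der_eq (derN (der_cos (d2 s)))); ring.
  by apply: isO_ext => s; rewrite /Y; ring.
have cs s : cos (2 * s) ^+ 2 + sin (2 * s) ^+ 2 = 1 by exact: cos2Dsin2.
split.
  have h1 : isO m.+1 (fun s => X s * sin (2 * s) - Y s * cos (2 * s)).
    by apply: isOB; exact: isO_bounded.
  have := isOM h1 (isO_cst 2^-1); rewrite addn0; apply: isO_ext => s.
  transitivity (r s * (cos (2 * s) ^+ 2 + sin (2 * s) ^+ 2)); last by rewrite cs mulr1.
  by rewrite /X /Y; field.
have : isO m.+1 (fun s => X s * cos (2 * s) + Y s * sin (2 * s)).
  by apply: isOD; exact: isO_bounded.
apply: isO_ext => s.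
transitivity (r1 s * (cos (2 * s) ^+ 2 + sin (2 * s) ^+ 2)); last by rewrite cs mulr1.
by rewrite /X /Y; ring.
Qed.

End Decay.

Ltac isO0 := repeat first [assumption | exact: isO_cst | apply: isOB | apply: isOD | apply: isO10].

(** * A modulus without oscillation *)

Section ModulusPhase.
Context {R : realType}.
Variables (a c : R) (u u1 : R -> R).
Implicit Types (s t x m M K l : R).
Hypothesis a0 : 0 < a.
Hypothesis du : forall s, 0 < s -> der u s (u1 s).
Hypothesis du1 : forall s, 0 < s -> der u1 s (- (1 - c * s^-1 ^+ 2) * u s).
Hypothesis unz : exists2 s, 0 < s & u s != 0.
Local Notation isO := (isO a).

(** The energy of [u'' = - u], which the equation perturbs: its derivative is of size [E / s^2], so
    that [E] has a positive limit at infinity. *)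
Let E s := u s ^+ 2 + u1 s ^+ 2.
Let k := `|c|.

Let dE s : 0 < s -> der E s (2 * (c * s^-1 ^+ 2) * u s * u1 s).
Proof.
move=> s0; apply: (der_eq (derD (derX 2 (du s0)) (derX 2 (du1 s0)))).
by rewrite /= !expr1; ring.
Qed.

Let E_ge0 s : 0 <= E s. Proof. by nng. Qed.

Let dE_le s : 0 < s -> `|2 * (c * s^-1 ^+ 2) * u s * u1 s| <= k * s^-1 ^+ 2 * E s.
Proof.
move=> s0; rewrite -mulrA normrM.
have -> : `|2 * (c * s^-1 ^+ 2)| = k * s^-1 ^+ 2 * 2.
  have z0 : 0 <= s^-1 ^+ 2 by nng.
  rewrite normrM (normrM c) (ger0_norm z0) /k ger0_norm//; ring.
have z0 : 0 <= k * s^-1 ^+ 2.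
  by apply: mulr_ge0; [exact: normr_ge0|apply: exprn_ge0; rewrite invr_ge0 ltW].
rewrite -[leLHS]mulrA; apply: (ler_wpM2l z0).
rewrite /E normrM -(real_normK (num_real (u s))) -(real_normK (num_real (u1 s))).
have := sqr_ge0 (`|u s| - `|u1 s|); lra.
Qed.

Let dexp (e s : R) : 0 < s -> der (fun s => expR (e * s^-1) * E s) s
  (expR (e * s^-1) * (2 * (c * s^-1 ^+ 2) * u s * u1 s - e * s^-1 ^+ 2 * E s)).
Proof.
move=> s0; have s1 : s != 0 by rewrite gt_eqF.
apply: (der_eq (derM (der_exp (derM (der_cst e s) (derV s1 (der_id s)))) (dE s0))).
by rewrite /= exprVn; ring.
Qed.

(** Gronwall's inequality in both directions, with [- k / s] as antiderivative of [k / s^2]. *)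
Let E_mono s t : 0 < s -> s <= t ->
  expR (k * t^-1) * E t <= expR (k * s^-1) * E s /\
  expR (- k * s^-1) * E s <= expR (- k * t^-1) * E t.
Proof.
move=> s0 st; have xpos x : s <= x -> 0 < x by exact: lt_le_trans.
split.
- have := @der_nondecr R s t (fun s => - (expR (k * s^-1) * E s)) _ st
    (fun x hx => derN (dexp k (xpos x (andP hx).1))).
  rewrite lerN2; apply=> x /andP[/xpos x0 _]; rewrite oppr_ge0 mulr_ge0_le0 ?expR_ge0//.
  by rewrite subr_le0 (le_trans (ler_norm _))// dE_le.
- apply: (@der_nondecr R s t _ _ st (fun x hx => dexp (- k) (xpos x (andP hx).1))) => x /andP[/xpos x0 _].
  rewrite mulr_ge0 ?expR_ge0// mulNr mulNr opprK.
  by have := dE_le x0; rewrite ler_norml => /andP[h _]; lra.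
Qed.

Let E_gt0 s : 0 < s -> 0 < E s.
Proof.
move=> s0; have [t t0 ut] := unz.
have Et : 0 < E t by rewrite /E ltr_wpDr ?sqr_ge0// lt_neqAle eq_sym sqrf_eq0 ut sqr_ge0.
have [st|/ltW ts] := leP s t.
- have [h _] := E_mono s0 st; rewrite -(pmulr_rgt0 _ (expR_gt0 (k * s^-1))).
  by apply: lt_le_trans h; rewrite mulr_gt0 ?expR_gt0.
- have [_ h] := E_mono t0 ts; rewrite -(pmulr_rgt0 _ (expR_gt0 (- k * s^-1))).
  by apply: lt_le_trans h; rewrite mulr_gt0 ?expR_gt0.
Qed.

Let pos s : a <= s -> 0 < s. Proof. exact: lt_le_trans. Qed.

Let E_bd : exists m M, [/\ 0 < m, 0 < M & forall s, a <= s -> m <= E s <= M].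
Proof.
exists (expR (- k * a^-1) * E a), (expR (k * a^-1) * E a).
split; rewrite ?mulr_gt0 ?expR_gt0 ?E_gt0// => s as_; have s0 := pos as_.
have [h1 h2] := E_mono a0 as_.
have k0 : 0 <= k * s^-1 by rewrite mulr_ge0 ?normr_ge0// invr_ge0 ltW.
apply/andP; split; [apply: (le_trans h2)|apply: le_trans h1].
- by rewrite ger_pMl ?E_gt0// expR_le1 mulNr oppr_le0.
- by rewrite ler_pMl ?E_gt0// -expR0 ler_expR.
Qed.

Let f_O f : (forall s, f s ^+ 2 <= E s) -> isO 0 f.
Proof.
move=> fE; have [m [M [m0 M0 h]]] := E_bd; exists (M + 1) => [|s as_]; first by nng.
rewrite mulr1; have /andP[_ /(le_trans (fE s))] := h s as_; rewrite -[f s ^+ 2]real_normK ?num_real//.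
have := sqr_ge0 (`|f s| - 1); nra.
Qed.

Let u_O : isO 0 u. Proof. by apply: f_O => s; rewrite lerDl sqr_ge0. Qed.
Let u1_O : isO 0 u1. Proof. by apply: f_O => s; rewrite lerDr sqr_ge0. Qed.

Let e s := (E s)^-1.

Let e_O : isO 0 e.
Proof.
have [m [M [m0 M0 h]]] := E_bd; exists m^-1; first by nng.
move=> s as_; have /andP[h1 _] := h s as_; rewrite mulr1 /e ger0_norm ?invr_ge0//.
by rewrite lef_pV2 ?posrE// (lt_le_trans m0).
Qed.

Let E_lim : exists2 A2, 0 < A2 & isO 1 (fun s => E s - A2).
Proof.
have hO : isO 2 (fun s => 2 * (c * s^-1 ^+ 2) * u s * u1 s).
  have : isO (0 + (0 + 2) + 0 + 0) (fun s => 2 * (c * s^-1 ^+ 2) * u s * u1 s).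
    apply: isOM u1_O; apply: isOM u_O; apply: isOM (isO_cst _ _) _; apply: isOM (isO_cst _ _) _.
    exact: isO_inv.
  by [].
have [l hl] := isO_integrate a0 (fun s as_ => dE (pos as_)) hO.
exists l => //; have [m [M [m0 M0 h]]] := E_bd; have [K K0 hK] := hl.
pose s := Num.max a (2 * K / m); have as_ : a <= s by rewrite le_max lexx.
have s0 := pos as_; have := hK s as_; have /andP[h1 _] := h s as_.
have : K * s^-1 ^+ 1 <= m / 2.
  rewrite expr1 ler_pdivrMr// mulrAC ler_pdivlMr// mulrC [m * s]mulrC -ler_pdivrMr//.
  by rewrite le_max lexx orbT.
by rewrite ler_norml => h2 /andP[_ h3]; lra.
Qed.

(* Rofe-Beketov's second solution [v = u J - u'/(u^2 + u'^2)], normalized so that the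
   modulus [u^2 / A2 + A2 v^2] does not oscillate. *)
Theorem modulus : exists A2 p p1 p2 X Y X1 Y1,
  [/\ 0 < A2,
      (forall s, 0 < s -> [/\ der X s (X1 s), der Y s (Y1 s), X s * Y1 s - X1 s * Y s = 1 &
         p s = X s ^+ 2 + Y s ^+ 2]),
      (forall s, 0 < s -> u s = Num.sqrt A2 * X s),
      (forall s, 0 < s -> [/\ der p s (p1 s), der p1 s (p2 s) &
         der p2 s (- 4 * (1 - c * s^-1 ^+ 2) * p1 s - 4 * c * s^-1 ^+ 3 * p s)]) &
      [/\ isO 1 (fun s => p s - 1), isO 1 p1, isO 1 p2, isO 0 X1 & isO 0 Y1]].
Proof.
have [A2 A20 hA] := E_lim.
pose i s := c * s^-1 ^+ 2 * (u s ^+ 2 - u1 s ^+ 2) * e s ^+ 2.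
have de s : 0 < s -> der e s (- (2 * (c * s^-1 ^+ 2) * u s * u1 s) * e s ^+ 2).
  move=> s0; have N : E s != 0 by rewrite gt_eqF ?E_gt0.
  by apply: (der_eq (@derV _ E s _ N (dE s0))); rewrite /e (exprVn (E s) 2).
have ic s : 0 < s -> {for s, continuous i}.
  move=> s0; have s1 : s != 0 by rewrite gt_eqF.
  have h1 := du s0; have h2 := du1 s0; have h3 := de s s0.
  by rewrite /i; eapply der_cont; deriv.
have [I0 dI0] := antideriv ic.
have iO : isO 2 i.
  have : isO (0 + 2 + 0 + 0) i.
    apply: isOM; last by have := isOM e_O e_O; apply: isO_ext => s; rewrite expr2.
    apply: isOM; first by apply: isOM (isO_cst _ _) _; exact: isO_inv.
    apply: isOB; [have := isOM u_O u_O|have := isOM u1_O u1_O];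
    by apply: isO_ext => s; rewrite expr2.
  by [].
have [l hl] := isO_integrate a0 (fun s as_ => dI0 s (pos as_)) iO.
(* With [J] vanishing at infinity, [v] approaches [- u1 / A2], so that [u^2 / A2 + A2 v^2]
   approaches [E / A2] and hence [1]. *)
pose J s := I0 s - l.
have dJ s : 0 < s -> der J s (i s).
  by move=> s0; apply: (der_eq (derB (dI0 s s0) (der_cst l s))); rewrite subr0.
have JO : isO 1 J by exact: hl.
pose v s := u s * J s - u1 s * e s.
pose v1 s := u1 s * J s + u s * e s.
have Ee s : 0 < s -> (u s ^+ 2 + u1 s ^+ 2) * e s = 1.
  by move=> s0; rewrite mulfV// gt_eqF// E_gt0.
have dv s : 0 < s -> der v s (v1 s).
  move=> s0; apply: (der_eq (derB (derM (du s0) (dJ s s0)) (derM (du1 s0) (de s s0)))).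
  have := Ee s s0; rewrite /i /v1; move: (u s) (u1 s) (e s) (s^-1) (J s) => U U1 e0 z j h.
  transitivity (U1 * j + U * e0 +
    c * z ^+ 2 * U * e0 * ((U ^+ 2 + U1 ^+ 2) * e0 - 1)); first by ring.
  by rewrite h; ring.
have dv1 s : 0 < s -> der v1 s (- (1 - c * s^-1 ^+ 2) * v s).
  move=> s0; apply: (der_eq (derD (derM (du1 s0) (dJ s s0)) (derM (du s0) (de s s0)))).
  have := Ee s s0; rewrite /i /v; move: (u s) (u1 s) (e s) (s^-1) (J s) => U U1 e0 z j h.
  transitivity (- (1 - c * z ^+ 2) * (U * j - U1 * e0) -
    c * z ^+ 2 * U1 * e0 * ((U ^+ 2 + U1 ^+ 2) * e0 - 1)); first by ring.
  by rewrite h; ring.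
have W s : 0 < s -> u s * v1 s - u1 s * v s = 1.
  by move=> s0; rewrite -(Ee s s0) /v /v1; ring.
pose A := Num.sqrt A2; have A0 : 0 < A by rewrite sqrtr_gt0.
have AA : A ^+ 2 = A2 by rewrite sqr_sqrtr// ltW.
pose p s := u s ^+ 2 / A2 + A2 * v s ^+ 2.
pose p1 s := 2 * u s * u1 s / A2 + 2 * A2 * v s * v1 s.
pose p2 s := 2 * u1 s ^+ 2 / A2 + 2 * A2 * v1 s ^+ 2 - 2 * (1 - c * s^-1 ^+ 2) * p s.
have N2 : A2 != 0 by rewrite gt_eqF.
have NA : A != 0 by rewrite gt_eqF.
have dp s : 0 < s -> der p s (p1 s).
  move=> s0; have h1 := du s0; have h2 := dv s s0; rewrite /p; eapply der_eq; first by deriv.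
  by rewrite /p1 /=; ring.
have dp1 s : 0 < s -> der p1 s (p2 s).
  move=> s0; have h1 := du s0; have h2 := dv s s0; have h3 := du1 s0; have h4 := dv1 s s0.
  by rewrite /p1; eapply der_eq; first (by deriv); rewrite /p2 /p /=; ring.
exists A2, p, p1, p2, (fun s => u s / A), (fun s => A * v s), (fun s => u1 s / A), (fun s => A * v1 s).
split; first exact: A20.
- move=> s s0; split.
  + by apply: (der_eq (derM (du s0) (der_cst _ s))); rewrite mulr0 addr0.
  + by apply: (der_eq (derM (der_cst _ s) (dv s s0))); rewrite mul0r add0r.
  + by rewrite -(W s s0); field.
  + by rewrite /p -AA; field.
- by move=> s s0; rewrite mulrC divfK.
- move=> s s0; split; [exact: dp|exact: dp1|].
  have s1 : s != 0 by rewrite gt_eqF.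
  have h0 := der_invX 2 s0.
  have h1 := dp s s0; have h2 := dv s s0; have h3 := du1 s0; have h4 := dv1 s s0.
  rewrite /p2; eapply der_eq; first by deriv.
  by rewrite /p1 /p /=; field; rewrite ?N2 ?s1.
have s2 : isO 2 (fun s => s^-1 ^+ 2) by exact: isO_inv.
have J0 := isO_low a0 (leq0n 1) JO; have hA0 := isO_low a0 (leq0n 1) hA; have eO := e_O; have uO := u_O; have u1O := u1_O.
have vO : isO 0 v by isO0.
have v1O : isO 0 v1 by isO0.
have pO : isO 1 (fun s => p s - 1).
  (* Each term of this expression of [p - 1] carries a factor [E - A2] or [J], both of order
     [1 / s]; the same holds for [p1] below. *)
  have h : isO 1 (fun s => (E s - A2) * (e s * (u s * u s * A2^-1 - u1 s * u1 s * e s)) +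
     J s * (A2 * (u s * u s * J s - 2 * u s * u1 s * e s))).
    by apply: isOD; apply: isO10 => //; isO0.
  apply: isO_congr h => s as_; have s0 := pos as_.
  rewrite /p /v /E -{2}(Ee s s0); have := Ee s s0.
  move: (u s) (u1 s) (e s) (J s) => U U1 e0 j h.
  have -> : A2 * (U * j - U1 * e0) ^+ 2 = A2 * j * (U * U * j - 2 * U * U1 * e0) + A2 * U1 ^+ 2 * e0 ^+ 2 by ring.
  have h2 : U1 ^+ 2 * e0 * (U ^+ 2 + U1 ^+ 2) * e0 = U1 ^+ 2 * e0.
    by rewrite -mulrA h mulr1.
  have h3 : U ^+ 2 * A2^-1 * ((U ^+ 2 + U1 ^+ 2) * e0) = U ^+ 2 * A2^-1 by rewrite h mulr1.
  transitivity (U ^+ 2 * A2^-1 * ((U ^+ 2 + U1 ^+ 2) * e0) - U1 ^+ 2 * e0 * (U ^+ 2 + U1 ^+ 2) * e0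
    - U ^+ 2 * e0 + A2 * U1 ^+ 2 * e0 ^+ 2 + A2 * j * (U * U * j - 2 * U * U1 * e0)).
    by field.
  by rewrite h2 h3; field.
have p1O : isO 1 p1.
  have h : isO 1 (fun s => (E s - A2) * ((E s - A2 + 2 * A2) * e s * e s * (2 * u s * u1 s * A2^-1)) +
     J s * (2 * A2 * (u s * u1 s * J s + u s * u s * e s - u1 s * u1 s * e s))).
    by apply: isOD; apply: isO10 => //; isO0.
  apply: isO_congr h => s as_; have s0 := pos as_; rewrite /p1 /v /v1.
  have := Ee s s0; rewrite /E; move: (u s) (u1 s) (e s) (J s) => U U1 e0 j h.
  set EE := U ^+ 2 + U1 ^+ 2 in h *.
  transitivity ((EE * e0) ^+ 2 * (2 * U * U1 * A2^-1) - A2 * e0 ^+ 2 * (2 * U * U1) +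
    j * (2 * A2 * (U * U1 * j + U * U * e0 - U1 * U1 * e0))); first by field.
  by rewrite h; field.
have p0 : isO 0 (fun s => p s - 1) by exact: isO_low pO.
have p10 : isO 0 p1 by exact: isO_low p1O.
have p2O : isO 0 p2.
  apply: isO_ext (_ : isO 0 (fun s => 2 * (u1 s * u1 s) * A2^-1 + 2 * A2 * (v1 s * v1 s) - 2 * (1 - c * s^-1 ^+ 2) * (p s - 1 + 1))) => [s|].
    by rewrite /p2; ring.
  have s0 : isO 0 (fun s => s^-1 ^+ 2) by exact: isO_low s2.
  by isO0.
(* [p p2 / 2 - p1 ^ 2 / 4 + (1 - c / s ^ 2) p ^ 2 = 1], the square of the Wronskian. *)
have h : isO 1 (fun s => p1 s * (p1 s * 2^-1) - (p s - 1) * (2 * (p s - 1 + 2)) - (p s - 1) * p2 s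
    + s^-1 ^+ 2 * (2 * c * (p s - 1 + 1) * (p s - 1 + 1))).
  have s1 : isO 1 (fun s => s^-1 ^+ 2) by exact: isO_low s2.
  by apply: isOD; [apply: isOB; [apply: isOB|]|]; apply: isO10 => //; isO0.
split; [exact: pO|exact: p1O| |by isO0|by isO0].
apply: isO_congr h => s as_; have s0 := pos as_; have := congr1 (fun x => 2 * x ^+ 2) (W s s0).
rewrite /p2 /p1 /p; move: (u s) (u1 s) (v s) (v1 s) => U U1 V V1; rewrite expr1n mulr1 => h.
apply/eqP; rewrite -subr_eq0; apply/eqP; transitivity (2 - 2 * (U * V1 - U1 * V) ^+ 2); last by rewrite h subrr.
by field; rewrite ?N2 ?gt_eqF.
Qed.

End ModulusPhase.

(** * Symbol estimates for the modulus *)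

Section ModulusSymbol.
Context {R : realType}.
Variables (a c : R).
Hypothesis a0 : 0 < a.
Implicit Types (p : R -> R) (s C K : R) (n m k N : nat).
Let D (s : R) := a < s.
Let sg k (s : R) := s^-1 ^+ k.

Let Dpos s : D s -> 0 < s. Proof. exact: lt_trans. Qed.

Lemma sym_invX n m : exists2 C, 0 <= C & sym n D id (sg m) C (sg m).
Proof.
exists ((1 + m%:R) ^+ n); first by nng.
have h1 : 1 <= 1 + m%:R :> R by rewrite lerDl.
have base s : D s -> `|sg m s| <= sg m s.
  by move=> /Dpos s0; rewrite ger0_norm// exprn_ge0// invr_ge0 ltW.
elim: n => [|n ih]; split => //.
- by move=> s Ds; rewrite expr0 mul1r base.
- move=> s Ds; rewrite (le_trans (base s Ds))// ler_peMl//; last exact: exprn_ege1.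
  by rewrite (le_trans _ (base s Ds)).
exists (fun s => - m%:R * sg m s).
  move=> s /Dpos s0; apply: (der_eq (der_invX m s0)); rewrite /sg exprS; rewrite /=; field.
  by rewrite gt_eqF.
have := symZ (- m%:R) ih; apply: sym_weak => // s Ds.
rewrite normrN ger0_norm// ler_wpM2r ?(le_trans _ (base s Ds))//.
by rewrite exprS ler_wpM2r ?exprn_ge0 ?(le_trans ler01)// lerDr.
Qed.

Lemma sym_sg_le n m k C f : (k <= m)%N -> sym n D id (sg m) C f -> 0 <= C ->
  exists2 C', 0 <= C' & sym n D id (sg k) C' f.
Proof.
move=> km h C0; exists (C * a^-1 ^+ (m - k)); first by nng.
apply: sym_weak h => // s Ds; have s0 := Dpos Ds.
have sv : 0 <= s^-1 by nng.
have av : 0 <= a^-1 by nng.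
rewrite /sg -{1}(subnK km) exprD mulrA ler_wpM2r ?exprn_ge0// ler_wpM2l// lerXn2r ?nnegrE//.
by rewrite lef_pV2 ?posrE// ltW.
Qed.

Lemma sym_var n : sym n D id id 1 id.
Proof.
elim: n => [|n ih]; split => //; try by move=> s /Dpos s0; rewrite mul1r gtr0_norm.
exists id => // s /Dpos s0; rewrite divff ?gt_eqF//; exact: der_id.
Qed.

(** Partial sums, in powers of [s^-2], of the formal solution of the third-order equation of the
    modulus. The next coefficient [A = rho / (4 * m%:R)] cancels the residue through the term
    [- 4 * P1], and the other terms produce a residue two orders smaller. *)
Lemma expansion N : exists P P1 P2 rho,
  [/\ forall s, 0 < s -> [/\ der P s (P1 s), der P1 s (P2 s) &
        der P2 s (- 4 * (1 - c * s^-1 ^+ 2) * P1 s - 4 * c * s^-1 ^+ 3 * P s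
          + rho * s^-1 ^+ (2 * N + 3))],
      forall n, exists2 C, 0 <= C & sym n D id (sg 2) C (fun s => P s - 1) &
      [/\ isO a 1 (fun s => P s - 1), isO a 1 P1 & isO a 1 P2]].
Proof.
elim: N => [|N [P [P1 [P2 [rho [dP sP [q0 q1 q2]]]]]]].
  exists (fun=> 1), (fun=> 0), (fun=> 0), (4 * c); split.
  - move=> s s0; split; try exact: der_cst.
    by apply: (der_eq (der_cst 0 s)); ring.
  - move=> n; exists 0 => //; rewrite subrr; apply: sym_zero => s _; by rewrite mul0r.
  - have z : isO a 1 (fun=> 0) by exists 0 => // s _; rewrite normr0 mul0r.
    by split => //; move: z; apply: isO_ext => s; rewrite subrr.
pose m := (2 * N + 2)%N; pose A := rho / (4 * m%:R).
have m0 : m%:R != 0 :> R by rewrite pnatr_eq0 /m addn2.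
exists (fun s => P s + A * s^-1 ^+ m), (fun s => P1 s - m%:R * A * s^-1 ^+ m.+1),
  (fun s => P2 s + m%:R * (m%:R + 1) * A * s^-1 ^+ m.+2),
  (A * (4 * c * m%:R + 4 * c - m%:R * (m%:R + 1) * (m%:R + 2))).
split.
- move=> s s0; have [d0 d1 d2] := dP s s0; split.
  + apply: (der_eq (derD d0 (derM (der_cst A s) (der_invX m s0)))); by ring.
  + apply: (der_eq (derB d1 (derM (der_cst _ s) (der_invX m.+1 s0)))).
    by rewrite -natr1; ring.
  + apply: (der_eq (derD d2 (derM (der_cst _ s) (der_invX m.+2 s0)))).
    have -> : (2 * N.+1 + 3 = m.+3)%N by rewrite /m; lia.
    have -> : (2 * N + 3 = m.+1)%N by rewrite /m; lia.
    have -> : rho = A * (4 * m%:R) by rewrite /A divfK// mulf_neq0.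
    by rewrite -!natr1 !exprS; ring.
- move=> n; have [C C0 h] := sP n; have [C' C'0 h'] := sym_invX n m.
  have [C2 C20 h2] := @sym_sg_le n m 2 _ _ ltac:(by rewrite /m addn2) h' C'0.
  exists (C + `|A| * C2); first by nng.
  have := symD h (symZ A h2); apply: sym_ext => s; rewrite /sg; ring.
- have z k : isO a (0 + k) (fun s => s^-1 ^+ k) by exact: isO_inv.
  have zz K k : (1 <= k)%N -> isO a 1 (fun s => K * s^-1 ^+ k).
    by move=> k1; apply: (isO_low a0 k1); exact: (isOM (isO_cst a K) (isO_inv a0 k)).
  have m1 : (1 <= m)%N by rewrite /m addn2.
  split; [|by apply: isOB q1 _; exact: zz|by apply: isOD q2 _; exact: zz].
  have := isOD q0 (zz A m m1); apply: isO_ext => s; ring.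
Qed.

(** Decay of a function says nothing about its derivatives. The modulus is therefore compared with a
    partial sum [P] long enough that [p - P], a solution of a forced oscillator with small forcing,
    has surplus decay to pay a factor [s] for every derivation. *)
Lemma modulus_sym p p1 p2 :
  (forall s, 0 < s -> [/\ der p s (p1 s), der p1 s (p2 s) &
     der p2 s (- 4 * (1 - c * s^-1 ^+ 2) * p1 s - 4 * c * s^-1 ^+ 3 * p s)]) ->
  isO a 1 (fun s => p s - 1) -> isO a 1 p1 -> isO a 1 p2 ->
  forall n, exists2 C, 0 <= C & sym n D id (sg 2) C (fun s => p s - 1).
Proof.
move=> dp o0 o1 o2 n; pose N := n.+1.
have [P [P1 [P2 [rho [dP sP [q0 q1 q2]]]]]] := expansion N.
pose e s := p s - P s; pose e1 s := p1 s - P1 s; pose e2 s := p2 s - P2 s.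
have pos s : a <= s -> 0 < s by exact: lt_le_trans.
have de s : 0 < s -> der e s (e1 s).
  by move=> s0; have [d0 _ _] := dp s s0; have [d0' _ _] := dP s s0; exact: derB.
have de1 s : 0 < s -> der e1 s (e2 s).
  by move=> s0; have [_ d0 _] := dp s s0; have [_ d0' _] := dP s s0; exact: derB.
pose h s := 4 * c * s^-1 ^+ 2 * e1 s - 4 * c * s^-1 ^+ 3 * e s - rho * s^-1 ^+ (2 * N + 3).
have de2 s : 0 < s -> der e2 s (- 4 * e1 s + h s).
  move=> s0; have [_ _ d0] := dp s s0; have [_ _ d0'] := dP s s0.
  by apply: (der_eq (derB d0 d0')); rewrite /h /e1 /e; ring.
have E0 : isO a 1 e by have := isOB o0 q0; apply: isO_ext => s; rewrite /e; ring.
have E1 : isO a 1 e1 by exact: isOB.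
have E2 : isO a 1 e2 by exact: isOB.
have cz K k f j : isO a j f -> isO a (k + j) (fun s => K * s^-1 ^+ k * f s).
  move=> hf; rewrite -[k]add0n; apply: isOM hf; exact: (isOM (isO_cst a K) (isO_inv a0 k)).
have osc m : (m <= 2 * N)%N -> isO a m e -> isO a m.+1 e1 -> isO a m.+2 e1 /\ isO a m.+2 e2.
  move=> mN h0 h1; apply: (oscillator a0 (fun s as_ => de1 s (pos s as_)) (fun s as_ => de2 s (pos s as_)) _ E1 E2).
  apply: isOB; first by apply: isOB; [exact: (@cz _ 2 _ _ h1)|exact: (@cz _ 3 _ _ h0)].
  by apply: (@isO_low _ _ a0 _ (2 * N + 3)); [lia|exact: (isOM (isO_cst a rho) (isO_inv a0 _))].
(* The forcing contains [s^-2 e'] and [s^-3 e], so each use of [oscillator] gains one power of [s],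
   until the residue of the expansion limits the decay. *)
have boot m : (m <= 2 * N + 1)%N -> isO a m e /\ isO a m.+1 e1.
  elim: m => [|m ih mN]; first by split => //; exact: isO_low E0.
  have [h0 h1] := ih (ltnW mN); have [k1 _] := osc m ltac:(lia) h0 h1.
  split => //; exact: (isO_integrate0 a0 (fun s as_ => de s (pos s as_)) k1 E0).
have [b0 b1] := boot (2 * N + 1)%N (leqnn _).
have b2 : isO a (2 * N + 1) e2.
  have [h0 h1] := boot (2 * N)%N ltac:(lia); have [_ k1] := osc _ (leqnn _) h0 h1.
  by apply: (isO_low a0 _ k1); lia.
(* A bound of order [m + 1] at decay [k] is assembled from bounds of order [m] at the decays [k] and
   [k + 1]: one power of [s] per derivation. *)
have main m : forall k, (k + m <= 2 * N + 1)%N -> exists C, [/\ 0 <= C,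
    sym m D id (sg k) C e, sym m D id (sg k) C e1 & sym m D id (sg k) C e2].
  elim: m => [|m ih] k km.
    have k1 : (k <= 2 * N + 1)%N by lia.
    have k2 : (k <= (2 * N + 1).+1)%N by lia.
    have [C0 C00 g0] := isO_low a0 k1 b0; have [C1 C10 g1] := isO_low a0 k2 b1.
    have [C2 C20 g2] := isO_low a0 k1 b2.
    have w s : D s -> 0 <= s^-1 ^+ k by move=> /Dpos s0; rewrite exprn_ge0// invr_ge0 ltW.
    exists (C0 + C1 + C2); split; first by nng.
    - split => // s Ds; rewrite (le_trans (g0 s (ltW Ds)))// ler_wpM2r ?w//; lra.
    - split => // s Ds; rewrite (le_trans (g1 s (ltW Ds)))// ler_wpM2r ?w//; lra.
    - split => // s Ds; rewrite (le_trans (g2 s (ltW Ds)))// ler_wpM2r ?w//; lra.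
  have [Ca [Ca0 s0 s1 s2]] := ih k ltac:(lia).
  have [Cb [Cb0 t0 t1 t2]] := ih k.+1 ltac:(lia).
  have vm f C : sym m D id (sg k.+1) C f -> sym m D id (sg k) (2 ^+ m * (1 * C)) (fun s => id s * f s).
    move=> hf; have := symM (sym_var m) hf; apply: sym_weak => // s /Dpos spos.
    by rewrite [id s * _](_ : _ = sg k s)// /sg exprS /= mulrA mulfV ?gt_eqF// mul1r.
  have [V2 V20 v2] := sym_invX m 2; have [V3 V30 v3] := sym_invX m 3.
  have [Vr Vr0 vr] := sym_invX m (2 * N + 3).
  have [Vr' Vr'0 vr'] := @sym_sg_le m (2 * N + 3) k.+1 _ _ ltac:(lia) vr Vr0.
  have [W2 W20 w2] := @sym_sg_le m 2 0 _ _ isT v2 V20.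
  have [W3 W30 w3] := @sym_sg_le m 3 0 _ _ isT v3 V30.
  have one C f : sym m D id (sg 0) C f -> sym m D id (@one_ R) C f.
    by apply: sym_weak => // s _; rewrite /sg expr0.
  have d2 := symB (symB (symD (symZ (-4) t1) (symZ (4 * c) (symM1 t1 (one _ _ w2))))
    (symZ (4 * c) (symM1 t0 (one _ _ w3)))) (symZ rho vr').
  set Ch := _ + _ in d2.
  have h2 := vm _ _ d2; have h1 := vm _ _ t2; have h0 := vm _ _ t1.
  set K := 2 ^+ m * (1 * Ch) in h2; set L := 2 ^+ m * (1 * Cb) in h0 h1.
  have L0 : 0 <= L by rewrite /L mul1r mulr_ge0// exprn_ge0.
  have wk C C' f : C <= C' -> sym m D id (sg k) C f -> sym m D id (sg k) C' f.
    move=> CC; apply: sym_weak => // s /Dpos spos; rewrite ler_wpM2r// exprn_ge0// invr_ge0 ltW//.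
  have wb C C' (f : R -> R) : C <= C' -> (forall s, D s -> `|f s| <= C * sg k s) -> forall s, D s -> `|f s| <= C' * sg k s.
    move=> CC hC s Ds; rewrite (le_trans (hC s Ds))// ler_wpM2r// exprn_ge0// invr_ge0 ltW//.
    exact: Dpos.
  exists (Ca + L + `|K|); split; first by nng.
  - split; first by apply: wb (sym_bound s0); rewrite -addrA lerDl addr_ge0.
    exists (fun s => id s * e1 s).
      by move=> s /Dpos spos; apply: (der_eq (de s spos)); rewrite /= mulrAC mulfV ?mul1r ?gt_eqF.
    by apply: wk h0; rewrite addrAC lerDr addr_ge0.
  - split; first by apply: wb (sym_bound s1); rewrite -addrA lerDl addr_ge0.
    exists (fun s => id s * e2 s).
      by move=> s /Dpos spos; apply: (der_eq (de1 s spos)); rewrite /= mulrAC mulfV ?mul1r ?gt_eqF.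
    by apply: wk h1; rewrite addrAC lerDr addr_ge0.
  - split; first by apply: wb (sym_bound s2); rewrite -addrA lerDl addr_ge0.
    exists (fun s => id s * (- 4 * e1 s + 4 * c * (e1 s * sg 2 s) - 4 * c * (e s * sg 3 s) - rho * sg (2 * N + 3) s)).
      move=> s /Dpos spos; apply: (der_eq (de2 s spos)); rewrite /= mulrAC mulfV ?mul1r ?gt_eqF//.
      by rewrite /h /sg; ring.
    by apply: wk h2; rewrite (le_trans (ler_norm _))// lerDr addr_ge0.
have [C [C0 s0 _ _]] := main n 2%N ltac:(rewrite /N; lia).
have [C' C'0 s1] := sP n.
exists (C + C'); first exact: addr_ge0.
have := symD s0 s1; apply: sym_ext => s; rewrite /e; ring.
Qed.

End ModulusSymbol.

(** * The phase and the zeros *)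

Section Phase.
Context {R : realType}.
Variables (a c : R) (u u1 : R -> R) (z : nat -> R).
Hypothesis a0 : 0 < a.
Hypothesis du : forall s, 0 < s -> der u s (u1 s).
Hypothesis du1 : forall s, 0 < s -> der u1 s (- (1 - c * s^-1 ^+ 2) * u s).
Hypothesis unz : exists2 s, 0 < s & u s != 0.
Hypothesis z_pos : forall j, 0 < z j.
Hypothesis z_zero : forall j, u (z j) = 0.
Hypothesis z_incr : forall i j, (i < j)%N -> z i < z j.
Hypothesis z_all : forall s, 0 < s -> u s = 0 -> exists j, z j = s.
Implicit Types (s t C : R) (n j : nat).

Theorem phase : exists A2 p th,
  [/\ 0 < A2,
      (forall s, 0 < s -> 0 < p s /\ der th s (p s)^-1),
      (exists2 B, B ^+ 2 = A2 & forall s, 0 < s -> u s = B * Num.sqrt (p s) * sin (th s)),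
      (forall j, th (z j) = pi * j%:R /\ u1 (z j) ^+ 2 = A2 / p (z j)) &
      [/\ (exists2 m, 0 < m & forall s, a < s -> m <= p s),
          (forall n, exists2 C, 0 <= C & sym n (fun s => a < s) id (fun s => s^-1 ^+ 2) C (fun s => p s - 1)) &
          (exists2 C, 0 <= C & forall s, a < s -> `|s - th s| <= C)]].
Proof.
have [A2 [p [p1 [p2 [X [Y [X1 [Y1 [A20 hXY uX dp [q0 q1 q2 qX qY]]]]]]]]]] := modulus a0 du du1 unz.
have p0 s : 0 < s -> 0 < p s.
  move=> s0; have [_ _ W ->] := hXY s s0.
  rewrite lt_neqAle addr_ge0 ?sqr_ge0// andbT eq_sym paddr_eq0 ?sqr_ge0// !sqrf_eq0.
  apply/negP => /andP[/eqP hx /eqP hy]; move: W; rewrite hx hy mul0r mulr0 subrr => /eqP.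
  by rewrite eq_sym oner_eq0.
have dpV s : 0 < s -> {for s, continuous (fun s => (p s)^-1)}.
  move=> s0; have [d0 _ _] := dp s s0; have N : p s != 0 by rewrite gt_eqF ?p0.
  exact: (der_cont (derV N d0)).
have [th0 dth0] := antideriv dpV.
pose th s := th0 s - th0 (z 0%N).
have dth s : 0 < s -> der th s (p s)^-1.
  by move=> s0; apply: (der_eq (derB (dth0 s s0) (der_cst _ s))); rewrite subr0.
have sA : 0 < Num.sqrt A2 by rewrite sqrtr_gt0.
(* Coordinates of [(X, Y) / sqrt p] in the frame turned by [th]. As [th' = 1 / p], they are
   constant; at the first zero [al] vanishes and [be] is [1] or [-1], which writes [X] as a multiple
   of [sqrt p * sin th]. *)
pose al s := (X s * cos (th s) + Y s * sin (th s)) / Num.sqrt (p s).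
pose be s := (Y s * cos (th s) - X s * sin (th s)) / Num.sqrt (p s).
have dp1' s : 0 < s -> p1 s = 2 * X s * X1 s + 2 * Y s * Y1 s.
  move=> s0; have [d0 _ _] := dp s s0; have [dX dY _ _] := hXY s s0.
  apply: (der_uniq d0); apply: (@der_congr_lt _ (fun s => X s ^+ 2 + Y s ^+ 2) _ s _ 0) => //.
    by move=> t t0; have [_ _ _ ->] := hXY t t0.
  by apply: (der_eq (derD (derX 2 dX) (derX 2 dY))); rewrite /= !expr1.
have dsq s : 0 < s -> der (fun s => (Num.sqrt (p s))^-1) s
    (- (2 * X s * X1 s + 2 * Y s * Y1 s) / (2 * Num.sqrt (p s) ^+ 3)).
  move=> s0; have [d0 _ _] := dp s s0; have sp : 0 < Num.sqrt (p s) by rewrite sqrtr_gt0 p0.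
  have N : Num.sqrt (p s) != 0 by rewrite gt_eqF.
  apply: (der_eq (@derV _ (fun s => Num.sqrt (p s)) s _ N (der_sqrt (p0 s s0) d0))).
  by rewrite dp1'//; field.
have key s : 0 < s -> [/\ X s * Y1 s - X1 s * Y s = 1, Num.sqrt (p s) ^+ 2 = X s ^+ 2 + Y s ^+ 2,
    p s = Num.sqrt (p s) ^+ 2 & Num.sqrt (p s) != 0].
  move=> s0; have [_ _ W E] := hXY s s0; have sp : 0 < Num.sqrt (p s) by rewrite sqrtr_gt0 p0.
  by rewrite sqr_sqrtr ?ltW ?p0// gt_eqF.
have rot s x y x1 y1 (U V : R -> R) : 0 < s -> U s = x -> V s = y -> der U s x1 -> der V s y1 -> x * y1 - x1 * y = 1 ->
    x ^+ 2 + y ^+ 2 = p s -> x * x1 + y * y1 = X s * X1 s + Y s * Y1 s ->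
    der (fun s => (U s * cos (th s) + V s * sin (th s)) / Num.sqrt (p s)) s 0.
  move=> s0 Ux Vy dU dV W1 E0 E3; have [W E1 E2 N] := key s s0.
  apply: (der_eq (derM (derD (derM dU (der_cos (dth s s0))) (derM dV (der_sin (dth s s0)))) (dsq s s0))).
  rewrite Ux Vy -[2 * X s * _]mulrA -[2 * Y s * _]mulrA -mulrDr -E3; rewrite E2 in E0.
  move: (Num.sqrt (p s)) E0 E2 N (sin (th s)) (cos (th s)) => q E0 E2 N S Co; rewrite E2.
  transitivity (((x1 * Co + y1 * S) * q ^+ 2 + (y * Co - x * S) - (x * Co + y * S) * (x * x1 + y * y1)) / q ^+ 3).
    by field.
  suff -> : (x1 * Co + y1 * S) * q ^+ 2 + (y * Co - x * S) - (x * Co + y * S) * (x * x1 + y * y1) = 0 by rewrite mul0r.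
  rewrite -E0; transitivity ((y * Co - x * S) * (1 - (x * y1 - x1 * y))); first by ring.
  by rewrite W1; ring.
have dal s : 0 < s -> der al s 0.
  by move=> s0; have [dX dY W E] := hXY s s0; apply: (rot s _ _ _ _ X Y s0 erefl erefl dX dY).
have dbe s : 0 < s -> der be s 0.
  move=> s0; have [dX dY W E] := hXY s s0; apply: (@der_ext _ (fun s => (Y s * cos (th s) + - X s * sin (th s)) / Num.sqrt (p s))) => [t|].
    by rewrite /be mulNr.
  apply: (rot s _ _ _ _ Y (fun s => - X s) s0 erefl erefl dY (derN dX)); last by ring.
    by rewrite -W; ring.
  by rewrite E; ring.
have cst_ f s t : (forall x, 0 < x -> der f x 0) -> 0 < s -> 0 < t -> f s = f t.
  move=> df; wlog st : s t / s <= t.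
    move=> hw s0 t0; have [st|/ltW ts] := leP s t; first exact: hw.
    by apply/esym; exact: hw.
  move=> s0 t0; apply: der_const st _ => x /andP[sx _]; apply: df; exact: lt_le_trans sx.
have z00 := z_pos 0; have thz : th (z 0%N) = 0 by rewrite /th subrr.
have Xz j : X (z j) = 0.
  have := z_zero j; rewrite uX ?z_pos// => /eqP; rewrite mulf_eq0 gt_eqF//= => /eqP.
  by [].
have al0 s : 0 < s -> al s = 0.
  by move=> s0; rewrite (cst_ al s (z 0%N))// /al thz Xz sin0 mul0r mulr0 addr0 mul0r.
pose eta := be (z 0%N).
have eta2 : eta ^+ 2 = 1.
  have [W E1 E2 N] := key (z 0%N) z00.
  rewrite /eta /be thz Xz cos0 mulr1 mul0r subr0 expr_div_n E1 Xz expr0n add0r divff//.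
  by move: N; rewrite -sqrf_eq0 E1 Xz expr0n add0r.
have be_ s : 0 < s -> be s = eta by move=> s0; exact: cst_.
have Xs s : 0 < s -> X s = - eta * Num.sqrt (p s) * sin (th s).
  move=> s0; have [W E1 E2 N] := key s s0.
  rewrite -(be_ s s0); have := al0 s s0; rewrite /al /be => /eqP.
  rewrite mulf_eq0 invr_eq0 (negbTE N) orbF => /eqP h.
  have cs := cos2Dsin2 (th s).
  transitivity (X s * (cos (th s) ^+ 2 + sin (th s) ^+ 2)); first by rewrite cs mulr1.
  transitivity (cos (th s) * (X s * cos (th s) + Y s * sin (th s)) - (Y s * cos (th s) - X s * sin (th s)) * sin (th s)).
    by ring.
  by rewrite h mulr0 sub0r; field.
have uE s : 0 < s -> u s = - eta * Num.sqrt A2 * Num.sqrt (p s) * sin (th s).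
  by move=> s0; rewrite uX// Xs//; ring.
have sin_z s : 0 < s -> sin (th s) = 0 -> exists j, z j = s.
  by move=> s0 h; apply: z_all => //; rewrite uE// h mulr0.
have zsin j : sin (th (z j)) = 0.
  have [W E1 E2 N] := key (z j) (z_pos j).
  have := Xz j; rewrite Xs ?z_pos// => /eqP; rewrite mulf_eq0 mulf_eq0 oppr_eq0 (negbTE N) orbF.
  case/orP => /eqP // e0; move: eta2; rewrite e0 expr0n => /eqP; by rewrite eq_sym oner_eq0.
have th_mono s t : 0 < s -> s < t -> th s < th t.
  move=> s0 st; rewrite lt_neqAle; have h x : s <= x <= t -> 0 < x.
    by move=> /andP[sx _]; exact: lt_le_trans sx.
  have [cc cab hc] := der_MVT (ltW st) (fun x hx => dth x (h x hx)).
  suff : 0 < th t - th s by rewrite subr_gt0 lt_neqAle.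
  by rewrite hc mulr_gt0 ?invr_gt0 ?subr_gt0 ?p0// h.
have th_cont s t : 0 < s -> {within `[s, t], continuous th}.
  move=> s0; apply: (@der_within _ s t th (fun x => (p x)^-1)) => x /andP[sx _].
  by apply: dth; exact: lt_le_trans sx.
(* Between consecutive zeros the phase grows by at least [pi], as the sine is positive on []0, pi[],
   and by no more, since otherwise the intermediate value theorem would give a zero missing from the
   enumeration. *)
have thj j : th (z j) = pi * j%:R.
  elim: j => [|j ih]; first by rewrite thz mulr0.
  have zz : z j < z j.+1 by exact: z_incr.
  have hlt := th_mono _ _ (z_pos j) zz.
  have shift (x : R) : sin (x - pi * j%:R) = 0 <-> sin x = 0.
    have : forall (x : R) (i : nat), sin (x + pi * i%:R) = (-1) ^+ i * sin x.
      move=> y i; elim: i => [|i ihi]; first by rewrite mulr0 addr0 expr0 mul1r.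
      rewrite -natr1 mulrDr mulr1 addrA sinDpi ihi exprS; ring.
    move=> hs; have := hs (x - pi * j%:R) j; rewrite subrK => ->; split => [->|]; first by rewrite mulr0.
    by move=> /eqP; rewrite mulf_eq0 signr_eq0 /= => /eqP.
  set y := th (z j.+1) - pi * j%:R.
  have y0 : 0 < y by rewrite /y -ih subr_gt0.
  have sy : sin y = 0 by apply/shift; exact: zsin.
  have ypi : pi <= y.
    rewrite leNgt; apply/negP => ypi; have := @sin_gt0_pi R y; rewrite y0 ypi sy ltxx => /(_ isT).
    by [].
  rewrite -natr1 mulrDr mulr1; apply/eqP; rewrite eq_le; apply/andP; split; last by move: ypi; rewrite /y; lra.
  rewrite leNgt; apply/negP => hgt.
  have [x hx tx] : exists2 x, x \in `[z j, z j.+1] & th x = pi * j%:R + pi.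
    apply: (@IVT _ th _ _ _ (ltW zz)); first exact: th_cont.
    rewrite ih; apply/andP; split; first by rewrite ge_min lerDl pi_ge0.
    by rewrite le_max (ltW hgt) orbT.
  move: hx; rewrite in_itv/= => /andP[x1 x2].
  have x0 : 0 < x by exact: lt_le_trans x1.
  have [i zi] : exists i, z i = x.
    apply: sin_z => //; rewrite tx; apply/shift.
    by rewrite addrAC subrr add0r sinpi.
  have xj : z j < z i.
    rewrite zi lt_neqAle x1 andbT; apply/eqP => E; move: tx; rewrite -E ih => /eqP.
    by rewrite lt_eqF// ltrDl pi_gt0.
  have xj1 : z i < z j.+1.
    rewrite zi lt_neqAle x2 andbT; apply/eqP => E; move: hgt; rewrite -E tx ltxx. by [].
  have [ij|ij|ij] := ltngtP i j; first by have := z_incr ij; move: xj; lra.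
    have : (j.+1 <= i)%N by []. rewrite leq_eqVlt => /orP[/eqP E|/z_incr]; last by lra.
    by move: xj1; rewrite E ltxx.
  by move: xj; rewrite ij ltxx.
(* The Wronskian bounds [p] from below: by Cauchy-Schwarz [1 = (X Y1 - X1 Y)^2 <= p (X1^2 + Y1^2)],
   and [X1], [Y1] are bounded. *)
have plow : exists2 m, 0 < m & forall s, a < s -> m <= p s.
  have [K K0 hK] := qX; have [L L0 hL] := qY.
  have Q0 : 0 < K ^+ 2 + L ^+ 2 + 1 by rewrite ltr_wpDl// addr_ge0 ?sqr_ge0.
  exists (K ^+ 2 + L ^+ 2 + 1)^-1; first by nng.
  move=> s as_; have s0 : 0 < s by exact: lt_trans as_.
  have [_ _ W E] := hXY s s0.
  have := hK s (ltW as_); have := hL s (ltW as_); rewrite !mulr1 => hy hx.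
  have x2 : X1 s ^+ 2 <= K ^+ 2 by rewrite -(real_normK (num_real (X1 s))) lerXn2r ?nnegrE.
  have y2 : Y1 s ^+ 2 <= L ^+ 2 by rewrite -(real_normK (num_real (Y1 s))) lerXn2r ?nnegrE.
  rewrite -[leLHS]mul1r ler_pdivrMr//.
  have : 1 <= p s * (X1 s ^+ 2 + Y1 s ^+ 2).
    rewrite E -[X in X <= _](expr1n _ 2) -W -subr_ge0.
    have -> : (X s ^+ 2 + Y s ^+ 2) * (X1 s ^+ 2 + Y1 s ^+ 2) - (X s * Y1 s - X1 s * Y s) ^+ 2 =
      (X s * X1 s + Y s * Y1 s) ^+ 2 by ring.
    exact: sqr_ge0.
  move=> h; apply: (le_trans h); rewrite ler_wpM2l ?ltW ?p0//; lra.
have psym := modulus_sym a0 dp q0 q1 q2.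
exists A2, p, th; split => //.
- by move=> s s0; split; [exact: p0|exact: dth].
- exists (- eta * Num.sqrt A2); last exact: uE.
  by rewrite exprMn sqrrN eta2 mul1r sqr_sqrtr// ltW.
- move=> j; split => //.
  have u1X : u1 (z j) = Num.sqrt A2 * X1 (z j).
    have [dX _ _ _] := hXY (z j) (z_pos j).
    apply: (der_uniq (du (z_pos j))).
    apply: (@der_congr_lt _ (fun s => Num.sqrt A2 * X s) _ _ _ 0) => //.
      by move=> t t0; rewrite uX.
    by apply: (der_eq (derM (der_cst _ _) dX)); rewrite mul0r add0r.
  have [_ _ W E] := hXY (z j) (z_pos j).
  rewrite u1X exprMn sqr_sqrtr ?ltW// E Xz expr0n add0r; congr (_ * _).
  move: W; rewrite Xz mul0r sub0r => /eqP; rewrite eqr_oppLR => /eqP W.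
  have Y0 : Y (z j) != 0 by apply/eqP => h; move: W; rewrite h mulr0 => /eqP; rewrite eq_sym oppr_eq0 oner_eq0.
  by apply: (mulIf (expf_neq0 2 Y0)); rewrite mulVf ?expf_neq0// -exprMn W sqrrN expr1n.
split => //.
have [m m0 hm] := plow; have [C C0 hC] := psym 0%N.
have pV x : a < x -> `|(p x)^-1| <= m^-1.
  move=> ax; have px := p0 x (lt_trans a0 ax); rewrite ger0_norm ?invr_ge0; last exact: ltW.
  by rewrite lef_pV2 ?posrE// hm.
(* The symbol bounds hold for [a < s], whereas [isO] speaks of a closed half line; the gap up to [b]
   is covered by the Lipschitz bound [lip]. *)
pose b := 2 * a; have ab : a < b by rewrite /b ltr_pMl// ltr1n.
have b0 : 0 < b by exact: lt_trans ab.
have dw s : b <= s -> der (fun s => s - th s) s (1 - (p s)^-1).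
  by move=> bs; apply: derB (der_id s) (dth s _); exact: lt_le_trans bs.
have wO : isO b 2 (fun s => 1 - (p s)^-1).
  exists (C / m); first by nng.
  move=> s bs; have as_ : a < s by exact: lt_le_trans bs.
  have s0 : 0 < s by exact: lt_trans as_.
  have -> : 1 - (p s)^-1 = (p s - 1) * (p s)^-1.
    by have : p s != 0; [rewrite gt_eqF ?p0|move=> N; field].
  have hb := (sym_bound hC) s as_; rewrite normrM mulrAC ler_pM//.
  exact: pV.
have [l [K K0 hl]] := isO_integrate b0 dw wO.
have lip s : a < s -> s <= b -> `|th b - th s| <= m^-1 * (b - s).
  move=> as_ sb; apply: (@der_lip R s b th (fun x => (p x)^-1) m^-1 sb) => x /andP[sx _].
    by apply: dth; apply: lt_le_trans sx; exact: lt_trans as_.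
  have ax : a < x by exact: lt_le_trans sx.
  exact: pV.
exists (K / b + `|l| + (b + `|th b| + m^-1 * b)).
  by nng.
move=> s as_; have s0 : 0 < s by exact: lt_trans as_.
have B0 : 0 <= K / b + `|l| by nng.
have B1 : 0 <= b + `|th b| + m^-1 * b by nng.
have [bs|/ltW sb] := leP b s.
  rewrite -[leLHS]addr0 lerD//.
  have -> : s - th s = (s - th s - l) + l by ring.
  rewrite (le_trans (ler_normD _ _))// lerD2r (le_trans (hl s bs))// ler_wpM2l//.
  by rewrite expr1 lef_pV2 ?posrE.
rewrite -[leLHS]add0r lerD//.
have -> : s - th s = s - th b + (th b - th s) by ring.
rewrite (le_trans (ler_normD _ _))// lerD//; last first.
  by rewrite (le_trans (lip s as_ sb))// ler_wpM2l ?invr_ge0 ?ltW//; lra.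
by rewrite (le_trans (ler_normB _ _))// lerD2r ger0_norm// ltW.
Qed.

End Phase.

(** * Zeros and the phase *)

Section BesselEigen.
Context {R : realType}.
Local Notation leb := (@lebesgue_measure R).
Implicit Types (nu l x y k : R).

(** The solution of [- (weight f')' = l weight f] regular at [0] with [f 0 = 1]. Taking
    [l = s_j ^+ 2] gives the eigenfunctions, [l = - b ^+ 2] the modified functions; [ph1] is its
    derivative. *)
Definition ph nu l x : R := Bes nu (l * x ^+ 2).
Definition ph1 nu l x : R := - (l * x / (2 * (nu + 1))) * Bes (nu + 1) (l * x ^+ 2).

Lemma nu1_gt0 nu : -1 < nu -> 0 < nu + 1. Proof. lra. Qed.

Lemma powRB1 x k : 0 < x -> powR x (k - 1) = powR x k / x.
Proof. by move=> x0; rewrite powRB ?powRr1 ?ltW// (gt_eqF x0) implybT. Qed.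

Lemma weight_gt0 nu x : 0 < x -> 0 < weight nu x.
Proof. by move=> x0; rewrite powR_gt0. Qed.

Lemma weight_der nu x : 0 < x -> der (weight nu) x ((2 * nu + 1) / x * weight nu x).
Proof.
move=> x0; apply: (der_eq (@der_powR _ _ (2 * nu + 1) _ _ x0 (der_id x))).
by rewrite powRB1// /weight; ring.
Qed.

Lemma ph_der nu l x : -1 < nu -> der (ph nu l) x (ph1 nu l x).
Proof.
move=> h; have n1 := nu1_gt0 h.
have hd : der (fun x => l * x ^+ 2) x (l * (2 * x)).
  by apply: (der_eq (derM (der_cst l x) (derX 2 (der_id x)))); rewrite /= expr1; ring.
apply: (der_eq (@der_comp _ (Bes nu) (fun t => l * t ^+ 2) x _ _ (bes_der _ h) hd)).
by rewrite /ph1; field; rewrite gt_eqF.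
Qed.

Lemma ph1_der nu l x : -1 < nu -> 0 < x ->
  der (ph1 nu l) x (- ((2 * nu + 1) / x * ph1 nu l x) - l * ph nu l x).
Proof.
move=> h x0; have n1 := nu1_gt0 h; have h' : -1 < nu + 1 by lra.
have n2 := nu1_gt0 h'.
have d0 : der (fun x => - (l * x / (2 * (nu + 1)))) x (- (l / (2 * (nu + 1)))).
  by apply: (der_eq (derN (derM (derM (der_cst l x) (der_id x)) (der_cst _ x)))); ring.
apply: (der_eq (derM d0 (@ph_der (nu + 1) l x h'))).
rewrite /ph (bes_rec (l * x ^+ 2) h) /ph1.
have -> : nu + 2 = nu + 1 + 1 by ring.
move: (Bes (nu + 1) _) (Bes (nu + 1 + 1) _) => P Q.
by field; rewrite ?gt_eqF//; lra.
Qed.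

Lemma ph_flux nu l x : -1 < nu -> 0 < x ->
  der (fun x => weight nu x * ph1 nu l x) x (- (l * weight nu x * ph nu l x)).
Proof.
move=> h x0; apply: (der_eq (derM (weight_der nu x0) (ph1_der l h x0))).
by field; rewrite gt_eqF.
Qed.

Lemma ph_0 nu l : -1 < nu -> ph nu l 0 = 1.
Proof. by move=> h; rewrite /ph expr0n mulr0 bes_0. Qed.

Lemma ph_1E nu x : ph nu 1 x = Bes nu (x ^+ 2).
Proof. by rewrite /ph mul1r. Qed.

Lemma ph1_1E nu x : ph1 nu 1 x = - (x / (2 * (nu + 1))) * Bes (nu + 1) (x ^+ 2).
Proof. by rewrite /ph1 !mul1r. Qed.

(** A multiple of [sqrt x * J_nu x], which removes the first-order term of the equation:
    [u'' + (1 - (nu^2 - 1/4) / x^2) u = 0]. *)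
Definition besu nu x : R := powR x (nu + 1 / 2) * ph nu 1 x.
Definition besu1 nu x : R := (nu + 1 / 2) / x * besu nu x + powR x (nu + 1 / 2) * ph1 nu 1 x.

Lemma besu_der nu x : -1 < nu -> 0 < x -> der (besu nu) x (besu1 nu x).
Proof.
move=> h x0; apply: (der_eq (derM (@der_powR _ _ (nu + 1 / 2) _ _ x0 (der_id x)) (ph_der 1 x h))).
by rewrite powRB1// /besu1 /besu; ring.
Qed.

Lemma besu1_der nu x : -1 < nu -> 0 < x ->
  der (besu1 nu) x (- (1 - (nu ^+ 2 - 1 / 4) * x^-1 ^+ 2) * besu nu x).
Proof.
move=> h x0; have N : x != 0 by rewrite gt_eqF.
apply: (der_eq (derD (derM (derM (der_cst _ x) (derV N (der_id x))) (besu_der h x0))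
  (derM (@der_powR _ _ (nu + 1 / 2) _ _ x0 (der_id x)) (ph1_der 1 h x0)))).
rewrite powRB1// /besu1 /besu; move: (powR _ _) (ph _ _ _) (ph1 _ _ _) => P F F1.
by field.
Qed.

Lemma besu_scale nu l x : 0 < l -> 0 < x ->
  ph nu (l ^+ 2) x = powR (l * x) (- (nu + 1 / 2)) * besu nu (l * x).
Proof.
move=> l0 x0; have lx : 0 < l * x by nng.
rewrite /besu mulrA -powRD ?(gt_eqF lx) ?implybT// addNr powRr0 mul1r /ph mul1r.
by rewrite exprMn.
Qed.

End BesselEigen.

Section Zeros.
Context {R : realType}.
Variables (nu : R) (s : nat -> R).
Hypothesis Hnu : -1 < nu.
Hypothesis Hz : bessel_zeros nu s.
Implicit Types (x y : R) (j n : nat).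

Lemma zeros_gt0 j : 0 < s j. Proof. by case: Hz. Qed.
Lemma zeros_incr i j : (i < j)%N -> s i < s j. Proof. by case: Hz => _ _ h _; exact: h. Qed.

(** Were it zero, division by it would give [0] and [besselJ nu] would vanish on the half line; but
    the midpoint of the first two zeros is not in the enumeration. *)
Lemma Gamma_neq0 : Gamma (nu + 1) != 0.
Proof.
apply/eqP => G0; have [h0 _ h2 h3] := Hz.
have J0 x : 0 < x -> besselJ nu x = 0 by move=> x0; rewrite besselJE// G0 invr0 mulr0 mul0r.
pose x := (s 0%N + s 1%N) / 2; have s01 := h2 0%N 1%N isT.
have x0 : 0 < x by nng.
have [j] := h3 x x0 (J0 x x0); case: j => [|j] hj.
  by move: hj s01; rewrite /x; lra.
have : s 1%N <= s j.+1 by case: j hj => // j _; apply/ltW/h2.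
by rewrite hj; move: s01; rewrite /x; lra.
Qed.

Lemma Gamma_gt0 : 0 < Gamma (nu + 1).
Proof.
rewrite lt_neqAle eq_sym Gamma_neq0/=; apply: Rintegral_ge0 => x _.
by nng.
Qed.

Lemma besu_zero x : 0 < x -> (besu nu x = 0 <-> besselJ nu x = 0).
Proof.
move=> x0; rewrite besselJE// /besu ph_1E; split => /eqP; rewrite mulf_eq0 => /orP[|/eqP ->].
- by rewrite gt_eqF ?powR_gt0.
- by rewrite mulr0.
- by rewrite gt_eqF// divr_gt0 ?powR_gt0 ?divr_gt0 ?Gamma_gt0.
- by rewrite mulr0.
Qed.

Lemma ph_zero j : ph nu (s j ^+ 2) 1 = 0.
Proof.
have [h0 h1 _ _] := Hz.
have := h1 j; rewrite -besu_zero// /besu ph_1E => /eqP.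
by rewrite mulf_eq0 gt_eqF ?powR_gt0//= /ph expr1n mulr1 => /eqP.
Qed.

(** The factor between [psi] and [ph], obtained from [|J_(nu+1) (s_j)|] after the Gamma factors
    cancel. *)
Definition cj j : R := 2 * Num.sqrt 2 * (nu + 1) / (s j * `|Bes (nu + 1) (s j ^+ 2)|).

Lemma psiE j x : 0 < x -> psi nu s j x = cj j * ph nu (s j ^+ 2) x.
Proof.
move=> x0; have sj := zeros_gt0 j; have n1 := nu1_gt0 Hnu.
have h' : -1 < nu + 1 by lra.
have sj2 : 0 < s j / 2 by nng.
rewrite /psi !besselJE ?mulr_gt0// GammaS// !normrM normfV normrM.
rewrite (ger0_norm (powR_ge0 _ _)) (gtr0_norm n1) (gtr0_norm Gamma_gt0).
have -> : s j * x / 2 = s j / 2 * x by ring.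
rewrite (powRM nu (ltW sj2) (ltW x0)) (@powRD _ (s j / 2)); last by rewrite (gt_eqF sj2) implybT.
rewrite powRr1 ?ltW// powRN /cj /ph -exprMn.
have N1 : powR x nu != 0 by rewrite gt_eqF ?powR_gt0.
have N2 : powR (s j / 2) nu != 0 by rewrite gt_eqF ?powR_gt0.
have N3 := Gamma_neq0; have N4 : nu + 1 != 0 by rewrite gt_eqF.
have N5 : s j != 0 by rewrite gt_eqF.
move: (powR x nu) (powR (s j / 2) nu) (Gamma (nu + 1)) N1 N2 N3 => a b c N1 N2 N3.
have [->|N6] := eqVneq `|Bes (nu + 1) (s j ^+ 2)| 0; first by rewrite !mulr0 !invr0 !mulr0 !mul0r.
by field; rewrite N1 N2 N3 N4 N5 N6.
Qed.

(** The normalization of [psi] involves [J_(nu+1) (s_j)], which up to a power of [s_j] is the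
    derivative of [besu] at its zero [s_j]; the phase gives the square of that derivative as
    [A2 / p (s_j)]. *)
Theorem bessel_phase (a : R) : 0 < a -> exists A2 p th,
  [/\ 0 < A2,
      (forall x, 0 < x -> 0 < p x /\ der th x (p x)^-1),
      (exists2 B, B ^+ 2 = A2 & forall x, 0 < x -> besu nu x = B * Num.sqrt (p x) * sin (th x)),
      (forall j, [/\ th (s j) = pi * j%:R, 0 < cj j &
          cj j ^+ 2 = 2 / A2 * p (s j) * powR (s j) (2 * nu + 1)]) &
      [/\ (exists2 m, 0 < m & forall x, a < x -> m <= p x),
          (forall n, exists2 C, 0 <= C & sym n (fun x => a < x) id (fun x => x^-1 ^+ 2) C (fun x => p x - 1)) &
          (exists2 C, 0 <= C & forall x, a < x -> `|x - th x| <= C)]].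
Proof.
move=> a0; have [h0 h1 h2 h3] := Hz.
have unz : exists2 x, 0 < x & besu nu x != 0.
  pose x := (s 0%N + s 1%N) / 2; have s01 := h2 0%N 1%N isT.
  have x0 : 0 < x by nng.
  exists x => //; apply/eqP => /(besu_zero x0) /(h3 x x0)[[|j] hj].
    by move: hj s01; rewrite /x; lra.
  have : s 1%N <= s j.+1 by case: j hj => // j _; apply/ltW/h2.
  by rewrite hj; move: s01; rewrite /x; lra.
have uz j : besu nu (s j) = 0 by apply/besu_zero.
have uall x : 0 < x -> besu nu x = 0 -> exists j, s j = x by move=> x0 /(besu_zero x0); exact: h3.
have [A2 [p [th [A20 pth uE zj rest]]]] := phase a0 (fun x => @besu_der _ nu x Hnu)
  (fun x => @besu1_der _ nu x Hnu) unz h0 uz h2 uall.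
exists A2, p, th; split => // j; have [thj u1j] := zj j.
have [ps _] := pth _ (h0 j).
have N : Bes (nu + 1) (s j ^+ 2) != 0.
  apply/eqP => B0; move: u1j; rewrite /besu1 uz mulr0 add0r ph1_1E B0 !mulr0 expr0n /= => /eqP.
  by rewrite eq_sym gt_eqF// divr_gt0.
have n1 := nu1_gt0 Hnu.
have C0 : 0 < cj j.
  by rewrite /cj divr_gt0 ?mulr_gt0 ?sqrtr_gt0 ?normr_gt0.
split => //; move: u1j; rewrite /besu1 uz mulr0 add0r ph1_1E.
rewrite exprMn.
have -> : powR (s j) (nu + 1 / 2) ^+ 2 = powR (s j) (2 * nu + 1).
  rewrite -powR_mulrn ?powR_ge0// -powRrM; congr (powR _ _); lra.
move=> u1j; have -> : p (s j) = A2 / (A2 / p (s j)) by field; rewrite !gt_eqF.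
rewrite -u1j /cj exprMn exprVn [in X in _ * X]exprMn real_normK ?num_real// exprMn.
rewrite exprMn sqr_sqrtr//.
have W0 : powR (s j) (2 * nu + 1) != 0 by rewrite gt_eqF ?powR_gt0.
by move: N (powR (s j) _) W0 => N P W0; field; rewrite W0 N ?gt_eqF.
Qed.

End Zeros.

(** * Oscillatory form of the Bessel function *)

Section Cutoff.
Context {R : realType}.
Implicit Types (D : R -> Prop) (rho w f : R -> R) (s x z C : R) (n Q : nat).

Lemma der_sq_small f : (forall x, `|f x| <= x ^+ 2) -> der f 0 0.
Proof.
move=> h; have f0 : f 0 = 0 by apply/eqP; rewrite -normr_le0 (le_trans (h 0))// expr0n.
have c : (fun y : R => y^-1 *: ((f \o shift 0) (y *: 1) - f 0)) @ 0^' --> (0 : R).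
  apply/cvgrPdist_lt => e e0; near=> y.
  have y0 : y != 0 by near: y; exact: nbhs_dnbhs_neq.
  rewrite sub0r normrN f0 subr0 /= addr0 /GRing.scale /= mulr1 normrM normfV.
  rewrite ltr_pdivrMl ?normr_gt0//; apply: (le_lt_trans (h y)).
  rewrite -real_normK ?num_real// expr2 ltr_pM2l ?normr_gt0//.
  by near: y; apply: dnbhs0_lt.
by split; [apply: cvgP c|exact: cvg_lim c].
Unshelve. all: by end_near. Qed.

Lemma der_pospow Q x : der (fun t => Num.max t 0 ^+ Q.+2) x (Q.+2%:R * Num.max x 0 ^+ Q.+1).
Proof.
have [x0|x0|->] := ltgtP x 0.
- rewrite expr0n mulr0; apply: (@der_congr_gt _ (fun=> 0) _ _ _ 0) (der_cst 0 x) => // t t0.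
  by rewrite max_r ?ltW// expr0n.
- have := derX Q.+2 (der_id x); rewrite mulr1; apply: (@der_congr_lt _ _ _ _ _ 0) => // t t0.
  by rewrite max_l// ltW.
rewrite expr0n mulr0.
apply: (@der_congr_near _ (fun t => if t < 1 then Num.max t 0 ^+ Q.+2 else 0)).
  by near=> t; case: ifPn => // /negP; case; near: t; apply: lt_nbhsl; exact: ltr01.
apply: der_sq_small => t; case: ifPn => [t1|_]; last by rewrite normr0 sqr_ge0.
have [t0|t0] := leP t 0; first by rewrite expr0n normr0 sqr_ge0.
have t0' := ltW t0; rewrite ger0_norm ?exprn_ge0// -addn2 exprD ler_piMl ?sqr_ge0//.
by rewrite exprn_ile1// ltW.
Unshelve. all: by end_near. Qed.

Lemma sym_pospow n Q C : (n < Q)%N -> exists2 C', 0 <= C' & forall D rho f,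
  sym n D rho one_ C f -> sym n D rho one_ C' (fun s => Num.max (f s) 0 ^+ Q).
Proof.
have bd m D rho f s : sym m D rho one_ C f -> D s -> `|Num.max (f s) 0| <= `|C|.
  move=> h Ds; rewrite ger0_norm ?le_max ?lexx ?orbT// ge_max normr_ge0 andbT.
  have := sym_bound h Ds; rewrite mulr1 => k.
  by rewrite (le_trans (ler_norm _))// (le_trans k)// ler_norm.
elim: n Q => [|n ih] Q nQ.
  exists (`|C| ^+ Q); first by nng.
  move=> D rho f h; split => // s Ds; rewrite mulr1 normrX lerXn2r ?nnegrE//.
  exact: (bd 0%N D rho f s h Ds).
case: Q nQ => [|[|Q]] // nQ; have [C' C'0 h'] := ih Q.+1 nQ.
pose K := 2 ^+ n * (Q.+2%:R * C' * `|C|).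
have K0 : 0 <= K by nng.
exists (`|C| ^+ Q.+2 + K); first by nng.
move=> D rho f hf; have [h1 [f' h2 h3]] := hf; split.
  move=> s Ds; rewrite mulr1 normrX (@le_trans _ _ (`|C| ^+ Q.+2)) ?lerDl//.
  by rewrite lerXn2r ?nnegrE//; exact: (bd _ _ _ _ _ hf Ds).
exists (fun s => Q.+2%:R * Num.max (f s) 0 ^+ Q.+1 * f' s).
  move=> s Ds; apply: (der_eq (@der_comp _ (fun t => Num.max t 0 ^+ Q.+2) f s _ _ (der_pospow Q (f s)) (h2 s Ds))).
  by rewrite mulrA.
have := symM1 (symZ Q.+2%:R (h' D rho f (sym_low hf))) h3; apply: sym_weak => // s _.
rewrite /one_ !mulr1 normr_nat (@le_trans _ _ K) ?lerDr ?exprn_ge0//.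
by rewrite ler_wpM2l ?exprn_ge0// ler_wpM2l ?mulr_ge0// ler_norm.
Qed.

(** A cutoff with finitely many derivatives, composed of powers of positive parts. Since [z^-1] is a
    symbol of order [0] away from [0], so is the result. The clause [z <= 1 / 2] discards the points
    [z <= 0], where [1 - z^-1] is positive. *)
Definition cutN Q z : R := if z <= 1 / 2 then 0 else Num.max (1 - z^-1) 0 ^+ Q.
Definition cutoff Q z : R := Num.max (1 - 2 ^+ Q * cutN Q z) 0 ^+ Q.

Lemma cutoff1 Q z : (0 < Q)%N -> z < 1 -> cutoff Q z = 1.
Proof.
move=> Q0 z1; rewrite /cutoff; suff -> : cutN Q z = 0 by rewrite mulr0 subr0 max_l// expr1n.
rewrite /cutN; case: ifPn => //; rewrite -ltNge => hz.
have z0 : 0 < z by apply: lt_trans hz; lra.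
rewrite max_r ?expr0n ?gtn_eqF// subr_le0 -[leLHS]invr1 lef_pV2 ?posrE//; exact: ltW.
Qed.

Lemma cutoff0 Q z : (0 < Q)%N -> 2 < z -> cutoff Q z = 0.
Proof.
move=> Q0 z2; rewrite /cutoff max_r ?expr0n ?gtn_eqF// subr_le0.
have z0 : 0 < z by apply: lt_trans z2.
rewrite /cutN ifF; last by apply/negbTE; rewrite -ltNge; lra.
have zi : z^-1 <= 2^-1 by rewrite lef_pV2 ?posrE// ltW.
rewrite -exprMn exprn_ege1// -ler_pdivrMl// mulr1 le_max; apply/orP; left; lra.
Qed.

Lemma sym_inv_half n : exists2 C, 0 <= C & sym n (fun s => 1 / 2 < s) id one_ C (fun s => s^-1).
Proof.
have a0 : 0 < 1 / 2 :> R by lra.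
have [C C0 h] := sym_invX a0 n 1; have [C' C'0 h'] := @sym_sg_le _ _ a0 n 1 0 _ _ isT h C0.
by exists C'.
Qed.

Lemma sym_far n w C f : (forall s, s < 1 -> f s = 0) -> (forall s, 0 < s -> 0 <= C * w s) ->
  sym n (fun s => 1 / 2 < s) id w C f -> sym n (fun s => 0 < s) id w C f.
Proof.
move=> f0 hw; apply: (@sym_glue _ _ _ (fun s => s < 1) _ _ _ _ _ _ _ _ hw f0).
- exact: open_lt.
- exact: open_gt.
- by move=> s; lra.
- by move=> s _; have [|s1] := ltP s 1; [left|right; lra].
Qed.

Lemma sym_cutoff Q : (0 < Q)%N ->
  exists2 C, 0 <= C & sym Q.-1 (fun s => 0 < s) id one_ C (fun z => 1 - cutoff Q z).
Proof.
move=> Q0; have nQ : (Q.-1 < Q)%N by rewrite prednK.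
have [C C0 h] := sym_inv_half Q.-1.
have [C1 C10 h1] := @sym_pospow Q.-1 Q (1 + C) nQ.
have [C2 C20 h2] := @sym_pospow Q.-1 Q (1 + `|2 ^+ Q| * C1) nQ.
have c1 D : sym Q.-1 D id (@one_ R) 1 (fun=> 1) by apply: sym_cst; rewrite ?normr1.
exists (1 + C2); first exact: addr_ge0.
have oD : open [set s : R | 1 / 2 < s] by exact: open_gt.
apply: sym_far.
- by move=> s s1; rewrite cutoff1// subrr.
- by move=> s _; rewrite mulr1 addr_ge0.
apply: symB (c1 _) _; apply: h2.
apply: symB (c1 _) _; apply: symZ.
apply: (@sym_congr _ _ _ _ _ _ (fun s => Num.max (1 - s^-1) 0 ^+ Q) _ oD).
  by move=> s hs; rewrite /cutN leNgt hs.
by apply: h1; exact: symB (c1 _) h.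
Qed.

End Cutoff.

Section OscillatoryForm.
Context {R : realType}.
Implicit Types (nu s x z C : R) (n : nat).

Definition wmin nu z : R := powR (Num.min 1 z) (nu + 1 / 2).

Lemma wmin_gt0 nu z : 0 < z -> 0 < wmin nu z.
Proof. by move=> z0; rewrite powR_gt0// lt_min ltr01. Qed.

Lemma sym_bes n nu : -1 < nu ->
  exists2 C, 0 <= C & sym n (fun s => 0 < s < 3) id one_ C (fun s => Bes nu (s ^+ 2)).
Proof.
have var : sym n (fun s => 0 < s < 3) id (@one_ R) 3 id.
  elim: n => [|n ih]; split => //; try by move=> s /andP[s0 s3]; rewrite mulr1 gtr0_norm// ltW.
  by exists id => // s /andP[s0 _]; rewrite divff ?gt_eqF//; exact: der_id.
have base mu : -1 < mu -> exists2 C, 0 <= C & forall s, 0 < s < 3 -> `|Bes mu (s ^+ 2)| <= C.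
  move=> h; have ct : {within `[0, 9], continuous (Bes mu)}.
    by apply: continuous_in_subspaceT => x _; exact: bes_cont.
  have [c1 _ hc1] := EVT_max (ler0n R 9) ct; have [c2 _ hc2] := EVT_min (ler0n R 9) ct.
  exists (`|Bes mu c1| + `|Bes mu c2|) => [|s /andP[s0 s3]]; first exact: addr_ge0.
  have i : s ^+ 2 \in `[0, 9].
    by rewrite in_itv/= sqr_ge0/=; have -> : 9 = 3 ^+ 2 :> R by [rewrite -natrX]; rewrite lerXn2r ?nnegrE// ltW.
  have := hc1 _ i; have := hc2 _ i; have := ler_norm (Bes mu c1); have := ler_norm (- Bes mu c2).
  by rewrite normrN ler_norml => *; have := normr_ge0 (Bes mu c1); have := normr_ge0 (Bes mu c2); lra.
elim: n nu var => [|n ih] nu var h.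
  by have [C C0 hC] := base nu h; exists C => //; split => // s hs; rewrite mulr1 hC.
have h' : -1 < nu + 1 by lra.
have [C C0 hC] := base nu h; have [C' C'0 hC'] := ih (nu + 1) (sym_low var) h'.
have vs := symM1 (sym_low var) (sym_low var).
have k := symM1 (symZ (- (2 * (nu + 1))^-1) vs) hC'; set K := 2 ^+ n * _ in k.
exists (C + `|K|); first exact: addr_ge0.
split; first by move=> s hs; rewrite mulr1 (le_trans (hC s hs))// lerDl.
exists (fun s => - (2 * (nu + 1))^-1 * (id s * id s) * Bes (nu + 1) (s ^+ 2)).
  move=> s /andP[s0 _]; have := ph_der 1 s h.
  rewrite (_ : ph nu 1 = fun s => Bes nu (s ^+ 2)); last by apply/funext => t; rewrite ph_1E.
  move=> d; apply: (der_eq d); rewrite ph1_1E /=; field.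
  by rewrite !gt_eqF//; lra.
by apply: sym_weak k => // s _; rewrite mulr1 mulr1 (le_trans (ler_norm _))// lerDr.
Qed.

Lemma sym_powR n (k : R) D : (forall s, D s -> 0 < s) ->
  sym n D id (fun s => powR s k) ((1 + `|k|) ^+ n) (fun s => powR s k).
Proof.
move=> Dp; have h1 : 1 <= 1 + `|k| by rewrite lerDl.
elim: n => [|n ih]; first by split => // s _; rewrite expr0 mul1r ger0_norm ?powR_ge0.
split; first by move=> s _; rewrite ger0_norm ?powR_ge0// ler_peMl ?powR_ge0// exprn_ege1.
exists (fun s => k * powR s k).
  move=> s /Dp s0; apply: (der_eq (@der_powR _ _ k _ _ s0 (der_id s))).
  by rewrite powRB1//= mulr1 mulrA.
have := symZ k ih; apply: sym_weak => // s _; rewrite ler_wpM2r ?powR_ge0//.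
by rewrite exprS ler_wpM2r ?exprn_ge0 ?(le_trans ler01)// lerDr.
Qed.

Lemma sym_besu n nu : -1 < nu ->
  exists2 C, 0 <= C & sym n (fun s => 0 < s < 3) id (wmin nu) C (besu nu).
Proof.
move=> h; have [C C0 hC] := sym_bes n h.
pose K := Num.max 1 (powR 3 (nu + 1 / 2)).
have K0 : 0 <= K by rewrite le_max ler01.
have Dp s : 0 < s < 3 -> 0 < s by case/andP.
have := symM1 (sym_powR n (nu + 1 / 2) Dp) hC; set L := _ * (_ * C).
have L0 : 0 <= L by nng.
move=> hL; exists (L * K); first by nng.
have -> : besu nu = fun s => powR s (nu + 1 / 2) * Bes nu (s ^+ 2).
  by apply/funext => s; rewrite /besu ph_1E.
apply: sym_weak hL => // s /andP[s0 s3].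
  rewrite -[leRHS]mulrA ler_wpM2l// /wmin.
  have [s1|s1] := leP 1 s; last by rewrite ler_peMl ?powR_ge0// le_max lexx.
  rewrite powR1 mulr1 /K le_max; have [k0|/ltW k0] := leP 0 (nu + 1 / 2).
    by rewrite (powR_le k0 _ (ltW s3)) ?orbT// ltW.
  by have := powR_leN k0 ltr01 s1; rewrite powR1 => ->.
Qed.

(** Away from [0], [sin (th x) = sin (x - (x - th x))] is expanded, [x - th x] being a symbol; near
    [0], [besu] is written as [besu * (sin^2 + cos^2)]. A cutoff joins the two, so that the
    amplitudes are symbols with weight [wmin] on the whole half line. *)
Lemma oscillatory_form n nu (a B : R) p th : -1 < nu -> 0 < a -> a <= 1 / 2 ->
  (forall x, 0 < x -> 0 < p x /\ der th x (p x)^-1) ->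
  (forall x, 0 < x -> besu nu x = B * Num.sqrt (p x) * sin (th x)) ->
  (exists2 m, 0 < m & forall x, a < x -> m <= p x) ->
  (forall n, exists2 C, 0 <= C & sym n (fun x => a < x) id (fun x => x^-1 ^+ 2) C (fun x => p x - 1)) ->
  (exists2 C, 0 <= C & forall x, a < x -> `|x - th x| <= C) ->
  [/\ (exists2 C, 0 <= C & sym n (fun x => a < x) id one_ C p),
      (exists2 C, 0 <= C & sym n (fun x => a < x) id one_ C (fun x => x - th x)) &
      exists b1 b2 C, [/\ 0 <= C, sym n (fun x => 0 < x) id (wmin nu) C b1,
         sym n (fun x => 0 < x) id (wmin nu) C b2 &
         forall x, 0 < x -> besu nu x = b1 x * sin x + b2 x * cos x]].
Proof.
move=> hnu a0 a2 pth uE [m m0 pm] ps [T T0 hT].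
have pos s : a < s -> 0 < s by exact: lt_trans.
have c1 k D : sym k D id (@one_ R) 1 (fun=> 1) by apply: sym_cst; rewrite ?normr1.
have [C0 C00 s0] := ps n.
have [C1 C10 s1] := @sym_sg_le _ a a0 n 2 0 C0 _ isT s0 C00.
have sp : sym n (fun x => a < x) id one_ (C1 + 1) p.
  by have := symD s1 (c1 n _); apply: sym_ext => s; rewrite subrK.
have [CV CV0 hV] := @symV _ n m (C1 + 1) m0; have sV := hV _ _ _ pm sp.
have sw : exists2 C, 0 <= C & sym n (fun x => a < x) id one_ C (fun x => x - th x).
  case: n C0 C00 s0 C1 C10 s1 sp CV CV0 hV sV => [|k] C0 C00 s0 C1 C10 s1 sp CV CV0 hV sV.
    by exists T => //; split => // s h; rewrite mulr1 hT.
  have h := symM (sym_var a0 k) (symM1 (sym_low s0) (sym_low sV)).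
  set K := 2 ^+ k * _ in h.
  have K0 : 0 <= K by nng.
  exists (T + K * a^-1); first by nng.
  split.
    by move=> s hs; rewrite mulr1 (le_trans (hT s hs))// lerDl mulr_ge0// invr_ge0 ltW.
  exists (fun s => id s * ((p s - 1) * (p s)^-1)).
    move=> s hs; have [p0 dth] := pth s (pos s hs).
    apply: (der_eq (derB (der_id s) dth)) => /=.
    by field; rewrite !gt_eqF// pos.
  apply: sym_weak h => // s hs; have s0' := pos s hs.
  have -> : id s * s^-1 ^+ 2 = s^-1 by rewrite /= expr2 mulrA mulfV ?mul1r// gt_eqF.
  rewrite mulr1 -[leLHS]add0r lerD// ler_wpM2l// lef_pV2 ?posrE//; exact: ltW.
split => //; first by exists (C1 + 1) => //; exact: addr_ge0.
have [W W0 hW] := sw.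
have [CS CS0 hS] := @symsqrt _ n m (C1 + 1) m0; have sS := hS _ _ _ pm sp.
have [CT CT0 hT2] := @sym_trig _ n W 1 ler01.
have [tc ts] := hT2 _ _ _ (-1) ltac:(by rewrite normrN1) hW.
pose Q := n.+1; have [CE CE0 sE] := @sym_cutoff R Q isT.
have [CU CU0 sU] := sym_besu n hnu.
pose m2 := Num.min 1 (powR (1 / 2) (nu + 1 / 2)).
have m20 : 0 < m2 by rewrite lt_min ltr01 powR_gt0//; lra.
have wlow s : 1 / 2 < s -> m2 <= wmin nu s.
  move=> hs; rewrite /wmin /m2 ge_min; have [s1'|s1'] := leP 1 s; first by rewrite powR1 lexx.
  have sp0 : 0 < s by apply: lt_trans hs; lra.
  have [k0|/ltW k0] := leP 0 (nu + 1 / 2).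
    by rewrite (powR_le k0 _ (ltW hs)) ?orbT//; lra.
  by have := powR_leN k0 sp0 (ltW s1'); rewrite powR1 => ->.
have w0 s : 0 < s -> 0 <= wmin nu s by move=> ?; exact/ltW/wmin_gt0.
have far (g : R -> R) C : 0 <= C -> sym n (fun x => a < x) id one_ C g ->
    exists2 C', 0 <= C' & sym n (fun x => 0 < x) id (wmin nu) C' (fun x => (1 - cutoff Q x) * g x).
  move=> C'0 hg; have hg' : sym n (fun x => 1 / 2 < x) id one_ C g.
    by apply: sym_weak hg => // s; exact: le_lt_trans.
  have hE : sym n (fun x => 1 / 2 < x) id one_ CE (fun z => 1 - cutoff Q z).
    by apply: sym_weak sE => // s; apply: lt_trans; lra.
  have := symM1 hE hg'; set K := _ * (CE * C).
  have K0 : 0 <= K by nng.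
  have Km : 0 <= K / m2 by nng.
  move=> hK; exists (K / m2) => //.
  apply: sym_far => [s s1'| |]; first by rewrite cutoff1// subrr mul0r.
    by move=> s s0'; rewrite mulr_ge0// w0.
  apply: sym_weak hK => // s hs; rewrite mulr1 -mulrA ler_peMr// ler_pdivlMl// mulr1.
  exact: wlow.
have near0 (g : R -> R) C : 0 <= C -> sym n (fun x => 0 < x < 3) id one_ C g ->
    exists2 C', 0 <= C' & sym n (fun x => 0 < x) id (wmin nu) C' (fun x => cutoff Q x * (besu nu x * g x)).
  move=> C'0 hg.
  have hE : sym n (fun x => 0 < x < 3) id one_ (1 + CE) (cutoff Q).
    have hE' : sym n (fun x => 0 < x < 3) id one_ CE (fun z => 1 - cutoff Q z).
      by apply: sym_weak sE => // s /andP[].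
    by have := symB (c1 n _) hE'; apply: sym_ext => s; ring.
  have := symM1 (symM1 sU hg) hE; set K := _ * (_ * (1 + CE)).
  have K0 : 0 <= K by nng.
  move=> hK; exists K => //; apply: (@sym_glue _ _ _ (fun s => 2 < s) (fun s => 0 < s < 3)).
  - exact: open_gt.
  - exact: open_oo.
  - by move=> s /andP[].
  - by move=> s s0'; have [|s3] := ltP 2 s; [left|right; rewrite s0'; lra].
  - by move=> s s0'; rewrite mulr_ge0// w0.
  - by move=> s s2; rewrite cutoff0// mul0r.
  - by move: hK; apply: sym_ext => s; rewrite mulrC.
have [Ct' Ct'0 hT3] := @sym_trig R n 3 1 ler01.
have var : sym n (fun s => 0 < s < 3) id (@one_ R) 3 id.
  elim: (n) => [|k ih]; split => //; try by move=> s /andP[s0' s3]; rewrite mulr1 gtr0_norm// ltW.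
  by exists id => // s /andP[s0' _]; rewrite divff ?gt_eqF//; exact: der_id.
have [vc vs] := hT3 _ _ _ 1 ltac:(by rewrite normr1) var.
have fc := symM1 (symZ B sS) tc; have fs := symM1 (symZ B sS) ts.
set K := 2 ^+ n * _ in fc fs.
have K0 : 0 <= K by nng.
have [F1 F10 f1] := far _ _ K0 fc; have [F2 F20 f2] := far _ _ K0 fs.
have [N1 N10 g1] := near0 _ _ (ltW Ct'0) vs; have [N2 N20 g2] := near0 _ _ (ltW Ct'0) vc.
have a1 := symD f1 g1; have a2' := symD f2 g2.
have wk C C' f : C <= C' -> sym n (fun x => 0 < x) id (wmin nu) C f -> sym n (fun x => 0 < x) id (wmin nu) C' f.
  by move=> CC; apply: sym_weak => // s s0'; rewrite ler_wpM2r// w0.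
eexists; eexists; exists (F1 + N1 + (F2 + N2)); split.
- by nng.
- by apply: wk a1; rewrite lerDl addr_ge0.
- by apply: wk a2'; rewrite lerDr addr_ge0.
move=> x x0 /=; rewrite !mul1r !mulN1r cosN sinN.
have u1 := uE x x0; have cs := cos2Dsin2 x.
rewrite [LHS](_ : _ = (1 - cutoff Q x) * (B * Num.sqrt (p x) * sin (x - (x - th x))) +
    cutoff Q x * besu nu x * (cos x ^+ 2 + sin x ^+ 2)); last first.
  by rewrite cs mulr1 subKr -u1; ring.
rewrite sinB; ring.
Qed.

End OscillatoryForm.

(** * Multipliers and resolvents *)

Section InversePhase.
Context {R : realType}.
Variables (a T : R) (p th : R -> R).
Hypothesis a0 : 0 < a.
Hypothesis pth : forall x : R, 0 < x -> 0 < p x /\ der th x (p x)^-1.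
Hypothesis thT : forall x : R, a < x -> `|x - th x| <= T.
Implicit Types (x y t : R).

Lemma phase_lt x y : 0 < x -> x < y -> th x < th y.
Proof.
move=> x0 xy; have h t : x <= t <= y -> 0 < t by move=> /andP[xt _]; exact: lt_le_trans xt.
have [c cxy hc] := der_MVT (ltW xy) (fun t ht => (pth (h t ht)).2).
by rewrite -subr_gt0 hc mulr_gt0 ?subr_gt0// invr_gt0; exact: (pth (h c cxy)).1.
Qed.

Lemma phase_le x y : 0 < x -> 0 < y -> (th x <= th y) = (x <= y).
Proof.
move=> x0 y0; apply/idP/idP => [|xy]; last first.
  by move: xy; rewrite le_eqVlt => /orP[/eqP ->//|xy]; exact/ltW/phase_lt.
by apply: contraTT; rewrite -!ltNge; exact: phase_lt.
Qed.

Lemma phase_inj x y : 0 < x -> 0 < y -> th x = th y -> x = y.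
Proof.
move=> x0 y0 h; have h1 := phase_le x0 y0; have h2 := phase_le y0 x0.
by apply/le_anti; rewrite -h1 -h2 h lexx.
Qed.

Definition phinv t : R := xget 1 [set x | a < x /\ th x = t].

Lemma phinvK x : a < x -> phinv (th x) = x.
Proof.
move=> ax; rewrite /phinv; case: xgetP => [y _ [ay h]|/(_ x) []//].
by apply: phase_inj => //; exact: lt_trans ax || exact: lt_trans ay.
Qed.

(** A preimage exists by the intermediate value theorem, as [th] stays within [T] of the identity.
    The inverse solves [sg' = p sg]. *)
Lemma phinvP t : th a < t -> [/\ a < phinv t, th (phinv t) = t & der phinv t (p (phinv t))].
Proof.
move=> at_; have T0 : 0 <= T by rewrite (le_trans (normr_ge0 _) (@thT (a + 1) _))// ltrDl.
pose b := Num.max (a + 1) (t + T + 1).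
have ab : a < b by rewrite lt_max ltrDl ltr01.
have tb : t < th b.
  have := thT ab; rewrite ler_norml => /andP[_]; rewrite lerBlDl.
  have : t + T + 1 <= b by rewrite le_max lexx orbT.
  by move: (th b) (b) => u v; lra.
have pos x : a <= x -> 0 < x by exact: lt_le_trans.
have ct : {within `[a, b], continuous th}.
  apply: (@der_within _ a b th (fun x => (p x)^-1)) => x /andP[ax _]; exact: (pth (pos x ax)).2.
have [x xab tx] : exists2 x, x \in `[a, b] & th x = t.
  by apply: (IVT (ltW ab) ct); rewrite ge_min le_max (ltW at_) (ltW tb) orbT.
have ax : a < x.
  move: xab; rewrite in_itv/= => /andP[]; rewrite le_eqVlt => /orP[/eqP ax|//] _.
  by move: at_; rewrite -tx ax ltxx.
have x0 := lt_trans a0 ax.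
rewrite -tx phinvK//; split => //; have [px dx] := pth x0.
rewrite -[p x]invrK; apply: (@is_derive_inverse _ th phinv) dx _.
- by near=> y; apply: phinvK; near: y; exact: lt_nbhsr.
- near=> y; apply: (der_cont (pth _).2); apply: (lt_trans a0); near: y; exact: lt_nbhsr.
- by rewrite invr_eq0 gt_eqF.
Unshelve. all: by end_near. Qed.

End InversePhase.

Section SymbolChain.
Context {R : realType}.
Implicit Types (D I : R -> Prop) (rho w h F sg : R -> R) (C B b : R) (n k : nat).

Lemma dchain_le n I F B B' : B <= B' -> dchain n I F B -> dchain n I F B'.
Proof.
move=> BB; elim: n F => [|n ih] F; first by move=> h x Ix; exact: le_trans (h x Ix) BB.
by move=> [g h1 h2]; exists g => //; exact: ih.
Qed.

(** Along a solution of [sg' = h sg] every derivative in [t] is one application of [sym_field], so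
    [k] of them change the weight [w] into [w / rho^k]. *)
Lemma sym_chain n D rho (H V : R) h : (forall s, D s -> h s != 0) ->
  (forall s, D s -> 0 < rho s) -> 0 <= H -> 0 <= V ->
  sym n D rho one_ H h -> sym n D rho (fun s => (rho s)^-1) V (fun s => (rho s)^-1) ->
  forall k, (k <= n)%N -> forall w C F, 0 <= C -> (forall s, D s -> 0 <= w s) -> sym k D rho w C F ->
  forall I sg b, (forall t, I t -> D (sg t) /\ der sg t (h (sg t))) ->
  (forall t, I t -> w (sg t) * (rho (sg t))^-1 ^+ k <= b) -> 0 <= b ->
  dchain k I (fun t => F (sg t)) ((2 ^+ n * (2 ^+ n * (H * V))) ^+ k * C * b).
Proof.
move=> h0 r0 H0 V0 sh sr; set K := 2 ^+ n * _.
have K0 : 0 <= K by nng.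
elim=> [|k ih] kn w C F C0 w0 sF I sg b hI hb b0.
  move=> t It; have [Dt _] := hI t It; have := sym_bound sF Dt.
  rewrite expr0 mul1r => hF; apply: (le_trans hF); rewrite ler_wpM2l//.
  by have := hb t It; rewrite expr0 mulr1.
have [G hG sG] := sym_field h0 sF (sym_lower (ltnW kn) sh) (sym_lower (ltnW kn) sr).
exists (fun t => G (sg t)).
  move=> t It; have [Dt dt] := hI t It.
  by apply: (der_eq (@der_comp _ F sg t _ _ (hG _ Dt) dt)); rewrite divfK// h0.
set C' := 2 ^+ k * _ in sG.
have C'0 : 0 <= C' by nng.
have w'0 s : D s -> 0 <= w s * (rho s)^-1 by move=> Ds; rewrite mulr_ge0 ?w0// invr_ge0 ltW// r0.
have hb' t : I t -> w (sg t) * (rho (sg t))^-1 * (rho (sg t))^-1 ^+ k <= b.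
  by move=> It; rewrite -mulrA -exprS hb.
apply: dchain_le (ih (ltnW kn) _ C' G C'0 w'0 sG I sg b hI hb' b0).
rewrite exprSr -!mulrA ler_wpM2l ?exprn_ge0// !mulrA ler_wpM2r//.
have k2 : 2 ^+ k <= 2 ^+ n :> R by rewrite ler_eXn2l ?ltr1n// ltnW.
rewrite /C' /K [leLHS](_ : _ = (2 ^+ k * 2 ^+ k) * (H * V * C)); last by ring.
rewrite [leRHS](_ : _ = (2 ^+ n * 2 ^+ n) * (H * V * C)); last by ring.
by rewrite ler_wpM2r ?mulr_ge0// ler_pM ?exprn_ge0.
Qed.

End SymbolChain.

(** * The Riesz multiplier, its edge and its Taylor remainder *)

Section Multipliers.
Context {R : realType}.
Implicit Types (r s d C z al : R) (n m M N : nat) (D : R -> Prop).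

Lemma qpow_der m r s : 0 < r -> 0 < s ->
  der (fun s => (s / r) ^+ m) s (m%:R * (s / r) ^+ m / s).
Proof.
move=> r0 s0; have d : der (fun s => s / r) s r^-1.
  by apply: (der_eq (derM (der_id s) (der_cst _ s))); ring.
apply: (der_eq (derX m d)); case: m => [|m] /=; first by ring.
by rewrite exprS; move: ((s / r) ^+ m) => P; field; rewrite !gt_eqF.
Qed.

Lemma sym_qpow n m r D : 0 < r -> (forall s, D s -> 0 < s) ->
  sym n D id (fun s => (s / r) ^+ m) ((1 + m%:R) ^+ n) (fun s => (s / r) ^+ m).
Proof.
move=> r0 Dp; have h1 : 1 <= 1 + m%:R :> R by rewrite lerDl.
have q0 s : D s -> 0 <= (s / r) ^+ m by move=> /Dp s0; rewrite exprn_ge0// divr_ge0// ltW.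
elim: n => [|n ih]; first by split => // s Ds; rewrite expr0 mul1r ger0_norm ?q0.
split; first by move=> s Ds; rewrite ger0_norm ?q0// ler_peMl ?q0// exprn_ege1.
exists (fun s => m%:R * (s / r) ^+ m); first by move=> s /Dp s0; exact: qpow_der.
have := symZ m%:R ih; apply: sym_weak => // s Ds; rewrite ler_wpM2r ?q0// exprS normr_nat.
by rewrite ler_wpM2r ?exprn_ge0 ?(le_trans ler01)// lerDr.
Qed.

Lemma sym_qpowV n m r D : 0 < r -> (forall s, D s -> 0 < s) ->
  sym n D id (fun s => (s / r) ^- m) ((1 + m%:R) ^+ n) (fun s => (s / r) ^- m).
Proof.
move=> r0 Dp; have h1 : 1 <= 1 + m%:R :> R by rewrite lerDl.
have q0 s : D s -> 0 <= (s / r) ^- m.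
  by move=> /Dp s0; rewrite invr_ge0 exprn_ge0// divr_ge0// ltW.
elim: n => [|n ih]; first by split => // s Ds; rewrite expr0 mul1r ger0_norm ?q0.
split; first by move=> s Ds; rewrite ger0_norm ?q0// ler_peMl ?q0// exprn_ege1.
exists (fun s => - m%:R * (s / r) ^- m).
  move=> s /Dp s0; have N : (s / r) ^+ m != 0 by rewrite expf_neq0// gt_eqF// divr_gt0.
  apply: (der_eq (@derV _ (fun s => (s / r) ^+ m) s _ N (qpow_der m r0 s0))).
  by move: ((s / r) ^+ m) N => P N; field; rewrite N gt_eqF.
have := symZ (- m%:R) ih; apply: sym_weak => // s Ds; rewrite ler_wpM2r ?q0// exprS normrN normr_nat.
by rewrite ler_wpM2r ?exprn_ge0 ?(le_trans ler01)// lerDr.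
Qed.

(** The coefficient of a derivation that vanishes at [s = r]. For it the powers of [1 - (s / r)^2]
    are symbols of their own size, uniformly in [r], which fails for [s d/ds] near the edge. *)
Definition edge r s : R := s * (1 - (s / r) ^+ 2).

Lemma edge_gt0 r s : 0 < s -> s < r -> 0 < 1 - (s / r) ^+ 2.
Proof.
move=> s0 sr; have r0 := lt_trans s0 sr; have q0 : 0 <= s / r by nng.
by rewrite subr_gt0 exprn_ilt1// ltr_pdivrMr// mul1r.
Qed.

Lemma sym_edge_var n : exists2 C, 0 <= C & forall r, 0 < r ->
  sym n (fun s => 0 < s < r) (edge r) one_ C (fun s => 1 - (s / r) ^+ 2).
Proof.
elim: n => [|n [C C0 h]].
  exists 1 => // r r0; split => // s /andP[s0 sr]; rewrite mulr1 ger0_norm ?(ltW (edge_gt0 s0 sr))//.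
  by rewrite gerBl sqr_ge0.
pose K := `|-2| * (2 ^+ n * ((1 + C) * C)).
have K0 : 0 <= K by nng.
exists (1 + K); first exact: addr_ge0.
move=> r r0; have hr := h r r0; split.
  move=> s /andP[s0 sr]; rewrite mulr1 ger0_norm ?(ltW (edge_gt0 s0 sr))//.
  by rewrite -[leLHS]addr0 lerD// gerBl sqr_ge0.
exists (fun s => -2 * ((1 - (1 - (s / r) ^+ 2)) * (1 - (s / r) ^+ 2))).
  move=> s /andP[s0 sr]; have := edge_gt0 s0 sr => e0.
  apply: (der_eq (derB (der_cst 1 s) (qpow_der 2 r0 s0))).
  rewrite /edge; move: ((s / r) ^+ 2) e0 => P e0; field.
  by rewrite !gt_eqF.
have c1 : sym n (fun s => 0 < s < r) (edge r) (@one_ R) 1 (fun=> 1) by apply: sym_cst; rewrite ?normr1.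
have := symZ (-2) (symM1 (symB c1 hr) hr); apply: sym_weak => // s _.
by rewrite !mulr1 /K lerDr.
Qed.

Lemma sym_edge_pow n d : exists2 C, 0 <= C & forall r, 0 < r ->
  sym n (fun s => 0 < s < r) (edge r) (fun s => powR (1 - (s / r) ^+ 2) d) C
    (fun s => powR (1 - (s / r) ^+ 2) d).
Proof.
elim: n => [|n [C C0 h]].
  by exists 1 => // r r0; split => // s _; rewrite mul1r ger0_norm ?powR_ge0.
have [C1 C10 h1] := sym_edge_var n.
pose K := 2 ^+ n * (C * (`|-2 * d| * (1 + C1))).
have K0 : 0 <= K by nng.
exists (1 + K); first exact: addr_ge0.
move=> r r0; have hr := h r r0; have hr1 := h1 r r0; split.
  by move=> s _; rewrite ger0_norm ?powR_ge0// ler_peMl ?powR_ge0// lerDl.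
exists (fun s => powR (1 - (s / r) ^+ 2) d * (- 2 * d * (1 - (1 - (s / r) ^+ 2)))).
  move=> s /andP[s0 sr]; have e0 := edge_gt0 s0 sr.
  apply: (der_eq (@der_powR _ (fun s => 1 - (s / r) ^+ 2) d s _ e0 (derB (der_cst 1 s) (qpow_der 2 r0 s0)))).
  rewrite powRB1// /edge; move: (powR (1 - (s / r) ^+ 2) d) ((s / r) ^+ 2) e0 => Q P e0; field.
  by rewrite !gt_eqF.
have c1 : sym n (fun s => 0 < s < r) (edge r) (@one_ R) 1 (fun=> 1) by apply: sym_cst; rewrite ?normr1.
have := symM1 hr (symZ (-2 * d) (symB c1 hr1)); apply: sym_weak => // s _.
by rewrite ler_wpM2r ?powR_ge0// lerDr.
Qed.

Lemma sym_edge_inv n : exists2 C, 0 <= C & forall r, 0 < r ->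
  sym n (fun s => 0 < s < r) (edge r) (fun s => (edge r s)^-1) C (fun s => (edge r s)^-1).
Proof.
have ep r s : 0 < s < r -> 0 < edge r s.
  by move=> /andP[s0 sr]; rewrite mulr_gt0// edge_gt0.
elim: n => [|n [C C0 h]].
  by exists 1 => // r r0; split => // s hs; rewrite mul1r ger0_norm// invr_ge0 ltW// ep.
have [C1 C10 h1] := sym_edge_var n.
pose K := 2 ^+ n * (C * (2 + `|-3| * C1)).
have K0 : 0 <= K by nng.
exists (1 + K); first exact: addr_ge0.
move=> r r0; have hr := h r r0; have hr1 := h1 r r0; split.
  move=> s hs; rewrite ger0_norm ?invr_ge0 ?(ltW (ep _ _ hs))// ler_peMl ?lerDl//.
  by rewrite invr_ge0 (ltW (ep _ _ hs)).
exists (fun s => (edge r s)^-1 * (2 + (-3) * (1 - (s / r) ^+ 2))).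
  move=> s hs; have [s0 sr] := andP hs; have e0 := edge_gt0 s0 sr.
  have N : edge r s != 0 by rewrite gt_eqF// ep.
  apply: (der_eq (@derV _ (edge r) s _ N (derM (der_id s) (derB (der_cst 1 s) (qpow_der 2 r0 s0))))).
  rewrite /edge; move: ((s / r) ^+ 2) e0 => P e0; field.
  by rewrite !gt_eqF.
have c1 : sym n (fun s => 0 < s < r) (edge r) (@one_ R) 2 (fun=> 2) by apply: sym_cst; rewrite ?ger0_norm.
have := symM1 hr (symD c1 (symZ (-3) hr1)); apply: sym_weak => // s hs.
by rewrite ler_wpM2r ?invr_ge0 ?(ltW (ep _ _ hs))// lerDr.
Qed.

Lemma sym_resolvent n al : 1 <= al -> exists2 C, 0 <= C & forall r D, 0 < r -> (forall s, D s -> 0 < s) ->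
  sym n D id one_ C (fun s => (al + (s / r) ^+ 2)^-1).
Proof.
move=> al1; have al0 : 0 < al by exact: lt_le_trans al1.
have bd s r : `|(al + (s / r) ^+ 2)^-1| <= 1.
  have h : 1 <= al + (s / r) ^+ 2 by rewrite (le_trans al1)// lerDl sqr_ge0.
  have h0 := lt_le_trans ltr01 h.
  by rewrite ger0_norm ?invr_ge0 ?(ltW h0)// -[leRHS]invr1 lef_pV2 ?posrE.
elim: n => [|n [C C0 h]]; first by exists 1 => // r D r0 Dp; split => // s _; rewrite mulr1.
pose K := `|-2| * (2 ^+ n * ((1 + `|al| * C) * C)).
have K0 : 0 <= K by nng.
exists (1 + K); first exact: addr_ge0.
move=> r D r0 Dp; have hr := h r D r0 Dp; split.
  by move=> s _; rewrite mulr1 (le_trans (bd s r))// lerDl.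
exists (fun s => -2 * ((1 - al * (al + (s / r) ^+ 2)^-1) * (al + (s / r) ^+ 2)^-1)).
  move=> s /Dp s0; have N : al + (s / r) ^+ 2 != 0 by rewrite gt_eqF// ltr_pwDl// sqr_ge0.
  apply: (der_eq (@derV _ (fun s => al + (s / r) ^+ 2) s _ N (derD (der_cst al s) (qpow_der 2 r0 s0)))).
  by move: ((s / r) ^+ 2) N => P N; field; rewrite N gt_eqF.
have c1 : sym n D id (@one_ R) 1 (fun=> 1) by apply: sym_cst; rewrite ?normr1.
have := symZ (-2) (symM1 (symB c1 (symZ al hr)) hr); apply: sym_weak => // s _.
by rewrite !mulr1 /K lerDr.
Qed.

(** The Taylor coefficients of [(1 - z)^d] at [0]; [trem] is the remainder of order [M]. *)
Definition tcoef d i : R := \prod_(k < i) ((k%:R - d) / (k%:R + 1)).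
Definition trem d M z : R := powR (1 - z) d - \sum_(i < M) tcoef d i * z ^+ i.

Lemma tcoefS d i : (i%:R + 1) * tcoef d i.+1 = - d * tcoef (d - 1) i.
Proof.
rewrite /tcoef; elim: i => [|i ih]; first by rewrite big_ord_recr !big_ord0/=; field.
have N : i%:R + 1 != 0 :> R by rewrite natr1 pnatr_eq0.
have N' : i.+1%:R + 1 != 0 :> R by rewrite natr1 pnatr_eq0.
rewrite big_ord_recr /= [in RHS]big_ord_recr /= [RHS]mulrA -ih -natr1.
move: (\prod_(i0 < i.+1) _) N N' => P; rewrite -natr1; move: (i%:R) => y N N'.
by field; rewrite N N'.
Qed.

(** The remainder of order [M + 1] for [d] differentiates into that of order [M] for [d - 1]. Hence
    the bounds below go by induction with [d] varying. *)
Lemma trem_der d M z : z < 1 -> der (trem d M.+1) z (- d * trem (d - 1) M z).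
Proof.
move=> z1; have z0 : 0 < 1 - z by rewrite subr_gt0.
have d1 : der (fun z => 1 - z) z (- 1).
  by apply: (der_eq (derB (der_cst 1 z) (der_id z))); rewrite sub0r.
have ds k : der (fun z => \sum_(i < k.+1) tcoef d i * z ^+ i) z (- d * \sum_(i < k) tcoef (d - 1) i * z ^+ i).
  elim: k => [|k ih].
    rewrite big_ord0 mulr0; apply: (@der_ext _ (fun=> tcoef d 0)) (der_cst _ z) => t.
    by rewrite big_ord_recr big_ord0 /= add0r mulr1.
  apply: (@der_ext _ (fun z => \sum_(i < k.+1) tcoef d i * z ^+ i + tcoef d k.+1 * z ^+ k.+1)).
    by move=> t; rewrite [RHS]big_ord_recr.
  apply: (der_eq (derD ih (derM (der_cst _ z) (derX k.+1 (der_id z))))).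
  rewrite [in RHS]big_ord_recr /= mulrDr; congr (_ + _).
  by rewrite [RHS]mulrA -tcoefS -natr1; ring.
apply: (der_eq (derB (@der_powR _ (fun z => 1 - z) d z _ z0 d1) (ds M))).
by rewrite /trem mulrBr; ring.
Qed.

Lemma trem_bound d M : exists2 C, 0 <= C & forall z, 0 <= z <= 1 / 4 -> `|trem d M z| <= C * z ^+ M.
Proof.
elim: M d => [|M ih] d.
  exists (1 + powR (3 / 4) d); first by nng.
  move=> z /andP[z0 z1]; rewrite mulr1 /trem big_ord0 subr0 ger0_norm ?powR_ge0//.
  have h1 : 0 < 1 - z by lra.
  have h2 : 1 - z <= 1 by lra.
  have h3 : 3 / 4 <= 1 - z by lra.
  have h4 : 0 < 3 / 4 :> R by lra.
  have [d0|/ltW d0] := leP 0 d.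
    have := powR_le d0 (ltW h1) h2; rewrite powR1 => h.
    by rewrite (le_trans h)// lerDl powR_ge0.
  by rewrite (le_trans (powR_leN d0 h4 h3))// lerDr.
have [C C0 h] := ih (d - 1).
exists (`|d| * C); first by nng.
move=> z /andP[z0 z1].
have e0 : trem d M.+1 0 = 0.
  rewrite /trem subr0 powR1 big_ord_recl /tcoef big_ord0 expr0 mulr1 big1 ?addr0 ?subrr// => i _.
  by rewrite expr0n mulr0.
have := @der_lip R 0 z (trem d M.+1) (fun z => - d * trem (d - 1) M z) (`|d| * C * z ^+ M) z0.
rewrite e0 !subr0 exprSr mulrA; apply.
- by move=> x /andP[x0 xz]; apply: trem_der; lra.
- move=> x /andP[x0 xz]; rewrite normrM normrN -mulrA ler_wpM2l//.
  have := h x; rewrite x0 (le_trans (ltW xz) z1) => /(_ isT) hx; rewrite (le_trans hx)//.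
  by rewrite ler_wpM2l// lerXn2r ?nnegrE// ltW.
Qed.

Lemma sym_trem n M d : (n <= M)%N -> exists2 C, 0 <= C & forall r, 0 < r ->
  sym n (fun s => 0 < s < r / 2) id (fun s => (s / r) ^+ (2 * M)) C
    (fun s => trem d M ((s / r) ^+ 2)).
Proof.
have qz r s : 0 < r -> 0 < s < r / 2 -> 0 <= (s / r) ^+ 2 <= 1 / 4.
  move=> r0 /andP[s0 sr]; rewrite sqr_ge0/=.
  have -> : 1 / 4 = (1 / 2) ^+ 2 :> R by field.
  by rewrite lerXn2r ?nnegrE ?divr_ge0 ?(ltW s0) ?(ltW r0)// ler_pdivrMr//; lra.
elim: n M d => [|n ih] M d nM.
  have [C C0 h] := trem_bound d M; exists C => // r r0; split => // s hs.
  by rewrite exprM h// qz.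
case: M nM => [//|M] nM; have [C C0 h] := trem_bound d M.+1.
have [C1 C10 h1] := ih M (d - 1) nM.
pose K := `|-2 * d| * (2 ^+ n * ((1 + 2%:R) ^+ n * C1)).
have K0 : 0 <= K by nng.
exists (C + K); first exact: addr_ge0.
move=> r r0; have w0 s : 0 < s < r / 2 -> 0 <= (s / r) ^+ (2 * M.+1).
  by move=> /andP[s0 _]; rewrite exprn_ge0// divr_ge0// ltW.
split.
  move=> s hs; rewrite (@le_trans _ _ (C * (s / r) ^+ (2 * M.+1)))//; first by rewrite exprM h// qz.
  by rewrite ler_wpM2r ?w0// lerDl.
exists (fun s => -2 * d * ((s / r) ^+ 2 * trem (d - 1) M ((s / r) ^+ 2))).
  move=> s hs; have [s0 sr] := andP hs; have := qz r s r0 hs => /andP[_ z1].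
  have z1' : (s / r) ^+ 2 < 1 by lra.
  apply: (der_eq (@der_comp _ (trem d M.+1) (fun s => (s / r) ^+ 2) s _ _ (trem_der d M z1') (qpow_der 2 r0 s0))).
  by rewrite /=; ring.
have Dp s : 0 < s < r / 2 -> 0 < s by case/andP.
have := symZ (-2 * d) (symM (sym_qpow n 2 r0 Dp) (h1 r r0)); apply: sym_weak => // s hs.
by rewrite -exprD -mulnS ler_wpM2r ?w0// lerDr.
Qed.

End Multipliers.

(** * Combinations of resolvents with prescribed behaviour at zero and infinity *)

Section Resolvents.
Context {R : realType}.
Implicit Types (r s d z al : R) (n m M N L : nat).

Lemma vandermonde_solve L (c : 'I_L -> R) :
  exists E : 'I_L -> R, forall j : 'I_L, \sum_k E k * (k%:R + 1) ^+ j = c j.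
Proof.
pose a : 'rV[R]_L := \row_k (k%:R + 1); pose V := Vandermonde L a.
have uV : V \in unitmx.
  rewrite unitmxE unitfE det_Vandermonde; apply/prodf_neq0 => i _; apply/prodf_neq0 => j ij.
  by rewrite !mxE subr_eq0 (can_eq (addrK _)) eqr_nat gtn_eqF.
pose E := invmx V *m (\col_j c j).
exists (fun k => E k 0) => j; have /matrixP/(_ j 0) := mulKVmx uV (\col_j c j).
by rewrite !mxE => <-; apply: eq_bigr => k _; rewrite !mxE mulrC.
Qed.

Lemma resolvent_expand N z al : z != 0 -> z + al != 0 ->
  (z + al)^-1 = \sum_(i < N) (- al) ^+ i * z^-1 ^+ i.+1 + (- al) ^+ N * z^-1 ^+ N / (z + al).
Proof.
move=> z0 h; elim: N => [|N ih]; first by rewrite big_ord0 add0r expr0 !mul1r.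
rewrite big_ord_recr /= {1}ih -addrA; congr (_ + _).
by rewrite !exprS; move: ((- al) ^+ N) (z^-1 ^+ N) => P Q; field; rewrite z0 h.
Qed.

Definition nres L (D : 'I_L -> R) z : R := \sum_k D k * (k%:R + 1 + z)^-1.

(** With [D k = E k * (k + 1)^M], the Taylor coefficients at [0] are, up to sign, the moments of [E]
    of order below [M], and the coefficients at infinity those of orders [M] to [M + N - 1].
    Prescribing the former and cancelling the latter is a single Vandermonde system with nodes
    [k + 1]. *)
Lemma resolvent_match d M N : exists L (D D1 D2 : 'I_L -> R),
  (forall z, 0 <= z -> nres D z = \sum_(i < M) tcoef d i * z ^+ i - z ^+ M * nres D1 z) /\
  (forall z, 0 < z -> nres D z = z^-1 ^+ N * nres D2 z).
Proof.
pose L := (M + N)%N.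
pose c (j : 'I_L) : R := if (j < M)%N then (-1) ^+ (M - j.+1) * tcoef d (M - j.+1) else 0.
have [E hE] := vandermonde_solve c.
have al0 (k : 'I_L) : k%:R + 1 != 0 :> R by rewrite natr1 pnatr_eq0.
have az (k : 'I_L) z : 0 <= z -> k%:R + 1 + z != 0.
  by move=> z0; rewrite gt_eqF// ltr_pwDl// natr1 ltr0n.
exists L, (fun k => E k * (k%:R + 1) ^+ M), (fun k => - (-1) ^+ M * E k),
  (fun k => E k * (k%:R + 1) ^+ M * (- (k%:R + 1)) ^+ N); split => z z0.
  have ex (k : 'I_L) : E k * (k%:R + 1) ^+ M * (k%:R + 1 + z)^-1 =
      \sum_(i < M) (E k * (k%:R + 1) ^+ (M - i.+1)) * (- z) ^+ i - z ^+ M * (- (-1) ^+ M * E k * (k%:R + 1 + z)^-1).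
    rewrite [in LHS](resolvent_expand M (al0 k) (az k z z0)) mulrDr; congr (_ + _).
      rewrite mulr_sumr; apply: eq_bigr => i _.
      have -> : (k%:R + 1) ^+ M = (k%:R + 1) ^+ (M - i.+1) * (k%:R + 1) ^+ i.+1 :> R.
        by rewrite -exprD subnK.
      rewrite -!mulrA; congr (_ * _); congr (_ * _).
      by rewrite [(- z) ^+ i * _]mulrC mulrA -exprMn mulfV ?expr1n ?mul1r.
    have -> : (- z) ^+ M = (-1) ^+ M * z ^+ M by rewrite -exprMn mulN1r.
    have := al0 k; have := az k z z0.
    move: (k%:R + 1) => y h0 h1; rewrite exprVn; have hM : y ^+ M != 0 by rewrite expf_neq0.
    by move: (y ^+ M) hM ((-1) ^+ M) (z ^+ M) => Y hM S Z; field; rewrite h0 hM.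
  rewrite /nres; under eq_bigr => k _ do rewrite ex.
  rewrite sumrB; congr (_ - _); last by rewrite mulr_sumr.
  rewrite exchange_big /=; apply: eq_bigr => i _; rewrite -mulr_suml.
  have iM : (M - i.+1 < L)%N by rewrite /L; have := ltn_ord i; lia.
  have := hE (Ordinal iM); rewrite /c /= => ->.
  have -> : (M - i.+1 < M)%N by have := ltn_ord i; lia.
  have -> : (M - (M - i.+1).+1 = i)%N by have := ltn_ord i; lia.
  rewrite mulrAC -exprMn mulN1r opprK mulrC. by [].
have zn := gt_eqF z0; have z0' := ltW z0.
have ex (k : 'I_L) : E k * (k%:R + 1) ^+ M * (k%:R + 1 + z)^-1 =
    \sum_(i < N) (E k * (k%:R + 1) ^+ (M + i)) * ((-1) ^+ i * z^-1 ^+ i.+1) +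
    z^-1 ^+ N * (E k * (k%:R + 1) ^+ M * (- (k%:R + 1)) ^+ N * (k%:R + 1 + z)^-1).
  rewrite [k%:R + 1 + z]addrC [in LHS](resolvent_expand N (negbT zn)); last by rewrite addrC az.
  rewrite mulrDr; congr (_ + _).
    rewrite mulr_sumr; apply: eq_bigr => i _.
    by rewrite -[- (k%:R + 1)]mulN1r exprMn exprD; ring.
  ring.
rewrite /nres; under eq_bigr => k _ do rewrite ex.
rewrite big_split /= exchange_big /= big1 ?add0r ?mulr_sumr// => i _.
rewrite -mulr_suml; have iM : (M + i < L)%N by rewrite ltn_add2l.
have := hE (Ordinal iM); rewrite /c /= => ->.
by rewrite ifF ?mul0r//; apply/negbTE; rewrite -leqNgt leq_addr.
Qed.

Lemma sym_nres n L (D : 'I_L -> R) : exists2 C, 0 <= C & forall r (P : R -> Prop), 0 < r ->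
  (forall s, P s -> 0 < s) -> sym n P id one_ C (fun s => nres D ((s / r) ^+ 2)).
Proof.
have al1 (k : nat) : 1 <= k%:R + 1 :> R by rewrite lerDr.
elim: L D => [|L ih] D.
  exists 0 => // r P r0 Pp; have : sym n P id one_ 0 (fun=> 0 : R).
    by apply: sym_zero => s _; rewrite mul0r.
  by apply: sym_ext => s; rewrite /nres big_ord0.
have [C C0 h] := ih (fun k => D (widen_ord (leqnSn L) k)).
have [C1 C10 h1] := sym_resolvent n (al1 L).
exists (C + `|D ord_max| * C1); first by nng.
move=> r P r0 Pp; have := symD (h r P r0 Pp) (symZ (D ord_max) (h1 r P r0 Pp)).
by apply: sym_ext => s; rewrite /nres big_ord_recr.
Qed.

End Resolvents.

Section DifferenceBound.
Context {R : realType}.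
Variables (a T pM : R) (p th : R -> R) (K : nat).
Hypothesis a0 : 0 < a.
Hypothesis pth : forall x : R, 0 < x -> 0 < p x /\ der th x (p x)^-1.
Hypothesis thT : forall x : R, a < x -> `|x - th x| <= T.
Hypothesis tha : th a < 0.
Hypothesis pMP : forall x : R, a < x -> p x <= pM.
Implicit Types (x y t s r B C : R) (n M N j i : nat).

(** Smooth interpolation of the zeros: [zsg j = s_j], and [zsg' = pi * p zsg], so differences in the
    index become derivatives of symbols along this flow. *)
Definition zsg t : R := phinv a th (pi * t).

Lemma zsgP t : 0 <= t -> [/\ a < zsg t, th (zsg t) = pi * t & der zsg t (pi * p (zsg t))].
Proof.
move=> t0; have h : th a < pi * t by rewrite (lt_le_trans tha)// mulr_ge0// pi_ge0.
have [h1 h2 h3] := phinvP a0 pth thT h; split => //.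
have d : der (fun t => pi * t) t pi.
  by apply: (der_eq (derM (der_cst pi t) (der_id t))); rewrite mul0r add0r mulr1.
by rewrite mulrC; exact: (@der_comp _ (phinv a th) (fun t => pi * t) t _ _ h3 d).
Qed.

Lemma zsg_a t : 0 <= t -> a < zsg t. Proof. by move=> /zsgP[]. Qed.
Lemma zsg_gt0 t : 0 <= t -> 0 < zsg t. Proof. by move=> /zsg_a; exact: lt_trans. Qed.

Lemma zsg_T t : 0 <= t -> `|zsg t - pi * t| <= T.
Proof. by move=> /zsgP[h1 <- _]; exact: thT. Qed.

Lemma zsg_le x y : 0 <= x -> x <= y -> zsg x <= zsg y <= zsg x + pi * pM * (y - x).
Proof.
move=> x0 xy.
have d t : x <= t <= y -> der zsg t (pi * p (zsg t)).
  by move=> /andP[xt _]; have [] := zsgP (le_trans x0 xt).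
have [c /andP[xc cy] hc] := der_MVT xy d; have c0 := le_trans x0 xc.
have pc : 0 < p (zsg c) by exact: (pth (zsg_gt0 c0)).1.
apply/andP; split; first by rewrite -subr_ge0 hc !mulr_ge0 ?pi_ge0 ?(ltW pc)// subr_ge0.
by rewrite addrC -lerBlDr hc ler_wpM2r ?subr_ge0// ler_wpM2l ?pi_ge0// pMP// zsg_a.
Qed.

Lemma ndiffD M (f g : nat -> R) n k :
  iter k (ndiff M) (fun j => f j + g j) n = iter k (ndiff M) f n + iter k (ndiff M) g n.
Proof.
elim: k f g => [//|k ih] f g; rewrite !iterSr -ih; congr (iter k _ _ n).
by apply/funext => j; rewrite /ndiff; ring.
Qed.

(* [M]-step differences along the zeros, through the chain rule for the phase. *)
Lemma ndiff_sym (D : R -> Prop) (rho : R -> R) (Hp V : R) : (forall s, D s -> a < s) ->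
  (forall s, D s -> 0 < rho s) -> 0 <= Hp -> 0 <= V ->
  sym K D rho one_ Hp p -> sym K D rho (fun s => (rho s)^-1) V (fun s => (rho s)^-1) ->
  forall C w F, 0 <= C -> (forall s, D s -> 0 <= w s) -> sym K D rho w C F ->
  forall M n b, 0 <= b ->
  (forall t, n%:R <= t <= n%:R + K%:R * M%:R -> D (zsg t) /\ w (zsg t) * (rho (zsg t))^-1 ^+ K <= b) ->
  `|iter K (ndiff M) (fun j => F (zsg j%:R)) n| <=
     M%:R ^+ K * ((2 ^+ K * (2 ^+ K * (pi * Hp * V))) ^+ K * C * b).
Proof.
move=> Da r0 H0 V0 sp sr C w F C0 w0 sF M n b b0 hb.
rewrite (@ndiff_rdiff R K M 0 (fun t => F (zsg t)) (fun j => F (zsg j%:R)) n); last first.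
  by move=> i _; rewrite subr0 natrD natrM.
rewrite subr0; apply: rdiff_bound => //.
have Dp s : D s -> pi * p s != 0.
  by move=> /Da as_; rewrite gt_eqF// mulr_gt0 ?pi_gt0//; exact: (pth (lt_trans a0 as_)).1.
have sp' : sym K D rho one_ (pi * Hp) (fun s => pi * p s).
  by have := symZ pi sp; rewrite ger0_norm ?pi_ge0.
have pH0 : 0 <= pi * Hp by nng.
apply: (@sym_chain R K D rho (pi * Hp) V (fun s => pi * p s) Dp r0 pH0 V0 sp' sr K (leqnn K) w C F C0 w0 sF) => //.
- move=> t ht; have [Dt _] := hb t ht; split => //.
  by have [] := @zsgP t (le_trans (ler0n _ _) (andP ht).1).
- by move=> t ht; have [] := hb t ht.
Qed.

End DifferenceBound.

(** * Differences along the zeros *)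

Section Bump.
Context {R : realType}.

Lemma bump_ge (M x y c : R) : 0 < M -> 0 <= c -> `|x - y| <= c * M -> (1 + c) ^- 2 <= bump M y x.
Proof.
move=> M0 c0 h; have h1 : `|x - y| / M <= c by rewrite ler_pdivrMr.
have q0 : 0 <= `|x - y| / M by nng.
rewrite /bump lef_pV2 ?posrE ?exprn_gt0 ?ltr_pwDl//.
by rewrite lerXn2r ?nnegrE ?addr_ge0// lerD2l.
Qed.

Lemma bump_ge0 (M x y : R) : 0 <= bump M y x.
Proof. by rewrite /bump invr_ge0 sqr_ge0. Qed.

End Bump.

Ltac nng_ext ::= exact: bump_ge0.

(** * Differences of the multiplier below, above and at the edge *)

Section OscillatorySum.
Context {R : realType}.
Variables (a T pM d CF : R) (p th : R -> R) (K J L V : nat) (Dn D1 D2 : 'I_L -> R).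
Hypothesis a0 : 0 < a.
Hypothesis pth : forall x : R, 0 < x -> 0 < p x /\ der th x (p x)^-1.
Hypothesis thT : forall x : R, a < x -> `|x - th x| <= T.
Hypothesis T0 : 0 <= T.
Hypothesis tha : th a < 0.
Hypothesis pMP : forall x : R, a < x -> p x <= pM.
Hypothesis pM0 : 0 <= pM.
Hypothesis psym : exists2 C, 0 <= C & sym K (fun x => a < x) id one_ C p.
Hypothesis d0 : 0 < d.
Hypothesis dK : d + 2 <= K%:R.
Hypothesis KV : (K + 2 <= V)%N.
Hypothesis CF0 : 0 <= CF.
Hypothesis Dlow : forall z : R, 0 <= z -> nres Dn z = \sum_(i < V) tcoef d i * z ^+ i - z ^+ V * nres D1 z.
Hypothesis Dhigh : forall z : R, 0 < z -> nres Dn z = z^-1 ^+ J.+1 * nres D2 z.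
Implicit Types (x y t s r B C : R) (n M N j i : nat).

Let sg := zsg a th.
Let a1 (s : R) := a < s.
Let apos s : a1 s -> 0 < s. Proof. exact: lt_trans. Qed.

Definition riesz r s : R := powR (Num.max (1 - (s / r) ^+ 2) 0) d.

(** The weight of [F] measured against its size [B] at [r]. The growth [(r / s)^2] below [r] is
    absorbed by the Taylor remainder of order [V], the growth [(s / r)^(2 J)] above by the decay
    [z^-(J + 1)] of the resolvents. *)
Definition tame r B (H F : R -> R) : Prop :=
  [/\ 0 <= B, (forall s, a < s -> 0 <= H s), sym K a1 id H CF F,
      (forall s, a < s -> s <= r -> H s <= B * (r / s) ^+ 2) &
      (forall s, a < s -> r / 4 <= s -> H s <= B * (s / r) ^+ (2 * J))].

(** An envelope of the differences: a bump of width [M] at the index [r / pi] of the edge, and a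
    smaller background on the scale [r]. Both have sum of order [M (M / r)^d]. *)
Definition env r (M : nat) n : R := powR (M%:R / r) d * bump M%:R (r / pi) n%:R + (M%:R / r) ^+ K * bump r 0 n%:R.

Let sgj (j : nat) : a < sg j%:R. Proof. exact: (zsg_a a0 pth thT tha). Qed.

Let sg_step n M i : (i <= K)%N -> sg n%:R <= sg (n + i * M)%:R <= sg n%:R + pi * pM * (K%:R * M%:R).
Proof.
move=> iK; have le1 : n%:R <= (n + i * M)%:R :> R by rewrite ler_nat leq_addr.
have /andP[-> h] := zsg_le a0 pth thT tha pMP (ler0n R n) le1.
rewrite (le_trans h)// lerD2l ler_wpM2l ?mulr_ge0 ?pi_ge0//.
by rewrite natrD addrAC subrr add0r natrM ler_wpM2r// ler_nat.
Qed.

Let sg_mid n M t : n%:R <= t <= n%:R + K%:R * M%:R -> sg n%:R <= sg t <= sg (n + K * M)%:R.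
Proof.
move=> /andP[h1 h2]; have t0 : 0 <= t by exact: le_trans h1.
have /andP[-> _] := zsg_le a0 pth thT tha pMP (ler0n R n) h1.
have h3 : t <= (n + K * M)%:R by rewrite natrD natrM.
by have /andP[-> _] := zsg_le a0 pth thT tha pMP t0 h3.
Qed.

Let sg_n n : n%:R <= sg n%:R + T.
Proof.
have := zsg_T a0 pth thT tha (ler0n R n); rewrite ler_norml => /andP[h _].
have : n%:R <= pi * n%:R :> R by rewrite ler_peMl// (le_trans _ (pi_ge2 R))// ler1n.
by move: h; rewrite -/(sg n%:R); lra.
Qed.

Let idV : exists2 C, 0 <= C & sym K a1 id (fun s => (id s)^-1) C (fun s => (id s)^-1).
Proof.
have [C C0 h] := @sym_invX R a a0 K 1; by exists C.
Qed.

Lemma ndiff_id : exists2 C, 0 <= C & forall D CG w G M n b, (forall s, D s -> a < s) ->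
  0 <= CG -> (forall s, D s -> 0 <= w s) -> sym K D id w CG G -> 0 <= b ->
  (forall s, sg n%:R <= s <= sg (n + K * M)%:R -> D s /\ w s * s^-1 ^+ K <= b) ->
  `|iter K (ndiff M) (fun j => G (sg j%:R)) n| <= C * CG * (M%:R ^+ K * b).
Proof.
have [P P0 hP] := psym; have [V1 V10 hV1] := idV.
pose C := (2 ^+ K * (2 ^+ K * (pi * P * V1))) ^+ K.
exists C; first by nng.
move=> D CG w G M n b Da CG0 w0 sG b0 hb.
have := @ndiff_sym R a T p th K a0 pth thT tha D id P V1 Da
  (fun s Ds => apos (Da s Ds)) P0 V10 (sym_weak Da _ hP) (sym_weak Da _ hV1) CG w G CG0 w0 sG M n b b0.
have -> : C * CG * (M%:R ^+ K * b) = M%:R ^+ K * (C * CG * b) by ring.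
apply => //; by move=> t ht; apply: hb; exact: sg_mid.
Qed.

(** Chosen so that, when [K8 * M <= r], [K] steps of length [M] in the index move the interpolated
    zero by at most [r / 8], and [T], [M] and [1] are at most [r]. *)
Let K8 := 8 * (pi * pM * K%:R) + 2 * (T + 1) + 2.

Let K8_1 : 1 <= K8.
Proof.
have : 0 <= pi * pM * K%:R by nng.
by rewrite /K8; move: (pi * pM * K%:R) T0 => y; lra.
Qed.

Let scale r M : (1 <= M)%N -> K8 * M%:R <= r -> [/\ 0 < r, T <= r, pi * pM * (K%:R * M%:R) <= r / 8, M%:R <= r & 1 <= r].
Proof.
move=> M1 h; have M1' : 1 <= M%:R :> R by rewrite ler1n.
have q0 : 0 <= pi * pM * K%:R by nng.
have E : K8 * M%:R = 8 * (pi * pM * (K%:R * M%:R)) + 2 * (T * M%:R) + 4 * M%:R by rewrite /K8; ring.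
have q1 : 0 <= pi * pM * (K%:R * M%:R) by rewrite !mulrA mulr_ge0.
have q2 : T <= T * M%:R by rewrite ler_peMr.
move: h; rewrite E; move: (pi * pM * (K%:R * M%:R)) (T * M%:R) q1 q2 M1' => u v q1 q2 M1' h.
by split; move: T0; lra.
Qed.

(** Below [r / 2] the corrected multiplier is a Taylor remainder of size [(s / r)^(2 V)]. As
    [2 V >= K + 2], it pays for the factor [s^-K] of the [K] derivatives and for the growth
    [(r / s)^2] of [F], leaving [r^-K]. *)
Lemma ndiff_low : exists2 C, 0 <= C & forall r B H F M n, (1 <= M)%N -> K8 * M%:R <= r ->
  tame r B H F -> sg (n + K * M)%:R < r / 2 ->
  `|iter K (ndiff M) (fun j => (riesz r (sg j%:R) - nres Dn ((sg j%:R / r) ^+ 2)) * F (sg j%:R)) n| <= C * B * env r M n.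
Proof.
have VK : (K <= V)%N by move: KV; lia.
have [C1 C10 h1] := @sym_trem R K V d VK; have [C2 C20 h2] := @sym_nres R K L D1.
have [C3 C30 h3] := ndiff_id.
pose C4 := 2 ^+ K * ((C1 + 2 ^+ K * ((1 + (2 * V)%:R) ^+ K * C2)) * CF).
have C40 : 0 <= C4 by nng.
exists (C3 * C4 * 4); first by nng.
move=> r B H F M n M1 hM [B0 H0 sF Hl Hh] hn.
have [r0 Tr _ Mr r1] := scale M1 hM.
pose D s := a < s < r / 2.
have Da s : D s -> a < s by case/andP.
have Dp s : D s -> 0 < s by move/Da; exact: apos.
have D' s : D s -> 0 < s < r / 2 by move=> Ds; rewrite Dp//; case/andP: Ds.
have q0 s : D s -> 0 <= s / r by move=> Ds; rewrite divr_ge0 ?ltW// Dp.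
have sG0 : sym K D id (fun s => (s / r) ^+ (2 * V)) (C1 + 2 ^+ K * ((1 + (2 * V)%:R) ^+ K * C2))
    (fun s => trem d V ((s / r) ^+ 2) + (s / r) ^+ (2 * V) * nres D1 ((s / r) ^+ 2)).
  apply: symD; first by apply: sym_weak (h1 r r0).
  exact: symM1 (sym_qpow K (2 * V) r0 Dp) (h2 r D r0 Dp).
    have oD : open [set s : R | D s] by exact: open_oo.
have sG : sym K D id (fun s => (s / r) ^+ (2 * V)) (C1 + 2 ^+ K * ((1 + (2 * V)%:R) ^+ K * C2))
    (fun s => riesz r s - nres Dn ((s / r) ^+ 2)).
  apply: sym_congr sG0 => // s Ds; rewrite Dlow ?sqr_ge0// /riesz /trem exprM max_l; first by ring.
  by apply/ltW/edge_gt0; [exact: Dp|have /andP[_ h] := Ds; lra].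
have sF' : sym K D id H CF F by apply: sym_weak sF.
have Bn : 0 <= B * r^-1 ^+ K by nng.
have := h3 D C4 _ _ M n (B * r^-1 ^+ K) Da C40 _ (symM sG sF') Bn _; move=> /(_ _ _)/le_trans -> //.
- by move=> s Ds; rewrite mulr_ge0 ?exprn_ge0 ?q0 ?H0 ?Da.
- move=> s /andP[s1 s2]; have Ds : D s by rewrite /D (lt_le_trans (sgj n) s1) (le_lt_trans s2).
  split => //; have s0 := Dp s Ds; have /andP[_ sr] := Ds.
  apply: (@le_trans _ _ ((s / r) ^+ (2 * V) * (B * (r / s) ^+ 2) * s^-1 ^+ K)).
    rewrite ler_wpM2r ?exprn_ge0 ?invr_ge0 ?(ltW s0)// ler_wpM2l ?exprn_ge0 ?q0// Hl ?Da//; lra.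
  have -> : (2 * V = (2 * V - (K + 2)) + K + 2)%N.
    by rewrite -addnA subnK// (leq_trans KV)// mul2n -addnn leq_addr.
  rewrite !exprD; set X := (s / r) ^+ (_ - _).
  have X1 : X <= 1 by rewrite exprn_ile1 ?q0// ler_pdivrMr//; lra.
  have -> : X * (s / r) ^+ K * (s / r) ^+ 2 * (B * (r / s) ^+ 2) * s^-1 ^+ K = X * (B * r^-1 ^+ K).
    rewrite !expr_div_n !exprVn; have N1 : s ^+ K != 0 by rewrite expf_neq0// gt_eqF.
    have N2 : r ^+ K != 0 by rewrite expf_neq0// gt_eqF.
    by move: (s ^+ K) (r ^+ K) N1 N2 => u v N1 N2; field; rewrite N1 N2 !gt_eqF.
  by rewrite ler_piMl.
move: C4 C40 {h3 sG sG0} => C4 C40.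
rewrite -!mulrA ler_wpM2l// ler_wpM2l// !mulrA.
have -> : M%:R ^+ K * B * r^-1 ^+ K = B * (M%:R / r) ^+ K by rewrite expr_div_n exprVn; ring.
rewrite -mulrA [4 * _]mulrCA ler_wpM2l//.
have nr : n%:R <= r.
  have /andP[h _] := @sg_step n M K (leqnn _); have := sg_n n; move: h hn K8_1.
  have := hM; rewrite /K8; have M1' : 1 <= M%:R :> R by rewrite ler1n.
  have q0' : 0 <= pi * pM * K%:R by nng.
  have q1 : 0 <= (8 * (pi * pM * K%:R)) * M%:R by nng.
  have q2 : T <= T * M%:R by rewrite ler_peMr.
  by move: T0 => T0'; rewrite mulrDl mulrDl; move: ((8 * (pi * pM * K%:R)) * M%:R) q1 => u; lra.
have b4 : (1 + 1) ^- 2 <= bump r 0 n%:R.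
  by apply: bump_ge => //; rewrite subr0 ger0_norm// mul1r.
have X0 : 0 <= (M%:R / r) ^+ K by nng.
have Y0 : 0 <= powR (M%:R / r) d * bump M%:R (r / pi) n%:R by nng.
apply: (@le_trans _ _ (4 * ((M%:R / r) ^+ K * bump r 0 n%:R))); last by rewrite ler_wpM2l// lerDr.
rewrite mulrCA ler_peMr// -ler_pdivrMl// mulr1.
by move: b4; have -> : (1 + 1) ^- 2 = 4^-1 :> R by congr (_^-1); ring.
Qed.

(** The vanishing moments at infinity beat the growth of [F] by [(r / s)^2], which a bump of width
    [r] in the index dominates. *)
Lemma ndiff_high : exists2 C, 0 <= C & forall r B H F M n, (1 <= M)%N -> K8 * M%:R <= r ->
  tame r B H F -> r / 4 <= sg n%:R ->
  `|iter K (ndiff M) (fun j => nres Dn ((sg j%:R / r) ^+ 2) * F (sg j%:R)) n| <= C * B * env r M n.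
Proof.
have [C2 C20 h2] := @sym_nres R K L D2; have [C3 C30 h3] := ndiff_id.
pose C4 := 2 ^+ K * (2 ^+ K * ((1 + (2 * J.+1)%:R) ^+ K * C2) * CF).
have C40 : 0 <= C4 by nng.
exists (C3 * C4 * (4 ^+ K * 81)); first by nng.
move=> r B H F M n M1 hM [B0 H0 sF Hl Hh] hn.
have [r0 Tr _ Mr r1] := scale M1 hM.
have q0 s : a1 s -> 0 < s / r by move=> /apos s0; rewrite divr_gt0.
have sG0 := symM1 (sym_qpowV K (2 * J.+1) r0 apos) (h2 r a1 r0 apos).
have sG : sym K a1 id (fun s => (s / r) ^- (2 * J.+1)) (2 ^+ K * ((1 + (2 * J.+1)%:R) ^+ K * C2))
    (fun s => nres Dn ((s / r) ^+ 2)).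
  apply: sym_congr sG0; first exact: open_gt.
  by move=> s as_; rewrite (@Dhigh ((s / r) ^+ 2)) ?exprn_gt0 ?q0// exprM exprVn.
have s00 : 0 < sg n%:R by exact: apos (sgj n).
pose b := B * (4 / r) ^+ K * (r / sg n%:R) ^+ 2.
have b0 : 0 <= b by rewrite /b mulr_ge0 ?sqr_ge0// mulr_ge0// exprn_ge0// divr_ge0// ltW.
have := h3 a1 C4 _ _ M n b (fun s h => h) C40 _ (symM sG sF) b0 _; move=> /(_ _ _)/le_trans -> //.
- by move=> s Ds; rewrite mulr_ge0 ?H0// invr_ge0 exprn_ge0// ltW// q0.
- move=> s /andP[s1 s2]; have Ds : a1 s by exact: (lt_le_trans (sgj n) s1).
  split => //; have s0 := apos Ds; have sr : r / 4 <= s by exact: le_trans s1.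
  apply: (@le_trans _ _ ((s / r) ^- (2 * J.+1) * (B * (s / r) ^+ (2 * J)) * s^-1 ^+ K)).
    rewrite ler_wpM2r ?exprn_ge0 ?invr_ge0 ?(ltW s0)// ler_wpM2l ?Hh// invr_ge0 exprn_ge0// ltW// q0//.
  rewrite mulnS addnC exprD invfM.
  have -> : (s / r) ^- (2 * J) * (s / r) ^- 2 * (B * (s / r) ^+ (2 * J)) * s^-1 ^+ K = B * s^-1 ^+ K * (s / r) ^- 2.
    have N1 : (s / r) ^+ (2 * J) != 0 by rewrite expf_neq0// gt_eqF// q0.
    have N2 : (s / r) ^+ 2 != 0 by rewrite expf_neq0// gt_eqF// q0.
    by move: ((s / r) ^+ (2 * J)) ((s / r) ^+ 2) N1 N2 => u v N1 N2; field; rewrite N1 N2.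
  have u1 : s^-1 ^+ K <= (4 / r) ^+ K.
    have s0' := ltW s0; have r0' := ltW r0; rewrite lerXn2r ?nnegrE ?invr_ge0 ?divr_ge0//.
    by rewrite -[4 / r]invrK lef_pV2 ?posrE ?invr_gt0 ?divr_gt0// invf_div.
  have u2 : (s / r) ^- 2 <= (r / sg n%:R) ^+ 2.
    rewrite -exprVn invf_div lerXn2r ?nnegrE ?divr_ge0 ?(ltW r0) ?(ltW s0) ?(ltW s00)//.
    by rewrite ler_wpM2l ?(ltW r0)// lef_pV2 ?posrE.
  rewrite /b ler_pM ?mulr_ge0 ?exprn_ge0 ?invr_ge0 ?exprn_ge0 ?divr_ge0 ?(ltW s0) ?(ltW r0)//.
  by rewrite ler_wpM2l.
move: C4 C40 {h3 sG sG0} => C4 C40.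
rewrite -!mulrA ler_wpM2l// ler_wpM2l// /b.
have -> : M%:R ^+ K * (B * (4 / r) ^+ K * (r / sg n%:R) ^+ 2) =
    4 ^+ K * (B * ((M%:R / r) ^+ K * (r / sg n%:R) ^+ 2)) by rewrite !expr_div_n; ring.
rewrite ler_wpM2l ?exprn_ge0// [leRHS]mulrCA ler_wpM2l//.
have X0 : 0 <= (M%:R / r) ^+ K by nng.
have Y0 : 0 <= powR (M%:R / r) d * bump M%:R (r / pi) n%:R by nng.
apply: (@le_trans _ _ (81 * ((M%:R / r) ^+ K * bump r 0 n%:R))); last by rewrite ler_wpM2l// lerDr.
rewrite [leRHS]mulrCA ler_wpM2l//.
rewrite /bump subr0 ger0_norm// -exprVn.
have -> : 81 = 9 ^+ 2 :> R by rewrite -natrX.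
have h00 : 0 <= r / sg n%:R by nng.
have h01 : 0 <= 9 * (1 + n%:R / r)^-1 by nng.
rewrite -exprMn lerXn2r ?nnegrE//.
rewrite ler_pdivlMr; last by rewrite ltr_pwDl// divr_ge0// ltW.
have h9 : r / sg n%:R * (1 + n%:R / r) = (r + n%:R) / sg n%:R by field; rewrite !gt_eqF.
by rewrite h9 ler_pdivrMr//; have := sg_n n; move: hn Tr; lra.
Qed.

Lemma riesz_ge0 r s : 0 <= riesz r s. Proof. exact: powR_ge0. Qed.

Lemma riesz_out r s : 0 < r -> r <= s -> riesz r s = 0.
Proof.
move=> r0 rs; rewrite /riesz max_r; first by rewrite powR0// gt_eqF.
by rewrite subr_le0 exprn_ege1// ler_pdivlMr// mul1r.
Qed.

Lemma riesz_edge r s : 0 < s -> s < r -> riesz r s <= powR (2 * ((r - s) / r)) d.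
Proof.
move=> s0 sr; have r0 := lt_trans s0 sr; have e0 := edge_gt0 s0 sr.
rewrite /riesz max_l ?(ltW e0)// powR_le ?(ltW d0) ?(ltW e0)//.
have q0 : 0 <= s / r by nng.
have -> : 1 - (s / r) ^+ 2 = (1 + s / r) * ((r - s) / r) by field; rewrite gt_eqF.
rewrite ler_wpM2r ?divr_ge0 ?subr_ge0 ?(ltW sr) ?(ltW r0)//.
by have : s / r <= 1; [rewrite ler_pdivrMr// mul1r ltW|lra].
Qed.

(** Left of the edge by at least [M], the derivation [edge] bounds the differences by
    [(distance / r)^(d - K)]. Closer, the multiplier itself has size [(M / r)^d], and on the right
    it vanishes. *)
Lemma ndiff_edge : exists2 C, 0 <= C & forall r B H F M n, (1 <= M)%N -> K8 * M%:R <= r ->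
  tame r B H F -> r / 4 <= sg n%:R ->
  `|iter K (ndiff M) (fun j => riesz r (sg j%:R) * F (sg j%:R)) n| <= C * B * env r M n.
Proof.
have [P P0 hP] := psym.
have [C1 C10 h1] := @sym_edge_pow R K d; have [C2 C20 h2] := @sym_edge_inv R K.
have [C3' C30' h3'] := @sym_edge_var R K.
pose C3 := 1 + C3'; have C31 : 1 <= C3 by rewrite lerDl.
pose Kr := (2 ^+ K * C3) ^+ K.
have Kr0 : 0 <= Kr by rewrite /Kr exprn_ge0// mulr_ge0 ?exprn_ge0// (le_trans ler01).
pose CG := 2 ^+ K * (C1 * (Kr * CF)).
have CG0 : 0 <= CG by rewrite /CG; nng.
pose CA := (2 ^+ K * (2 ^+ K * (pi * (Kr * P) * C2))) ^+ K * CG.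
have CA0 : 0 <= CA by rewrite /CA; nng.
pose q := 2 + T + pi * K%:R; have piK : 0 <= pi * K%:R :> R by nng.
have q1 : 1 <= q by rewrite /q; move: T0 piK; lra.
pose w := pi * pM * K%:R; have w0 : 0 <= w by nng.
pose CB := 2 ^+ K * (powR (2 * (1 + w)) d * (CF * 16)) * (1 + (1 + w + T)) ^+ 2.
have CB0 : 0 <= CB by nng.
exists (CA * (16 * 4 ^+ K) * q ^+ 2 + CB).
  have q0 := le_trans ler01 q1; nng.
move=> r B H F M n M1 hM [B0 H0 sF Hl Hh] hn.
have q0 := le_trans ler01 q1; have [r0 Tr wr Mr r1] := scale M1 hM.
have M0 : 0 < M%:R :> R by rewrite ltr0n.
have s00 : 0 < sg n%:R by exact: apos (sgj n).
have X0 : 0 <= (M%:R / r) ^+ K by nng.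
have Y1 : 0 <= (M%:R / r) ^+ K * bump r 0 n%:R by nng.
have Y2 : 0 <= powR (M%:R / r) d * bump M%:R (r / pi) n%:R by nng.
have H16 s : a < s -> r / 4 <= s -> s <= r -> H s <= B * 16.
  move=> as_ h4 sr; rewrite (le_trans (Hl s as_ sr))// ler_wpM2l//.
  have -> : 16 = 4 ^+ 2 :> R by rewrite -natrX.
  have s0 := apos as_; rewrite lerXn2r ?nnegrE ?divr_ge0 ?(ltW r0) ?(ltW s0)// ler_pdivrMr//; lra.
suff key : `|iter K (ndiff M) (fun j => riesz r (sg j%:R) * F (sg j%:R)) n| <=
    (CA * (16 * 4 ^+ K) * q ^+ 2 + CB) * B * (powR (M%:R / r) d * bump M%:R (r / pi) n%:R).
  apply: (le_trans key); rewrite ler_wpM2l ?lerDl//.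
  by nng.
have pn : (pi : R) != 0 by rewrite (gt_eqF (pi_gt0 R)).
have ppi (y : R) : pi * (y - r / pi) = pi * y - r by rewrite mulrBr [pi * (r / pi)]mulrCA mulfV ?mulr1.
have pin : `|sg n%:R - pi * n%:R| <= T by exact: (zsg_T a0 pth thT tha (ler0n R n)).
have pi1 : 1 <= pi :> R by have := pi_ge2 R; lra.
have npi c : `|sg n%:R - r| <= c -> `|n%:R - r / pi| <= c + T.
  move=> hc; have h : `|pi * (n%:R - r / pi)| <= c + T.
    have -> : pi * (n%:R - r / pi) = (sg n%:R - r) - (sg n%:R - pi * n%:R) by rewrite ppi; ring.
    by rewrite (le_trans (ler_normB _ _))// lerD.
  apply: le_trans h; rewrite normrM ger0_norm ?pi_ge0// ler_peMl//.
have wM : pi * pM * (K%:R * M%:R) = w * M%:R by rewrite /w; ring.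
have /andP[se1 se2] := @sg_step n M K (leqnn _).
(* The whole block of [K] steps lies at distance at least [M] left of the edge. The remaining blocks
   start beyond the edge or come within [M] of it or cross it. *)
have [hA|hA] := leP (sg (n + K * M)%:R) (r - M%:R).
  have s1r : sg (n + K * M)%:R < r by lra.
  pose D s := a < s < r; have Da s : D s -> a < s by case/andP.
  have D0 s : D s -> 0 < s < r by move=> /andP[as_ ->]; rewrite apos.
  have e0 s : D s -> 0 < edge r s by move=> /D0/andP[s0 sr]; rewrite mulr_gt0// edge_gt0.
  have D00 s : D s -> 0 < id s by move=> /D0/andP[].
  have ratio : sym K D (edge r) one_ C3 (fun s => edge r s / id s).
    have oD : open [set s : R | D s] by exact: open_oo.
    have hh : sym K D (edge r) one_ C3 (fun s => 1 - (s / r) ^+ 2).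
      by apply: sym_weak (h3' r r0) => // s _; rewrite /one_ !mulr1 /C3 lerDr.
    by apply: sym_congr hh => // s Ds; rewrite /edge /= mulrAC mulfV ?mul1r// gt_eqF// D00.
  have one0 s : D s -> 0 <= @one_ R s by move=> _; rewrite /one_ ler01.
  have sp : sym K D (edge r) one_ (Kr * P) p.
    exact: (sym_rho D00 e0 ratio (sym_weak Da (fun s _ => lexx _) hP) P0 C31 one0).
  have sF' : sym K D (edge r) H (Kr * CF) F.
    exact: (sym_rho D00 e0 ratio (sym_weak Da (fun s _ => lexx _) sF) CF0 C31 (fun s Ds => H0 s (Da s Ds))).
  have sG0 := symM (sym_weak D0 (fun s _ => lexx _) (h1 r r0)) sF'.
  have sG : sym K D (edge r) (fun s => powR (1 - (s / r) ^+ 2) d * H s) CG (fun s => riesz r s * F s).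
    apply: sym_congr sG0; last by move=> s /D0/andP[s0 sr]; rewrite /riesz max_l// ltW// edge_gt0.
    exact: open_oo.
  pose X := (r - sg (n + K * M)%:R) / M%:R.
  have X1 : 1 <= X by rewrite ler_pdivlMr// mul1r; lra.
  have x0 : 0 < X by exact: lt_le_trans X1.
  pose b := 16 * 4 ^+ K * B * r^-1 ^+ K * powR (X * M%:R / r) (d - K%:R).
  have b0 : 0 <= b by nng.
  have W0 s : D s -> 0 <= powR (1 - (s / r) ^+ 2) d * H s by move=> Ds; rewrite mulr_ge0 ?powR_ge0// H0// Da.
  have := @ndiff_sym R a T p th K a0 pth thT tha D (edge r) (Kr * P) C2 Da e0 (mulr_ge0 Kr0 P0) C20 sp
    (sym_weak D0 (fun s _ => lexx _) (h2 r r0)) CG _ _ CG0 W0 sG M n b b0.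
  move=> /(_ _)/le_trans -> //.
    move=> t ht; have /andP[s1 s2] := sg_mid ht; rewrite -/sg; set s := sg t in s1 s2 *.
    have Ds : D s by rewrite /D (lt_le_trans (sgj n) s1) (le_lt_trans s2).
    have /andP[s0 sr] := D0 s Ds; have as_ := Da s Ds; have ee := edge_gt0 s0 sr.
    split => //; have h4 : r / 4 <= s by exact: le_trans s1.
    have eK : (1 - (s / r) ^+ 2) ^+ K != 0 by rewrite expf_neq0// gt_eqF.
    apply: (@le_trans _ _ (powR (1 - (s / r) ^+ 2) d * (B * 16) * (edge r s)^-1 ^+ K)).
      by rewrite ler_wpM2r ?exprn_ge0 ?invr_ge0 ?(ltW (e0 s Ds))// ler_wpM2l ?powR_ge0// H16// ltW.
    have -> : powR (1 - (s / r) ^+ 2) d * (B * 16) * (edge r s)^-1 ^+ K =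
        16 * B * (s^-1 ^+ K * powR (1 - (s / r) ^+ 2) (d - K%:R)).
      rewrite /edge; move: (1 - (s / r) ^+ 2) ee => E ee.
      by rewrite powRB ?(gt_eqF ee) ?implybT// powR_mulrn ?(ltW ee)// invfM exprMn [E^-1 ^+ K]exprVn; ring.
    rewrite /b; have -> : 16 * 4 ^+ K * B * r^-1 ^+ K * powR (X * M%:R / r) (d - K%:R) =
      16 * B * ((4 / r) ^+ K * powR (X * M%:R / r) (d - K%:R)) by rewrite expr_div_n exprVn; ring.
    have s0' := ltW s0; have r0' := ltW r0.
    rewrite ler_wpM2l ?mulr_ge0// ler_pM ?exprn_ge0 ?invr_ge0 ?powR_ge0//.
      rewrite lerXn2r ?nnegrE ?invr_ge0 ?divr_ge0//.
      by rewrite -[4 / r]invrK lef_pV2 ?posrE ?invr_gt0 ?divr_gt0// invf_div.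
    apply: powR_leN; first by (move: dK; lra).
      by nng.
    have -> : 1 - (s / r) ^+ 2 = (1 + s / r) * ((r - s) / r) by field; rewrite gt_eqF.
    apply: (@le_trans _ _ (1 * ((r - s) / r))).
      rewrite mul1r ler_wpM2r ?invr_ge0// /X divfK ?gt_eqF//; move: s2; lra.
    rewrite ler_wpM2r ?lerDl ?divr_ge0 ?subr_ge0 ?(ltW sr)//.
  (* As [d + 2 <= K], the decay in the distance [X] to the edge, in units of [M], is at least
     quadratic, hence controlled by a summable bump. *)
  have Xd : powR X (d - K%:R) <= X ^- 2.
    rewrite -powR_mulrn ?(ltW x0)// -powRN; apply: ler_powR => //; move: dK; lra.
  have Xb : X ^- 2 <= q ^+ 2 * bump M%:R (r / pi) n%:R.
    rewrite /bump -exprVn -exprVn -exprMn.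
    have hX : `|n%:R - r / pi| / M%:R <= X + pi * K%:R + T.
      have pie : `|sg (n + K * M)%:R - pi * (n + K * M)%:R| <= T by exact: (zsg_T a0 pth thT tha (ler0n R _)).
      have hb : `|pi * (n%:R - r / pi)| <= X * M%:R + pi * (K%:R * M%:R) + T.
        have -> : pi * (n%:R - r / pi) = - (r - sg (n + K * M)%:R) - pi * (K%:R * M%:R) - (sg (n + K * M)%:R - pi * (n + K * M)%:R).
          by rewrite ppi natrD natrM; ring.
        rewrite (le_trans (ler_normB _ _))// lerD// (le_trans (ler_normB _ _))// normrN lerD//.
          by rewrite ger0_norm ?subr_ge0 ?(ltW s1r)// /X divfK// gt_eqF.
        by rewrite ger0_norm// !mulr_ge0 ?pi_ge0.
      rewrite ler_pdivrMr//; apply: (@le_trans _ _ (X * M%:R + pi * (K%:R * M%:R) + T)).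
        by apply: le_trans hb; rewrite normrM ger0_norm ?pi_ge0// ler_peMl.
      by rewrite !mulrDl mulrA lerD2l ler_peMr// ler1n.
    have h0 : 0 <= `|n%:R - r / pi| / M%:R by nng.
    have h00 : 0 <= X^-1 by nng.
    have h01 : 0 <= q * (1 + `|n%:R - r / pi| / M%:R)^-1 by nng.
    rewrite lerXn2r ?nnegrE//.
    rewrite ler_pdivlMr ?ltr_pwDl// mulrC ler_pdivrMr//.
    apply: (@le_trans _ _ (1 + (X + pi * K%:R + T))); first by rewrite lerD2l.
    have e1 : pi * K%:R <= pi * K%:R * X by rewrite ler_peMr.
    have e2 : T <= T * X by rewrite ler_peMr.
    have -> : q * X = X + X + T * X + pi * K%:R * X by rewrite /q; ring.
    by move: e1 e2 X1; lra.
  have Mrp : 0 < M%:R / r by nng.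
  have bE : M%:R ^+ K * b = 16 * 4 ^+ K * B * (powR (M%:R / r) d * powR X (d - K%:R)).
    rewrite /b -[X * _ / r]mulrA powRM ?(ltW x0) ?(ltW Mrp)// (@powRB _ (M%:R / r)); last by rewrite (gt_eqF Mrp) implybT.
    rewrite powR_mulrn ?(ltW Mrp)// expr_div_n exprVn.
    have N1 : M%:R ^+ K != 0 :> R by rewrite expf_neq0// gt_eqF.
    have N2 : r ^+ K != 0 by rewrite expf_neq0// gt_eqF.
    by move: (M%:R ^+ K) (r ^+ K) N1 N2 => u v N1 N2; field; rewrite N1 N2.
  rewrite -/CA [leLHS](_ : _ = CA * (M%:R ^+ K * b)); last by rewrite /CA; ring.
  rewrite bE; move: CA0 CB0; move: (CA) (CB) => ca cb ca0 cb0.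
  apply: (@le_trans _ _ (ca * (16 * 4 ^+ K) * q ^+ 2 * B * (powR (M%:R / r) d * bump M%:R (r / pi) n%:R))).
    rewrite [leLHS](_ : _ = ca * (16 * 4 ^+ K) * B * (powR (M%:R / r) d * powR X (d - K%:R))); last by ring.
    rewrite [leRHS](_ : _ = ca * (16 * 4 ^+ K) * B * (powR (M%:R / r) d * (q ^+ 2 * bump M%:R (r / pi) n%:R))); last by ring.
    rewrite ler_wpM2l ?mulr_ge0 ?exprn_ge0// ler_wpM2l ?powR_ge0//.
    exact: le_trans Xb.
  by rewrite ler_wpM2r// ler_wpM2r// lerDl.
have [hC|hC] := leP r (sg n%:R).
  rewrite (@le_trans _ _ 0)//; last by nng.
  have := @ndiff_triv R K M (fun j => riesz r (sg j%:R) * F (sg j%:R)) n 0; rewrite mulr0; apply.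
  move=> i iK; rewrite riesz_out ?mul0r ?normr0//.
  by have /andP[h _] := @sg_step n M i iK; exact: le_trans h.
pose c := powR (2 * (1 + w)) d.
have bb : (1 + (1 + w + T)) ^- 2 <= bump M%:R (r / pi) n%:R.
  apply: bump_ge => //; first by nng.
  have hc : `|sg n%:R - r| <= M%:R + w * M%:R.
    by rewrite distrC ger0_norm ?subr_ge0 ?(ltW hC)//; move: se2 hA; rewrite wM; lra.
  by apply: (le_trans (npi _ hc)); rewrite !mulrDl mul1r lerD2l ler_peMr// ler1n.
pose g (j : nat) := riesz r (sg j%:R) * F (sg j%:R).
have hT : forall i, (i <= K)%N -> `|g (n + i * M)%N| <= powR (M%:R / r) d * (c * (CF * 16)) * B.
  move=> i iK; have /andP[h5 h6] := @sg_step n M i iK; rewrite /g; set s := sg (n + i * M)%:R in h5 h6 *.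
  have as_ : a < s by exact: lt_le_trans (sgj n) h5.
  have R0 : 0 <= powR (M%:R / r) d * (c * (CF * 16)) * B by nng.
  have [rs|sr] := leP r s; first by rewrite riesz_out// mul0r normr0.
  rewrite normrM ger0_norm ?riesz_ge0//.
  have hF : `|F s| <= CF * 16 * B.
    rewrite (le_trans (sym_bound sF as_))// -mulrA ler_wpM2l// mulrC H16//; first exact: le_trans h5.
    exact: ltW.
  have hR : riesz r s <= powR (M%:R / r) d * c.
    apply: (le_trans (riesz_edge (apos as_) sr)).
    rewrite /c mulrC -powRM ?divr_ge0 ?(ltW r0) ?mulr_ge0 ?addr_ge0//.
    apply: powR_le; [exact: ltW|by rewrite !mulr_ge0 ?subr_ge0 ?invr_ge0 ?(ltW sr) ?(ltW r0)|].
    rewrite [leLHS](_ : _ = 2 * (r - s) / r); last by ring.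
    rewrite [leRHS](_ : _ = 2 * ((1 + w) * M%:R) / r); last by ring.
    rewrite ler_wpM2r ?invr_ge0 ?(ltW r0)// ler_wpM2l//.
    by move: se2 hA h5; rewrite wM mulrDl mul1r; lra.
  rewrite [leRHS](_ : _ = powR (M%:R / r) d * c * (CF * 16 * B)); last by ring.
  by rewrite ler_pM ?riesz_ge0.
apply: (le_trans (@ndiff_triv R K M g n _ hT)).
apply: (@le_trans _ _ (CB * B * (powR (M%:R / r) d * bump M%:R (r / pi) n%:R))); last first.
  by rewrite ler_wpM2r// ler_wpM2r// lerDr; nng.
rewrite /CB -/c [leRHS](_ : _ = 2 ^+ K * (powR (M%:R / r) d * (c * (CF * 16)) * B) * ((1 + (1 + w + T)) ^+ 2 * bump M%:R (r / pi) n%:R)); last by ring.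
rewrite ler_peMr ?mulr_ge0 ?exprn_ge0 ?powR_ge0// -ler_pdivrMl ?mulr1//.
by rewrite exprn_gt0// ltr_pwDl// !addr_ge0.
Qed.

End OscillatorySum.

Section OscillatorySumBound.
Context {R : realType}.
Implicit Types (g : nat -> R) (M N n i k : nat).

Lemma eq_ler (x y : R) : x = y -> x <= y. Proof. by move=> ->. Qed.

Lemma ndiff_ext K M n g g' : (forall i, (i <= K)%N -> g (n + i * M)%N = g' (n + i * M)%N) ->
  iter K (ndiff M) g n = iter K (ndiff M) g' n.
Proof.
elim: K g g' n => [|K ih] g g' n h; first by have := h 0%N isT; rewrite mul0n addn0.
rewrite !iterSr; apply: ih => i iK; rewrite /ndiff -!addnA.
have -> : (i * M + M = i.+1 * M)%N by rewrite mulSn addnC.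
by rewrite !h//; exact: leqW.
Qed.

Lemma ndiff_shift K M g off n :
  iter K (ndiff M) g (n + off)%N = iter K (ndiff M) (fun j => g (j + off)%N) n.
Proof.
elim: K g => [//|K ih] g; rewrite !iterSr ih; congr (iter K _ _ n).
by apply/funext => j; rewrite /ndiff addnAC.
Qed.

(** [osc_sum] needs a sequence vanishing at its start. Here it is shifted and padded with zeros;
    differences reaching into the padding are estimated by the first values of [g]. *)
Lemma osc_sum0 k g N M (a al Lw : R) : 1 <= 2 - 2 * cos (a * M%:R) ->
  (forall n, (N <= n)%N -> g n = 0) -> (forall n, (n <= 2 * k * M)%N -> `|g n| <= Lw) ->
  `|\sum_(0 <= n < N) g n * cos (a * n%:R + al)| <=
    (2 * k * M)%:R * (2 ^+ (2 * k) * Lw) + \sum_(0 <= n < N) `|iter (2 * k) (ndiff M) g n|.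
Proof.
move=> c1 gN gL; set off := (2 * k * M)%N.
pose g' n := if (n < off)%N then 0 else g (n - off)%N.
have g'0 n : (n < off)%N -> g' n = 0 by rewrite /g' => ->.
have g'k n : g' (n + off)%N = g n by rewrite /g' ltnNge leq_addl /= addnK.
have g'N n : (N + off <= n)%N -> g' n = 0.
  by move=> h; rewrite -(subnK (leq_trans (leq_addl _ _) h)) g'k gN// leq_subRL ?(leq_trans (leq_addl N _) h)// addnC.
have := @osc_sum R k g' (N + off) M a (al - a * off%:R) g'0 g'N.
have split_ (f : nat -> R) : \sum_(0 <= n < N + off) f n = \sum_(0 <= n < off) f n + \sum_(0 <= n < N) f (n + off)%N.
  by rewrite (big_cat_nat (leq0n off) (leq_addl N off))/=; congr (_ + _); rewrite -{1}[off]add0n big_addn addnK.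
rewrite !split_ big_nat big1 ?add0r; last by move=> n /andP[_ h]; rewrite g'0// mul0r.
have -> : \sum_(0 <= n < N) g' (n + off)%N * cos (a * (n + off)%:R + (al - a * off%:R)) =
    \sum_(0 <= n < N) g n * cos (a * n%:R + al).
  by apply: eq_bigr => n _; rewrite g'k natrD; congr (_ * cos _); ring.
have -> : \sum_(0 <= n < N) `|iter (2 * k) (ndiff M) g' (n + off)%N| = \sum_(0 <= n < N) `|iter (2 * k) (ndiff M) g n|.
  apply: eq_bigr => n _; rewrite ndiff_shift; congr (`|iter _ _ _ n|).
  by apply/funext => j; rewrite g'k.
set S := `|_| => hS; apply: (@le_trans _ _ ((2 - 2 * cos (a * M%:R)) ^+ k * S)).
  by rewrite ler_peMl ?normr_ge0// exprn_ege1.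
apply: (le_trans hS); rewrite lerD2r.
have L0 : 0 <= Lw by exact: le_trans (normr_ge0 _) (gL 0%N isT).
apply: (@le_trans _ _ (\sum_(0 <= n < off) (2 ^+ (2 * k) * Lw))); last first.
  by rewrite sumr_const_nat subn0 mulr_natl.
rewrite big_nat [leRHS]big_nat; apply: ler_sum => n /andP[_ hn].
apply: (@ndiff_triv R (2 * k) M g' n Lw) => i ik; rewrite /g'.
case: ltnP => h; first by rewrite normr0.
apply: gL; by rewrite leq_subLR leq_add ?(ltnW hn)// leq_mul2r ik orbT.
Qed.

End OscillatorySumBound.

(** * Oscillatory sums over the zeros *)

Section OscillatoryCore.
Context {R : realType}.
Variables (a T pM d CF : R) (p th : R -> R) (k J L V : nat) (Dn D1 D2 : 'I_L -> R).
Local Notation K := (2 * k)%N.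
Hypothesis a0 : 0 < a.
Hypothesis pth : forall x : R, 0 < x -> 0 < p x /\ der th x (p x)^-1.
Hypothesis thT : forall x : R, a < x -> `|x - th x| <= T.
Hypothesis T0 : 0 <= T.
Hypothesis tha : th a < 0.
Hypothesis pMP : forall x : R, a < x -> p x <= pM.
Hypothesis pM0 : 0 <= pM.
Hypothesis psym : exists2 C, 0 <= C & sym K (fun x => a < x) id one_ C p.
Hypothesis d0 : 0 < d.
Hypothesis dK : d + 2 <= K%:R.
Hypothesis KV : (K + 2 <= V)%N.
Hypothesis CF0 : 0 <= CF.
Hypothesis Dlow : forall z : R, 0 <= z -> nres Dn z = \sum_(i < V) tcoef d i * z ^+ i - z ^+ V * nres D1 z.
Hypothesis Dhigh : forall z : R, 0 < z -> nres Dn z = z^-1 ^+ J.+1 * nres D2 z.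
Implicit Types (x y t s r B C : R) (n M N j i : nat).

Let sg := zsg a th.
Let K8 := 8 * (pi * pM * K%:R) + 2 * (T + 1) + 2.
Let sgj (j : nat) : a < sg j%:R. Proof. exact: (zsg_a a0 pth thT tha). Qed.
Let sgp (j : nat) : 0 < sg j%:R. Proof. exact: lt_trans (sgj j). Qed.

Definition mterm r F n : R := (riesz d r (sg n%:R) - nres Dn ((sg n%:R / r) ^+ 2)) * F (sg n%:R).

(** Since a block of [K] steps is shorter than [r / 4], it either ends below [r / 2] or starts above
    [r / 4]; in the second case the multiplier and the resolvents are treated separately. *)
Lemma ndiff_env : exists2 C, 0 <= C & forall r B H F M n, (1 <= M)%N -> K8 * M%:R <= r ->
  tame a CF K J r B H F -> `|iter K (ndiff M) (mterm r F) n| <= C * B * env d K r M n.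
Proof.
have [C1 C10 h1] := ndiff_low J a0 pth thT T0 tha pMP pM0 psym d0 dK KV CF0 Dlow.
have [C2 C20 h2] := ndiff_high d a0 pth thT T0 tha pMP pM0 psym CF0 Dhigh.
have [C3 C30 h3] := ndiff_edge J a0 pth thT T0 tha pMP pM0 psym d0 dK CF0.
exists (C1 + (C3 + C2)); first by nng.
move=> r B H F M n M1 hM tm; have [B0 _ _ _ _] := tm.
have M0 : 0 < M%:R :> R by rewrite ltr0n.
have piK : 0 <= pi * pM * K%:R by nng.
have r0 : 0 < r.
  by apply: lt_le_trans hM; rewrite mulr_gt0// /K8; move: T0 piK; lra.
have e0 : 0 <= env d K r M n.
  have : 0 <= r^-1 by nng.
  by move=> ri; rewrite /env; nng.
have [hn|hn] := ltP (sg (n + K * M)%:R) (r / 2).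
  apply: (le_trans (h1 r B H F M n M1 hM tm hn)).
  by rewrite ler_wpM2r// ler_wpM2r// lerDl addr_ge0.
have hn4 : r / 4 <= sg n%:R.
  have le1 : n%:R <= (n + K * M)%:R :> R by rewrite ler_nat leq_addr.
  have /andP[_] := zsg_le a0 pth thT tha pMP (ler0n R n) le1.
  rewrite -/sg natrD addrAC subrr add0r natrM mulrA => h.
  have : 8 * (pi * pM * K%:R * M%:R) <= r.
    apply: le_trans hM; rewrite mulrA ler_wpM2r// /K8; move: T0; lra.
  by move: hn h r0; rewrite natrD natrM; move: (pi * pM * K%:R * M%:R) (sg _) (sg _) => u v w; lra.
have -> : mterm r F = fun j => riesz d r (sg j%:R) * F (sg j%:R) +
    - (nres Dn ((sg j%:R / r) ^+ 2) * F (sg j%:R)).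
  by apply/funext => j; rewrite /mterm mulrBl.
rewrite ndiffD (le_trans (ler_normD _ _))//.
have -> : iter K (ndiff M) (fun j => - (nres Dn ((sg j%:R / r) ^+ 2) * F (sg j%:R))) n =
   - iter K (ndiff M) (fun j => nres Dn ((sg j%:R / r) ^+ 2) * F (sg j%:R)) n.
  have opp m (f : nat -> R) : iter m (ndiff M) (fun j => - f j) n = - iter m (ndiff M) f n.
    elim: m f => [//|m ih] f; rewrite !iterSr -ih.
    by congr (iter m _ _ n); apply/funext => j; rewrite /ndiff; ring.
  exact: opp.
rewrite normrN; have q3 := h3 r B H F M n M1 hM tm hn4; have q2 := h2 r B H F M n M1 hM tm hn4.
apply: (le_trans (lerD q3 q2)); rewrite -mulrDl -mulrDl ler_wpM2r// ler_wpM2r// lerDr//.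
Qed.

Let pinf (j : nat) : j%:R <= sg j%:R + T.
Proof.
have := zsg_T a0 pth thT tha (ler0n R j); rewrite ler_norml => /andP[h _].
have : j%:R <= pi * j%:R :> R by rewrite ler_peMl// (le_trans _ (pi_ge2 R))// ler1n.
by move: h; rewrite -/(sg j%:R); lra.
Qed.

Lemma powR_leX (x : R) (m : nat) (e : R) : 0 < x -> x <= 1 -> e <= m%:R -> x ^+ m <= powR x e.
Proof. by move=> x0 x1 em; rewrite -powR_mulrn ?(ltW x0)// ger_powR// x0. Qed.

(** The first zeros are of size [M], where the Taylor remainder is at most a multiple of
    [(M / r)^K], and [K >= d]. This pays for the padding in [osc_sum0]. *)
Lemma mterm_low : exists2 C, 0 <= C & forall r B H F M n, (1 <= M)%N -> (K8 + 4 * T + 4) * M%:R <= r ->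
  tame a CF K J r B H F -> (n <= K * M)%N -> `|mterm r F n| <= C * B * powR (M%:R / r) d.
Proof.
have [C1 C10 h1] := @sym_trem R 0 V d isT; have [C2 C20 h2] := @sym_nres R 0 L D1.
have V2 : (2 <= 2 * V)%N.
  by rewrite (leq_trans (leq_trans (leq_addl K 2) KV))// mul2n -addnn leq_addr.
have KV2 : (K <= 2 * V - 2)%N.
  by rewrite -(leq_add2r 2) subnK// (leq_trans KV)// mul2n -addnn leq_addr.
pose w := T + pi * pM * K%:R; have piK : 0 <= pi * pM * K%:R by nng.
have w0 : 0 <= w by nng.
exists ((C1 + C2) * CF * w ^+ K); first by nng.
move=> r B H F M n M1 hM [B0 H0 sF Hl Hh] nK.
have M1' : 1 <= M%:R :> R by rewrite ler1n.
have M0 : 0 < M%:R :> R by exact: lt_le_trans M1'.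
have TM : T <= T * M%:R by rewrite ler_peMr.
have piKM : 0 <= pi * pM * K%:R * M%:R by nng.
have hM' : 8 * (pi * pM * K%:R * M%:R) + 6 * (T * M%:R) + 8 * M%:R <= r.
  by apply: le_trans hM; rewrite /K8; apply: eq_ler; ring.
have r0 : 0 < r by move: hM' T0 TM M1' piKM; lra.
have sn : sg n%:R <= w * M%:R.
  have /andP[_] := zsg_le a0 pth thT tha pMP (lexx 0) (ler0n R n).
  rewrite -/sg subr0 => h; have := zsg_T a0 pth thT tha (lexx 0).
  rewrite mulr0 subr0 -/sg => h'; have := ler_norm (sg 0) => h''.
  have hn : pi * pM * n%:R <= pi * pM * K%:R * M%:R by rewrite -[leRHS]mulrA ler_wpM2l ?mulr_ge0 ?pi_ge0// -natrM ler_nat.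
  by rewrite /w mulrDl; move: h h' h'' hn TM; lra.
have s0 := sgp n.
have sr : sg n%:R < r / 2.
  by apply: (le_lt_trans sn); rewrite /w mulrDl; move: hM' M1' T0 TM piKM; lra.
set q := sg n%:R / r; have q0 : 0 < q by nng.
have q1 : q <= 1 by rewrite ler_pdivrMr//; lra.
have hG : `|riesz d r (sg n%:R) - nres Dn (q ^+ 2)| <= (C1 + C2) * q ^+ (2 * V).
  have -> : riesz d r (sg n%:R) - nres Dn (q ^+ 2) = trem d V (q ^+ 2) + q ^+ (2 * V) * nres D1 (q ^+ 2).
    rewrite Dlow ?sqr_ge0// /riesz /trem exprM max_l; first by rewrite -/q; ring.
    by apply/ltW/edge_gt0 => //; lra.
  rewrite (le_trans (ler_normD _ _))// mulrDl lerD//.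
    by apply: (sym_bound (h1 r r0)); rewrite s0.
  rewrite normrM ger0_norm ?exprn_ge0 ?(ltW q0)// mulrC ler_wpM2r ?exprn_ge0 ?(ltW q0)//.
  have := sym_bound (h2 r (fun s => 0 < s) r0 (fun s h => h)) s0; rewrite mulr1; exact.
have hF : `|F (sg n%:R)| <= CF * (B * q ^- 2).
  rewrite (le_trans (sym_bound sF (sgj n)))// ler_wpM2l// -exprVn /q invf_div Hl//; lra.
rewrite /mterm normrM (le_trans (ler_pM _ _ hG hF))//.
have -> : (C1 + C2) * q ^+ (2 * V) * (CF * (B * q ^- 2)) = (C1 + C2) * CF * B * q ^+ (2 * V - 2).
  have -> : (2 * V = 2 * V - 2 + 2)%N by rewrite subnK.
  rewrite exprD addnK; have N : q ^+ 2 != 0 by rewrite expf_neq0// gt_eqF.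
  by move: (q ^+ (2 * V - 2)) (q ^+ 2) N => u v N; field.
rewrite [leRHS](_ : _ = (C1 + C2) * CF * B * (w ^+ K * powR (M%:R / r) d)); last by ring.
apply: ler_wpM2l; first by nng.
apply: (@le_trans _ _ (q ^+ K)).
  by rewrite ler_wiXn2l ?(ltW q0).
apply: (@le_trans _ _ ((w * (M%:R / r)) ^+ K)).
  have h3 : 0 <= w * (M%:R / r) by nng.
  rewrite lerXn2r ?nnegrE ?(ltW q0)// /q mulrA ler_wpM2r// invr_ge0 ltW//.
rewrite exprMn ler_wpM2l ?exprn_ge0// powR_leX ?divr_gt0//.
  by rewrite ler_pdivrMr// mul1r; move: hM' T0 TM M1' piKM; lra.
by move: dK; lra.
Qed.

(** The edge bump sums to [8 M]. The background sums to [8 r (M / r)^K], which is no larger than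
    [8 M (M / r)^d] because [K - 1 >= d]. *)
Lemma env_sum r M N : 0 < r -> (1 <= M)%N -> M%:R <= r ->
  \sum_(0 <= n < N) env d K r M n <= 16 * (M%:R * powR (M%:R / r) d).
Proof.
move=> r0 M1 Mr; have M1' : 1 <= M%:R :> R by rewrite ler1n.
have M0 : 0 < M%:R :> R by exact: lt_le_trans M1'.
rewrite /env big_split /= -!mulr_sumr.
have b1 := bump_sum (r / pi) N M1'; have b2 := bump_sum 0 N (le_trans M1' Mr).
have x0 : 0 < M%:R / r by nng.
apply: (@le_trans _ _ (powR (M%:R / r) d * (8 * M%:R) + (M%:R / r) ^+ K * (8 * r))).
  by rewrite lerD// ler_wpM2l ?powR_ge0 ?exprn_ge0// ltW.
have h : (M%:R / r) ^+ K * r <= M%:R * powR (M%:R / r) d.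
  have K1 : (0 < K)%N.
    by rewrite lt0n; apply/eqP => E; move: dK d0; rewrite E; lra.
  rewrite -{1}(prednK K1) exprSr -mulrA divfK ?gt_eqF// mulrC ler_wpM2l// powR_leX//.
    by rewrite ler_pdivrMr// mul1r.
  by move: dK; rewrite -{1}(prednK K1) -natr1; lra.
by move: h; move: (powR _ _) (_ ^+ K) => u v h; lra.
Qed.

(** Cutting the series at [N] spoils the last [K * M] differences. They are estimated trivially,
    with [N0] so large that the decay of the resolvents makes them smaller than the main term. *)
Theorem osc_core : exists2 C, 0 <= C & forall r B H F M (al al' : R), (1 <= M)%N ->
  (K8 + 4 * T + 4) * M%:R <= r -> tame a CF K J r B H F -> 1 <= 2 - 2 * cos (al * M%:R) ->
  exists N0, forall N, (N0 <= N)%N ->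
  `|\sum_(0 <= n < N) mterm r F n * cos (al * n%:R + al')| <= C * B * (M%:R * powR (M%:R / r) d).
Proof.
have [C1 C10 h1] := ndiff_env; have [C2 C20 h2] := mterm_low.
have [C3 C30 h3] := @sym_nres R 0 L D2.
have kk : 0 <= K%:R * 2 ^+ K :> R by nng.
exists (K%:R * 2 ^+ K * C2 + C1 * 16 + K%:R * 2 ^+ K * (C3 * CF)); first by nng.
move=> r B H F M al al' M1 hM tm hc; have [B0 H0 sF Hl Hh] := tm.
have M1' : 1 <= M%:R :> R by rewrite ler1n.
have M0 : 0 < M%:R :> R by exact: lt_le_trans M1'.
have piKM : 0 <= pi * pM * K%:R * M%:R by nng.
have TM : T <= T * M%:R by rewrite ler_peMr.
have hM' : 8 * (pi * pM * K%:R * M%:R) + 6 * (T * M%:R) + 8 * M%:R <= r.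
  by apply: le_trans hM; rewrite /K8; apply: eq_ler; ring.
have r0 : 0 < r by move: hM' T0 TM M1' piKM; lra.
have Mr : M%:R <= r by move: hM' T0 TM M1' piKM; lra.
have K8r : K8 * M%:R <= r.
  by apply: le_trans hM; rewrite ler_wpM2r//; move: T0; lra.
have x0 : 0 < M%:R / r by nng.
set X := powR (M%:R / r) d; have X0 : 0 < X by nng.
(* Beyond [s_j = r * Y] only the resolvents remain, of size [(s_j / r)^-2 <= X]. *)
pose Y := 1 + X^-1; have Y1 : 1 <= Y by rewrite lerDl invr_ge0 ltW.
pose b := Num.bound (r * Y + T).
have rY0 : 0 <= r * Y + T by rewrite addr_ge0// mulr_ge0 ?(ltW r0)// (le_trans ler01).
exists (b + K * M)%N => N hN.
have far j : (b <= j)%N -> `|mterm r F j| <= C3 * CF * B * X.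
  move=> bj; have rs : r * Y <= sg j%:R.
    have h5 := archi_boundP rY0; have h6 : b%:R <= j%:R :> R by rewrite ler_nat.
    by have := pinf j; move: h5 h6; rewrite -/b; lra.
  have rs1 : r <= sg j%:R by apply: le_trans rs; rewrite ler_peMr// ltW.
  set q := sg j%:R / r; have q0 : 0 < q by nng.
  have Yq : Y <= q by rewrite ler_pdivlMr// mulrC.
  have hF : `|F (sg j%:R)| <= CF * (B * q ^+ (2 * J)).
    rewrite (le_trans (sym_bound sF (sgj j)))// ler_wpM2l// Hh//; lra.
  rewrite /mterm riesz_out// sub0r normrM normrN -/q (Dhigh (exprn_gt0 2 q0)).
  rewrite normrM ger0_norm ?exprn_ge0 ?invr_ge0 ?sqr_ge0//.
  have hD : `|nres D2 (q ^+ 2)| <= C3.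
    have := sym_bound (h3 r (fun s => 0 < s) r0 (fun s h => h)) (sgp j); rewrite mulr1; exact.
  have e1 : 0 <= (q ^+ 2)^-1 ^+ J.+1 by nng.
  apply: (le_trans (ler_pM (mulr_ge0 e1 (normr_ge0 _)) (normr_ge0 _) (ler_wpM2l e1 hD) hF)).
  have -> : (q ^+ 2)^-1 ^+ J.+1 * C3 * (CF * (B * q ^+ (2 * J))) = C3 * CF * B * q ^- 2.
    rewrite exprS !exprVn -exprM; have N1 : q ^+ (2 * J) != 0 by rewrite expf_neq0// gt_eqF.
    have N2 : q ^+ 2 != 0 by rewrite expf_neq0// gt_eqF.
    by move: (q ^+ (2 * J)) (q ^+ 2) N1 N2 => u v N1 N2; field; rewrite N1 N2.
  apply: ler_wpM2l; first by nng.
  rewrite -[X]invrK lef_pV2 ?posrE ?invr_gt0 ?exprn_gt0//.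
  have q1 : 1 <= q by exact: le_trans Yq.
  apply: (@le_trans _ _ q); first by apply: le_trans Yq; rewrite lerDr.
  by rewrite expr2 ler_peMr// ltW.
pose g n := if (n < N)%N then mterm r F n else 0.
have gg : \sum_(0 <= n < N) mterm r F n * cos (al * n%:R + al') = \sum_(0 <= n < N) g n * cos (al * n%:R + al').
  by rewrite big_nat [RHS]big_nat; apply: eq_bigr => n /andP[_ h]; rewrite /g h.
have g0 n : (N <= n)%N -> g n = 0 by rewrite /g leqNgt => /negbTE ->.
have B2 : 0 <= C2 * B * X by nng.
have gl n : (n <= K * M)%N -> `|g n| <= C2 * B * X.
  by move=> nK; rewrite /g; case: ifP => _; [exact: (h2 r B H F M n M1 hM tm nK)|rewrite normr0].
rewrite gg; apply: (le_trans (@osc_sum0 R k g N M al al' _ hc g0 gl)).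
have NK : (N - K * M <= N)%N by rewrite leq_subr.
rewrite (big_cat_nat (leq0n _) NK)/=.
have KN : (K * M <= N)%N by exact: leq_trans (leq_addl b _) hN.
have bN : (b <= N - K * M)%N by rewrite leq_subRL// addnC.
have s1 : \sum_(0 <= n < N - K * M) `|iter K (ndiff M) g n| <= C1 * B * (16 * (M%:R * X)).
  apply: (@le_trans _ _ (\sum_(0 <= n < N - K * M) C1 * B * env d K r M n)).
    rewrite big_nat [leRHS]big_nat; apply: ler_sum => n /andP[_ hn].
    rewrite (@ndiff_ext _ _ _ _ _ (mterm r F)); first exact: (h1 r B H F M n M1 K8r tm).
    move=> i iK; rewrite /g ifT//; have h5 : (i * M <= K * M)%N by rewrite leq_mul2r iK orbT.
    by apply: (@leq_ltn_trans (K * M + n)); [rewrite addnC leq_add2r|rewrite -ltn_subRL].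
  by rewrite -mulr_sumr ler_wpM2l ?mulr_ge0// env_sum.
have s2 : \sum_(N - K * M <= n < N) `|iter K (ndiff M) g n| <= (K * M)%:R * (2 ^+ K * (C3 * CF * B * X)).
  apply: (@le_trans _ _ (\sum_(N - K * M <= n < N) (2 ^+ K * (C3 * CF * B * X)))).
    rewrite big_nat [leRHS]big_nat; apply: ler_sum => n /andP[hn _].
    apply: ndiff_triv => i iK; rewrite /g; case: ifP => _; last by rewrite normr0; have xx := ltW X0; nng.
    by apply: far; rewrite (leq_trans bN)// (leq_trans hn)// leq_addr.
  rewrite sumr_const_nat subKn//.
  by rewrite mulr_natl.
apply: (le_trans (lerD (lexx _) (lerD s1 s2))); rewrite natrM; apply: eq_ler; ring.
Qed.

End OscillatoryCore.

Section Weights.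
Context {R : realType}.
Implicit Types (nu s r x y : R) (J : nat).

(** When [nu + 1 / 2] is negative it still exceeds [-1], so passing from [r] down to [s] enlarges
    the weight by at most [r / s]. *)
Lemma wmin_le1 nu s r x : -1 < nu -> 0 < s -> s <= r -> 0 < x ->
  wmin nu (s * x) <= r / s * wmin nu (r * x).
Proof.
move=> hnu s0 sr x0; have r0 := lt_le_trans s0 sr; have q1 : 1 <= r / s by rewrite ler_pdivlMr// mul1r.
have m0 : 0 < Num.min 1 (s * x) by rewrite lt_min ltr01 mulr_gt0.
have m1 : 0 < Num.min 1 (r * x) by rewrite lt_min ltr01 mulr_gt0.
have [k0|/ltW k0] := leP 0 (nu + 1 / 2).
  apply: (@le_trans _ _ (wmin nu (r * x))); last by rewrite ler_peMl// ltW// wmin_gt0// mulr_gt0.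
  apply: (powR_le k0 (ltW m0)); rewrite le_min !ge_min lexx /=.
  by rewrite ler_wpM2r ?orbT// ltW.
apply: (@le_trans _ _ (powR ((r / s)^-1 * Num.min 1 (r * x)) (nu + 1 / 2))).
  apply: powR_leN => //; first by rewrite mulr_gt0// invr_gt0 (lt_le_trans ltr01).
  have q0 : (r / s)^-1 <= 1 by rewrite -[leRHS]invr1 lef_pV2 ?posrE// (lt_le_trans ltr01).
  rewrite le_min; apply/andP; split.
    by apply: mulr_ile1 => //; [rewrite invr_ge0 (le_trans ler01)|exact: ltW|rewrite ge_min lexx].
  apply: (@le_trans _ _ ((r / s)^-1 * (r * x))).
    by rewrite ler_wpM2l ?invr_ge0 ?(le_trans ler01)// ge_min lexx orbT.
  by apply: eq_ler; field; rewrite !gt_eqF.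
rewrite powRM ?invr_ge0 ?(le_trans ler01 q1) ?(ltW m1)// ler_wpM2r ?powR_ge0//.
rewrite -powR_inv1 ?(le_trans ler01 q1)// -powRrM -[leRHS]powRr1 ?(le_trans ler01 q1)//.
by apply: ler_powR => //; lra.
Qed.

Lemma wmin_le2 nu J s r x : -1 < nu -> nu + 1 / 2 <= J%:R -> 0 < r -> r / 4 <= s -> 0 < x ->
  wmin nu (s * x) <= 4 * (4 * (s / r)) ^+ J * wmin nu (r * x).
Proof.
move=> hnu hJ r0 rs x0; have s0 : 0 < s by apply: lt_le_trans rs; rewrite divr_gt0.
have q1 : 1 <= 4 * (s / r) by rewrite mulrA ler_pdivlMr//; lra.
have q0 := lt_le_trans ltr01 q1.
have m0 : 0 < Num.min 1 (s * x) by rewrite lt_min ltr01 mulr_gt0.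
have m1 : 0 < Num.min 1 (r * x) by rewrite lt_min ltr01 mulr_gt0.
have [k0|/ltW k0] := leP 0 (nu + 1 / 2).
  apply: (@le_trans _ _ (powR (4 * (s / r) * Num.min 1 (r * x)) (nu + 1 / 2))).
    apply: (powR_le k0 (ltW m0)).
    have [h|h] := leP 1 (r * x); first by rewrite mulr1 ge_min q1.
    have -> : 4 * (s / r) * (r * x) = 4 * (s * x) by field; rewrite gt_eqF.
    by rewrite ge_min; apply/orP; right; rewrite ler_peMl ?mulr_ge0 ?(ltW s0) ?(ltW x0)//; lra.
  rewrite powRM ?(ltW q0) ?(ltW m1)// ler_wpM2r ?powR_ge0//.
  rewrite -powR_mulrn ?(ltW q0)//; apply: (@le_trans _ _ (powR (4 * (s / r)) J%:R)).
    exact: ler_powR.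
  by rewrite ler_peMl ?powR_ge0//; lra.
apply: (@le_trans _ _ (powR (4^-1 * Num.min 1 (r * x)) (nu + 1 / 2))).
  apply: powR_leN => //; first by nng.
  have h4 : (4^-1 : R) <= 1 by lra.
  rewrite le_min; apply/andP; split; first by apply: mulr_ile1 => //; [exact: ltW|rewrite ge_min lexx].
  apply: (@le_trans _ _ (4^-1 * (r * x))); first by rewrite ler_wpM2l// ge_min lexx orbT.
  by rewrite mulrA ler_wpM2r ?(ltW x0)//; lra.
rewrite powRM ?(ltW m1)// ler_wpM2r ?powR_ge0//.
apply: (@le_trans _ _ 4); last by rewrite ler_peMr// exprn_ege1.
rewrite -[4^-1]powR_inv1// -powRrM -[leRHS]powRr1//.
by apply: ler_powR; [lra|lra].
Qed.

End Weights.

Section StepChoice.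
Context {R : realType}.
Implicit Types (t tau : R).

(** With [M] the integer part of [1 / tau], the angle [pi * tau * M] lies in [[pi / 2, pi]]. *)
Lemma step_choice tau : 0 < tau -> tau <= 1 -> exists M : nat,
  [/\ (1 <= M)%N, M%:R * tau <= 1 & cos (pi * tau * M%:R) <= 0].
Proof.
move=> t0 t1; have h0 : 0 <= tau^-1 by nng.
exists (Num.truncn tau^-1).
have /andP[h1 h2] := truncn_itv h0.
have M1 : (1 <= Num.truncn tau^-1)%N.
  by rewrite truncn_ge_nat// -[leLHS]invr1 lef_pV2 ?posrE.
have h3 : (Num.truncn tau^-1)%:R * tau <= 1 by rewrite -ler_pdivlMr// mul1r.
split => //; set M := (Num.truncn _)%:R in h1 h2 h3 *.
have M1' : 1 <= M by rewrite ler1n.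
have h4 : 1 / 2 <= M * tau.
  have : 1 < (M + 1) * tau by rewrite -ltr_pdivrMr// mul1r natr1.
  have : tau <= M * tau by rewrite ler_peMl// ltW.
  by rewrite mulrDl mul1r; lra.
rewrite -[pi * tau * M]mulrA [tau * M]mulrC.
have p0 := pi_gt0 R.
have -> : pi * (M * tau) = pi * (M * tau) - pi + pi by ring.
rewrite cosDpi oppr_le0; apply: cos_ge0_pihalf; apply/andP; split.
  have : pi * (1 / 2) <= pi * (M * tau) by rewrite ler_wpM2l// ltW.
  by lra.
have : pi * (M * tau) <= pi * 1 by rewrite ler_wpM2l// ltW.
by lra.
Qed.

Lemma cos_mod2 tau (M : nat) : cos (pi * (2 - tau) * M%:R) = cos (pi * tau * M%:R).
Proof.
have -> : pi * (2 - tau) * M%:R = - (pi * tau * M%:R) + pi *+ (2 * M).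
  by rewrite -[pi *+ _]mulr_natr natrM; ring.
rewrite -[RHS]cosN; elim: M (- _) => [|M ih] z; first by rewrite muln0 mulr0n addr0.
by rewrite mulnS mulrnDr addrA ih mulr2n addrA !cosDpi opprK.
Qed.

(** The angle [pi * t] matters only modulo [2 pi] and sign. For [t = x + y > 1] it is replaced by
    [2 - (x + y)], which is still at least [|x - y|] because [x] and [y] are below [1]. *)
Definition angle_at (t D : R) := exists tau, [/\ D <= tau, tau <= 1 & forall M : nat, cos (pi * t * M%:R) = cos (pi * tau * M%:R)].

Lemma angle_choice (x y : R) : 0 < x -> x < 1 -> 0 < y -> y < 1 ->
  (`|x + y| <= 2 /\ angle_at (x + y) `|x - y|) /\ (`|x - y| <= 2 /\ angle_at (x - y) `|x - y|).
Proof.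
move=> x0 x1 y0 y1; split; split.
- by rewrite ger0_norm; lra.
- have [h|h] := leP (x + y) 1; first by exists (x + y); split => //; rewrite ler_norml; lra.
  exists (2 - (x + y)); split; [by rewrite ler_norml; lra|lra|].
  by move=> M; rewrite -cos_mod2; congr (cos (_ * _ * _)); ring.
- by rewrite ler_norml; lra.
exists `|x - y|; split => //; first by rewrite ler_norml; lra.
move=> M; have [h|h] := leP 0 (x - y); first by rewrite ger0_norm.
by rewrite ltr0_norm// -[in LHS]cosN; congr cos; ring.
Qed.

End StepChoice.

(** * The kernel off the diagonal, up to resolvents *)

Section KernelOscillation.
Context {R : realType}.
Variables (nu d : R) (s : nat -> R).
Hypothesis Hnu : -1 < nu.
Hypothesis d0 : 0 < d.
Hypothesis Hz : bessel_zeros nu s.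
Implicit Types (x y t r : R) (j n N : nat).

Definition kw r x y : R := powR (x * y) (- (nu + 1 / 2)) * (wmin nu (r * x) * wmin nu (r * y)).

Lemma psi_prod A2 p (j : nat) x y : 0 < x -> 0 < y -> cj nu s j ^+ 2 = 2 / A2 * p (s j) * powR (s j) (2 * nu + 1) ->
  psi nu s j x * psi nu s j y = 2 / A2 * powR (x * y) (- (nu + 1 / 2)) * (p (s j) * (besu nu (s j * x) * besu nu (s j * y))).
Proof.
move=> x0 y0 hc; have s0 := zeros_gt0 Hz j.
rewrite !(psiE Hnu Hz)// !besu_scale//.
transitivity (cj nu s j ^+ 2 * (powR (s j * x) (- (nu + 1 / 2)) * powR (s j * y) (- (nu + 1 / 2)))
   * (besu nu (s j * x) * besu nu (s j * y))); first by ring.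
rewrite hc !powRM ?(ltW s0) ?(ltW x0) ?(ltW y0)//.
have E : powR (s j) (2 * nu + 1) * (powR (s j) (- (nu + 1 / 2)) * powR (s j) (- (nu + 1 / 2))) = 1.
  rewrite -!powRD ?(gt_eqF s0) ?implybT//; rewrite (_ : 2 * nu + 1 + _ = 0) ?powRr0//; lra.
move: (powR (s j) (2 * nu + 1)) (powR (s j) (- (nu + 1 / 2))) E => u v E.
transitivity (2 / A2 * p (s j) * (u * (v * v)) * (powR x (- (nu + 1 / 2)) * powR y (- (nu + 1 / 2))) *
  (besu nu (s j * x) * besu nu (s j * y))); first by ring.
by rewrite E; ring.
Qed.

(** Inserting the oscillatory form leaves sums of tame amplitudes times [cos (s_j * t + al)] with
    [t = x + y] or [t = x - y]. As [th (s_j) = pi * j], the deviation [s_j - pi * j] is the symbol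
    [s - th s] at [s_j]: its trigonometric functions join the amplitude, and a cosine linear in [j]
    remains for [osc_core]. The condition on [J] is the one under which the resolvent series
    converges absolutely. *)
Theorem kernel_osc : exists L (Dn : 'I_L -> R) (J : nat) (C C' K0 : R),
  [/\ 0 <= C, 1 <= K0, `|nu| + 3 <= J%:R, (forall z, 0 < z -> `|nres Dn z| <= C' * z^-1 ^+ J.+1) &
  forall x y r, 0 < x < 1 -> 0 < y < 1 -> 0 < r -> K0 <= r * `|x - y| ->
   exists N0, forall N, (N0 <= N)%N ->
   `|\sum_(0 <= j < N) (riesz d r (s j) - nres Dn ((s j / r) ^+ 2)) * (psi nu s j x * psi nu s j y)|
   <= C * (r * kw r x y * powR (r * `|x - y|) (- (1 + d)))].
Proof.
(* Below the first zero, so that [th a < 0] and the interpolation of the zeros starts inside the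
   domain. *)
pose a := Num.min (1 / 2) (s 0%N / 2); have s00 := zeros_gt0 Hz 0.
have a0 : 0 < a by rewrite lt_min divr_gt0 ?divr_gt0.
have a2 : a <= 1 / 2 by rewrite ge_min lexx.
have as0 : a < s 0%N by rewrite gt_min; apply/orP; right; lra.
have asj j : a < s j.
  by case: j => // j; apply: (lt_trans as0); exact: (zeros_incr Hz).
have [A2 [p [th [A20 pth [B B2 uE] zj [pm ps pT]]]]] := bessel_phase Hnu Hz a0.
have [T T0 hT] := pT.
pose k := Num.bound (d + 2); pose K := (2 * k)%N.
have dK : d + 2 <= K%:R.
  have h : d + 2 < k%:R by apply: archi_boundP; rewrite addr_ge0// ltW.
  have : k%:R <= K%:R :> R by rewrite ler_nat /K mul2n -addnn leq_addr.
  lra.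
pose J := Num.bound (`|nu| + 3).
have hJ : `|nu| + 3 <= J%:R by apply/ltW/archi_boundP; rewrite addr_ge0.
have hJ' : nu + 1 / 2 <= J%:R by have := ler_norm nu; lra.
have [[Cp Cp0 sp] [Cw Cw0 sw] [b1 [b2 [Cb [Cb0 sb1 sb2 ub]]]]] :=
  @oscillatory_form R K nu a B p th Hnu a0 a2 pth uE pm ps pT.
have pMP x : a < x -> p x <= Cp.
  by move=> ax; have := sym_bound sp ax; rewrite mulr1; apply: le_trans; exact: ler_norm.
have tha : th a < 0.
  by have := phase_lt pth a0 as0; have [-> _ _] := zj 0%N; rewrite mulr0.
have psym : exists2 C, 0 <= C & sym K (fun x => a < x) id one_ C p by exists Cp.
have sgE j : zsg a th j%:R = s j.
  by rewrite /zsg; have [<- _ _] := zj j; exact: (phinvK a0 pth).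
pose V := (K + 2)%N.
have [L [Dn [D1 [D2 [Dlow Dhigh]]]]] := resolvent_match d V J.+1.
have [CD CD0 hD] := @sym_nres R 0 L D2.
have B20 : 0 <= 2 :> R by [].
have [Ct Ct0 htrig] := @sym_trig R K Cw 2 B20.
pose CF := 2 ^+ K * (2 ^+ K * (2 ^+ K * (Cb * Cb) * Cp) * Ct).
have CF0 : 0 <= CF by have := ltW Ct0; rewrite /CF => h; nng.
have [C C0 hosc] := osc_core a0 pth hT T0 tha pMP Cp0 psym d0 dK (leqnn V) CF0 Dlow Dhigh.
set K9 := _ + 4 in hosc.
have K91 : 1 <= K9.
  have : 0 <= pi * Cp * (2 * k)%:R by nng.
  by rewrite /K9; move: T0; lra.
pose Bw := 16 * 16 ^+ J : R.
exists L, Dn, J, (2 / A2 * (8 * (C * Bw))), CD, K9; split => //.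
- by have := ltW A20 => h; rewrite mulr_ge0 ?divr_ge0// /Bw; nng.
- move=> z z0; rewrite Dhigh// normrM ger0_norm ?exprn_ge0 ?invr_ge0 ?(ltW z0)// mulrC.
  rewrite ler_wpM2r ?exprn_ge0 ?invr_ge0 ?(ltW z0)//.
  have q0 : 0 < Num.sqrt z by rewrite sqrtr_gt0.
  have := sym_bound (hD 1 (fun s => 0 < s) ltr01 (fun s h => h)) q0.
  by rewrite divr1 sqr_sqrtr ?(ltW z0)// mulr1.
move=> x y r /andP[x0 x1] /andP[y0 y1] r0 hr.
have D0 : 0 < `|x - y|.
  rewrite normr_gt0; apply/eqP => E; move: hr; rewrite E normr0 mulr0 => h.
  by have := le_trans K91 h; rewrite ler10.
pose W := wmin nu (r * x) * wmin nu (r * y).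
have W0 : 0 < W by rewrite mulr_gt0// wmin_gt0// mulr_gt0.
pose H t := wmin nu (t * x) * wmin nu (t * y).
pose BB := Bw * W.
have Bw0 : 0 <= Bw by rewrite /Bw; nng.
have Bw1 : 1 <= Bw by rewrite /Bw mulr_ege1 ?exprn_ege1// ler1n.
have BB0 : 0 <= BB by nng.
(* Here [wmin_le1] and [wmin_le2] compare the weights at [t] with those at [r]; [Bw] collects their
   constants. *)
have tamed F : sym K (fun t => a < t) id H CF F -> tame a CF K J r BB H F.
  move=> sF; split => //.
  - by move=> t at_; have t0 := lt_trans a0 at_; rewrite mulr_ge0// ltW// wmin_gt0// mulr_gt0.
  - move=> t at_ tr; have t0 := lt_trans a0 at_.
    have e1 : 0 <= wmin nu (t * x) by nng.
    have e2 : 0 <= wmin nu (t * y) by nng.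
    apply: (le_trans (ler_pM e1 e2 (wmin_le1 Hnu t0 tr x0) (wmin_le1 Hnu t0 tr y0))).
    rewrite /BB; have -> : r / t * wmin nu (r * x) * (r / t * wmin nu (r * y)) = W * (r / t) ^+ 2 by rewrite /W; ring.
    by rewrite ler_wpM2r ?sqr_ge0// ler_peMl// ltW.
  - move=> t at_ tr; have t0 := lt_trans a0 at_.
    have e1 : 0 <= wmin nu (t * x) by nng.
    have e2 : 0 <= wmin nu (t * y) by nng.
    apply: (le_trans (ler_pM e1 e2 (wmin_le2 Hnu hJ' r0 tr x0) (wmin_le2 Hnu hJ' r0 tr y0))).
    apply: eq_ler; rewrite /BB /Bw /W (mulnC 2) exprM !exprMn.
    have -> : 16 ^+ J = 4 ^+ J * 4 ^+ J :> R by rewrite -exprMn; congr (_ ^+ _); ring.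
    by move: (4 ^+ J) (t ^+ J) (r^-1 ^+ J) => A u v; ring.
have symF (f g : R -> R) (tr : R -> R) : sym K (fun t => 0 < t) id (wmin nu) Cb f ->
    sym K (fun t => 0 < t) id (wmin nu) Cb g -> sym K (fun t => a < t) id one_ Ct tr ->
    sym K (fun t => a < t) id H CF (fun t => f (t * x) * g (t * y) * p t * tr t).
  move=> sf sg str.
  have sf' : sym K (fun t => a < t) id (fun t => wmin nu (t * x)) Cb (fun t => f (t * x)).
    by apply: sym_weak (sym_scale x0 sf) => // t at_; rewrite mulr_gt0// (lt_trans a0).
  have sg' : sym K (fun t => a < t) id (fun t => wmin nu (t * y)) Cb (fun t => g (t * y)).
    by apply: sym_weak (sym_scale y0 sg) => // t at_; rewrite mulr_gt0// (lt_trans a0).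
  exact: symM1 (symM1 (symM sf' sg') sp) str.
pose Q := `|x - y|^-1 * powR ((r * `|x - y|)^-1) d.
have one (f g : R -> R) t al : sym K (fun t => 0 < t) id (wmin nu) Cb f ->
    sym K (fun t => 0 < t) id (wmin nu) Cb g -> `|t| <= 2 ->
    angle_at t `|x - y| ->
    exists N0, forall N, (N0 <= N)%N ->
    `|\sum_(0 <= j < N) (riesz d r (s j) - nres Dn ((s j / r) ^+ 2)) * (f (s j * x) * g (s j * y) * p (s j) * cos (s j * t + al))|
     <= 2 * (C * BB * Q).
  move=> sf sg t2 [tau [tD t1 tc]]; have tau0 := lt_le_trans D0 tD.
  have [M [M1 Mt cM]] := step_choice tau0 t1.
  have M1' : 1 <= M%:R :> R by rewrite ler1n.
  have M0 := lt_le_trans ltr01 M1'.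
  have MD : M%:R <= `|x - y|^-1.
    by rewrite -[leRHS]mul1r ler_pdivlMr// (le_trans _ Mt)// ler_wpM2l// ltW.
  have hM : K9 * M%:R <= r.
    apply: (@le_trans _ _ (K9 * `|x - y|^-1)); first by rewrite ler_wpM2l// (le_trans ler01).
    by rewrite ler_pdivrMr.
  have hc : 1 <= 2 - 2 * cos (pi * t * M%:R) by rewrite tc; move: cM; lra.
  have [tc1 ts1] := htrig _ _ (fun u => u - th u) t t2 sw.
  have [N1 hN1] := hosc r BB H _ M (pi * t) al M1 hM (tamed _ (symF _ _ _ sf sg tc1)) hc.
  have [N2 hN2] := hosc r BB H _ M (pi * t) (al - pi / 2) M1 hM (tamed _ (symF _ _ _ sf sg ts1)) hc.
  exists (N1 + N2)%N => N hN.
  have QM : M%:R * powR (M%:R / r) d <= Q.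
    rewrite /Q ler_pM ?powR_ge0 ?(ltW M0)//; apply: powR_le; [exact: ltW|by rewrite divr_ge0 ?(ltW M0) ?(ltW r0)|].
    by rewrite invfM mulrC ler_wpM2l ?invr_ge0 ?(ltW r0).
  have -> : \sum_(0 <= j < N) (riesz d r (s j) - nres Dn ((s j / r) ^+ 2)) * (f (s j * x) * g (s j * y) * p (s j) * cos (s j * t + al)) =
      \sum_(0 <= j < N) mterm a d th Dn r (fun u => f (u * x) * g (u * y) * p u * cos (t * (u - th u))) j * cos (pi * t * j%:R + al)
      - \sum_(0 <= j < N) mterm a d th Dn r (fun u => f (u * x) * g (u * y) * p u * sin (t * (u - th u))) j * cos (pi * t * j%:R + (al - pi / 2)).
    rewrite -sumrB; apply: eq_bigr => j _; rewrite /mterm sgE.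
    have [thj _ _] := zj j; rewrite thj.
    have -> : s j * t + al = (pi * t * j%:R + al) + t * (s j - pi * j%:R) by ring.
    by rewrite cosD addrA cosBpihalf; ring.
  have -> : 2 * (C * BB * Q) = C * BB * Q + C * BB * Q by ring.
  rewrite (le_trans (ler_normB _ _))// lerD//.
    by apply: (le_trans (hN1 N (leq_trans (leq_addr _ _) hN))); apply: ler_wpM2l => //; exact: mulr_ge0.
  by apply: (le_trans (hN2 N (leq_trans (leq_addl _ _) hN))); apply: ler_wpM2l => //; exact: mulr_ge0.
have [[tx1 tau1] [tx2 tau2]] := angle_choice x0 x1 y0 y1.
have pair (f g : R -> R) al be : sym K (fun t => 0 < t) id (wmin nu) Cb f ->
    sym K (fun t => 0 < t) id (wmin nu) Cb g ->
    exists N0, forall N, (N0 <= N)%N ->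
    `|\sum_(0 <= j < N) (riesz d r (s j) - nres Dn ((s j / r) ^+ 2)) * (f (s j * x) * g (s j * y) * p (s j) * (cos (s j * x + al) * cos (s j * y + be)))|
     <= 2 * (C * BB * Q).
  move=> sf sg; have [N1 h1] := one f g (x + y) (al + be) sf sg tx1 tau1.
  have [N2 h2] := one f g (x - y) (al - be) sf sg tx2 tau2.
  exists (N1 + N2)%N => N hN.
  have -> : \sum_(0 <= j < N) (riesz d r (s j) - nres Dn ((s j / r) ^+ 2)) * (f (s j * x) * g (s j * y) * p (s j) * (cos (s j * x + al) * cos (s j * y + be))) =
     2^-1 * (\sum_(0 <= j < N) (riesz d r (s j) - nres Dn ((s j / r) ^+ 2)) * (f (s j * x) * g (s j * y) * p (s j) * cos (s j * (x + y) + (al + be))) +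
      \sum_(0 <= j < N) (riesz d r (s j) - nres Dn ((s j / r) ^+ 2)) * (f (s j * x) * g (s j * y) * p (s j) * cos (s j * (x - y) + (al - be)))).
    rewrite -big_split /= mulr_sumr; apply: eq_bigr => j _.
    have -> : s j * (x + y) + (al + be) = (s j * x + al) + (s j * y + be) by ring.
    have -> : s j * (x - y) + (al - be) = (s j * x + al) - (s j * y + be) by ring.
    by move: (s j * x + al) (s j * y + be) => A1 A3; rewrite cosD cosB; field.
  have g1 := h1 N (leq_trans (leq_addr _ _) hN); have g2 := h2 N (leq_trans (leq_addl _ _) hN).
  rewrite normrM ger0_norm// ler_pdivrMl//.
  have -> : 2 * (2 * (C * BB * Q)) = 2 * (C * BB * Q) + 2 * (C * BB * Q) by ring.
  by rewrite (le_trans (ler_normD _ _))// lerD.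
have [N1 h1] := pair b1 b1 (- (pi / 2)) (- (pi / 2)) sb1 sb1.
have [N2 h2] := pair b1 b2 (- (pi / 2)) 0 sb1 sb2.
have [N3 h3] := pair b2 b1 0 (- (pi / 2)) sb2 sb1.
have [N4 h4] := pair b2 b2 0 0 sb2 sb2.
exists (N1 + N2 + (N3 + N4))%N => N hN.
pose X0 := 2 / A2 * powR (x * y) (- (nu + 1 / 2)).
have X00 : 0 <= X0 by nng.
have hNa := leq_trans (leq_addr _ _) hN; have hNb := leq_trans (leq_addl _ _) hN.
have g1 := h1 N (leq_trans (leq_addr _ _) hNa); have g2 := h2 N (leq_trans (leq_addl _ _) hNa).
have g3 := h3 N (leq_trans (leq_addr _ _) hNb); have g4 := h4 N (leq_trans (leq_addl _ _) hNb).
have -> : \sum_(0 <= j < N) (riesz d r (s j) - nres Dn ((s j / r) ^+ 2)) * (psi nu s j x * psi nu s j y) =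
  X0 * (\sum_(0 <= j < N) (riesz d r (s j) - nres Dn ((s j / r) ^+ 2)) * (b1 (s j * x) * b1 (s j * y) * p (s j) * (cos (s j * x + - (pi / 2)) * cos (s j * y + - (pi / 2)))) +
   \sum_(0 <= j < N) (riesz d r (s j) - nres Dn ((s j / r) ^+ 2)) * (b1 (s j * x) * b2 (s j * y) * p (s j) * (cos (s j * x + - (pi / 2)) * cos (s j * y + 0))) +
   (\sum_(0 <= j < N) (riesz d r (s j) - nres Dn ((s j / r) ^+ 2)) * (b2 (s j * x) * b1 (s j * y) * p (s j) * (cos (s j * x + 0) * cos (s j * y + - (pi / 2)))) +
   \sum_(0 <= j < N) (riesz d r (s j) - nres Dn ((s j / r) ^+ 2)) * (b2 (s j * x) * b2 (s j * y) * p (s j) * (cos (s j * x + 0) * cos (s j * y + 0))))).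
  rewrite -!big_split /= mulr_sumr; apply: eq_bigr => j _; have sj := zeros_gt0 Hz j.
  have [_ _ hc] := zj j; rewrite (psi_prod x0 y0 hc) -/X0 !ub ?mulr_gt0// !cosBpihalf !addr0.
  by rewrite /X0; ring.
rewrite normrM (ger0_norm X00).
apply: (@le_trans _ _ (X0 * (2 * (C * BB * Q) + 2 * (C * BB * Q) + (2 * (C * BB * Q) + 2 * (C * BB * Q))))).
  rewrite ler_wpM2l// (le_trans (ler_normD _ _))// lerD// (le_trans (ler_normD _ _))// lerD//.
apply: eq_ler.
have QE : Q = r * powR (r * `|x - y|) (- (1 + d)).
  have rD : 0 < r * `|x - y| by nng.
  rewrite /Q opprD powRD; last by rewrite (gt_eqF rD) implybT.
  rewrite powR_inv1 ?(ltW rD)// -[(r * `|x - y|)^-1 in LHS]powR_inv1 ?(ltW rD)// -powRrM mulN1r invfM.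
  by rewrite !mulrA mulfV ?mul1r// gt_eqF.
by rewrite QE /X0 /BB /kw -/W; ring.
Qed.

End KernelOscillation.

(** * The inverse of the Bessel operator *)

Section WeightedIntegral.
Context {R : realType}.
Local Notation leb := (@lebesgue_measure R).
Variable nu : R.
Hypothesis Hnu : -1 < nu.
Implicit Types (f g h P Q F : R -> R) (x y t B K e : R).

Local Notation I01 := (`]0, 1[%classic : set R).
Local Notation wi g := (leb.-integrable I01 (EFin \o (fun x : R => g x * weight nu x))).

Definition posc f := forall x, 0 < x -> {for x, continuous f}.
Definition bdd f B := forall x, 0 < x < 1 -> `|f x| <= B.
Definition wint f : R := \int[leb]_(x in I01) (f x * weight nu x).

Let n1 : 0 < 2 * nu + 2. Proof. by move: Hnu; lra. Qed.
Let mI : measurable I01. Proof. exact: measurable_itv. Qed.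
Let w_ge0 x : 0 <= weight nu x. Proof. exact: powR_ge0. Qed.

Lemma posc_der f (f' : R -> R) : (forall x, 0 < x -> der f x (f' x)) -> posc f.
Proof. by move=> h x x0; exact: der_cont (h x x0). Qed.

Lemma weight_cont : posc (weight nu).
Proof. by apply: posc_der => x x0; exact: weight_der. Qed.

Lemma poscM f g : posc f -> posc g -> posc (fun x => f x * g x).
Proof. by move=> hf hg x x0; apply: cvgM; [exact: hf|exact: hg]. Qed.
Lemma poscD f g : posc f -> posc g -> posc (fun x => f x + g x).
Proof. by move=> hf hg x x0; apply: cvgD; [exact: hf|exact: hg]. Qed.
Lemma posc_cst B : posc (fun=> B).
Proof. by move=> x x0; exact: cst_continuous. Qed.

Lemma xweight x : 0 < x -> x * weight nu x = powR x (2 * nu + 2).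
Proof.
move=> x0; rewrite /weight -{1}[x]powRr1 ?(ltW x0)// -powRD ?(gt_eqF x0) ?implybT//.
by congr powR; ring.
Qed.

(** The integral of the weight from [0] to [x]. *)
Definition wX x : R := x * weight nu x / (2 * nu + 2).

Lemma wX_der x : 0 < x -> der wX x (weight nu x).
Proof.
move=> x0; apply: (der_eq (derM (derM (der_id x) (weight_der nu x0)) (der_cst _ x))).
by field; rewrite !gt_eqF.
Qed.

Lemma xw_le x : 0 < x -> x <= 1 -> x * weight nu x <= 1.
Proof.
by move=> x0 x1; rewrite xweight// (le_trans (powR_le (ltW n1) (ltW x0) x1))// powR1.
Qed.

Lemma xw_small e : 0 < e -> exists2 d, 0 < d & forall x, 0 < x < d -> x * weight nu x <= e.
Proof.
move=> e0; have q0 : 0 < (2 * nu + 2)^-1 by nng.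
exists (powR e (2 * nu + 2)^-1); first by nng.
move=> x /andP[x0 xd]; rewrite xweight// (le_trans (powR_le (ltW n1) (ltW x0) (ltW xd)))//.
by rewrite -powRrM mulVf ?powRr1 ?(ltW e0)// gt_eqF.
Qed.

Lemma wint_weight : leb.-integrable I01 (EFin \o weight nu).
Proof.
apply: (@integrable_antideriv _ _ _ _ (weight nu) wX (2 * nu + 2)^-1 exhaust01) => x; rewrite /= in_itv/= => /andP[x0 x1].
- exact: weight_cont.
- exact/ltW/weight_gt0.
- exact: wX_der.
- rewrite /wX ger0_norm ?divr_ge0 ?mulr_ge0 ?(ltW x0) ?(ltW (weight_gt0 nu x0)) ?(ltW n1)//.
  by rewrite ler_pdivrMr// mulVf ?gt_eqF// xw_le// ltW.
Qed.

Lemma posc_measurable f : posc f -> measurable_fun I01 f.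
Proof.
move=> cf; apply: continuous_on_measurable; first exact: interval_open.
by move=> x; rewrite /= in_itv/= => /andP[x0 _]; exact: cf.
Qed.

Lemma wiD f g : wi f -> wi g -> wi (fun x => f x + g x).
Proof.
move=> hf hg; have := intgD mI hf hg.
by congr (integrable _ _ _); apply/funext => x /=; rewrite mulrDl.
Qed.

Lemma wiZ f K : wi f -> wi (fun x => K * f x).
Proof.
move=> hf; have := intgZ K mI hf.
by congr (integrable _ _ _); apply/funext => x /=; rewrite mulrA.
Qed.

Lemma wintD f g : wi f -> wi g -> wint (fun x => f x + g x) = wint f + wint g.
Proof.
move=> hf hg; rewrite /wint -(RintD mI hf hg).
by congr Rintegral; apply/funext => x; rewrite mulrDl.
Qed.

Lemma wintZ f K : wi f -> wint (fun x => K * f x) = K * wint f.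
Proof.
move=> hf; rewrite /wint -(RintZ K mI hf).
by congr Rintegral; apply/funext => x; rewrite mulrA.
Qed.

Lemma wi_dom f g : measurable_fun I01 f -> (forall x, 0 < x < 1 -> `|f x| <= g x) -> wi g -> wi f.
Proof.
move=> mf h; apply: intg_dom.
- exact: mI.
- by apply: measurable_funM => //; exact: posc_measurable weight_cont.
- by move=> x; rewrite /= in_itv/= => hx; rewrite normrM [`|weight _ _|]ger0_norm// ler_wpM2r// h.
Qed.

Lemma wint_le f g : wi f -> wi g -> (forall x, 0 < x < 1 -> f x <= g x) -> wint f <= wint g.
Proof.
move=> hf hg h; apply: (@le_Rintegral _ _ _ leb I01 _ _ mI hf hg).
by move=> x; rewrite /= in_itv/= => hx; rewrite ler_wpM2r// h.
Qed.

Lemma wint_integrable f B : posc f -> bdd f B -> wi f.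
Proof.
move=> cf bf; apply: (@wi_dom _ (fun=> B)) => //; first exact: posc_measurable.
exact: intgZ mI wint_weight.
Qed.

Lemma eq_wint f g : (forall x, 0 < x < 1 -> f x = g x) -> wint f = wint g.
Proof. by move=> h; apply: eq_Rintegral => x; rewrite inE/= in_itv/= => hx; rewrite h. Qed.

Lemma wint_ge0 f : (forall x, 0 < x < 1 -> 0 <= f x) -> 0 <= wint f.
Proof.
move=> h; apply: Rintegral_ge0 => x; rewrite /= in_itv/= => hx; have [x0 _] := andP hx.
by rewrite mulr_ge0 ?h// ltW// weight_gt0.
Qed.

Lemma wint_FTC f F B A K : posc f -> bdd f B ->
  (forall x, 0 < x -> der F x (f x * weight nu x)) ->
  (forall x, 0 < x < 1 -> `|F x - A| <= K * (x * weight nu x)) -> wint f = F 1 - A.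
Proof.
move=> cf bf dF hA; apply: (@FTC01 _ _ F A (F 1)).
- by move=> x /andP[x0 _]; exact: (poscM cf weight_cont).
- exact: wint_integrable cf bf.
- by move=> x /andP[x0 _]; exact: dF.
- move=> e e0; have K1 : 0 < `|K| + 1 by rewrite ltr_wpDl.
  have [d d0 hd] := xw_small (divr_gt0 e0 K1); exists (Num.min d 1); first by rewrite lt_min d0 ltr01.
  move=> x /andP[x0]; rewrite lt_min => /andP[xd x1].
  have w0 : 0 <= x * weight nu x by nng.
  rewrite (le_trans (hA x _)) ?x0//.
  have := hd x; rewrite x0 xd => /(_ isT); rewrite ler_pdivlMr// => h.
  apply: le_trans h; rewrite mulrC ler_wpM2l//; have := ler_norm K; lra.
- move=> e e0; have cF : {for 1, continuous F} by exact: der_cont (dF 1 ltr01).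
  have /cvgrPdist_lt /(_ e e0) := cF.
  move=> /nbhs_ballP[d /= d0 hd]; exists d => // x /andP[x0 xd].
  have := hd (1 - x); rewrite /ball /= opprB addrC subrK gtr0_norm// => /(_ xd).
  by rewrite distrC => /ltW.
Qed.

(** [der_dominated] started at [0], where the functions need not be defined: the initial comparison
    is replaced by smallness of [f] and near nonnegativity of [g]. *)
Lemma dom0 f g (f' g' : R -> R) K y : 0 < y ->
  (forall x, 0 < x <= y -> der f x (f' x)) -> (forall x, 0 < x <= y -> der g x (g' x)) ->
  (forall x, 0 < x < y -> `|f' x| <= g' x) ->
  (forall e, 0 < e -> exists2 d, 0 < d & forall x, 0 < x < d -> `|f x| <= e /\ 0 <= g x + e) -> `|f y| <= g y.
Proof.
move=> y0 df dg fg h; rewrite leNgt; apply/negP => hlt.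
pose e := (`|f y| - g y) / 4; have e0 : 0 < e by rewrite divr_gt0// subr_gt0.
have [d d0 hd] := h e e0; pose x := Num.min d y / 2.
have m0 : 0 < Num.min d y by rewrite lt_min d0.
have x0 : 0 < x by nng.
have xm : x < Num.min d y by rewrite /x; move: m0; lra.
have [xd xy] : x < d /\ x < y by move: xm; rewrite lt_min => /andP[].
have pos t : x <= t <= y -> 0 < t <= y by move=> /andP[xt ->]; rewrite (lt_le_trans x0 xt).
have pos' t : x <= t < y -> 0 < t < y by move=> /andP[xt ->]; rewrite (lt_le_trans x0 xt).
have := der_dominated (ltW xy) (fun t ht => df t (pos t ht)) (fun t ht => dg t (pos t ht)) (fun t ht => fg t (pos' t ht)).
have [h1 h2] := hd x ltac:(by rewrite x0).
have := ler_normD (f y - f x) (f x); rewrite subrK.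
by move: h1 h2 e0; rewrite /e; lra.
Qed.

Lemma xw_small2 K e : 0 < e -> exists2 d, 0 < d & forall x, 0 < x < d -> `|K| * (x * weight nu x) <= e.
Proof.
move=> e0; have K1 : 0 < `|K| + 1 by rewrite ltr_wpDl.
have [d d0 hd] := xw_small (divr_gt0 e0 K1); exists d => // x hx; have [x0 _] := andP hx.
have := hd x hx; rewrite ler_pdivlMr// => h; apply: le_trans h.
rewrite mulrC ler_wpM2l ?lerDl//; by nng.
Qed.

(** The primitive normalized to vanish at [0], where its limit exists by [limit_squeeze] in the
    variable [t^-1]. *)
Lemma wprim f B : posc f -> bdd f B -> exists P,
  [/\ (forall x, 0 < x -> der P x (f x * weight nu x)),
      (forall x, 0 < x <= 1 -> `|P x| <= B * wX x) & wint f = P 1].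
Proof.
move=> cf bf; have [F dF] := antideriv (poscM cf weight_cont).
have B0 : 0 <= B by apply: le_trans (normr_ge0 _) (bf (1 / 2) _); apply/andP; split; lra.
have wX0 x : 0 < x -> 0 <= wX x.
  by move=> x0; rewrite divr_ge0 ?(ltW n1)// mulr_ge0 ?(ltW x0)// ltW// weight_gt0.
have step x y : 0 < x -> x <= y -> y <= 1 -> `|F y - F x| <= B * wX y - B * wX x.
  move=> x0 xy y1; apply: (@der_dominated _ x y F (fun t => B * wX t) (fun t => f t * weight nu t) (fun t => B * weight nu t) xy).
  - by move=> t /andP[xt _]; apply: dF; exact: lt_le_trans xt.
  - move=> t /andP[xt _]; have t0 := lt_le_trans x0 xt.
    by apply: (der_eq (derM (der_cst B t) (wX_der t0))); rewrite mul0r add0r.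
  - move=> t /andP[xt ty]; have t0 := lt_le_trans x0 xt.
    rewrite normrM (ger0_norm (ltW (weight_gt0 nu t0))) ler_wpM2r ?(ltW (weight_gt0 nu t0))// bf//.
    by rewrite t0 (lt_le_trans ty).
have [l hl] : exists l, forall t, 2 <= t -> `|F t^-1 - l| <= B * wX t^-1.
  apply: (@limit_squeeze _ (fun t => F t^-1) (fun t => B * wX t^-1) 2).
  - move=> s t s2 st; have s0 : 0 < s by lra.
    have t0 : 0 < t by lra.
    rewrite distrC; apply: step; first by nng.
      by rewrite lef_pV2 ?posrE.
    by rewrite invf_le1//; lra.
  - move=> e e0 s; have [d d0 hd] := @xw_small2 (B / (2 * nu + 2)) e e0.
    exists (Num.max s (1 + d^-1)); first by rewrite le_max lexx.
    set t := Num.max _ _; have dt : d^-1 < t by rewrite lt_max ltrDr ltr01 orbT.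
    have di : 0 < d^-1 by nng.
    have t0 : 0 < t by exact: lt_trans dt.
    have td : 0 < t^-1 < d by rewrite invr_gt0 t0 -[ltRHS]invrK ltf_pV2 ?posrE.
    have w0 : 0 <= t^-1 * weight nu t^-1.
      by nng.
    have -> : B * wX t^-1 = B / (2 * nu + 2) * (t^-1 * weight nu t^-1) by rewrite /wX; ring.
    by rewrite normrM (ger0_norm w0) hd.
have small x : 0 < x <= 1 / 2 -> `|F x - l| <= B * wX x.
  move=> /andP[x0 x2]; have := hl x^-1; rewrite invrK; apply.
  rewrite -[leLHS]invrK lef_pV2 ?posrE ?invr_gt0//; lra.
have all x : 0 < x -> x <= 1 -> `|F x - l| <= B * wX x.
  move=> x0 x1; have [h|h] := leP x (1 / 2); first by apply: small; rewrite x0.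
  have h2 := small (1 / 2) ltac:(apply/andP; split; lra).
  have h3 := step (1 / 2) x ltac:(lra) (ltW h) x1.
  have -> : F x - l = F x - F (1 / 2) + (F (1 / 2) - l) by ring.
  by rewrite (le_trans (ler_normD _ _))//; move: h2 h3; lra.
exists (fun x => F x - l); split.
- by move=> x x0; apply: (der_eq (derB (dF x x0) (der_cst l x))); rewrite subr0.
- by move=> x /andP[x0 x1]; exact: all.
- apply: (@wint_FTC f F B l (B / (2 * nu + 2)) cf bf dF) => x /andP[x0 x1].
  by rewrite (le_trans (all x x0 (ltW x1)))// /wX; apply: eq_ler; ring.
Qed.

Lemma wint_zero f B : posc f -> bdd f B -> (forall x, 0 < x < 1 -> 0 <= f x) -> wint f = 0 ->
  forall x, 0 < x < 1 -> f x = 0.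
Proof.
move=> cf bf f0 i0; have [P [dP hP iP]] := wprim cf bf.
have B0 : 0 <= B by apply: le_trans (normr_ge0 _) (bf (1 / 2) _); apply/andP; split; lra.
have w0 x : 0 < x -> 0 < weight nu x by exact: weight_gt0.
have mono x y : 0 < x -> x <= y -> y <= 1 -> P x <= P y.
  move=> x0 xy y1; apply: (@der_nondecr _ x y P (fun t => f t * weight nu t) xy).
    by move=> t /andP[xt _]; apply: dP; exact: lt_le_trans xt.
  move=> t /andP[xt ty]; have t0 := lt_le_trans x0 xt.
  by rewrite mulr_ge0 ?(ltW (w0 _ t0))// f0// t0 (lt_le_trans ty).
have ge0 y : 0 < y -> y < 1 -> 0 <= P y.
  move=> y0 y1; apply/ler_addgt0Pr => e e0; have [d d0 hd] := @xw_small2 (B / (2 * nu + 2)) e e0.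
  pose m := Num.min (d / 2) y; have m0 : 0 < m by rewrite lt_min y0 divr_gt0.
  have m2 : m <= d / 2 by rewrite ge_min lexx.
  have my : m <= y by rewrite ge_min lexx orbT.
  have := hP m; rewrite m0 (le_trans my (ltW y1)) => /(_ isT).
  have := hd m; rewrite m0 (le_lt_trans m2) => [|]; last by lra.
  move=> /(_ isT); rewrite ger0_norm ?divr_ge0 ?(ltW n1)// => h1 h2.
  have h3 : B * wX m <= e by apply: le_trans h1; rewrite /wX; apply: eq_ler; ring.
  by have := mono m y m0 my (ltW y1); move: h2; rewrite ler_norml => /andP[h4 _]; lra.
have P0 y : 0 < y -> y < 1 -> P y = 0.
  move=> y0 y1; apply/eqP; rewrite eq_le ge0// andbT.
  by rewrite -i0 iP mono// ltW.
move=> x /andP[x0 x1]; have d0 : der P x 0.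
  apply: (@der_congr_near _ (fun=> 0)) (der_cst 0 x); near=> t; rewrite P0//; near: t.
    exact: lt_nbhsr.
  exact: lt_nbhsl.
have := der_uniq d0 (dP x x0) => /esym/eqP; rewrite mulf_eq0 => /orP[/eqP //|].
by rewrite gt_eqF// w0.
Unshelve. all: by end_near. Qed.

End WeightedIntegral.

(** * The inverse operator: symmetry, positivity and a stability estimate *)

Section InverseOperator.
Context {R : realType}.
Variable nu : R.
Hypothesis Hnu : -1 < nu.
Implicit Types (f g h P Q F v w : R -> R) (x y t B K e l : R).
Local Notation wint := (wint nu).
Local Notation wX := (wX nu).
Local Notation leb := (@lebesgue_measure R).
Local Notation I01 := (`]0, 1[%classic : set R).

Let n1 : 0 < 2 * nu + 2. Proof. by move: Hnu; lra. Qed.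
Let w_gt0 x : 0 < x -> 0 < weight nu x. Proof. exact: weight_gt0. Qed.

Definition BC f := posc f /\ exists B, bdd f B.

Lemma BC_wi f : BC f -> leb.-integrable I01 (EFin \o (fun x => f x * weight nu x)).
Proof. by move=> [cf [B bf]]; exact: wint_integrable bf. Qed.

Lemma BC_D f g : BC f -> BC g -> BC (fun x => f x + g x).
Proof.
move=> [cf [B bf]] [cg [B' bg]]; split; first exact: poscD.
by exists (B + B') => x hx; rewrite (le_trans (ler_normD _ _))// lerD ?bf ?bg.
Qed.
Lemma BC_M f g : BC f -> BC g -> BC (fun x => f x * g x).
Proof.
move=> [cf [B bf]] [cg [B' bg]]; split; first exact: poscM.
by exists (B * B') => x hx; rewrite normrM ler_pM ?bf ?bg.
Qed.
Lemma BC_cst B : BC (fun=> B).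
Proof. by split; [exact: posc_cst|exists `|B|]. Qed.
Lemma BC_Z B f : BC f -> BC (fun x => B * f x).
Proof. exact: BC_M (BC_cst B). Qed.

Lemma wint_lin f g K : BC f -> BC g -> wint (fun x => K * f x + g x) = K * wint f + wint g.
Proof. by move=> hf hg; rewrite (wintD (BC_wi (BC_Z K hf)) (BC_wi hg)) (wintZ K (BC_wi hf)). Qed.

Lemma wint_ler f g : BC f -> BC g -> (forall x, 0 < x < 1 -> f x <= g x) -> wint f <= wint g.
Proof. by move=> /BC_wi hf /BC_wi hg; exact: wint_le. Qed.

Lemma wint_abs f B : BC f -> bdd f B -> `|wint f| <= B * wint (fun=> 1).
Proof.
move=> hf bf; have c K : wint (fun=> K) = K * wint (fun=> 1).
  rewrite -(wintZ K (BC_wi (BC_cst 1))); apply: eq_wint => x _; by rewrite mulr1.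
rewrite ler_norml -mulNr -!c; apply/andP; split; apply: wint_ler => //; try exact: BC_cst.
  by move=> x hx; have := bf x hx; rewrite ler_norml => /andP[].
by move=> x hx; have := bf x hx; rewrite ler_norml => /andP[].
Qed.

(** [w] is the image of [f] under the inverse of the Bessel operator with [w 1 = 0]. The flux [P],
    the integral of [f] against the weight from [0], is made explicit: the bound by [wX] selects the
    solution regular at [0]. *)
Definition Op f w := exists P K,
  [/\ (forall x, 0 < x -> der P x (f x * weight nu x)),
      (forall x, 0 < x <= 1 -> `|P x| <= K * wX x),
      (forall x, 0 < x -> der w x (- (P x / weight nu x))) & w 1 = 0].

Lemma Op_ex f : BC f -> exists w, Op f w.
Proof.
move=> [cf [B bf]]; have [P [dP hP _]] := wprim Hnu cf bf.
have cV : posc (fun x => P x / weight nu x).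
  move=> x x0; apply: cvgM; first exact: der_cont (dP x x0).
  by apply: cvgV; [rewrite gt_eqF// w_gt0|exact: weight_cont].
have [Q dQ] := antideriv cV.
exists (fun x => Q 1 - Q x), P, B; split => //; last by rewrite subrr.
by move=> x x0; apply: (der_eq (derB (der_cst (Q 1) x) (dQ x x0))); rewrite sub0r.
Qed.

Lemma wX_w x : 0 < x -> wX x / weight nu x = x / (2 * nu + 2).
Proof. by move=> x0; rewrite /wX; field; rewrite !gt_eqF ?w_gt0. Qed.

Lemma wX_ge0 x : 0 < x -> 0 <= wX x.
Proof. by move=> x0; rewrite divr_ge0 ?(ltW n1)// mulr_ge0 ?(ltW x0)// ltW// w_gt0. Qed.

Lemma wX_small K e : 0 < e -> exists2 d, 0 < d & forall x, 0 < x < d -> `|K| * wX x <= e.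
Proof.
move=> e0; have [d d0 hd] := @xw_small2 _ nu Hnu (K / (2 * nu + 2)) e e0.
exists d => // x hx; have [x0 _] := andP hx; apply: le_trans (hd x hx).
by rewrite normrM normfV (gtr0_norm n1) /wX; apply: eq_ler; ring.
Qed.

Lemma flux_le f P K g Q y : 0 < y -> (forall x, 0 < x -> der P x (f x * weight nu x)) ->
  (forall x, 0 < x <= 1 -> `|P x| <= K * wX x) ->
  (forall x, 0 < x -> der Q x (g x * weight nu x)) -> (forall x, 0 < x -> 0 <= Q x) ->
  (forall x, 0 < x < y -> `|f x| <= g x) -> `|P y| <= Q y.
Proof.
move=> y0 dP hP dQ Q0 fg.
apply: (@dom0 _ P Q (fun x => f x * weight nu x) (fun x => g x * weight nu x) 0 y y0).
- by move=> x /andP[x0 _]; exact: dP.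
- by move=> x /andP[x0 _]; exact: dQ.
- move=> x hx; have [x0 _] := andP hx.
  by rewrite normrM (ger0_norm (ltW (w_gt0 x0))) ler_wpM2r ?fg// ltW// w_gt0.
- move=> e e0; have [d d0 hd] := wX_small K e0; exists (Num.min d 1); first by rewrite lt_min d0 ltr01.
  move=> x /andP[x0]; rewrite lt_min => /andP[xd x1]; split; last by rewrite addr_ge0 ?Q0// ltW.
  have hx1 : 0 < x <= 1 by rewrite x0 ltW.
  have hxd : 0 < x < d by rewrite x0.
  apply: (le_trans (hP x hx1)); apply: le_trans (hd x hxd).
  by rewrite ler_wpM2r ?wX_ge0// ler_norm.
Qed.

Lemma Op_bdd f w B : Op f w -> 0 <= B -> bdd f B -> bdd w (B / (2 * nu + 2)).
Proof.
move=> [P [K [dP hP dw w1]]] B0 bf x /andP[x0 x1].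
have Pb t : 0 < t -> t < 1 -> `|P t| <= B * wX t.
  move=> t0 t1; apply: (@flux_le f P K (fun=> B) (fun x => B * wX x) t t0 dP hP).
  - by move=> u u0; apply: (der_eq (derM (der_cst B u) (wX_der Hnu u0))); rewrite mul0r add0r.
  - by move=> u u0; rewrite mulr_ge0// wX_ge0.
  - by move=> u /andP[u0 ut]; apply: bf; rewrite u0 (lt_trans ut).
rewrite -normrN -[X in `|X|]add0r -w1; apply: (@le_trans _ _ (B / (2 * nu + 2) * (1 - x))).
  apply: (der_lip (ltW x1)) => u /andP[xu u1]; have u0 := lt_le_trans x0 xu; first exact: dw.
  rewrite normrN normrM normfV (gtr0_norm (w_gt0 u0)).
  apply: (@le_trans _ _ (B * wX u / weight nu u)); first by rewrite ler_wpM2r ?Pb// invr_ge0 ltW// w_gt0.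
  by rewrite -mulrA wX_w// ler_wpM2l// ler_piMl ?invr_ge0 ?(ltW n1)// ltW.
by rewrite ler_piMr ?divr_ge0 ?(ltW n1)//; lra.
Qed.

Lemma Op_BC f w : BC f -> Op f w -> BC w.
Proof.
move=> [cf [B bf]] h; have B0 : 0 <= B by apply: le_trans (normr_ge0 _) (bf (1 / 2) _); apply/andP; split; lra.
split; last by exists (B / (2 * nu + 2)); exact: Op_bdd h B0 bf.
by have [P [K [_ _ dw _]]] := h; exact: posc_der dw.
Qed.

Lemma Op_lin f1 w1 f2 w2 K : Op f1 w1 -> Op f2 w2 -> Op (fun x => K * f1 x + f2 x) (fun x => K * w1 x + w2 x).
Proof.
move=> [P1 [K1 [dP1 h1 dw1 e1]]] [P2 [K2 [dP2 h2 dw2 e2]]].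
exists (fun x => K * P1 x + P2 x), (`|K| * K1 + K2); split.
- move=> x x0; apply: (der_eq (derD (derM (der_cst K x) (dP1 x x0)) (dP2 x x0))); ring.
- move=> x hx; rewrite (le_trans (ler_normD _ _))// mulrDl lerD ?h2// normrM -mulrA ler_wpM2l// h1//.
- move=> x x0; apply: (der_eq (derD (derM (der_cst K x) (dw1 x x0)) (dw2 x x0))); ring.
- by rewrite e1 e2 mulr0 addr0.
Qed.

(** Integration by parts turns the pairing of the image of [f1] with [f2] into the energy form of
    the two fluxes, which is symmetric and nonnegative. The boundary terms vanish by [w1 1 = 0] and
    by the flux bound at [0]. *)
Lemma Op_energy f1 w1 P1 K1 f2 P2 K2 : BC f1 -> BC f2 ->
  (forall x, 0 < x -> der P1 x (f1 x * weight nu x)) -> (forall x, 0 < x <= 1 -> `|P1 x| <= K1 * wX x) ->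
  (forall x, 0 < x -> der w1 x (- (P1 x / weight nu x))) -> w1 1 = 0 -> BC w1 ->
  (forall x, 0 < x -> der P2 x (f2 x * weight nu x)) -> (forall x, 0 < x <= 1 -> `|P2 x| <= K2 * wX x) ->
  wint (fun x => w1 x * f2 x) = wint (fun x => P1 x / weight nu x * (P2 x / weight nu x)).
Proof.
move=> b1 b2 dP1 h1 dw1 e1 bw1 dP2 h2.
have bV (P f : R -> R) K : (forall x, 0 < x -> der P x (f x * weight nu x)) -> (forall x, 0 < x <= 1 -> `|P x| <= K * wX x) ->
    BC (fun x => P x / weight nu x).
  move=> dP hP; split.
    move=> x x0; apply: cvgM; first exact: der_cont (dP x x0).
    by apply: cvgV; [rewrite gt_eqF// w_gt0|exact: weight_cont].
  exists (`|K| / (2 * nu + 2)) => x /andP[x0 x1].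
  rewrite normrM normfV (gtr0_norm (w_gt0 x0)).
  apply: (@le_trans _ _ (`|K| * wX x / weight nu x)).
    have hx1 : 0 < x <= 1 by rewrite x0 ltW.
    rewrite ler_wpM2r ?invr_ge0 ?(ltW (w_gt0 x0))// (le_trans (hP x hx1))//.
    by rewrite ler_wpM2r ?wX_ge0// ler_norm.
  rewrite -mulrA wX_w// ler_wpM2l// ler_piMl ?invr_ge0 ?(ltW n1)//; exact: ltW.
have bh := BC_M (bV _ _ _ dP1 h1) (bV _ _ _ dP2 h2); have bf := BC_M bw1 b2.
suff : wint (fun x => -1 * (P1 x / weight nu x * (P2 x / weight nu x)) + w1 x * f2 x) = 0.
  by rewrite wint_lin// mulN1r addrC => /eqP; rewrite subr_eq0 => /eqP.
have [cb [Bb bb]] := BC_D (BC_Z (-1) bh) bf; have [_ [Bw bw]] := bw1.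
rewrite (@wint_FTC _ nu Hnu _ (fun x => w1 x * P2 x) Bb 0 (`|Bw| * `|K2| / (2 * nu + 2)) cb bb).
- by rewrite e1 mul0r subr0.
- move=> x x0; apply: (der_eq (derM (dw1 x x0) (dP2 x x0))).
  by field; rewrite gt_eqF// w_gt0.
- move=> x hx; have [x0 x1] := andP hx; rewrite subr0 normrM.
  have k1 : `|w1 x| <= `|Bw| by rewrite (le_trans (bw x hx))// ler_norm.
  have k2 : `|P2 x| <= `|K2| * wX x.
    have hx1 : 0 < x <= 1 by rewrite x0 ltW.
    by rewrite (le_trans (h2 x hx1))// ler_wpM2r ?wX_ge0// ler_norm.
  by apply: (le_trans (ler_pM _ _ k1 k2)) => //; rewrite /wX; apply: eq_ler; ring.
Qed.

Lemma Op_sym f1 w1 f2 w2 : BC f1 -> BC f2 -> Op f1 w1 -> Op f2 w2 ->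
  wint (fun x => w1 x * f2 x) = wint (fun x => w2 x * f1 x).
Proof.
move=> b1 b2 o1 o2; have bw1 := Op_BC b1 o1; have bw2 := Op_BC b2 o2.
have [P1 [K1 [dP1 h1 dw1 e1]]] := o1; have [P2 [K2 [dP2 h2 dw2 e2]]] := o2.
rewrite (Op_energy b1 b2 dP1 h1 dw1 e1 bw1 dP2 h2) (Op_energy b2 b1 dP2 h2 dw2 e2 bw2 dP1 h1).
by apply: eq_wint => x _; rewrite mulrC.
Qed.

Lemma Op_pos f w : BC f -> Op f w -> 0 <= wint (fun x => w x * f x).
Proof.
move=> b1 o1; have bw1 := Op_BC b1 o1; have [P1 [K1 [dP1 h1 dw1 e1]]] := o1.
rewrite (Op_energy b1 b1 dP1 h1 dw1 e1 bw1 dP1 h1); apply: wint_ge0 => x _.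
by rewrite -expr2 sqr_ge0.
Qed.

Lemma Op_inj f w : Op f w -> (forall x, 0 < x < 1 -> w x = 0) -> forall x, 0 < x < 1 -> f x = 0.
Proof.
move=> [P [K [dP _ dw _]]] w0 x hx.
have loc (h : R -> R) y : 0 < y < 1 -> (forall x, 0 < x < 1 -> h x = 0) -> der h y 0.
  move=> /andP[y0 y1] h0; apply: (@der_congr_near _ (fun=> 0)) (der_cst 0 y); near=> t.
  by rewrite h0//; apply/andP; split; near: t; [exact: lt_nbhsr|exact: lt_nbhsl].
have P0 y : 0 < y < 1 -> P y = 0.
  move=> hy; have [y0 _] := andP hy.
  have := der_uniq (loc w y hy w0) (dw y y0) => /esym/eqP.
  by rewrite oppr_eq0 mulf_eq0 invr_eq0 (gt_eqF (w_gt0 y0)) orbF => /eqP.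
have [x0 _] := andP hx; have := der_uniq (loc P x hx P0) (dP x x0) => /esym/eqP.
by rewrite mulf_eq0 (gt_eqF (w_gt0 x0)) orbF => /eqP.
Unshelve. all: by end_near. Qed.

Lemma bes_bounded mu (X : R) : -1 < mu -> 0 < X -> exists2 C, 0 <= C & forall z, `|z| <= X -> `|Bes mu z| <= C.
Proof.
move=> h X0; have ct : {within `[- X, X], continuous (Bes mu)}.
  by apply: continuous_in_subspaceT => x _; exact: bes_cont.
have XX : - X <= X by lra.
have [c1 _ hc1] := EVT_max XX ct; have [c2 _ hc2] := EVT_min XX ct.
exists (`|Bes mu c1| + `|Bes mu c2|) => [|z]; first exact: addr_ge0.
rewrite ler_norml => zX; have i : z \in `[- X, X] by rewrite in_itv/=.
have := hc1 _ i; have := hc2 _ i; have := ler_norm (Bes mu c1); have := ler_norm (- Bes mu c2).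
by rewrite normrN ler_norml => *; have := normr_ge0 (Bes mu c1); have := normr_ge0 (Bes mu c2); lra.
Qed.

Lemma ph_BC l : BC (ph nu l).
Proof.
split; first by apply: posc_der => x _; exact: ph_der.
have X0 : 0 < `|l| + 1 by rewrite ltr_wpDl.
have [C C0 h] := bes_bounded Hnu X0; exists C => x /andP[x0 x1]; apply: h.
rewrite normrM normrX (gtr0_norm x0) -[leRHS]addr0 -[leRHS]addrA.
apply: (@le_trans _ _ `|l|); last by rewrite addr0 lerDl.
by rewrite ler_piMr// exprn_ile1// ltW.
Qed.

Lemma ph1_le l : exists2 K, 0 <= K & forall x, 0 < x <= 1 -> `|ph1 nu l x| <= K * x.
Proof.
have X0 : 0 < `|l| + 1 by rewrite ltr_wpDl.
have h' : -1 < nu + 1 by move: Hnu; lra.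
have [C C0 h] := bes_bounded h' X0.
exists (`|l| / (2 * (nu + 1)) * C); first by rewrite mulr_ge0// divr_ge0//; move: n1; lra.
move=> x /andP[x0 x1]; rewrite /ph1 normrM normrN normrM normfV (gtr0_norm (_ : 0 < 2 * (nu + 1))); last by move: n1; lra.
have hb : `|Bes (nu + 1) (l * x ^+ 2)| <= C.
  apply: h; rewrite normrM normrX (gtr0_norm x0) (@le_trans _ _ `|l|) ?lerDl//.
  by rewrite ler_piMr// exprn_ile1// ltW.
rewrite normrM (gtr0_norm x0) [leRHS](_ : _ = `|l| * x / (2 * (nu + 1)) * C); last by ring.
by rewrite ler_wpM2l// divr_ge0 ?mulr_ge0 ?(ltW x0)//; move: n1; lra.
Qed.

Lemma Op_ph l : l != 0 -> ph nu l 1 = 0 -> Op (ph nu l) (fun x => l^-1 * ph nu l x).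
Proof.
move=> l0 p1; have [K K0 hK] := ph1_le l.
exists (fun x => - l^-1 * (weight nu x * ph1 nu l x)), (`|l|^-1 * K * (2 * nu + 2)); split.
- move=> x x0; apply: (der_eq (derM (der_cst _ x) (ph_flux l Hnu x0))).
  by field.
- move=> x hx; have [x0 _] := andP hx.
  rewrite normrM normrN normfV normrM (gtr0_norm (w_gt0 x0)).
  have -> : `|l|^-1 * K * (2 * nu + 2) * wX x = `|l|^-1 * (weight nu x * (K * x)).
    by rewrite /wX; field; rewrite normr_eq0 l0 gt_eqF.
  by rewrite ler_wpM2l ?invr_ge0// ler_wpM2l ?hK// ltW// w_gt0.
- move=> x x0; apply: (der_eq (derM (der_cst _ x) (ph_der l x Hnu))).
  by field; rewrite l0 gt_eqF// w_gt0.
- by rewrite p1 mulr0.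
Qed.

(* A priori bound for [(lam^-1 - G) v = e]: subtract the regular solution [a * ph] and compare the
   remainder with the positive solution [Phi = ph nu (- lam)]; the comparison improves a bound
   [e (Phi - 1) + A Phi] by the factor [q = (Phi 1 - 1) / Phi 1] on [A], so it can be iterated. *)
Lemma Op_stable lam : 0 < lam -> exists2 C, 0 <= C & forall v w e, BC v -> Op v w -> 0 < e ->
  (forall x, 0 < x < 1 -> `|lam^-1 * v x - w x| <= e) ->
  (ph nu lam 1 = 0 -> wint (fun x => w x * ph nu lam x) = 0) ->
  bdd w (C * e).
Proof.
move=> l0; pose Phi := ph nu (- lam).
have Phi_ge1 x : 1 <= Phi x by apply: bes_ge1 => //; rewrite mulNr oppr_le0 mulr_ge0 ?sqr_ge0// ltW.
pose S x := weight nu x * ph1 nu (- lam) x.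
have dS x : 0 < x -> der S x (lam * Phi x * weight nu x).
  by move=> x0; apply: (der_eq (ph_flux (- lam) Hnu x0)); rewrite /Phi; ring.
have S_ge0 x : 0 < x -> 0 <= S x.
  move=> x0; rewrite mulr_ge0 ?(ltW (w_gt0 x0))// /ph1 mulr_ge0//.
    by rewrite mulNr mulNr opprK divr_ge0 ?mulr_ge0 ?(ltW l0) ?(ltW x0)//; move: n1; lra.
  apply: (le_trans ler01); apply: bes_ge1; first by move: Hnu; lra.
  by rewrite mulNr oppr_le0 mulr_ge0 ?sqr_ge0// ltW.
have dPhi x : der Phi x (ph1 nu (- lam) x) by exact: ph_der.
have Phi_mono x y : 0 < x -> x <= y -> Phi x <= Phi y.
  move=> x0 xy; apply: (der_nondecr xy) => t /andP[xt _]; first exact: dPhi.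
  have t0 := lt_le_trans x0 xt; have := S_ge0 t t0.
  by rewrite /S pmulr_rge0// w_gt0.
pose M := Phi 1 - 1; have M0 : 0 <= M by rewrite subr_ge0.
have [_ [Bp bp]] := ph_BC lam.
have bp' : bdd (ph nu lam) `|Bp| by move=> x hx; rewrite (le_trans (bp x hx))// ler_norm.
have [k1 k10 hk1] := ph1_le lam.
have lipph x : 0 < x <= 1 -> `|ph nu lam x - 1| <= k1 * x.
  move=> /andP[x0 x1]; have <- : ph nu lam 0 = 1 by exact: ph_0.
  have := @der_lip _ 0 x (ph nu lam) (ph1 nu lam) k1 (ltW x0); rewrite subr0; apply => [y _|y /andP[y0 yx]].
    exact: ph_der.
  move: y0; rewrite le_eqVlt => /predU1P[<-|y0]; first by rewrite /ph1 !(mulr0, mul0r, oppr0) normr0.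
  have y1 := le_trans (ltW yx) x1; by rewrite (le_trans (hk1 y _)) ?y0// ler_piMr.
pose pp := wint (fun x => ph nu lam x * ph nu lam x).
have pp0 : 0 < pp.
  have h2 := BC_M (ph_BC lam) (ph_BC lam); have [c2 [B2 b2]] := h2.
  rewrite lt_neqAle eq_sym; apply/andP; split; last by apply: wint_ge0 => x _; rewrite -expr2 sqr_ge0.
  apply/eqP => E; have sq x : 0 < x < 1 -> 0 <= ph nu lam x * ph nu lam x by rewrite -expr2 sqr_ge0.
  have z := wint_zero Hnu c2 b2 sq E; pose t := (2 * (k1 + 1))^-1.
  have k0 : 0 < 2 * (k1 + 1) by rewrite mulr_gt0// ltr_wpDl.
  have t1 : 0 < t < 1 by rewrite invr_gt0 k0 invf_lt1//; lra.
  have := lipph t ltac:(by move: t1 => /andP[-> /ltW]).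
  have /eqP := z t t1; rewrite mulf_eq0 orbb => /eqP ->.
  by rewrite sub0r normrN normr1 /t ler_pdivlMr// mul1r; lra.
pose W1 := wint (fun=> 1).
have W10 : 0 <= W1 by exact: wint_ge0.
pose C := (if ph nu lam 1 == 0 then M * `|Bp| * W1 / pp else M / `|ph nu lam 1|) * `|Bp| + M.
have C0 : 0 <= C.
  rewrite addr_ge0// mulr_ge0//; case: ifP => _; first by nng.
  by nng.
exists C => // v w e hv ov e0 hE horth.
have [P [K [dP hP dw w1]]] := ov; have bw := Op_BC hv ov.
have K'P x : 0 < x <= 1 -> `|P x / weight nu x| <= `|K| / (2 * nu + 2) * x.
  move=> hx; have [x0 _] := andP hx; rewrite normrM normfV (gtr0_norm (w_gt0 x0)).
  apply: (@le_trans _ _ (`|K| * wX x / weight nu x)).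
    rewrite ler_wpM2r ?invr_ge0 ?(ltW (w_gt0 x0))// (le_trans (hP x hx))//.
    by rewrite ler_wpM2r ?wX_ge0// ler_norm.
  by rewrite -mulrA wX_w// mulrA mulrAC.
pose K' := `|K| / (2 * nu + 2); have K'0 : 0 <= K' by nng.
have lipw x y : 0 < x -> x <= y -> y <= 1 -> `|w y - w x| <= K' * (y - x).
  move=> x0 xy y1; apply: (der_lip xy) => t /andP[xt ty]; have t0 := lt_le_trans x0 xt; first exact: dw.
  have t1 := le_trans (ltW ty) y1; by rewrite normrN (le_trans (K'P t _)) ?t0// ler_piMr.
(* The derivative of [w] is bounded, so [w] has a limit at [0]; this is the coefficient of the
   regular solution to subtract. *)
have [a ha] : exists a, forall t, 1 <= t -> `|w t^-1 - a| <= K' * t^-1.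
  apply: (@limit_squeeze _ (fun t => w t^-1) (fun t => K' * t^-1) 1).
  - move=> x t x1 xt; have x0 := lt_le_trans ltr01 x1; have t0 := lt_le_trans x0 xt.
    rewrite distrC -mulrBr; apply: lipw; first by nng.
      by rewrite lef_pV2 ?posrE.
    by rewrite invf_le1.
  - move=> u u0 x; exists (Num.max x (1 + K' / u)); first by rewrite le_max lexx.
    set t := Num.max _ _; have tt : 1 + K' / u <= t by rewrite le_max lexx orbT.
    have t0 : 0 < t by apply: lt_le_trans tt; rewrite ltr_pwDl// divr_ge0// ltW.
    rewrite ger0_norm; last by nng.
    rewrite ler_pdivrMr// mulrC -ler_pdivrMr//; lra.
have lima x : 0 < x <= 1 -> `|w x - a| <= K' * x.
  by move=> /andP[x0 x1]; have := ha x^-1; rewrite invrK; apply; rewrite invf_ge1.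
pose D x := w x - a * ph nu lam x; pose PD x := P x + a * (weight nu x * ph1 nu lam x).
have dPD x : 0 < x -> der PD x ((v x - a * lam * ph nu lam x) * weight nu x).
  by move=> x0; apply: (der_eq (derD (dP x x0) (derM (der_cst a x) (ph_flux lam Hnu x0)))); ring.
have dD x : 0 < x -> der D x (- (PD x / weight nu x)).
  move=> x0; apply: (der_eq (derB (dw x x0) (derM (der_cst a x) (ph_der lam x Hnu)))).
  by rewrite /PD; field; rewrite gt_eqF// w_gt0.
have PDb x : 0 < x <= 1 -> `|PD x| <= (`|K| + `|a| * k1 * (2 * nu + 2)) * wX x.
  move=> hx; have [x0 _] := andP hx; rewrite (le_trans (ler_normD _ _))// mulrDl lerD//.
    by rewrite (le_trans (hP x hx))// ler_wpM2r ?wX_ge0// ler_norm.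
  rewrite normrM [`|weight nu x * _|]normrM (gtr0_norm (w_gt0 x0)).
  have -> : `|a| * k1 * (2 * nu + 2) * wX x = `|a| * (weight nu x * (k1 * x)) by rewrite /wX; field; rewrite gt_eqF.
  by rewrite ler_wpM2l// ler_wpM2l ?hk1// ltW// w_gt0.
have Dsmall x : 0 < x <= 1 -> `|D x| <= (K' + `|a| * k1) * x.
  move=> hx; have -> : D x = (w x - a) - a * (ph nu lam x - 1) by rewrite /D; ring.
  rewrite (le_trans (ler_normB _ _))// mulrDl lerD ?lima// normrM -mulrA ler_wpM2l// lipph//.
have P1 : 0 < Phi 1 by apply: lt_le_trans (Phi_ge1 1).
have q0 : 0 <= K' + `|a| * k1 by nng.
have step A : 0 <= A -> (forall x, 0 < x < 1 -> `|D x| <= e * (Phi x - 1) + A * Phi x) ->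
    forall x, 0 < x <= 1 -> `|D x| <= (e + A) * (Phi x - 1).
  move=> A0 hA x /andP[x0 x1]; have eA : 0 <= e + A by nng.
  have fl t : 0 < t < x -> `|PD t / weight nu t| <= (e + A) * ph1 nu (- lam) t.
    move=> /andP[t0 tx]; rewrite normrM normfV (gtr0_norm (w_gt0 t0)) ler_pdivrMr ?w_gt0//.
    rewrite -mulrA [ph1 _ _ _ * _]mulrC.
    apply: (@flux_le (fun x => v x - a * lam * ph nu lam x) PD _ (fun x => lam * (e + A) * Phi x)
       (fun t => (e + A) * S t) t t0 dPD PDb).
    - by move=> u u0; apply: (der_eq (derM (der_cst _ u) (dS u u0))); ring.
    - by move=> u u0; rewrite mulr_ge0 ?S_ge0.
    - move=> u /andP[u0 ut]; have u1 : 0 < u < 1 by rewrite u0 (lt_trans ut (lt_le_trans tx x1)).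
      have -> : v u - a * lam * ph nu lam u = lam * ((lam^-1 * v u - w u) + D u) by rewrite /D; field; rewrite gt_eqF.
      rewrite normrM (gtr0_norm l0) -mulrA ler_wpM2l ?(ltW l0)// (le_trans (ler_normD _ _))//.
      by move: (lerD (hE u u1) (hA u u1)); lra.
  apply: (@dom0 _ D (fun x => (e + A) * (Phi x - 1)) (fun x => - (PD x / weight nu x)) (fun x => (e + A) * ph1 nu (- lam) x) 0 x x0).
  - by move=> t /andP[t0 _]; exact: dD.
  - by move=> t _; apply: (der_eq (derM (der_cst _ t) (derB (dPhi t) (der_cst 1 t)))); ring.
  - by move=> t ht; rewrite normrN fl.
  - move=> u u0; have q1 : 0 < K' + `|a| * k1 + 1 by rewrite ltr_wpDl.
    exists (Num.min 1 (u / (K' + `|a| * k1 + 1))); first by rewrite lt_min ltr01 divr_gt0.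
    move=> t /andP[t0]; rewrite lt_min => /andP[t1]; rewrite ltr_pdivlMr// => tu; split.
      rewrite ltW// (le_lt_trans (Dsmall t _)) ?t0 ?ltW//; apply: le_lt_trans tu.
      by rewrite mulrC ler_wpM2l ?(ltW t0)// lerDl.
    by rewrite addr_ge0 ?(ltW u0)// mulr_ge0 ?subr_ge0.
(* From [A] the comparison returns [A * (Phi - 1)], at most [q * A * Phi] because [Phi] is largest
   at [1]; iterating leaves only the term in [e]. *)
pose q := M / Phi 1; have qb : 0 <= q by nng.
have q1 : q < 1 by rewrite ltr_pdivrMr// mul1r /M; lra.
have MP x : 0 < x <= 1 -> 0 <= Phi x - 1 <= M.
  by move=> /andP[x0 x1]; rewrite subr_ge0 Phi_ge1 lerD2r Phi_mono.
have Dn n x : 0 < x < 1 -> `|D x| <= e * (Phi x - 1) + q ^+ n * (K' + `|a| * k1) * Phi x.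
  elim: n x => [|n IH] x hx; have [x0 x1] := andP hx.
    have hx1 : 0 < x <= 1 by rewrite x0 ltW.
    rewrite expr0 mul1r (le_trans (Dsmall x hx1))// -[leLHS]add0r lerD ?mulr_ge0 ?(ltW e0) ?subr_ge0//.
    by rewrite ler_wpM2l// (le_trans (ltW x1)).
  have A0 : 0 <= q ^+ n * (K' + `|a| * k1) by nng.
  have hx1 : 0 < x <= 1 by rewrite x0 ltW.
  rewrite (le_trans (step _ A0 IH x hx1))// mulrDl lerD// exprSr -!mulrA ler_wpM2l ?exprn_ge0//.
  rewrite [leRHS](_ : _ = (K' + `|a| * k1) * (q * Phi x)); last by rewrite /q; ring.
  rewrite ler_wpM2l// /q mulrAC ler_pdivlMr//.
  by rewrite /M mulrBl mul1r [leRHS]mulrBl mul1r [Phi 1 * _]mulrC lerD2l lerN2 Phi_mono// ltW.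
have Dle x : 0 < x <= 1 -> `|D x| <= M * e.
  move=> hx; apply/ler_addgt0Pr => u u0; have /andP[h1 h2] := MP x hx.
  have : [sequence q ^+ n]_n @ \oo --> 0 by apply: cvg_expr; rewrite ger0_norm.
  pose B := (K' + `|a| * k1) * M + 1; have B0 : 0 < B by rewrite ltr_wpDl// mulr_ge0.
  move=> /cvgrPdist_lt /(_ _ (divr_gt0 u0 B0)) [n _ /(_ n (leqnn n))] /=.
  rewrite sub0r normrN ger0_norm ?exprn_ge0// ltr_pdivlMr// => hn.
  have A0 : 0 <= q ^+ n * (K' + `|a| * k1) by nng.
  apply: (le_trans (step _ A0 (Dn n) x hx)); rewrite mulrDl lerD//; first by rewrite mulrC ler_wpM2r// ltW.
  apply: le_trans (ltW hn); rewrite -mulrA ler_wpM2l ?exprn_ge0//.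
  by apply: (@le_trans _ _ ((K' + `|a| * k1) * M)); rewrite ?lerDl// ler_wpM2l.
(* Off the spectrum [w 1 = 0] gives [a * ph nu lam 1 = - D 1]. At an eigenvalue the orthogonality
   assumption gives [a * pp] as minus the pairing of [D] with the eigenfunction. *)
have aM : `|a| <= (if ph nu lam 1 == 0 then M * `|Bp| * W1 / pp else M / `|ph nu lam 1|) * e.
  case: ifPn => [/eqP p1|p1].
    have := horth p1; have -> : (fun x => w x * ph nu lam x) = fun x => a * (ph nu lam x * ph nu lam x) + D x * ph nu lam x.
      by apply/funext => x; rewrite /D; ring.
    have bD : BC D.
      split; first exact: posc_der dD.
      by exists (M * e) => x /andP[x0 /ltW x1]; rewrite Dle// x0.
    rewrite wint_lin; [|exact: BC_M (ph_BC lam) (ph_BC lam)|exact: BC_M bD (ph_BC lam)].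
    move=> /eqP; rewrite addr_eq0 -/pp => /eqP E.
    have h1 : `|wint (fun x => D x * ph nu lam x)| <= M * e * `|Bp| * W1.
      have bb := BC_M bD (ph_BC lam).
      have ub x : 0 < x < 1 -> `|D x * ph nu lam x| <= M * e * `|Bp|.
        by move=> hx; have /andP[x0 /ltW x1] := hx; rewrite normrM ler_pM ?bp'// Dle// x0.
      by rewrite (wint_abs bb ub).
    have -> : `|a| = `|a * pp| / pp by rewrite normrM (gtr0_norm pp0) mulfK// gt_eqF.
    rewrite E normrN ler_pdivrMr// (le_trans h1)//; apply: eq_ler; field; rewrite gt_eqF//.
  have p1' : 0 < `|ph nu lam 1| by rewrite normr_gt0.
  rewrite mulrAC ler_pdivlMr// -normrM.
  have -> : a * ph nu lam 1 = - D 1 by rewrite /D w1; ring.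
  by rewrite normrN Dle// ltr01 lexx.
move=> x hx; have -> : w x = a * ph nu lam x + D x by rewrite /D; ring.
rewrite (le_trans (ler_normD _ _))// /C mulrDl lerD//; last by have /andP[x0 /ltW x1] := hx; rewrite Dle ?x0.
by rewrite normrM mulrAC ler_pM// bp'.
Qed.

End InverseOperator.

(** * Completeness *)

Section Smoothing.
Context {R : realType}.
Variable nu : R.
Hypothesis Hnu : -1 < nu.
Implicit Types (f w : R -> R) (x y t B K N e al : R) (k q m : nat).
Local Notation wint := (wint nu).
Local Notation wX := (wX nu).

Let n1 : 0 < 2 * nu + 2. Proof. by move: Hnu; lra. Qed.
Let w_gt0 x : 0 < x -> 0 < weight nu x. Proof. exact: weight_gt0. Qed.

Lemma Op_decay w P al (C : R) :
  (forall x, 0 < x -> der w x (- (P x / weight nu x))) -> w 1 = 0 -> 0 <= al ->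
  (forall x, 0 < x < 1 -> `|P x / weight nu x| <= C * powR x (- al)) ->
  forall x, 0 < x < 1 -> `|w x| <= C * powR x (- al).
Proof.
move=> dw w1 al0 hP x hx; have [x0 x1] := andP hx.
have C0 : 0 <= C.
  have := le_trans (normr_ge0 _) (hP x hx); rewrite pmulr_lge0// powR_gt0//.
rewrite -normrN -[X in `|X|]add0r -w1; apply: (@le_trans _ _ (C * powR x (- al) * (1 - x))).
  apply: (der_lip (ltW x1)) => u /andP[xu u1]; have u0 := lt_le_trans x0 xu; first exact: dw.
  by rewrite normrN (le_trans (hP u _)) ?u0// ler_wpM2l// powR_leN// oppr_le0.
by rewrite ler_piMr ?mulr_ge0 ?powR_ge0//; lra.
Qed.

(** Cauchy-Schwarz bounds the flux by [N * sqrt (wX x)]. It is run as a comparison of derivatives,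
    the parameter [r] being frozen at the value that is optimal at [x]. Division by the weight
    leaves [x^-nu]. *)
Lemma Op_smooth0 f w N : BC f -> Op nu f w -> 0 < N -> wint (fun x => f x * f x) <= N ^+ 2 ->
  forall x, 0 < x < 1 -> `|w x| <= N / Num.sqrt (2 * nu + 2) * powR x (- Num.max nu 0).
Proof.
move=> bf [P [K [dP hP dw w1]]] N0 hN.
have [cf2 [B2 bf2]] := BC_M bf bf; have [P2 [dP2 hP2 iP2]] := wprim Hnu cf2 bf2.
apply: (Op_decay dw w1); first by rewrite le_max lexx orbT.
move=> x hx; have [x0 x1] := andP hx.
have P2_le : P2 x <= N ^+ 2.
  apply: le_trans hN; rewrite iP2; apply: (@der_nondecr _ x 1 P2 (fun t => f t * f t * weight nu t) (ltW x1)).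
    by move=> t /andP[xt _]; apply: dP2; exact: lt_le_trans xt.
  by move=> t /andP[xt _]; rewrite mulr_ge0 ?(ltW (w_gt0 (lt_le_trans x0 xt)))// -expr2 sqr_ge0.
have wX0 t : 0 < t -> 0 < wX t by move=> t0; rewrite divr_gt0// mulr_gt0// w_gt0.
pose r := Num.sqrt (wX x); have r0 : 0 < r by rewrite sqrtr_gt0 wX0.
have r2 : r ^+ 2 = wX x by rewrite sqr_sqrtr// ltW// wX0.
(* Cauchy-Schwarz: 2 |f| <= (r / N) f^2 + N / r *)
have hPx : `|2 * P x| <= r / N * P2 x + N / r * wX x.
  apply: (@dom0 _ (fun x => 2 * P x) (fun x => r / N * P2 x + N / r * wX x)
    (fun x => 2 * (f x * weight nu x)) (fun x => r / N * (f x * f x * weight nu x) + N / r * weight nu x) 0 x x0).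
  - by move=> t /andP[t0 _]; apply: (der_eq (derM (der_cst 2 t) (dP t t0))); ring.
  - move=> t /andP[t0 _].
    by apply: (der_eq (derD (derM (der_cst _ t) (dP2 t t0)) (derM (der_cst _ t) (wX_der Hnu t0)))); ring.
  - move=> t /andP[t0 _]; have wt := w_gt0 t0.
    have -> : r / N * (f t * f t * weight nu t) + N / r * weight nu t = (r / N * f t ^+ 2 + N / r) * weight nu t by ring.
    rewrite mulrA normrM (gtr0_norm wt) ler_wpM2r ?(ltW wt)// normrM ger0_norm//.
    have k0 : 0 < r / N by nng.
    have -> : N / r = (r / N)^-1 by rewrite invf_div.
    rewrite -(real_normK (num_real (f t))); move: (r / N) `|f t| k0 => k y k0.
    rewrite -subr_ge0; have -> : k * y ^+ 2 + k^-1 - 2 * y = k * (y - k^-1) ^+ 2 by field; rewrite gt_eqF.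
    by nng.
  - move=> e e0.
    have e40 : 0 < e / 4 by nng.
    have [d1 d10 h1] := wX_small Hnu K e40; have [d2 d20 h2] := wX_small Hnu (r / N * B2) e40.
    exists (Num.min (Num.min d1 d2) 1); first by rewrite !lt_min d10 d20 ltr01.
    move=> t /andP[t0]; rewrite !lt_min => /andP[/andP[t1 t2] t3].
    have hh : 0 < t <= 1 by rewrite t0 ltW.
    have wt := ltW (wX0 t t0); split.
      have q := h1 t ltac:(by rewrite t0 t1); have q' := hP t hh.
      have q2 : K * wX t <= `|K| * wX t by rewrite ler_wpM2r// ler_norm.
      by rewrite normrM ger0_norm//; move: q q' q2 e0; lra.
    have q := h2 t ltac:(by rewrite t0 t2); have := hP2 t hh; rewrite ler_norml => /andP[q' _].
    have q2 : r / N * B2 * wX t <= `|r / N * B2| * wX t by rewrite ler_wpM2r// ler_norm.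
    have q3 : r / N * - (B2 * wX t) <= r / N * P2 t by rewrite ler_wpM2l// divr_ge0// ltW.
    have q4 : 0 <= N / r * wX t by nng.
    by move: q q2 q3 q4 e0; lra.
have hP3 : `|P x| <= N * r.
  have : r / N * P2 x <= r / N * N ^+ 2 by rewrite ler_wpM2l// divr_ge0// ltW.
  have -> : r / N * N ^+ 2 = N * r by field; rewrite gt_eqF.
  have : N / r * wX x = N * r by rewrite -r2; field; rewrite gt_eqF.
  by move: hPx; rewrite normrM ger0_norm//; lra.
rewrite normrM normfV (gtr0_norm (w_gt0 x0)) ler_pdivrMr ?w_gt0// (le_trans hP3)//.
rewrite -!mulrA ler_wpM2l ?(ltW N0)//.
have -> : r = (Num.sqrt (2 * nu + 2))^-1 * powR x (nu + 1).
  rewrite /r /wX xweight// sqrtrM ?powR_ge0// sqrtrV ?(ltW n1)// mulrC; congr (_ * _).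
  rewrite -powR12_sqrt ?powR_ge0// -powRrM; congr powR; lra.
rewrite ler_wpM2l ?invr_ge0 ?sqrtr_ge0//.
rewrite /weight -powRD ?(gt_eqF x0) ?implybT//; apply: ger_powR; first by rewrite x0 ltW.
have h : nu <= Num.max nu 0 by rewrite le_max lexx.
by lra.
Qed.

(** The flux of [x^-al] has size [x^(2 nu + 2 - al)]; dividing by the weight gains one power of
    [x]. *)
Lemma Op_smoothS f w B al : 0 <= al -> al <= nu + 1 -> 0 <= B -> Op nu f w ->
  (forall x, 0 < x < 1 -> `|f x| <= B * powR x (- al)) ->
  forall x, 0 < x < 1 -> `|w x| <= B / (nu + 1) * powR x (- Num.max (al - 1) 0).
Proof.
move=> al0 aln B0 [P [K [dP hP dw w1]]] hf.
apply: (Op_decay dw w1); first by rewrite le_max lexx orbT.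
move=> x hx; have [x0 x1] := andP hx.
have g0 : 0 < 2 * nu + 2 - al by move: n1; lra.
have nn : 0 < nu + 1 by move: Hnu; lra.
have hPx : `|P x| <= B / (2 * nu + 2 - al) * powR x (2 * nu + 2 - al).
  apply: (@flux_le _ nu Hnu f P K (fun x => B * powR x (- al)) (fun x => B / (2 * nu + 2 - al) * powR x (2 * nu + 2 - al)) x x0 dP hP).
  - move=> t t0; apply: (der_eq (derM (der_cst _ t) (@der_powR _ _ (2 * nu + 2 - al) _ _ t0 (der_id t)))).
    rewrite mul0r add0r mulr1 mulrA divfK ?gt_eqF// -mulrA; congr (_ * _).
    rewrite /weight -powRD ?(gt_eqF t0) ?implybT//; congr powR; ring.
  - by move=> t t0; rewrite mulr_ge0 ?powR_ge0// divr_ge0// ltW.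
  - by move=> t /andP[t0 tx]; apply: hf; rewrite t0 (lt_trans tx).
rewrite normrM normfV (gtr0_norm (w_gt0 x0)) ler_pdivrMr ?w_gt0// (le_trans hPx)//.
apply: (@le_trans _ _ (B / (nu + 1) * powR x (2 * nu + 2 - al))).
  by rewrite ler_wpM2r ?powR_ge0// ler_wpM2l// lef_pV2 ?posrE//; lra.
rewrite -[leRHS]mulrA ler_wpM2l ?divr_ge0 ?(ltW nn)//.
rewrite /weight -powRD ?(gt_eqF x0) ?implybT//; apply: ger_powR; first by rewrite x0 ltW.
have h : al - 1 <= Num.max (al - 1) 0 by rewrite le_max lexx.
by lra.
Qed.

(** The power method controls errors in the mean square, whereas [Op_stable] needs them in the
    supremum norm. A number of applications depending on [nu] alone removes the singularity [x^-nu]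
    left by the first one. *)
Lemma Op_smooth : exists q (C : R), 0 < C /\ forall (e : nat -> R -> R) N, BC (e 0%N) ->
  (forall k, Op nu (e k) (e k.+1)) -> 0 < N -> wint (fun x => e 0%N x * e 0%N x) <= N ^+ 2 ->
  forall x, 0 < x < 1 -> `|e q x| <= C * N.
Proof.
have nn : 0 < nu + 1 by move: Hnu; lra.
pose c k := (Num.sqrt (2 * nu + 2))^-1 * (nu + 1)^-1 ^+ k.
have main k : forall (e : nat -> R -> R) N, BC (e 0%N) ->
  (forall k, Op nu (e k) (e k.+1)) -> 0 < N -> wint (fun x => e 0%N x * e 0%N x) <= N ^+ 2 ->
  forall x, 0 < x < 1 -> `|e k.+1 x| <= c k * N * powR x (- Num.max (nu - k%:R) 0).
  move=> e N b0 oe N0 hN; elim: k => [|k ih] x hx.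
    rewrite subr0 /c expr0 mulr1 mulrC [X in _ <= X](_ : _ = N / Num.sqrt (2 * nu + 2) * powR x (- Num.max nu 0)); last by ring.
    exact: (Op_smooth0 b0 (oe 0%N) N0 hN).
  have c0 : 0 <= c k * N.
    by nng.
  have m0 : 0 <= Num.max (nu - k%:R) 0 by rewrite le_max lexx orbT.
  have m1 : Num.max (nu - k%:R) 0 <= nu + 1.
    by rewrite ge_max (ltW nn) andbT; have : 0 <= k%:R :> R by []; move: (k%:R) => u; lra.
  have := Op_smoothS m0 m1 c0 (oe k.+1) ih hx; set M' := Num.max (_ - 1) 0.
  have -> : M' = Num.max (nu - k.+1%:R) 0.
    rewrite /M' -natr1; have [h|h] := leP (nu - k%:R) 0.
      rewrite !max_r//; lra.
    by congr Num.max; ring.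
  by move=> h; apply: (le_trans h); rewrite /c exprSr; apply: eq_ler; ring.
exists (Num.bound `|nu|).+1, (c (Num.bound `|nu|)); split.
  by rewrite mulr_gt0 ?invr_gt0 ?sqrtr_gt0 ?exprn_gt0 ?invr_gt0.
move=> e N b0 oe N0 hN x hx; have := main (Num.bound `|nu|) e N b0 oe N0 hN x hx.
rewrite max_r ?oppr0 ?powRr0 ?mulr1//.
by rewrite subr_le0 (le_trans (ler_norm nu))// ltW// archi_boundP.
Qed.

End Smoothing.

Section Completeness.
Context {R : realType}.
Variables (nu : R) (s : nat -> R).
Hypothesis Hnu : -1 < nu.
Hypothesis Hz : bessel_zeros nu s.
Implicit Types (f g w : R -> R) (x y t B K N e : R) (k q m j : nat).
Local Notation wint := (wint nu).

Lemma bernoulli x k : 0 <= x -> 1 + k%:R * x <= (1 + x) ^+ k.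
Proof.
move=> x0; elim: k => [|k ih]; first by rewrite mul0r addr0.
rewrite exprS (le_trans _ (ler_wpM2l _ ih)) ?addr_ge0// -natr1 -subr_ge0.
have -> : (1 + x) * (1 + k%:R * x) - (1 + (k%:R + 1) * x) = k%:R * (x * x) by ring.
by nng.
Qed.

(* Power method for the positive operator [G = L^{-1}] on the orthogonal complement of the
   eigenfunctions: the ratios [a m.+1 / a m] increase to some [rho > 0], and [sqrt rho] would be an
   approximate eigenvalue of [G], which [Op_stable] excludes. *)
Theorem completeness g : BC g -> (forall j, wint (fun x => g x * ph nu (s j ^+ 2) x) = 0) ->
  forall x, 0 < x < 1 -> g x = 0.
Proof.
move=> bg orth.
pose Gop f := xget (fun=> 0) [set w | Op nu f w].
have GopP f : BC f -> Op nu f (Gop f).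
  by move=> bf; rewrite /Gop; case: xgetP => // /(_ _) h; have [w /h] := Op_ex Hnu bf.
pose G k := iter k Gop g.
have bG k : BC (G k) by elim: k => [//|k ih]; exact: (Op_BC Hnu ih (GopP _ ih)).
have oG k : Op nu (G k) (G k.+1) by exact: GopP.
pose a m := wint (fun x => G m x * G m x).
have b2 k k' : BC (fun x => G k x * G k' x) by exact: BC_M.
have sq0 m x : 0 < x < 1 -> 0 <= G m x * G m x by rewrite -expr2 sqr_ge0.
have a_ge0 m : 0 <= a m by exact: wint_ge0 (sq0 m).
have a_zero m : a m = 0 -> forall x, 0 < x < 1 -> G m x = 0.
  move=> am x hx; have [c [B b]] := b2 m m.
  by have /eqP := wint_zero Hnu c b (sq0 m) am hx; rewrite mulf_eq0 orbb => /eqP.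
have [/eqP a00|a0] := boolP (a 0%N == 0); first exact: a_zero 0%N a00.
exfalso.
have a_gt0 m : 0 < a m.
  rewrite lt_neqAle eq_sym a_ge0 andbT; elim: m => [//|m ih]; apply: contraNN ih => /eqP am.
  have z := Op_inj (oG m) (a_zero _ am); apply/eqP; rewrite /a.
  have -> : wint (fun x => G m x * G m x) = wint (fun x => 0 * (G m x * G m x)).
    by apply: eq_wint => x hx; rewrite z// !mul0r.
  by rewrite (wintZ 0 (BC_wi Hnu (b2 m m))) mul0r.
have mid m : wint (fun x => G m.+2 x * G m x) = a m.+1.
  by rewrite -(Op_sym Hnu (bG m) (bG m.+1) (oG m) (oG m.+1)).
have quad m (t u v : R) : wint (fun x => (t * G m x + u * G m.+1 x + v * G m.+2 x) ^+ 2) =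
    t ^+ 2 * a m + u ^+ 2 * a m.+1 + v ^+ 2 * a m.+2 + 2 * t * v * a m.+1
    + 2 * t * u * wint (fun x => G m.+1 x * G m x) + 2 * u * v * wint (fun x => G m.+2 x * G m.+1 x).
  have -> : (fun x => (t * G m x + u * G m.+1 x + v * G m.+2 x) ^+ 2) = fun x =>
    t ^+ 2 * (G m x * G m x) + (u ^+ 2 * (G m.+1 x * G m.+1 x) + (v ^+ 2 * (G m.+2 x * G m.+2 x) +
     (2 * t * v * (G m.+2 x * G m x) + (2 * t * u * (G m.+1 x * G m x) + 2 * u * v * (G m.+2 x * G m.+1 x))))).
    by apply/funext => x; ring.
  have z k k' K : BC (fun x => K * (G k x * G k' x)) by exact: BC_Z.
  rewrite !wint_lin ?mid//; do ?[exact: z | exact: b2 | apply: BC_D].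
  rewrite (wintZ _ (BC_wi Hnu (b2 m.+2 m.+1))) /a; ring.
(* Cauchy-Schwarz, [a m.+1] being also the pairing of [G m.+2] with [G m]. It makes the ratios
   increase. *)
have cs m : a m.+1 ^+ 2 <= a m * a m.+2.
  pose t := a m.+1 / a m.
  have : 0 <= wint (fun x => (- t * G m x + 0 * G m.+1 x + 1 * G m.+2 x) ^+ 2).
    by apply: wint_ge0 => x _; exact: sqr_ge0.
  rewrite quad => h; have am := a_gt0 m; rewrite -ler_pdivrMl//; rewrite -subr_ge0; apply: le_trans h _.
  by apply: eq_ler; rewrite /t; field; rewrite gt_eqF.
pose rho m := a m.+1 / a m.
have rho_gt0 m : 0 < rho m by nng.
have rho_incr m : rho m <= rho m.+1.
  by rewrite ler_pdivrMr// mulrAC ler_pdivlMr// -expr2 mulrC.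
have rho_mono m k : rho m <= rho (m + k)%N.
  elim: k => [|k ih]; first by rewrite addn0.
  by rewrite addnS (le_trans ih).
have a_grow m k : a m * rho m ^+ k <= a (m + k)%N.
  elim: k => [|k ih]; first by rewrite addn0 expr0 mulr1.
  have -> : a (m + k.+1)%N = a (m + k)%N * rho (m + k)%N by rewrite /rho mulrC divfK ?gt_eqF// addnS.
  rewrite exprSr mulrA; apply: ler_pM => //; last exact: ltW.
  by apply: mulr_ge0 => //; exact/exprn_ge0/ltW.
have n1 : 0 < 2 * nu + 2 by move: Hnu; lra.
have [_ [B0 hB0]] := bg.
have B00 : 0 <= B0 by apply: le_trans (normr_ge0 _) (hB0 (1 / 2) _); apply/andP; split; lra.
have Gb k : bdd (G k) (B0 * (2 * nu + 2)^-1 ^+ k).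
  elim: k => [|k ih]; first by rewrite expr0 mulr1.
  rewrite exprSr mulrA; apply: (Op_bdd Hnu (oG k) _ ih).
  by nng.
pose c := (2 * nu + 2)^-1 ^+ 2; have c0 : 0 < c by nng.
pose W1 := wint (fun=> 1).
have W10 : 0 <= W1 by exact: wint_ge0.
have a_le k : a k <= B0 ^+ 2 * W1 * c ^+ k.
  have bb : bdd (fun x => G k x * G k x) (B0 ^+ 2 * c ^+ k).
    move=> x hx; rewrite normrM (le_trans (ler_pM _ _ (Gb k x hx) (Gb k x hx)))//.
    by rewrite /c -exprM mulnC exprM; apply: eq_ler; ring.
  by have := wint_abs Hnu (b2 k k) bb; rewrite -/W1 => h; rewrite (le_trans (ler_norm _))// (le_trans h)//; apply: eq_ler; ring.
(* A ratio above [c] would persist, since the ratios increase, and [a] would outgrow the geometric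
   bound [a_le]. *)
have rho_le m : rho m <= c.
  rewrite leNgt; apply/negP => h; pose x := rho m / c - 1.
  have x0 : 0 < x by rewrite subr_gt0 ltr_pdivlMr// mul1r.
  pose A := B0 ^+ 2 * W1 * c ^+ m / a m.
  have hk k : 1 + k%:R * x <= A.
    apply: (le_trans (bernoulli k (ltW x0))); rewrite /x [1 + _]addrC subrK expr_div_n.
    have ck : 0 < c ^+ k by exact: exprn_gt0.
    rewrite ler_pdivrMr// -(ler_pM2l (a_gt0 m)) mulrA.
    have -> : a m * A = B0 ^+ 2 * W1 * c ^+ m by rewrite /A mulrC divfK// gt_eqF.
    by rewrite (le_trans (a_grow m k))// (le_trans (a_le _))// exprD mulrA.
  have A0 : 0 <= A / x by rewrite divr_ge0 ?(ltW x0)// (le_trans _ (hk 0%N))// mul0r addr0.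
  have := archi_boundP A0; rewrite ltr_pdivrMr// => h1.
  by have := hk (Num.bound (A / x)); lra.
pose S := [set rho m | m in setT].
have hS : has_sup S by split; [exists (rho 0%N); exists 0%N|exists c => _ [m _ <-]].
pose rh := sup S.
have rh_ge m : rho m <= rh by apply: ub_le_sup; [case: hS|exists m].
have rh0 : 0 < rh by exact: lt_le_trans (rho_gt0 0%N) (rh_ge 0%N).
pose mu := Num.sqrt rh; have mu0 : 0 < mu by rewrite sqrtr_gt0.
have mu2 : mu ^+ 2 = rh by rewrite sqr_sqrtr// ltW.
pose lam := mu^-1; have lam0 : 0 < lam by nng.
have horth m : ph nu lam 1 = 0 -> wint (fun x => G m x * ph nu lam x) = 0.
  move=> p1; have [j sj] : exists j, s j = Num.sqrt lam.
    have [_ _ _ h] := Hz; apply: h; first by rewrite sqrtr_gt0.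
    rewrite besselJE ?sqrtr_gt0// sqr_sqrtr ?(ltW lam0)//.
    by move: p1; rewrite /ph expr1n mulr1 => ->; rewrite mulr0.
  have lE : lam = s j ^+ 2 by rewrite sj sqr_sqrtr// ltW.
  elim: m => [|m ih]; first by rewrite lE; exact: orth.
  rewrite (Op_sym Hnu (bG m) (ph_BC Hnu lam) (oG m) (Op_ph Hnu (lt0r_neq0 lam0) p1)).
  have -> : wint (fun x => lam^-1 * ph nu lam x * G m x) = wint (fun x => lam^-1 * (G m x * ph nu lam x)).
    by apply: eq_wint => x _; ring.
  by rewrite (wintZ _ (BC_wi Hnu (BC_M (bG m) (ph_BC Hnu lam)))) ih mulr0.
have [q [Cs [Cs0 hs]]] := Op_smooth Hnu.
have [Ct Ct0 ht] := Op_stable Hnu lam0.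
pose C3 := (Ct + 1) * Cs / mu; have C30 : 0 <= C3 by nng.
(* With [G] for the operator, [rh - G^2 = (mu - G) (mu + G)]. If [(rh - G^2) G^m g] is small in the
   mean square, [q] more applications make it uniformly small, and then [Op_stable] makes
   [v = (mu + G) G^(m+q) g] small. As [G] is positive, the square norm of [v] is at least
   [rh * a (m + q)]. *)
have key m N : 0 < N -> wint (fun x => (rh * G m x + 0 * G m.+1 x + -1 * G m.+2 x) ^+ 2) <= N ^+ 2 ->
    rh * a (m + q)%N <= (C3 * N) ^+ 2 * W1.
  move=> N0 hN.
  pose e k := fun x => rh * G (m + k)%N x + -1 * G (m + k).+2 x.
  have oe k : Op nu (e k) (e k.+1).
    rewrite /e !addnS; apply: Op_lin (oG _) _.
    have := Op_lin (-1) (oG (m + k).+2) (_ : Op nu (fun=> 0) (fun=> 0)).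
    have z : Op nu (fun=> 0) (fun=> 0).
      exists (fun=> 0), 0; split => //.
      - by move=> x _; rewrite mul0r; exact: der_cst.
      - by move=> x _; rewrite normr0 mul0r.
      - by move=> x _; rewrite mul0r oppr0; exact: der_cst.
    move=> /(_ z); congr (Op nu _ _); apply/funext => x; rewrite addr0//.
  have be : BC (e 0%N) by apply: BC_D; apply: BC_Z; exact: bG.
  have he : wint (fun x => e 0%N x * e 0%N x) <= N ^+ 2.
    apply: le_trans hN; apply: eq_ler; apply: eq_wint => x _; rewrite /e addn0; ring.
  have hE := hs e N be oe N0 he.
  pose v x := mu * G (m + q)%N x + G (m + q).+1 x.
  pose w x := mu * G (m + q).+1 x + G (m + q).+2 x.
  have ov : Op nu v w by exact: Op_lin.
  have bv : BC v by apply: BC_D => //; exact: BC_Z.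
  have eE x : lam^-1 * v x - w x = e q x.
    by rewrite /lam invrK /v /w /e -mu2; ring.
  have CN : 0 < Cs * N by nng.
  have hw := ht v w (Cs * N) bv ov CN; have {}hw : bdd w (Ct * (Cs * N)).
    apply: hw; first by move=> x hx; rewrite eE; exact: hE.
    move=> p1; have -> : (fun x => w x * ph nu lam x) = fun x =>
       mu * (G (m + q).+1 x * ph nu lam x) + G (m + q).+2 x * ph nu lam x by apply/funext => x; rewrite /w; ring.
    by rewrite wint_lin ?horth ?mulr0 ?addr0//; apply: BC_M => //; exact: ph_BC.
  have hv : bdd (fun x => v x * v x) ((C3 * N) ^+ 2).
    move=> x hx; have h1 : `|v x| <= C3 * N.
      have -> : v x = (w x + e q x) / mu by rewrite -eE /lam invrK; field; rewrite gt_eqF.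
      rewrite normrM normfV (gtr0_norm mu0) ler_pdivrMr// (le_trans (ler_normD _ _))//.
      apply: (le_trans (lerD (hw x hx) (hE x hx))); apply: eq_ler; rewrite /C3; field; rewrite gt_eqF//.
    by rewrite normrM expr2 ler_pM.
  have := wint_abs Hnu (BC_M bv bv) hv; rewrite -/W1; apply: le_trans; apply: le_trans (ler_norm _).
  have -> : wint (fun x => v x * v x) = wint (fun x => (mu * G (m + q)%N x + 1 * G (m + q).+1 x + 0 * G (m + q).+2 x) ^+ 2).
    by apply: eq_wint => x _; rewrite /v; ring.
  rewrite quad mu2; have p := Op_pos Hnu (bG (m + q)%N) (oG (m + q)%N).
  have p1 := ltW (a_gt0 (m + q).+1).
  have p2 : 0 <= mu * wint (fun x => G (m + q).+1 x * G (m + q)%N x) by nng.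
  by clear -p1 p2; lra.
pose D := C3 ^+ 2 * W1 * (2 * rh + 1); have D0 : 0 <= D.
  by nng.
(* For [rho m] within [eps] of its supremum, [key] bounds [rh * a (m + q)] by [D * eps * a m], while
   growth of [a] bounds it below by [rh * rho 0 ^+ q * a m], which is [(D + 1) * eps * a m]. *)
pose eps := rh * rho 0%N ^+ q / (D + 1); have eps0 : 0 < eps.
  by rewrite divr_gt0 ?mulr_gt0 ?exprn_gt0// ltr_wpDl.
have [_ [m _ <-] hm] := sup_adherent eps0 hS.
have am := a_gt0 m.
pose N := Num.sqrt ((2 * rh + 1) * eps * a m).
have q1 : 0 < 2 * rh + 1 by rewrite ltr_wpDl ?mulr_ge0// ltW.
have N20 : 0 < (2 * rh + 1) * eps * a m by nng.
have N0 : 0 < N by rewrite sqrtr_gt0.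
have N2 : N ^+ 2 = (2 * rh + 1) * eps * a m by rewrite sqr_sqrtr// ltW.
have := key m N N0 _; rewrite quad N2 => /(_ _) hkey.
have {hkey} : rh * a (m + q)%N <= (C3 * N) ^+ 2 * W1.
  apply: hkey; have h1 : a m.+1 = rho m * a m by rewrite divfK// gt_eqF.
  have h2 : a m.+2 <= rh * (rho m * a m).
    by rewrite -h1 -ler_pdivrMr//; exact: rh_ge.
  have h3 : rho m * a m <= rh * a m by rewrite ler_wpM2r ?rh_ge// ltW.
  have h4 : rh * (rho m * a m) <= rh * (rh * a m) by rewrite ler_wpM2l// ltW.
  have h5 : (rh - rho m) * a m <= eps * a m by rewrite ler_wpM2r ?(ltW am)//; move: hm; rewrite -/rh; lra.
  have h6 : rh * ((rh - rho m) * a m) <= rh * (eps * a m) by rewrite ler_wpM2l// ltW.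
  have h7 : 0 <= eps * a m by nng.
  rewrite h1; move: h2 h4 h6 h7; nra.
rewrite exprMn N2 => hk.
have g1 : rh * (a m * rho 0%N ^+ q) <= D * eps * a m.
  apply: le_trans (_ : rh * a (m + q)%N <= _); last by apply: (le_trans hk); rewrite /D; apply: eq_ler; ring.
  rewrite ler_wpM2l ?(ltW rh0)// (le_trans _ (a_grow m q))// ler_wpM2l ?(ltW am)//.
  by rewrite lerXn2r ?nnegrE ?(ltW (rho_gt0 _))//; have := rho_mono 0%N m; rewrite add0n.
have : rh * rho 0%N ^+ q <= D * eps.
  by rewrite -(ler_pM2r am) mulrAC; apply: le_trans g1; apply: eq_ler; ring.
have -> : rh * rho 0%N ^+ q = (D + 1) * eps by rewrite /eps [RHS]mulrC divfK// gt_eqF// ltr_wpDl.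
by rewrite mulrDl mul1r; lra.
Qed.

End Completeness.

(** * Green functions *)

Section Green.
Context {R : realType}.
Variable nu : R.
Hypothesis Hnu : -1 < nu.
Implicit Types (f g P : R -> R) (x y t b B K e l : R).

Let n1 : 0 < 2 * nu + 2. Proof. by move: Hnu; lra. Qed.
Let w_gt0 x : 0 < x -> 0 < weight nu x. Proof. exact: weight_gt0. Qed.

Local Notation phi b := (ph nu (- b ^+ 2)).

Lemma phi_ge1 b x : 1 <= phi b x.
Proof. by apply: bes_ge1 => //; rewrite mulNr oppr_le0 mulr_ge0 ?sqr_ge0. Qed.

Let phi_gt0 b x : 0 < phi b x. Proof. by apply: lt_le_trans (phi_ge1 b x). Qed.

Lemma phi1_ge0 b x : 0 <= x -> 0 <= ph1 nu (- b ^+ 2) x.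
Proof.
move=> x0; rewrite /ph1 !mulNr opprK mulr_ge0//.
  by apply: divr_ge0; apply: mulr_ge0 => //; [exact: sqr_ge0|exact/ltW/nu1_gt0].
apply: ltW; apply: (@lt_le_trans _ _ 1) => //; apply: bes_ge1; first by move: Hnu; lra.
by rewrite oppr_le0 mulr_ge0 ?sqr_ge0.
Qed.

Lemma phi_mono b x y : 0 <= x -> x <= y -> phi b x <= phi b y.
Proof.
move=> x0 xy; apply: (@der_nondecr _ x y (phi b) (ph1 nu (- b ^+ 2))) => // t /andP[xt _].
  exact: ph_der.
by apply: phi1_ge0; exact: le_trans xt.
Qed.

(** Reduction of order: [phi b] times an antiderivative of [1 / (weight phi^2)] is a second
    solution. Normalized to vanish at [1], it is [chi], and the Wronskian of the two is a multiple
    of [1 / weight]. *)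
Definition gsol b : R -> R :=
  xget (fun=> 0) [set F | forall x, 0 < x -> der F x (weight nu x * phi b x ^+ 2)^-1].

Lemma gsol_der b x : 0 < x -> der (gsol b) x (weight nu x * phi b x ^+ 2)^-1.
Proof.
have c : posc (fun x => (weight nu x * phi b x ^+ 2)^-1).
  move=> t t0; apply: continuousV; first by rewrite gt_eqF// mulr_gt0 ?exprn_gt0 ?w_gt0.
  apply: continuousM; first exact: weight_cont.
  by apply: continuousM; apply: (der_cont (ph_der _ t Hnu)).
have [F hF] := antideriv c.
have : [set F | forall x, 0 < x -> der F x (weight nu x * phi b x ^+ 2)^-1] F by [].
move=> h; exact: (xgetPex (fun=> 0) (ex_intro _ F h)).
Qed.

Definition chi b x := phi b x * (gsol b 1 - gsol b x).
Definition chi1 b x := ph1 nu (- b ^+ 2) x * (gsol b 1 - gsol b x) - (weight nu x * phi b x)^-1.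

Lemma chi_der b x : 0 < x -> der (chi b) x (chi1 b x).
Proof.
move=> x0; apply: (der_eq (derM (ph_der (- b ^+ 2) x Hnu) (derB (der_cst (gsol b 1) x) (gsol_der b x0)))).
rewrite /chi1; have W := w_gt0 x0; have F := phi_gt0 b x.
move: (gsol b 1 - _) (ph1 _ _ _) W F; move: (weight _ _) (phi b x) => W F A B W0 F0.
by field; rewrite !gt_eqF.
Qed.

Lemma chi_flux b x : 0 < x -> der (fun x => weight nu x * chi1 b x) x (b ^+ 2 * weight nu x * chi b x).
Proof.
move=> x0.
have h : der (fun x => weight nu x * ph1 nu (- b ^+ 2) x * (gsol b 1 - gsol b x) - (phi b x)^-1) x
    (b ^+ 2 * weight nu x * chi b x).
  have F := phi_gt0 b x; have W := w_gt0 x0.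
  apply: (der_eq (derB (derM (ph_flux (- b ^+ 2) Hnu x0) (derB (der_cst (gsol b 1) x) (gsol_der b x0))) (derV (lt0r_neq0 F) (ph_der _ x Hnu)))).
  rewrite /chi; move: (gsol b 1 - _) (ph1 _ _ _) W F; move: (weight _ _) (phi b x) => W F A B W0 F0.
  by field; rewrite !gt_eqF.
apply: (@der_congr_lt _ _ _ x _ 0 x0 _ h) => t t0.
by rewrite /chi1; have := phi_gt0 b t; have := w_gt0 t0; move: (weight _ _) (phi b t) => W F W0 F0; field; rewrite !gt_eqF.
Qed.

Lemma gsol_le b x y : 0 < x -> x <= y -> gsol b x <= gsol b y.
Proof.
move=> x0 xy; apply: (@der_nondecr _ x y _ (fun x => (weight nu x * phi b x ^+ 2)^-1)) => // t /andP[xt _].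
  by apply: gsol_der; exact: lt_le_trans xt.
by rewrite invr_ge0 mulr_ge0 ?exprn_ge0 ?(ltW (phi_gt0 _ _))// ltW// w_gt0//; exact: lt_le_trans xt.
Qed.

Definition green b x y := phi b (Num.min x y) * chi b (Num.max x y).

Lemma greenC b x y : green b x y = green b y x.
Proof. by rewrite /green minC maxC. Qed.

Lemma green_BC b y : 0 < y < 1 -> BC (fun x => green b x y).
Proof.
move=> /andP[y0 y1]; split.
  move=> x x0; apply: continuousM.
    apply: (@continuous_comp _ _ _ (fun x => Num.min x y) (phi b)).
      by apply: (@continuous_min _ _ (fun x => x) (fun=> y)); [exact: cvg_id|exact: cvg_cst].
    by apply: der_cont (ph_der _ _ Hnu).
  apply: (@continuous_comp _ _ _ (fun x => Num.max x y) (chi b)).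
    by apply: (@continuous_max _ _ (fun x => x) (fun=> y)); [exact: cvg_id|exact: cvg_cst].
  by apply: der_cont (chi_der _ _); rewrite lt_max x0.
exists (phi b 1 * (phi b 1 * (gsol b 1 - gsol b y))) => x /andP[x0 x1].
have m1 : Num.max x y <= 1 by rewrite ge_max !ltW.
have m0 : 0 < Num.max x y by rewrite lt_max x0.
have ym : y <= Num.max x y by rewrite le_max lexx orbT.
have G0 : 0 <= gsol b 1 - gsol b (Num.max x y) by rewrite subr_ge0 gsol_le.
rewrite /green /chi !normrM (gtr0_norm (phi_gt0 _ _)) (gtr0_norm (phi_gt0 _ _)) (ger0_norm G0).
apply: ler_pM; rewrite ?mulr_ge0 ?(ltW (phi_gt0 _ _))//.
  by apply: phi_mono; [rewrite le_min !ltW|rewrite ge_min (ltW x1)].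
apply: ler_pM; rewrite ?(ltW (phi_gt0 _ _))//.
  by apply: phi_mono => //; exact: ltW.
by rewrite lerD2l lerN2 gsol_le.
Qed.

(** On either side of [y] the integrand is the derivative of a flux [Q1] or [Q2], a Wronskian with
    [ph nu l]. The boundary terms vanish at [0] by regularity and at [1] because both functions do;
    the jump at [y] is the Wronskian of [phi] and [chi]. These pairings with eigenfunctions identify
    the resolvent series. *)
Lemma green_eig b l y : 0 < y < 1 -> 0 < l + b ^+ 2 -> ph nu l 1 = 0 ->
  wint nu (fun x => green b x y * ph nu l x) = ph nu l y / (l + b ^+ 2).
Proof.
move=> hy lb hl; have [y0 y1] := andP hy; set D := l + b ^+ 2.
have DN : D != 0 by rewrite gt_eqF.
have [cG [B bG]] := BC_M (green_BC b hy) (ph_BC Hnu l).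
have [P [dP hP ->]] := wprim Hnu cG bG.
pose Q1 x := chi b y / D * (weight nu x * ph1 nu (- b ^+ 2) x * ph nu l x - weight nu x * ph1 nu l x * phi b x).
pose Q2 x := phi b y / D * (weight nu x * chi1 b x * ph nu l x - weight nu x * ph1 nu l x * chi b x).
have dQ1 x : 0 < x -> der Q1 x (chi b y * phi b x * ph nu l x * weight nu x).
  move=> x0; apply: (der_eq (derM (der_cst _ x) (derB (derM (ph_flux (- b ^+ 2) Hnu x0) (ph_der l x Hnu)) (derM (ph_flux l Hnu x0) (ph_der (- b ^+ 2) x Hnu))))).
  by rewrite /D; move: (ph1 _ _ _) (ph1 _ _ _) => A A'; field.
have dQ2 x : 0 < x -> der Q2 x (phi b y * chi b x * ph nu l x * weight nu x).
  move=> x0; apply: (der_eq (derM (der_cst _ x) (derB (derM (chi_flux b x0) (ph_der l x Hnu)) (derM (ph_flux l Hnu x0) (chi_der b x0))))).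
  by rewrite /D; move: (ph1 _ _ _) (chi1 _ _) => A A'; field.
have e1 : P y = Q1 y.
  apply/eqP; rewrite -subr_eq0 -normr_le0.
  have [K1 K10 hK1] := ph1_le Hnu (- b ^+ 2); have [K2 K20 hK2] := ph1_le Hnu l.
  have [_ [M1 bM1]] := ph_BC Hnu l; have [_ [M2 bM2]] := ph_BC Hnu (- b ^+ 2).
  pose K := `|B| / (2 * nu + 2) + `|chi b y / D| * (K1 * M1 + K2 * M2).
  apply: (@dom0 _ (fun x => P x - Q1 x) (fun=> 0) (fun=> 0) (fun=> 0) K y y0) => //.
  - move=> x /andP[x0 xy]; apply: (der_eq (derB (dP x x0) (dQ1 x x0))).
    by rewrite /green min_l// max_r//; ring.
  - by move=> x _; exact: der_cst.
  - by move=> x _; rewrite normr0.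
  move=> e e0; have [d d0 hd] := xw_small2 Hnu K e0; exists (Num.min d 1).
    by rewrite lt_min d0 ltr01.
  move=> x; rewrite lt_min => /andP[x0 /andP[xd x1]]; rewrite add0r (ltW e0); split => //.
  apply: le_trans (hd x _); last by rewrite x0.
  have x01 : 0 < x < 1 by rewrite x0.
  have x01' : 0 < x <= 1 by rewrite x0 ltW.
  have xw : 0 <= x * weight nu x by nng.
  have a1 : `|P x| <= `|B| / (2 * nu + 2) * (x * weight nu x).
    apply: (le_trans (hP x x01')); have -> : B * wX nu x = B * ((2 * nu + 2)^-1 * (x * weight nu x)) by rewrite /wX; ring.
    by rewrite -[leRHS]mulrA ler_wpM2r ?ler_norm// mulr_ge0// invr_ge0 ltW.
  have a2 : `|weight nu x * ph1 nu (- b ^+ 2) x * ph nu l x| <= (K1 * M1) * (x * weight nu x).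
    rewrite 2!normrM (gtr0_norm (w_gt0 x0)).
    have -> : K1 * M1 * (x * weight nu x) = weight nu x * (K1 * x) * M1 by ring.
    apply: ler_pM; rewrite ?mulr_ge0 ?(ltW (w_gt0 _))//; last exact: bM1.
    by rewrite ler_wpM2l ?(ltW (w_gt0 _))//; exact: hK1.
  have a3 : `|weight nu x * ph1 nu l x * phi b x| <= (K2 * M2) * (x * weight nu x).
    rewrite 2!normrM (gtr0_norm (w_gt0 x0)).
    have -> : K2 * M2 * (x * weight nu x) = weight nu x * (K2 * x) * M2 by ring.
    apply: ler_pM; rewrite ?mulr_ge0 ?(ltW (w_gt0 _))//; last exact: bM2.
    by rewrite ler_wpM2l ?(ltW (w_gt0 _))//; exact: hK2.
  apply: (le_trans (ler_normB _ _)); apply: (@le_trans _ _ (K * (x * weight nu x))); last first.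
    by rewrite ler_wpM2r ?ler_norm.
  rewrite /K mulrDl; apply: lerD => //; rewrite /Q1 normrM -[leRHS]mulrA ler_wpM2l//.
  by apply: (le_trans (ler_normB _ _)); rewrite [leRHS]mulrDl lerD.
have e2 : P y - Q2 y = P 1 - Q2 1.
  apply: (@der_const _ y 1 (fun x => P x - Q2 x)); first exact: ltW.
  move=> x /andP[yx x1]; have x0 : 0 < x by exact: lt_le_trans yx.
  apply: (der_eq (derB (dP x x0) (dQ2 x x0))).
  by rewrite /green min_r// max_l//; ring.
have e3 : Q2 1 = 0 by rewrite /Q2 hl /chi subrr !mulr0 subrr mulr0.
have -> : P 1 = Q1 y - Q2 y by rewrite -e1 e2 e3 subr0.
rewrite /Q1 /Q2 /chi1 /chi; have := phi_gt0 b y; have := w_gt0 y0.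
move: (ph1 _ _ _) (ph1 _ _ _) (gsol _ _ - _); move: (weight _ _) (phi b y) => W F A A' G W0 F0.
by field; rewrite DN !gt_eqF.
Qed.

(* A barrier for the modified Bessel equation: the logarithmic derivative stays above [rho]. *)
Lemma phi_growth : exists2 rho, 0 < rho & forall x y, 1 <= x -> x <= y ->
  phi 1 x * expR (rho * (y - x)) <= phi 1 y.
Proof.
set n := 2 * nu + 1; pose rho := Num.min (ph1 nu (- 1 ^+ 2) 1 / phi 1 1) (`|n| + 1)^-1.
have nn : 0 < `|n| + 1 by rewrite ltr_wpDl.
have p1 : 0 < ph1 nu (- 1 ^+ 2) 1.
  rewrite /ph1 !mulNr opprK mulr_gt0 ?divr_gt0 ?mulr_gt0 ?(nu1_gt0 Hnu) ?exprn_gt0//.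
  by apply: (@lt_le_trans _ _ 1) => //; apply: bes_ge1; [move: Hnu; lra|rewrite oppr_le0 mulr_ge0 ?sqr_ge0].
have r0 : 0 < rho by rewrite lt_min divr_gt0// invr_gt0.
have r1 : rho * phi 1 1 <= ph1 nu (- 1 ^+ 2) 1 by rewrite -ler_pdivlMr// ge_min lexx.
have r2 : rho * (`|n| + 1) <= 1 by rewrite -ler_pdivlMr// mul1r ge_min lexx orbT.
move: rho r0 r1 r2 => rho r0 r1 r2; exists rho => //.
pose N x := ph1 nu (- 1 ^+ 2) x - rho * phi 1 x.
have Nge x : 1 <= x -> 0 <= N x.
  move=> x1; have x0 : 0 < x by lra.
  have h : weight nu 1 * expR (rho * 1) * N 1 <= weight nu x * expR (rho * x) * N x.
    apply: (@der_nondecr _ 1 x (fun x => weight nu x * expR (rho * x) * N x)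
      (fun x => weight nu x * expR (rho * x) * phi 1 x * (1 - rho ^+ 2 - n * rho / x))) => // t /andP[t1 _].
      have t0 : 0 < t by lra.
      apply: (der_eq (derM (derM (weight_der nu t0) (der_exp (derM (der_cst rho t) (der_id t)))) (derB (ph1_der (- 1 ^+ 2) Hnu t0) (derM (der_cst rho t) (ph_der (- 1 ^+ 2) t Hnu))))).
      by rewrite /N -/n; field; rewrite gt_eqF.
    have t0 : 0 < t by lra.
    rewrite !mulr_ge0 ?expR_ge0 ?(ltW (phi_gt0 _ _)) ?(ltW (w_gt0 _))//.
    have q1 : n * rho / t <= `|n| * rho.
      apply: (@le_trans _ _ (`|n| * rho / t)).
        by rewrite ler_wpM2r ?invr_ge0 ?(ltW t0)// ler_wpM2r ?ler_norm// ltW.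
      by rewrite ler_pdivrMr// ler_peMr// mulr_ge0// ltW.
    have q2 : rho ^+ 2 <= rho.
      rewrite expr2 ler_piMr ?(ltW r0)// (le_trans _ r2)// ler_peMr ?(ltW r0)//.
      by rewrite lerDr.
    by move: r2; rewrite mulrDr mulr1; lra.
  have N1 : 0 <= N 1 by rewrite /N subr_ge0.
  have : 0 <= weight nu x * expR (rho * x) * N x.
    by apply: le_trans h; rewrite !mulr_ge0 ?expR_ge0 ?(ltW (w_gt0 _)).
  by rewrite pmulr_rge0// mulr_gt0 ?expR_gt0 ?w_gt0.
move=> x y x1 xy.
have h : expR (- rho * x) * phi 1 x <= expR (- rho * y) * phi 1 y.
  apply: (@der_nondecr _ x y (fun x => expR (- rho * x) * phi 1 x) (fun x => expR (- rho * x) * N x)) => //.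
    move=> t _; apply: (der_eq (derM (der_exp (derM (der_cst _ t) (der_id t))) (ph_der _ t Hnu))).
    by rewrite /N; ring.
  by move=> t /andP[xt _]; rewrite mulr_ge0 ?expR_ge0// Nge//; exact: le_trans xt.
have -> : rho * (y - x) = rho * y + - rho * x by ring.
rewrite expRD mulrCA [X in _ * X]mulrC (le_trans (ler_wpM2l (expR_ge0 _) h))//.
by rewrite mulrA -expRD mulNr addrN expR0 mul1r.
Qed.

Lemma phi_scale b x : phi b x = phi 1 (b * x).
Proof. by rewrite /ph expr1n exprMn; congr Bes; ring. Qed.

Lemma powR_ratio e m y : 0 < m -> m <= y -> e <= 1 -> powR y e <= powR m e * (y / m).
Proof.
move=> m0 my e1; have y0 : 0 < y by exact: lt_le_trans my.
have {1}-> : y = m * (y / m) by rewrite mulrC divfK// gt_eqF.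
have ym : 0 <= y / m by nng.
have m0' := ltW m0.
rewrite powRM// ler_wpM2l ?powR_ge0// ler1_powR//.
by rewrite ler_pdivlMr// mul1r.
Qed.

Lemma expR_decay rho q : 0 < rho -> 0 < q -> exists2 C : R, 0 < C &
  forall a, 1 <= a -> (1 + a) * expR (- rho * a) <= C * powR a (- q).
Proof.
move=> r0 q0; have q10 : 0 < q + 1 by lra.
have [C C0 hC] := powR_expR_le q10.
exists (2 * (C * powR rho^-1 (q + 1))) => [|a a1]; first by do 2 (apply: mulr_gt0 => //); rewrite powR_gt0// invr_gt0.
have a0 : 0 < a by lra.
have ra : 0 < rho * a by nng.
have h : powR (rho * a) (q + 1) <= C * expR (rho * a).
  apply: le_trans (hC _ ra); have := powR_ge0 (rho * a) (q + 1); move: (powR _ _) => u u0.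
  rewrite expr2; nra.
have h2 : powR a (q + 1) * expR (- rho * a) <= C * powR rho^-1 (q + 1).
  have -> : a = rho^-1 * (rho * a) by rewrite mulKf// gt_eqF.
  rewrite powRM ?invr_ge0 ?(ltW r0) ?(ltW ra)// mulKf ?(gt_eqF r0)// -mulrA [leRHS]mulrC.
  rewrite ler_wpM2l ?powR_ge0//.
  by rewrite mulNr expRN ler_pdivrMr ?expR_gt0.
have h3 : powR a (- q) = a / powR a (q + 1).
  have -> : - q = 1 - (q + 1) by ring.
  by rewrite powRB ?powRr1 ?(ltW a0)// (gt_eqF a0) implybT.
rewrite h3 [leRHS]mulrA ler_pdivlMr ?powR_gt0//.
apply: (@le_trans _ _ (2 * a * (powR a (q + 1) * expR (- rho * a)))).
  have -> : (1 + a) * expR (- rho * a) * powR a (q + 1) = (1 + a) * (powR a (q + 1) * expR (- rho * a)) by ring.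
  by rewrite ler_wpM2r ?mulr_ge0 ?powR_ge0 ?expR_ge0//; lra.
have -> : 2 * (C * powR rho^-1 (q + 1)) * a = 2 * a * (C * powR rho^-1 (q + 1)) by ring.
by rewrite ler_wpM2l// mulr_ge0// ltW.
Qed.

(** The prefactor and the weight of the kernel merge into a power of [max(x, 1 / r)], the form in
    which all kernel estimates below are carried out. *)
Lemma wmin_max r x : 0 < r -> 0 < x ->
  powR x (- (nu + 1 / 2)) * wmin nu (r * x) = powR (Num.max x r^-1) (- (nu + 1 / 2)).
Proof.
move=> r0 x0; rewrite /wmin; have rx : 0 < r * x by nng.
have [h|h] := leP 1 (r * x).
  by rewrite powR1 mulr1 max_l// -div1r ler_pdivrMr// mulrC.
rewrite max_r; last by rewrite -div1r ler_pdivlMr// mulrC ltW.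
rewrite powRM ?(ltW r0) ?(ltW x0)// mulrCA -powRD ?(gt_eqF x0) ?implybT// addNr powRr0 mulr1.
by rewrite -(powR_inv1 (ltW r0)) -powRrM mulN1r opprK.
Qed.

(** For [t >= y] the factor [phi^-2] supplies two exponentials in [rho * b * (t - y)]: one absorbs
    the at most linear growth of the ratio of weights, the other is integrated explicitly. *)
Lemma gsol_bound : exists rho C : R, [/\ 0 < rho, 0 < C,
  (forall x y, 1 <= x -> x <= y -> phi 1 x * expR (rho * (y - x)) <= phi 1 y) &
  forall b y, 0 < b -> 1 <= b * y -> y <= 1 ->
  gsol b 1 - gsol b y <= C * (powR y (- (2 * nu + 1)) / (phi b y ^+ 2 * b))].
Proof.
have [rho r0 hr] := phi_growth; exists rho, ((1 + rho^-1) / rho); split => //.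
  by nng.
move=> b y b0 by1 y1; have y0 : 0 < y by rewrite -(pmulr_rgt0 _ b0); lra.
pose A := powR y (- (2 * nu + 1)) / phi b y ^+ 2 * (1 + rho^-1).
have A0 : 0 <= A by nng.
pose H t := - (A / (rho * b)) * expR (- (rho * b) * (t - y)).
have rb : 0 < rho * b by nng.
have hD : `|gsol b 1 - gsol b y| <= H 1 - H y.
  apply: (@der_dominated _ y 1 (gsol b) H (fun x => (weight nu x * phi b x ^+ 2)^-1) (fun t => A * expR (- (rho * b) * (t - y)))) => //.
  - by move=> t /andP[yt _]; apply: gsol_der; exact: lt_le_trans yt.
  - move=> t _; apply: (der_eq (derM (der_cst _ t) (der_exp (derM (der_cst _ t) (derB (der_id t) (der_cst y t)))))).
    by field; rewrite !gt_eqF.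
  move=> t /andP[yt t1]; have t0 : 0 < t by exact: lt_le_trans yt.
  have pw := w_gt0 t0; have pp := phi_gt0 b t; have py := phi_gt0 b y.
  have q0 : 0 <= (weight nu t * phi b t ^+ 2)^-1 by nng.
  rewrite (ger0_norm q0) invfM.
  have a1 : (weight nu t)^-1 <= powR y (- (2 * nu + 1)) * (1 + b * (t - y)).
    rewrite /weight -powRN; apply: (le_trans (powR_ratio y0 yt _)); first by move: Hnu; lra.
    rewrite ler_wpM2l ?powR_ge0// ler_pdivrMr//.
    have : t - y <= b * y * (t - y) by rewrite ler_peMl// subr_ge0.
    by lra.
  set E := expR (rho * (b * t - b * y)).
  have E1 : 1 <= E by rewrite -expR0 ler_expR mulr_ge0 ?(ltW r0)// -mulrBr mulr_ge0 ?subr_ge0// ltW.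
  have a2 : (phi b t ^+ 2)^-1 <= (phi b y ^+ 2)^-1 * E ^- 2.
    rewrite -invfM -exprMn lef_pV2 ?posrE ?exprn_gt0 ?mulr_gt0 ?expR_gt0//.
    rewrite lerXn2r ?nnegrE ?mulr_ge0 ?(ltW pp) ?(ltW py) ?expR_ge0// (phi_scale b t) (phi_scale b y).
    by apply: hr => //; rewrite ler_pM2l.
  have a3 : (1 + b * (t - y)) * E ^- 2 <= (1 + rho^-1) * E^-1.
    have hE : rho * (b * t - b * y) <= E by apply: le_trans (expR_ge1Dx _); lra.
    have E0 : 0 < E by lra.
    rewrite expr2 invfM mulrA ler_wpM2r ?invr_ge0 ?(ltW E0)// ler_pdivrMr// mulrDl mul1r lerD//.
    by rewrite -mulrBr in hE; rewrite -ler_pdivrMl ?invr_gt0// invrK.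
  apply: (le_trans (ler_pM _ _ a1 a2)); rewrite ?invr_ge0 ?sqr_ge0 ?(ltW pw)//.
  have -> : expR (- (rho * b) * (t - y)) = E^-1 by rewrite /E -expRN; congr expR; ring.
  have -> : powR y (- (2 * nu + 1)) * (1 + b * (t - y)) * ((phi b y ^+ 2)^-1 * E ^- 2) =
    powR y (- (2 * nu + 1)) / phi b y ^+ 2 * ((1 + b * (t - y)) * E ^- 2) by ring.
  have -> : A * E^-1 = powR y (- (2 * nu + 1)) / phi b y ^+ 2 * ((1 + rho^-1) * E^-1) by rewrite /A; ring.
  by rewrite ler_wpM2l// mulr_ge0 ?powR_ge0 ?invr_ge0 ?sqr_ge0.
apply: (le_trans (ler_norm _)); apply: (le_trans hD).
apply: (@le_trans _ _ (A / (rho * b))).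
  rewrite /H subrr mulr0 expR0 mulr1 opprK gerDr mulNr oppr_le0 mulr_ge0 ?expR_ge0//.
  by nng.
by apply: eq_ler; rewrite /A; field; rewrite ?gt_eqF.
Qed.

(** The Green function decays exponentially in [r |x - y|], hence faster than the power claimed; the
    same exponential absorbs the ratio of [y] to [max(x, 1 / r)], which is at most
    [1 + r |x - y|]. *)
Lemma green_bound (d kap : R) : 0 < d -> 1 <= kap -> exists2 C, 0 < C &
  forall r x y, 0 < x < 1 -> 0 < y < 1 -> 0 < r -> 1 <= r * `|x - y| ->
  `|(kap * r) ^+ 2 * green (kap * r) x y| <= C * (r * kw nu r x y * powR (r * `|x - y|) (- (1 + d))).
Proof.
move=> d0 k1; have [rho [C [r0 C0 hr hg]]] := gsol_bound.
have d1 : 0 < 1 + d by lra.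
have [C' C'0 hC'] := expR_decay r0 d1.
have k0 : 0 < kap by lra.
exists (C * kap * expR rho * C') => [|r x y]; first by nng.
wlog xy : x y / x <= y => [hw hx hy rr0 hxy|].
  have [xy|/ltW yx] := leP x y; first exact: hw.
  rewrite greenC distrC (_ : kw nu r x y = kw nu r y x); last by rewrite /kw [y * x]mulrC; congr (_ * _); rewrite mulrC.
  by apply: hw => //; rewrite distrC.
move=> /andP[x0 x1] /andP[y0 y1] rr0 hxy; set b := kap * r; have b0 : 0 < b by nng.
set a := r * `|x - y|; have aE : a = r * (y - x) by rewrite /a distrC ger0_norm ?subr_ge0.
have ry : 1 + r * x <= r * y by move: hxy; rewrite -/a aE mulrBr; lra.
have rx0 : 0 < r * x by nng.
have rb : r <= b by rewrite ler_peMl// ltW.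
have by1 : 1 <= b * y.
  by apply: (@le_trans _ _ (r * y)); [lra|rewrite ler_wpM2r// ltW].
have G0 : 0 <= gsol b 1 - gsol b y by rewrite subr_ge0 gsol_le// ltW.
have px := phi_gt0 b x; have py := phi_gt0 b y.
have N0 := mulr_ge0 (sqr_ge0 b) (mulr_ge0 (ltW px) (mulr_ge0 (ltW py) G0)).
rewrite /green min_l// max_r// /chi (ger0_norm N0).
(* Exponential growth of [phi 1] is known from [1] on only; replacing [b * x] by its maximum with
   [1] costs the factor [expR rho]. *)
have pxy : phi b x <= phi b y * (expR rho * expR (- rho * a)).
  rewrite -expRD.
  have bx : b * x <= b * y - a.
    have : r * (y - x) <= b * (y - x) by rewrite ler_wpM2r// subr_ge0.
    by rewrite aE; lra.
  have hM : phi 1 (Num.max 1 (b * x)) * expR (rho * (b * y - Num.max 1 (b * x))) <= phi 1 (b * y).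
    apply: hr; first by rewrite le_max lexx.
    by rewrite ge_max by1 ler_pM2l.
  rewrite (phi_scale b x) (phi_scale b y); move: hM; set M := Num.max 1 (b * x) => hM.
  apply: (@le_trans _ _ (phi 1 M)).
    by apply: phi_mono; [rewrite mulr_ge0// ltW|rewrite /M le_max lexx orbT].
  rewrite -ler_pdivrMr ?expR_gt0// -expRN; apply: le_trans hM.
  rewrite ler_wpM2l ?(ltW (phi_gt0 _ _))// ler_expR.
  have : b * y - M >= a - 1.
    rewrite /M.
    have [h|h] := leP 1 (b * x); first by lra.
    have : 0 < b * x by nng.
    by lra.
  move/(ler_wpM2l (ltW r0)); rewrite !mulrBr mulr1; lra.
have hgy := hg b y b0 by1 (ltW y1).
have s1 : b ^+ 2 * (phi b x * (phi b y * (gsol b 1 - gsol b y))) <=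
   b * C * expR rho * (powR y (- (2 * nu + 1)) * expR (- rho * a)).
  apply: (@le_trans _ _ (b ^+ 2 * (phi b y * (expR rho * expR (- rho * a)) * (phi b y * (C * (powR y (- (2 * nu + 1)) / (phi b y ^+ 2 * b))))))).
    rewrite ler_wpM2l ?sqr_ge0//; apply: ler_pM; rewrite ?mulr_ge0 ?(ltW px) ?(ltW py)//.
    by rewrite ler_wpM2l ?(ltW py).
  by apply: eq_ler; field; rewrite !gt_eqF.
apply: (le_trans s1).
set m := Num.max x r^-1.
have m0 : 0 < m by rewrite lt_max x0.
have my : m <= y.
  rewrite ge_max xy -div1r ler_pdivrMr// mulrC; lra.
have ym : y / m <= 1 + a.
  rewrite ler_pdivrMr// mulrDl mul1r.
  have : r^-1 <= m by rewrite le_max lexx orbT.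
  have : x <= m by rewrite le_max lexx.
  move=> xm rm; have : r * (y - x) * r^-1 <= a * m by rewrite -aE ler_wpM2l// /a mulr_ge0 ?(ltW rr0).
  by rewrite mulrAC mulfV ?gt_eqF// mul1r; lra.
have kwE : kw nu r x y = powR m (- (nu + 1 / 2)) * powR y (- (nu + 1 / 2)).
  rewrite /kw powRM ?(ltW x0) ?(ltW y0)// -(wmin_max rr0 x0) /m.
  rewrite (_ : wmin nu (r * y) = 1); last by rewrite /wmin min_l ?powR1//; lra.
  by rewrite mulr1 mulrAC.
have s2 : powR y (- (2 * nu + 1)) <= kw nu r x y * (1 + a).
  have -> : - (2 * nu + 1) = - (nu + 1 / 2) + - (nu + 1 / 2) by lra.
  rewrite powRD ?(gt_eqF y0) ?implybT// kwE mulrAC ler_wpM2r ?powR_ge0//.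
  apply: (le_trans (powR_ratio m0 my _)); first by move: Hnu; lra.
  by rewrite ler_wpM2l ?powR_ge0.
have s3 : powR y (- (2 * nu + 1)) * expR (- rho * a) <= kw nu r x y * (C' * powR a (- (1 + d))).
  apply: (le_trans (ler_wpM2r (expR_ge0 _) s2)); rewrite -mulrA ler_wpM2l ?hC'//.
  by rewrite kwE mulr_ge0 ?powR_ge0.
apply: (le_trans (ler_wpM2l _ s3)); first by apply: mulr_ge0; [apply: mulr_ge0; exact: ltW|exact: expR_ge0].
by apply: eq_ler; rewrite /b; ring.
Qed.

End Green.

(** * Eigenfunction expansions *)

Section ZeroFacts.
Context {R : realType}.
Variables (nu : R) (s : nat -> R).
Hypothesis Hnu : -1 < nu.
Hypothesis Hz : bessel_zeros nu s.
Implicit Types (f g P : R -> R) (x y t b B K e l r X : R) (i j N M : nat).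
Local Notation cj := (cj nu s).

Let s_gt0 j : 0 < s j. Proof. exact: zeros_gt0 Hz j. Qed.

(** The zeros grow linearly because [th (s_j) = pi * j] and [th] stays within [T] of the identity;
    the other two bounds are read off the phase and the oscillatory form. *)
Lemma zeros_facts : exists c C : R, [/\ 0 < c, 0 < C,
  (forall j, c * j.+1%:R <= s j),
  (forall j, 0 < cj j /\ cj j ^+ 2 <= C * powR (s j) (2 * nu + 1)) &
  (forall z, 0 < z -> `|besu nu z| <= C * wmin nu z)].
Proof.
pose a := Num.min (1 / 2) (s 0%N / 2); have s00 := s_gt0 0.
have a0 : 0 < a by rewrite lt_min divr_gt0 ?divr_gt0.
have a2 : a <= 1 / 2 by rewrite ge_min lexx.
have as0 : a < s 0%N by rewrite gt_min; apply/orP; right; lra.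
have s0j j : s 0%N <= s j by case: j => // j; exact/ltW/(zeros_incr Hz).
have asj j : a < s j by apply: lt_le_trans (s0j j).
have [A2 [p [th [A20 pth [B B2 uE] zj [pm psym pT]]]]] := bessel_phase Hnu Hz a0.
have [[Cp Cp0 sp] _ [b1 [b2 [Cb [Cb0 sb1 sb2 ub]]]]] :=
  @oscillatory_form R 0 nu a B p th Hnu a0 a2 pth uE pm psym pT.
have [T T0 hT] := pT.
pose C1 := 2 / A2 * (1 + Cp).
pose c := (1 + (T + 1) / s 0%N)^-1.
have S0 : 0 < 1 + (T + 1) / s 0%N by rewrite ltr_pwDl// divr_ge0 ?(ltW s00) ?addr_ge0.
have C10 : 0 < C1 by rewrite mulr_gt0 ?divr_gt0// ltr_pwDl.
exists c, (C1 + (Cb + Cb)); split.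
- by nng.
- by rewrite ltr_pwDl// addr_ge0.
- move=> j; rewrite /c mulrC ler_pdivrMr//.
  have [hth _ _] := zj j; have := hT _ (asj j); rewrite hth => h1.
  have h2 : pi * j%:R <= s j + T by move: h1; rewrite ler_norml => /andP[h _]; move: h; lra.
  have h3 : j%:R <= pi * j%:R :> R by rewrite ler_peMl// (le_trans _ (pi_ge2 R))// ler1n.
  have h4 : T + 1 <= s j * ((T + 1) / s 0%N).
    by rewrite mulrCA ler_peMr ?addr_ge0// ler_pdivlMr// mul1r.
  by rewrite mulrDr mulr1 -addn1 natrD; lra.
- move=> j; have [_ c0 ->] := zj j; split => //.
  rewrite ler_wpM2r ?powR_ge0//; apply: (@le_trans _ _ C1); last by rewrite lerDl addr_ge0.
  rewrite ler_wpM2l ?divr_ge0 ?(ltW A20)//.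
  by have := sym_bound sp (asj j); rewrite mulr1 => /(le_trans (ler_norm _)) /le_trans; apply; rewrite lerDr.
move=> z z0; rewrite ub//.
have w0 := ltW (wmin_gt0 nu z0).
have bd (f g : R -> R) : (forall x, `|g x| <= 1) -> sym 0 (fun x => 0 < x) id (wmin nu) Cb f -> `|f z * g z| <= Cb * wmin nu z.
  move=> hg hf; rewrite normrM -[leRHS]mulr1 ler_pM//; exact: (sym_bound hf z0).
apply: (le_trans (ler_normD _ _)); rewrite mulrDl; apply: ler_wpDl; first by nng.
rewrite mulrDl; apply: lerD; apply: bd => // x; rewrite ler_norml.
  by rewrite sin_geN1 sin_le1.
by rewrite cos_geN1 cos_le1.
Qed.

Lemma ph_growth (C : R) l x : (forall z, 0 < z -> `|besu nu z| <= C * wmin nu z) -> 0 <= C ->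
  0 < l -> 0 < x -> `|ph nu (l ^+ 2) x| <= C * (1 + l * x).
Proof.
move=> hC C0 l0 x0; have lx : 0 < l * x by nng.
rewrite besu_scale// normrM ger0_norm ?powR_ge0//.
apply: (@le_trans _ _ (powR (l * x) (- (nu + 1 / 2)) * (C * wmin nu (l * x)))).
  by rewrite ler_wpM2l ?powR_ge0// hC.
rewrite mulrCA ler_wpM2l//; have := @wmin_max _ nu 1 (l * x) ltr01 lx; rewrite [1 * (l * x)]mul1r invr1 => ->.
apply: (le_trans (ler1_powR _ _)); first by rewrite le_max lexx orbT.
  by move: Hnu; lra.
by rewrite ge_max; apply/andP; split; lra.
Qed.

End ZeroFacts.

Section Orthonormality.
Context {R : realType}.
Variable nu : R.
Hypothesis Hnu : -1 < nu.
Implicit Types (f g P : R -> R) (x y t b B K e l r X : R) (i j N M : nat).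
Local Notation wint := (wint nu).

Lemma ph_orth l m : l != 0 -> m != 0 -> l != m -> ph nu l 1 = 0 -> ph nu m 1 = 0 ->
  wint (fun x => ph nu l x * ph nu m x) = 0.
Proof.
move=> l0 m0 lm hl hm.
have := Op_sym Hnu (ph_BC Hnu l) (ph_BC Hnu m) (Op_ph Hnu l0 hl) (Op_ph Hnu m0 hm).
have b := BC_M (ph_BC Hnu l) (ph_BC Hnu m).
have z := wint_lin Hnu _ b (BC_cst 0).
have e1 : wint (fun x => l^-1 * ph nu l x * ph nu m x) = l^-1 * wint (fun x => ph nu l x * ph nu m x) + wint (fun=> 0).
  by rewrite -z; apply: eq_wint => x _; ring.
have e2 : wint (fun x => m^-1 * ph nu m x * ph nu l x) = m^-1 * wint (fun x => ph nu l x * ph nu m x) + wint (fun=> 0).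
  by rewrite -z; apply: eq_wint => x _; ring.
rewrite e1 e2 => /addIr /eqP; rewrite -subr_eq0 -mulrBl mulf_eq0 => /orP[|/eqP//].
by rewrite subr_eq0 => /eqP /invr_inj E; move: lm; rewrite E eqxx.
Qed.

(** Lommel's integral: [F] is an explicit antiderivative of [weight * ph^2], of which only the flux
    term survives at [1]. *)
Lemma ph_norm l : 0 < l -> ph nu l 1 = 0 ->
  wint (fun x => ph nu l x * ph nu l x) = ph1 nu l 1 ^+ 2 / (2 * l).
Proof.
move=> l0 hl; have lN : l != 0 by rewrite gt_eqF.
pose F x := (x * weight nu x * ph nu l x ^+ 2 + x * weight nu x * ph1 nu l x ^+ 2 / l
  + 2 * nu / l * (weight nu x * ph1 nu l x * ph nu l x)) / 2.
have [cf [B bf]] := BC_M (ph_BC Hnu l) (ph_BC Hnu l).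
have [_ [M bM]] := ph_BC Hnu l; have [K K0 hK] := ph1_le Hnu l.
rewrite (@wint_FTC _ nu Hnu _ F B 0 (M ^+ 2 + K ^+ 2 / l + `|2 * nu / l| * (K * M)) cf bf).
- by rewrite subr0 /F hl /weight powR1; field.
- move=> x x0; have xN : x != 0 by rewrite gt_eqF.
  have dxw : der (fun x => x * weight nu x) x ((2 * nu + 2) * weight nu x).
    by apply: (der_eq (derM (der_id x) (weight_der nu x0))); field.
  apply: (der_eq (derM (derD (derD (derM dxw (derX 2 (ph_der l x Hnu)))
     (derM (derM dxw (derX 2 (ph1_der l Hnu x0))) (der_cst l^-1 x)))
     (derM (der_cst (2 * nu / l) x) (derM (ph_flux l Hnu x0) (ph_der l x Hnu)))) (der_cst 2^-1 x))).
  by rewrite /= !expr1; move: (ph1 _ _ _) (ph _ _ _) (weight _ _) => A A' W; field; rewrite xN lN.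
move=> x hx; have [x0 x1] := andP hx; rewrite subr0.
have w0 : 0 < weight nu x := weight_gt0 nu x0.
have M0 : 0 <= M by apply: le_trans (bM x hx).
have hk : `|ph1 nu l x| <= K * x by apply: hK; rewrite x0 ltW.
have hk1 : `|ph1 nu l x| <= K by apply: (le_trans hk); rewrite ler_piMr// ltW.
have hm := bM x hx.
have xw : 0 <= x * weight nu x by nng.
rewrite /F; move: (ph1 _ _ _) (ph _ _ _) hk hk1 hm => A A' hk hk1 hm.
have a1 : `|x * weight nu x * A' ^+ 2| <= M ^+ 2 * (x * weight nu x).
  rewrite normrM (ger0_norm xw) mulrC ler_wpM2r// normrX lerXn2r ?nnegrE//.
have a2 : `|x * weight nu x * A ^+ 2 / l| <= K ^+ 2 / l * (x * weight nu x).
  rewrite normrM [X in _ * X]ger0_norm ?invr_ge0 ?(ltW l0)// [leRHS]mulrAC ler_wpM2r ?invr_ge0 ?(ltW l0)//.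
  by rewrite normrM (ger0_norm xw) mulrC ler_wpM2r// normrX lerXn2r ?nnegrE.
have a3 : `|2 * nu / l * (weight nu x * A * A')| <= `|2 * nu / l| * (K * M) * (x * weight nu x).
  rewrite normrM -[leRHS]mulrA ler_wpM2l// 2!normrM (gtr0_norm w0).
  have -> : K * M * (x * weight nu x) = weight nu x * (K * x) * M by ring.
  by apply: ler_pM => //; [rewrite mulr_ge0// ltW|rewrite ler_wpM2l// ltW].
have h := le_trans (ler_normD _ _) (lerD (le_trans (ler_normD _ _) (lerD a1 a2)) a3).
rewrite normrM [X in _ * X]ger0_norm ?invr_ge0//.
apply: (@le_trans _ _ (`|x * weight nu x * A' ^+ 2 + x * weight nu x * A ^+ 2 / l + 2 * nu / l * (weight nu x * A * A')|)).
  by rewrite ler_piMr// invf_le1// ler1n.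
by apply: (le_trans h); rewrite !mulrDl.
Qed.

Lemma psi_norm (s : nat -> R) (Hz : bessel_zeros nu s) j :
  cj nu s j ^+ 2 * wint (fun x => ph nu (s j ^+ 2) x * ph nu (s j ^+ 2) x) = 1.
Proof.
have s0 : 0 < s j := zeros_gt0 Hz j; have n1 := nu1_gt0 Hnu.
have [zc0 [zC [_ _ _ zc _]]] := zeros_facts Hnu Hz; have [c0 _] := zc j.
rewrite ph_norm ?exprn_gt0//; last exact: ph_zero.
have N : Bes (nu + 1) (s j ^+ 2) != 0.
  by apply/eqP => E; move: c0; rewrite /cj E normr0 mulr0 invr0 mulr0 ltxx.
have e1 : cj nu s j ^+ 2 = 8 * (nu + 1) ^+ 2 / (s j ^+ 2 * Bes (nu + 1) (s j ^+ 2) ^+ 2).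
  rewrite /cj expr_div_n !exprMn real_normK ?num_real// sqr_sqrtr//; congr (_ / _); ring.
rewrite e1 /ph1 expr1n !mulr1; move: (Bes _ _) N => b N.
by field; rewrite N !gt_eqF.
Qed.

Lemma BC_sum (I : Type) (q : seq I) (F : I -> R -> R) : (forall k, BC (F k)) ->
  BC (fun x => \sum_(k <- q) F k x) /\ wint (fun x => \sum_(k <- q) F k x) = \sum_(k <- q) wint (F k).
Proof.
move=> h; elim: q => [|a q [ih1 ih2]].
  rewrite big_nil; have E : (fun x : R => \sum_(k <- [::]) F k x) = fun=> 0 by apply/funext => x; rewrite big_nil.
  rewrite E; split; first exact: BC_cst.
  have := wint_lin Hnu 1 (BC_cst 0) (BC_cst (0 : R)).
  rewrite mul1r (_ : (fun=> _) = (fun=> 0 : R)); last by apply/funext => x; ring.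
  by move: (wint _) => u; lra.
have E : (fun x : R => \sum_(k <- a :: q) F k x) = fun x => 1 * F a x + \sum_(k <- q) F k x.
  by apply/funext => x; rewrite big_cons mul1r.
rewrite E big_cons -ih2; split; first by apply: BC_D => //; exact: BC_Z.
by rewrite wint_lin// mul1r.
Qed.

End Orthonormality.

Lemma small_div {R : realType} (c e : R) : 0 < e -> exists2 N, (0 < N)%N & forall M, (N <= M)%N -> c / M%:R <= e.
Proof.
move=> e0; exists (Num.bound (`|c| / e)).+1 => // M NM.
have M0 : 0 < M%:R :> R by rewrite ltr0n; exact: leq_trans NM.
rewrite ler_pdivrMr// (le_trans (ler_norm _))// -ler_pdivrMl// mulrC ltW//.
apply: (lt_le_trans (archi_boundP _)); first by nng.
by rewrite ler_nat; exact: leq_trans NM.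
Qed.

Lemma weight_decay {R : realType} (nu c S : R) (J : nat) : 0 < c -> c <= S -> `|nu| + 3 <= J%:R ->
  powR S (2 * nu + 1) * (S ^+ 2)^-1 ^+ J <= powR c (2 * nu + 3 - 2 * J%:R) / S ^+ 2.
Proof.
move=> c0 cS hJ; have S0 : 0 < S by exact: lt_le_trans cS.
have E : powR S (2 * J%:R) = (S ^+ 2) ^+ J.
  by rewrite powRrM (@powR_mulrn _ S 2) ?powR_mulrn ?sqr_ge0// ltW.
have -> : (S ^+ 2)^-1 ^+ J = powR S (- (2 * J%:R)) by rewrite powRN E exprVn.
rewrite -powRD ?(gt_eqF S0) ?implybT//.
have -> : 2 * nu + 1 - 2 * J%:R = (2 * nu + 3 - 2 * J%:R) - 2%:R by ring.
rewrite powRB ?(gt_eqF S0) ?implybT// powR_mulrn ?(ltW S0)//.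
rewrite ler_wpM2r ?invr_ge0 ?sqr_ge0//; apply: powR_leN => //.
by have := ler_norm nu; lra.
Qed.

(** [limit_squeeze] applied to the sequence read at the integer part of a real variable. *)
Lemma cauchy_harmonic {R : realType} (u : nat -> R) (K : R) :
  (forall N M, (0 < N)%N -> (N <= M)%N -> `|u M - u N| <= K * (N%:R^-1 - M%:R^-1)) ->
  exists l, forall N, (0 < N)%N -> `|u N - l| <= K / N%:R.
Proof.
move=> h.
have [||l hl] := @limit_squeeze R (fun x => u (Num.trunc x)) (fun x => K / (Num.trunc x)%:R) 1.
- move=> x y x1 xy; rewrite -mulrBr; apply: h; first by rewrite truncn_gt0.
  by apply: le_truncn.
- move=> e e0 x; have [N N0 hN] := small_div `|K| e0; pose n := maxn N (Num.bound `|x|).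
  exists n%:R.
    apply: (le_trans (ler_norm _)); apply: ltW; apply: (lt_le_trans (archi_boundP (normr_ge0 x))).
    by rewrite ler_nat leq_maxr.
  rewrite natrK normrM [X in _ * X]ger0_norm ?invr_ge0//; apply: hN; exact: leq_maxl.
exists l => N N0; have := hl N%:R; rewrite natrK; apply.
by rewrite ler1n.
Qed.

Section Expansion.
Context {R : realType}.
Variables (nu : R) (s : nat -> R).
Hypothesis Hnu : -1 < nu.
Hypothesis Hz : bessel_zeros nu s.
Implicit Types (f g P : R -> R) (x y t b B K e l r X : R) (i j N M : nat).
Local Notation wint := (wint nu).
Local Notation cj := (cj nu s).
Local Notation ps := (psi nu s).
Let s_gt0 j : 0 < s j. Proof. exact: zeros_gt0 Hz j. Qed.

Lemma harmonic_tail (F : nat -> R) K N M : 0 <= K -> (forall j, `|F j| <= K / j.+1%:R ^+ 2) ->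
  (0 < N)%N -> (N <= M)%N -> `|\sum_(0 <= j < M) F j - \sum_(0 <= j < N) F j| <= K * (N%:R^-1 - M%:R^-1).
Proof.
move=> K0 hF N0; elim: M => [|M ih]; first by rewrite leqn0 => /eqP E; rewrite E in N0.
rewrite leq_eqVlt => /orP[/eqP ->|]; first by rewrite !subrr mulr0 normr0.
rewrite ltnS => NM; have M0 : (0 < M)%N by exact: leq_trans NM.
rewrite big_nat_recr//= addrAC; apply: (le_trans (ler_normD _ _)).
apply: (le_trans (lerD (ih NM) (hF M))); rewrite -mulrDr ler_wpM2l//.
have m0 : 0 < M%:R :> R by rewrite ltr0n.
have m1 : 0 < M.+1%:R :> R by rewrite ltr0n.
have : M.+1%:R ^- 2 <= M%:R^-1 - M.+1%:R^-1 :> R.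
  have -> : M%:R^-1 - M.+1%:R^-1 = (M%:R * M.+1%:R)^-1 :> R.
    by rewrite -natr1; rewrite -natr1 in m1; field; rewrite !gt_eqF.
  by rewrite expr2 lef_pV2 ?posrE ?mulr_gt0// ler_pM2r// ler_nat.
by move: (M.+1%:R ^- 2) (M.+1%:R^-1) (M%:R^-1) (N%:R^-1) => A1 A2 A3 A4; lra.
Qed.

(** The series in [x] converges to a bounded continuous [g], which has the same pairings with all
    eigenfunctions as the combination [G] of Green functions. By [completeness] the two agree. *)
Lemma resolvent_series L (D : 'I_L -> R) (J : nat) (C' : R) r x y :
  `|nu| + 3 <= J%:R -> (forall z, 0 < z -> `|nres D z| <= C' * z^-1 ^+ J.+1) ->
  0 < r -> 0 < x < 1 -> 0 < y < 1 -> forall e, 0 < e -> exists N0, forall N, (N0 <= N)%N ->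
  `|\sum_(0 <= j < N) nres D ((s j / r) ^+ 2) * (ps j x * ps j y) -
    \sum_k D k * (r ^+ 2 * green nu (Num.sqrt (k%:R + 1) * r) x y)| <= e.
Proof.
move=> hJ hD r0 hx hy; have [y0 y1] := andP hy.
have [c [C [c0 C0 slin cb ub]]] := zeros_facts Hnu Hz.
have gro l t : 0 < l -> 0 < t -> `|ph nu (l ^+ 2) t| <= C * (1 + l * t) by move=> *; apply: (ph_growth Hnu ub (ltW C0)).
pose n j := nres D ((s j / r) ^+ 2).
pose T j t := n j * cj j ^+ 2 * ph nu (s j ^+ 2) y * ph nu (s j ^+ 2) t.
pose S N t := \sum_(0 <= j < N) T j t.
(* The squared normalization is of size [s_j^(2 nu + 1)] and the two eigenfunctions together of size
   [s_j^2]; the decay [z^-(J + 1)] with [J >= |nu| + 3] leaves [s_j^-2], hence a remainder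
   [1 / N]. *)
have [K K0 hT] : exists2 K, 0 <= K & forall j t, 0 < t -> `|T j t| <= K * (1 + t) / j.+1%:R ^+ 2.
  have C'0 : 0 <= C'.
    by have := le_trans (normr_ge0 _) (hD 1 ltr01); rewrite invr1 expr1n mulr1.
  pose q := c^-1 + 1; have q0 : 0 <= q by nng.
  pose Q := C' * (r ^+ 2) ^+ J.+1 * C * (C * q) ^+ 2 * powR c (2 * nu + 3 - 2 * J%:R).
  have Q0 : 0 <= Q.
    by rewrite /Q; apply: mulr_ge0; rewrite ?powR_ge0//; apply: mulr_ge0; rewrite ?sqr_ge0//; apply: mulr_ge0; rewrite ?(ltW C0)//; apply: mulr_ge0 => //; rewrite exprn_ge0 ?sqr_ge0.
  exists (Q / c ^+ 2) => [|j t t0]; first by nng.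
  have S0 := s_gt0 j; have cS : c <= s j.
    by apply: le_trans (slin j); rewrite ler_peMr ?(ltW c0)// ler1n.
  have [cj0 cj2] := cb j.
  have qS : 1 + s j <= q * s j.
    by rewrite /q mulrDl mul1r lerD2r mulrC ler_pdivlMr// mul1r.
  have b1 : `|n j| <= C' * ((r ^+ 2) ^+ J.+1 * (s j ^+ 2)^-1 ^+ J.+1).
    have z0 : 0 < (s j / r) ^+ 2 by nng.
    apply: (le_trans (hD _ z0)); rewrite -exprMn expr_div_n invfM invrK [r ^+ 2 * _]mulrC.
    by [].
  have b2 : `|ph nu (s j ^+ 2) y| <= C * (q * s j).
    apply: (le_trans (gro _ _ S0 y0)); rewrite ler_wpM2l ?(ltW C0)// (le_trans _ qS)// lerD2l.
    by rewrite ler_piMr// ltW.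
  have b3 : `|ph nu (s j ^+ 2) t| <= C * (q * s j * (1 + t)).
    apply: (le_trans (gro _ _ S0 t0)); rewrite ler_wpM2l ?(ltW C0)//.
    apply: (@le_trans _ _ ((1 + s j) * (1 + t))); last by rewrite ler_wpM2r// addr_ge0// ltW.
    by rewrite mulrDr mulr1 mulrDl mul1r; have := mulr_gt0 S0 t0; lra.
  have b0 : `|cj j ^+ 2| <= C * powR (s j) (2 * nu + 1) by rewrite ger0_norm// sqr_ge0.
  have := ler_pM (normr_ge0 _) (normr_ge0 _) b1 b0; rewrite -normrM => b4.
  have := ler_pM (normr_ge0 _) (normr_ge0 _) b4 b2; rewrite -normrM => b5.
  have := ler_pM (normr_ge0 _) (normr_ge0 _) b5 b3; rewrite -normrM => b6.
  apply: (le_trans b6).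
  have sN : s j != 0 by rewrite gt_eqF.
  have -> : C' * ((r ^+ 2) ^+ J.+1 * (s j ^+ 2)^-1 ^+ J.+1) * (C * powR (s j) (2 * nu + 1)) * (C * (q * s j)) * (C * (q * s j * (1 + t))) =
    C' * (r ^+ 2) ^+ J.+1 * C * (C * q) ^+ 2 * (1 + t) * (powR (s j) (2 * nu + 1) * (s j ^+ 2)^-1 ^+ J).
    by rewrite [(s j ^+ 2)^-1 ^+ J.+1]exprS; move: (_ ^+ J.+1) (_ ^+ J) (powR _ _) => A A' A''; field.
  apply: (le_trans (ler_wpM2l _ (weight_decay c0 cS hJ))).
    by apply: mulr_ge0; [apply: mulr_ge0; rewrite ?sqr_ge0//; apply: mulr_ge0; rewrite ?(ltW C0)//; apply: mulr_ge0 => //; rewrite exprn_ge0 ?sqr_ge0|rewrite addr_ge0// ltW].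
  have e1 : (s j ^+ 2)^-1 <= (c ^+ 2)^-1 / j.+1%:R ^+ 2.
    rewrite -invfM -exprMn lef_pV2 ?posrE ?exprn_gt0 ?mulr_gt0 ?ltr0n//.
    by rewrite lerXn2r ?nnegrE ?mulr_ge0 ?(ltW S0) ?(ltW c0).
  have -> : Q / c ^+ 2 * (1 + t) / j.+1%:R ^+ 2 = Q * (1 + t) * ((c ^+ 2)^-1 / j.+1%:R ^+ 2) by ring.
  apply: le_trans (ler_wpM2l _ e1); last by nng.
  by apply: eq_ler; rewrite /Q; ring.
have hS t : 0 < t -> forall N M, (0 < N)%N -> (N <= M)%N -> `|S M t - S N t| <= K * (1 + t) * (N%:R^-1 - M%:R^-1).
  move=> t0 N M N0 NM; apply: harmonic_tail => //; first by nng.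
  by move=> j; exact: hT.
have [g hg] : exists g, forall t, 0 < t -> forall N, (0 < N)%N -> `|S N t - g t| <= K * (1 + t) / N%:R.
  have h (t : R) : exists l : R, 0 < t -> forall N, (0 < N)%N -> `|S N t - l| <= K * (1 + t) / N%:R.
    have [t0|t0] := ltP 0 t; first by have [l hl] := cauchy_harmonic (hS t t0); exists l.
    by exists 0.
  by have [g hg] := choice h; exists g.
have bT j : BC (T j) by apply: BC_Z; exact: ph_BC.
have bS N : BC (S N) by have [] := @BC_sum _ nu Hnu _ (index_iota 0 N) T bT.
have cg : posc g.
  move=> t t0; apply/cvgrPdist_le => e e0.
  have [N N0 /(_ N (leqnn N)) hN] := small_div (K * (2 + t)) (divr_gt0 e0 (ltr0Sn R 2)).
  have [cS _] := bS N; have /cvgrPdist_le/(_ (e / 3)) := cS t t0.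
  move=> /(_ (divr_gt0 e0 (ltr0Sn _ 2))) hc; near=> u.
  have u0 : 0 < u by near: u; exact: lt_nbhsr.
  have u1 : u < t + 1 by near: u; apply: lt_nbhsl; rewrite ltrDl.
  have h1 : `|S N t - S N u| <= e / 3 by near: u; exact: hc.
  have h2 : `|S N t - g t| <= e / 3.
    by apply: (le_trans (hg t t0 N N0)); apply: le_trans hN; rewrite ler_wpM2r ?invr_ge0// ler_wpM2l//; lra.
  have h3 : `|S N u - g u| <= e / 3.
    by apply: (le_trans (hg u u0 N N0)); apply: le_trans hN; rewrite ler_wpM2r ?invr_ge0// ler_wpM2l//; lra.
  have -> : g t - g u = (S N t - S N u) + ((S N u - g u) - (S N t - g t)) by ring.
  apply: (le_trans (ler_normD _ _)); apply: (le_trans (lerD h1 (le_trans (ler_normB _ _) (lerD h3 h2)))).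
  by lra.
have bg : BC g.
  split => //; have [_ [B hB]] := bS 1%N; exists (B + K * 2) => t ht; have [t0 t1] := andP ht.
  have -> : g t = S 1%N t - (S 1%N t - g t) by ring.
  apply: (le_trans (ler_normB _ _)); apply: lerD; first exact: hB.
  by apply: (le_trans (hg t t0 1%N isT)); rewrite divr1 ler_wpM2l//; lra.
pose bk (k : 'I_L) := Num.sqrt (k%:R + 1) * r.
pose G t := \sum_k D k * r ^+ 2 * green nu (bk k) t y.
have bGk k : BC (fun t => D k * r ^+ 2 * green nu (bk k) t y) by apply: BC_Z; exact: green_BC.
have [bG _] : BC G /\ True by split => //; have [] := @BC_sum _ nu Hnu _ (index_enum _) (fun k t => D k * r ^+ 2 * green nu (bk k) t y) bGk.
have hl i : ph nu (s i ^+ 2) 1 = 0 := ph_zero Hnu Hz i.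
have wS i N : (i < N)%N -> wint (fun t => S N t * ph nu (s i ^+ 2) t) = n i * ph nu (s i ^+ 2) y.
  move=> iN; have [_] := @BC_sum _ nu Hnu _ (index_iota 0 N) (fun j t => T j t * ph nu (s i ^+ 2) t) (fun j => BC_M (bT j) (ph_BC Hnu _)).
  rewrite (_ : wint _ = wint (fun t => S N t * ph nu (s i ^+ 2) t)); last first.
    by apply: eq_wint => t _; rewrite /S mulr_suml.
  move=> ->.
  have wT j : wint (fun t => T j t * ph nu (s i ^+ 2) t) = n j * cj j ^+ 2 * ph nu (s j ^+ 2) y * wint (fun t => ph nu (s j ^+ 2) t * ph nu (s i ^+ 2) t).
    rewrite -(wintZ _ (BC_wi Hnu (BC_M (ph_BC Hnu (s j ^+ 2)) (ph_BC Hnu (s i ^+ 2))))).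
    by apply: eq_wint => t _; rewrite /T; ring.
  rewrite big_mkord (bigD1 (Ordinal iN))//= big1 => [|j ji]; last first.
    rewrite wT; have sl k : s k ^+ 2 != 0 by rewrite gt_eqF// exprn_gt0.
    rewrite ph_orth ?mulr0//; apply: contra ji; rewrite eqrXn2 ?(ltW (s_gt0 _))// => /eqP E.
    rewrite -val_eqE /=; have [h|h|//] := ltngtP j i.
      by have := zeros_incr Hz h; rewrite E ltxx.
    by have := zeros_incr Hz h; rewrite E ltxx.
  by rewrite addr0 wT -[RHS]mulr1 -(psi_norm Hnu Hz i); ring.
have wg i : wint (fun t => g t * ph nu (s i ^+ 2) t) = n i * ph nu (s i ^+ 2) y.
  have [_ [B hB]] := ph_BC Hnu (s i ^+ 2).
  have W1 : 0 <= wint (fun=> 1) by apply: wint_ge0.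
  have key N : (i < N)%N -> `|wint (fun t => g t * ph nu (s i ^+ 2) t) - n i * ph nu (s i ^+ 2) y| <= K * 2 / N%:R * B * wint (fun=> 1).
    move=> iN; rewrite -(wS i N iN).
    have N0 : (0 < N)%N by exact: leq_ltn_trans iN.
    have bd1 : BC (fun t => (g t - S N t) * ph nu (s i ^+ 2) t).
      apply: BC_M (ph_BC Hnu _); have := BC_D bg (BC_Z (-1) (bS N)).
      by congr BC; apply/funext => t; ring.
    rewrite (_ : _ - _ = wint (fun t => (g t - S N t) * ph nu (s i ^+ 2) t)); last first.
      have := wint_lin Hnu (-1) (BC_M (bS N) (ph_BC Hnu (s i ^+ 2))) (BC_M bg (ph_BC Hnu (s i ^+ 2))).
      rewrite mulN1r addrC => <-; apply: eq_wint => t _; ring.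
    apply: wint_abs => // t ht; have [t0 t1] := andP ht.
    rewrite normrM distrC; apply: ler_pM => //; last exact: hB.
    by apply: (le_trans (hg t t0 N N0)); rewrite ler_wpM2r ?invr_ge0// ler_wpM2l//; lra.
  apply/eqP; rewrite -subr_eq0 -normr_le0; apply/ler_addgt0Pr => e e0; rewrite add0r.
  have [N N0 hN] := small_div (K * 2 * B * wint (fun=> 1)) e0.
  apply: (le_trans (key (maxn N i.+1) _)); first by rewrite leq_max ltnSn orbT.
  apply: le_trans (hN (maxn N i.+1) (leq_maxl _ _)); apply: eq_ler; ring.
have wG i : wint (fun t => G t * ph nu (s i ^+ 2) t) = n i * ph nu (s i ^+ 2) y.
  have [_] := @BC_sum _ nu Hnu _ (index_enum 'I_L) (fun k t => D k * r ^+ 2 * green nu (bk k) t y * ph nu (s i ^+ 2) t) (fun k => BC_M (bGk k) (ph_BC Hnu _)).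
  rewrite (_ : wint _ = wint (fun t => G t * ph nu (s i ^+ 2) t)); last first.
    by apply: eq_wint => t _; rewrite /G mulr_suml.
  move=> ->; rewrite /n /nres mulr_suml; apply: eq_bigr => k _.
  have s2 : 0 < s i ^+ 2 by nng.
  have k0 : 0 < k%:R + 1 :> R by rewrite ltr_wpDl.
  have b2 : bk k ^+ 2 = (k%:R + 1) * r ^+ 2 by rewrite /bk exprMn sqr_sqrtr// ltW.
  have r2 : 0 < r ^+ 2 by nng.
  have lb : 0 < s i ^+ 2 + bk k ^+ 2 by rewrite ltr_pwDl// sqr_ge0.
  rewrite (_ : wint _ = wint (fun t => D k * r ^+ 2 * (green nu (bk k) t y * ph nu (s i ^+ 2) t))); last first.
    by apply: eq_wint => t _; ring.
  rewrite (wintZ _ (BC_wi Hnu (BC_M (green_BC Hnu (bk k) hy) (ph_BC Hnu (s i ^+ 2))))) green_eig// b2 exprMn exprVn.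
  have q0 : 0 < (k%:R + 1) * r ^+ 2 + s i ^+ 2 by nng.
  move: k0 r2 s2 q0; move: (s i ^+ 2) (r ^+ 2) (k%:R + 1) => A A' A'' k0 r2 s2 q0.
  by field; rewrite [_ + A]addrC gt_eqF//= gt_eqF// addrC.
have gG t : 0 < t < 1 -> g t - G t = 0.
  apply: (completeness Hnu Hz (g := fun t => g t - G t)).
    have := BC_D bg (BC_Z (-1) bG).
    by congr BC; apply/funext => u; ring.
  move=> i.
  have := wint_lin Hnu (-1) (BC_M bG (ph_BC Hnu (s i ^+ 2))) (BC_M bg (ph_BC Hnu (s i ^+ 2))).
  rewrite wG wg mulN1r addNr => <-; apply: eq_wint => u _; ring.
move=> e e0; have [x0 x1] := andP hx.
have [N N0 hN] := small_div (K * (1 + x)) e0.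
exists N => M NM.
have -> : \sum_(0 <= j < M) nres D ((s j / r) ^+ 2) * (ps j x * ps j y) = S M x.
  by apply: eq_bigr => j _; rewrite !(psiE Hnu Hz)// /T /n; ring.
have -> : \sum_k D k * (r ^+ 2 * green nu (Num.sqrt (k%:R + 1) * r) x y) = G x.
  by apply: eq_bigr => k _; rewrite mulrA.
have /eqP := gG x hx; rewrite subr_eq0 => /eqP <-.
apply: le_trans (hN M NM); apply: hg => //; exact: leq_trans NM.
Unshelve. all: by end_near.
Qed.

End Expansion.

(** * The Riesz kernel *)

Section PowerSums.
Context {R : realType}.
Implicit Types (b q t : R) (N j : nat).

Lemma powR_increment b j : 0 <= b < 1 ->
  (1 - b) * powR j.+1%:R (- b) <= powR j.+1%:R (1 - b) - powR j%:R (1 - b).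
Proof.
move=> /andP[b0 b1]; case: j => [|j].
  by rewrite !powR1 powR0 ?subr_eq0 ?gt_eqF// subr0 mulr1; lra.
have jj : j.+1%:R <= j.+2%:R :> R by rewrite ler_nat.
have h : powR j.+1%:R (1 - b) - (1 - b) * powR j.+2%:R (- b) * j.+1%:R <=
   powR j.+2%:R (1 - b) - (1 - b) * powR j.+2%:R (- b) * j.+2%:R.
  apply: (@der_nondecr _ j.+1%:R j.+2%:R (fun t => powR t (1 - b) - (1 - b) * powR j.+2%:R (- b) * t)
    (fun t => (1 - b) * (powR t (- b) - powR j.+2%:R (- b)))) => // t /andP[t1 t2].
    have t0 : 0 < t by apply: lt_le_trans t1; rewrite ltr0n.
    apply: (der_eq (derB (@der_powR _ _ (1 - b) _ _ t0 (der_id t)) (derM (der_cst _ t) (der_id t)))).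
    have -> : 1 - b - 1 = - b by ring.
    by ring.
  have t0 : 0 < t by apply: lt_le_trans t1; rewrite ltr0n.
  rewrite mulr_ge0 ?subr_ge0 ?(ltW b1)//; apply: powR_leN => //; lra.
have e : j.+2%:R = j.+1%:R + 1 :> R by rewrite -natr1.
move: h; move: (powR j.+2%:R (1 - b)) (powR j.+1%:R _) (powR j.+2%:R (- b)) => A A' A''; rewrite e; lra.
Qed.

(** The power [j^-b] is dominated by an increment of [j^(1 - b) / (1 - b)], so the sum telescopes;
    [b < 1] is essential. *)
Lemma power_sum b q N : 0 <= b < 1 -> 0 <= q ->
  \sum_(0 <= j < N) (if j.+1%:R < q then powR (q / j.+1%:R) b else 0) <= q / (1 - b).
Proof.
move=> hb q0; have [b0 b1] := andP hb.
have b10 : 0 < 1 - b by lra.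
have mono t t' : 0 <= t -> t <= t' -> powR t (1 - b) <= powR t' (1 - b) by move=> *; apply: powR_le => //; lra.
have h : \sum_(0 <= j < N) (if j.+1%:R < q then powR j.+1%:R (- b) else 0) <= powR (Num.min N%:R q) (1 - b) / (1 - b).
  elim: N => [|N ih]; first by rewrite big_nil divr_ge0 ?powR_ge0// ltW.
  rewrite big_nat_recr//= ; have [h|h] := ltP N.+1%:R q.
    have h' : N%:R <= q by apply: ltW; apply: le_lt_trans h; rewrite ler_nat.
    rewrite (min_l h') in ih.
    have := powR_increment N hb; rewrite -(ler_pM2r (x := (1 - b)^-1)) ?invr_gt0// mulrAC mulfV ?gt_eqF// mul1r mulrBl.
    by move: ih; lra.
  rewrite addr0 (le_trans ih)// ler_wpM2r ?invr_ge0 ?(ltW b10)// mono ?le_min ?ler0n//.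
  by rewrite ge_min lexx orbT.
apply: (@le_trans _ _ (powR q b * \sum_(0 <= j < N) (if j.+1%:R < q then powR j.+1%:R (- b) else 0))).
  rewrite mulr_sumr; apply: ler_sum => j _; case: ifP => hj; last by rewrite mulr0.
  by rewrite powRM ?invr_ge0// -powR_inv1// -powRrM mulN1r.
apply: (le_trans (ler_wpM2l (powR_ge0 _ _) h)); rewrite mulrA ler_wpM2r ?invr_ge0 ?(ltW b10)//.
apply: (@le_trans _ _ (powR q b * powR q (1 - b))).
  by rewrite ler_wpM2l ?powR_ge0// mono// ?le_min ?ler0n// ge_min lexx orbT.
move: q0; rewrite le_eqVlt => /orP[/eqP <-|q0].
  by rewrite [X in _ * X]powR0 ?mulr0// gt_eqF.
by rewrite -powRD ?(gt_eqF q0) ?implybT// addrC subrK powRr1// ltW.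
Qed.

End PowerSums.

Section KernelBound.
Context {R : realType}.
Variables (nu d : R) (s : nat -> R).
Hypothesis Hnu : -1 < nu.
Hypothesis d0 : 0 < d.
Hypothesis Hz : bessel_zeros nu s.
Implicit Types (x y t b B K e l r X : R) (i j N M : nat).
Local Notation cj := (cj nu s).
Local Notation ps := (psi nu s).

Let s_gt0 j : 0 < s j. Proof. exact: zeros_gt0 Hz j. Qed.

Lemma wmin_le3 l r x : 0 < l -> l <= r -> 0 < x ->
  wmin nu (l * x) <= powR (r / l) (Num.max (- (nu + 1 / 2)) 0) * wmin nu (r * x).
Proof.
move=> l0 lr x0; have r0 : 0 < r by exact: lt_le_trans lr.
have lx : 0 < l * x by nng.
have rx : 0 < r * x by nng.
have lrx : l * x <= r * x by rewrite ler_pM2r.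
have m0 : 0 < Num.min 1 (r * x) by rewrite lt_min ltr01.
have m0' : 0 < Num.min 1 (l * x) by rewrite lt_min ltr01.
rewrite /wmin; have [k0|k0] := leP 0 (nu + 1 / 2).
  have -> : Num.max (- (nu + 1 / 2)) 0 = 0 by apply: max_r; rewrite oppr_le0.
  rewrite powRr0 [1 * powR _ _]mul1r; apply: (@powR_le _ (nu + 1 / 2)) => //; first exact: ltW.
  by rewrite le_min !ge_min lexx lrx orbT.
rewrite max_l ?oppr_ge0 ?(ltW k0)//.
have rl : 0 < r / l by nng.
have -> : powR (r / l) (- (nu + 1 / 2)) = powR (r / l)^-1 (nu + 1 / 2).
  by rewrite -(powR_inv1 (ltW rl)) -powRrM mulN1r.
rewrite -powRM ?invr_ge0 ?(ltW rl) ?(ltW m0)//.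
apply: powR_leN; [exact: ltW| by rewrite mulr_gt0 ?invr_gt0|].
rewrite invf_div le_min; apply/andP; split.
  apply: mulr_ile1; rewrite ?divr_ge0 ?(ltW l0) ?(ltW r0) ?(ltW m0)//.
    by rewrite ler_pdivrMr// mul1r.
  by rewrite ge_min lexx.
apply: (@le_trans _ _ (l / r * (r * x))).
  by rewrite ler_wpM2l ?divr_ge0 ?(ltW l0) ?(ltW r0)// ge_min lexx orbT.
by rewrite mulrA divfK// gt_eqF.
Qed.

Lemma psi_pair_bound : exists c C : R, [/\ 0 < c, 0 < C, (forall j, c * j.+1%:R <= s j) &
  forall j x y, 0 < x -> 0 < y ->
  `|ps j x * ps j y| <= C * (powR (x * y) (- (nu + 1 / 2)) * (wmin nu (s j * x) * wmin nu (s j * y)))].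
Proof.
have [c [C [c0 C0 slin cb ub]]] := zeros_facts Hnu Hz.
exists c, (C * C ^+ 2); split => //; first by nng.
move=> j x y x0 y0; have S0 := s_gt0 j; have [cj0 cj2] := cb j.
rewrite !(psiE Hnu Hz)// !besu_scale//.
have hx := ub _ (mulr_gt0 S0 x0); have hy := ub _ (mulr_gt0 S0 y0).
have wx := ltW (wmin_gt0 nu (mulr_gt0 S0 x0)); have wy := ltW (wmin_gt0 nu (mulr_gt0 S0 y0)).
have -> : cj j * (powR (s j * x) (- (nu + 1 / 2)) * besu nu (s j * x)) * (cj j * (powR (s j * y) (- (nu + 1 / 2)) * besu nu (s j * y))) =
  cj j ^+ 2 * (powR (s j * x) (- (nu + 1 / 2)) * powR (s j * y) (- (nu + 1 / 2))) * (besu nu (s j * x) * besu nu (s j * y)) by ring.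
have -> : powR (s j * x) (- (nu + 1 / 2)) * powR (s j * y) (- (nu + 1 / 2)) = (powR (s j) (2 * nu + 1))^-1 * powR (x * y) (- (nu + 1 / 2)).
  rewrite !powRM ?(ltW S0) ?(ltW x0) ?(ltW y0)// -powRN.
  have -> : - (2 * nu + 1) = - (nu + 1 / 2) + - (nu + 1 / 2) by lra.
  by rewrite powRD ?(gt_eqF S0) ?implybT//; ring.
have W0 : 0 < powR (s j) (2 * nu + 1) by nng.
rewrite normrM; apply: (@le_trans _ _ (C * powR (x * y) (- (nu + 1 / 2)) * (C * wmin nu (s j * x) * (C * wmin nu (s j * y))))).
  apply: ler_pM => //.
    rewrite mulrA normrM [X in _ * X]ger0_norm ?powR_ge0// ler_wpM2r ?powR_ge0//.
    have q0 : 0 <= cj j ^+ 2 / powR (s j) (2 * nu + 1) by nng.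
    by rewrite (ger0_norm q0) ler_pdivrMr.
  by rewrite normrM ler_pM.
by apply: eq_ler; ring.
Qed.

(** Near the diagonal absolute values suffice. Passing from the weights at [s_j] to those at [r]
    costs [(r / s_j)^b], with [b < 1] because [nu > -1], and about [r] terms are nonzero. *)
Lemma kernel_near : exists2 C, 0 < C & forall r x y N, 0 < r -> 0 < x -> 0 < y ->
  `|\sum_(0 <= j < N) riesz d r (s j) * (ps j x * ps j y)| <= C * (r * kw nu r x y).
Proof.
have [c [C [c0 C0 slin pb]]] := psi_pair_bound.
pose be := Num.max (- (nu + 1 / 2)) 0; pose b := be + be.
have hb : 0 <= b < 1.
  have h1 : 0 <= be by rewrite le_max lexx orbT.
  have h2 : be < 1 / 2 by rewrite gt_max; apply/andP; split; move: Hnu; lra.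
  by apply/andP; split; rewrite /b; lra.
have [b0 b1] := andP hb; have b10 : 0 < 1 - b by lra.
exists (C / c / (1 - b)) => [|r x y N r0 x0 y0]; first by nng.
have k0 : 0 <= kw nu r x y.
  by rewrite /kw !mulr_ge0 ?powR_ge0 ?(ltW (wmin_gt0 _ _)) ?mulr_gt0.
apply: (le_trans (ler_norm_sum _ _ _)).
have term j : `|riesz d r (s j) * (ps j x * ps j y)| <= C * kw nu r x y * (if j.+1%:R < r / c then powR (r / c / j.+1%:R) b else 0).
  have S0 := s_gt0 j; have [h|h] := leP r (s j).
    rewrite riesz_out// mul0r normr0; case: ifP => _; rewrite ?mulr0// mulr_ge0 ?powR_ge0// mulr_ge0//.
    exact: ltW.
  have jc : j.+1%:R < r / c by rewrite ltr_pdivlMr// mulrC (le_lt_trans (slin j)).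
  rewrite jc normrM; apply: (@le_trans _ _ (1 * `|ps j x * ps j y|)).
    rewrite ler_wpM2r// ger0_norm ?powR_ge0// /riesz.
    have m1 : Num.max (1 - (s j / r) ^+ 2) 0 <= 1.
      by rewrite ge_max ler01 andbT gerBl sqr_ge0.
    have m0 : 0 <= Num.max (1 - (s j / r) ^+ 2) 0 by rewrite le_max lexx orbT.
    have E1 : powR 1 d = 1 :> R by rewrite powR1.
    rewrite -[leRHS]E1; apply: powR_le => //; exact: ltW.
  rewrite mul1r; apply: (le_trans (pb j x y x0 y0)); rewrite -mulrA ler_wpM2l ?(ltW C0)//.
  rewrite /kw -mulrA ler_wpM2l ?powR_ge0//.
  have hx := wmin_le3 S0 (ltW h) x0; have hy := wmin_le3 S0 (ltW h) y0.
  have wx := ltW (wmin_gt0 nu (mulr_gt0 S0 x0)); have wy := ltW (wmin_gt0 nu (mulr_gt0 S0 y0)).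
  have wrx := ltW (wmin_gt0 nu (mulr_gt0 r0 x0)); have wry := ltW (wmin_gt0 nu (mulr_gt0 r0 y0)).
  apply: (le_trans (ler_pM wx wy hx hy)); rewrite -/be.
  have rs : 0 < r / s j by nng.
  rewrite mulrACA -powRD ?(gt_eqF rs) ?implybT// -/b mulrC ler_wpM2l ?mulr_ge0//.
  apply: powR_le => //; first exact: ltW.
  rewrite -mulrA ler_pM2l// -invfM lef_pV2 ?posrE ?mulr_gt0 ?ltr0n//.
apply: (le_trans (ler_sum _ (fun j _ => term j))); rewrite -mulr_sumr.
have := power_sum N hb (divr_ge0 (ltW r0) (ltW c0)) => h.
apply: (le_trans (ler_wpM2l _ h)); first by nng.
by apply: eq_ler; ring.
Qed.

(** For bounded [r |x - y|] this is [kernel_near]. Otherwise the sum is split into the corrected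
    multiplier, the resolvent series minus its limit, which is arbitrarily small, and the Green
    functions. *)
Theorem kernel_bound : exists2 C, 0 < C & forall r x y N, 0 < r -> 0 < x < 1 -> 0 < y < 1 ->
  (forall j, (N <= j)%N -> r <= s j) ->
  `|\sum_(0 <= j < N) riesz d r (s j) * (ps j x * ps j y)|
  <= C * (r * kw nu r x y * powR (1 + r * `|x - y|) (- (1 + d))).
Proof.
have [C1 C10 near] := kernel_near.
have [L [D [J [C2 [C' [K0 [C20 K01 hJ hD far]]]]]]] := kernel_osc Hnu d0 Hz.
have [E E0 hE] : exists2 E, 0 <= E & forall r x y, 0 < x < 1 -> 0 < y < 1 -> 0 < r -> 1 <= r * `|x - y| ->
    `|\sum_k D k * (r ^+ 2 * green nu (Num.sqrt (k%:R + 1) * r) x y)| <= E * (r * kw nu r x y * powR (r * `|x - y|) (- (1 + d))).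
  have k1 (k : 'I_L) : 1 <= Num.sqrt (k%:R + 1) :> R.
    by rewrite -[leLHS]sqrtr1 ler_sqrt ?lerDr// ltr_wpDl.
  have hg (k : 'I_L) : exists C : R, 0 < C /\ forall r x y, 0 < x < 1 -> 0 < y < 1 -> 0 < r -> 1 <= r * `|x - y| ->
      `|(Num.sqrt (k%:R + 1) * r) ^+ 2 * green nu (Num.sqrt (k%:R + 1) * r) x y| <= C * (r * kw nu r x y * powR (r * `|x - y|) (- (1 + d))).
    by have [C C0 h] := green_bound Hnu d0 (k1 k); exists C.
  have [G hG] := choice hg.
  exists (\sum_k `|D k| * G k) => [|r x y hx hy r0 hr].
    by apply: sumr_ge0 => k _; rewrite mulr_ge0// ltW//; case: (hG k).
  rewrite mulr_suml; apply: (le_trans (ler_norm_sum _ _ _)); apply: ler_sum => k _.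
  rewrite normrM -[leRHS]mulrA ler_wpM2l//; have [_ h] := hG k.
  apply: le_trans (h r x y hx hy r0 hr); rewrite exprMn sqr_sqrtr ?addr_ge0//.
  move: (green _ _ _ _) => g; rewrite -[(_ + 1) * _ * g]mulrA [leRHS]normrM ler_peMl// ger0_norm ?addr_ge0//.
  by rewrite lerDr.
pose q := 1 + d; have q0 : 0 < q by rewrite /q; move: d0; lra.
pose Cn := C1 * powR (1 + K0) q; pose Cf := (C2 + E) * powR 2 q.
have K00 : 0 < 1 + K0 by lra.
have Cn0 : 0 < Cn by nng.
have Cf0 : 0 <= Cf by nng.
exists (Cn + Cf) => [|r x y N r0 hx hy hN]; first exact: ltr_pwDl.
have [x0 x1] := andP hx; have [y0 y1] := andP hy.
have k0 : 0 <= r * kw nu r x y.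
  by rewrite /kw !mulr_ge0 ?powR_ge0 ?(ltW r0) ?(ltW (wmin_gt0 _ _)) ?mulr_gt0.
rewrite -/q; set a := r * `|x - y|; have a0 : 0 <= a by nng.
have pa : 0 <= powR (1 + a) (- q) := powR_ge0 _ _.
have [ha|ha] := ltP a K0.
  apply: (le_trans (near r x y N r0 x0 y0)).
  apply: (@le_trans _ _ (Cn * (r * kw nu r x y * powR (1 + a) (- q)))); last first.
    by apply: ler_wpM2r; [exact: mulr_ge0|rewrite lerDl].
  have -> : Cn * (r * kw nu r x y * powR (1 + a) (- q)) = C1 * (r * kw nu r x y) * (powR (1 + K0) q * powR (1 + a) (- q)).
    by rewrite /Cn; ring.
  have Q0 := mulr_ge0 (ltW C10) k0; rewrite (ler_peMr Q0)//.
  have a1 : 0 < 1 + a by lra.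
  rewrite powRN ler_pdivlMr ?powR_gt0// mul1r; apply: powR_le; lra.
apply: (@le_trans _ _ (Cf * (r * kw nu r x y * powR (1 + a) (- q)))); last first.
  by apply: ler_wpM2r; [exact: mulr_ge0|rewrite lerDr ltW].
have a1 : 1 <= a by exact: le_trans ha.
have aq : powR a (- q) <= powR 2 q * powR (1 + a) (- q).
  have -> : powR a (- q) = powR 2 q * powR (2 * a) (- q).
    rewrite powRM// mulrA -powRD ?(gt_eqF (ltr0Sn R 1)) ?implybT// addrN powRr0 mul1r//.
  rewrite ler_wpM2l ?powR_ge0//; apply: powR_leN; lra.
apply: (@le_trans _ _ ((C2 + E) * (r * kw nu r x y * powR a (- q)))); last first.
  rewrite /Cf -[leRHS]mulrA; apply: ler_wpM2l; first exact: addr_ge0.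
  by rewrite [leRHS]mulrCA; apply: ler_wpM2l.
apply/ler_addgt0Pr => e e0.
have [N1 h1] := far x y r hx hy r0 ha.
have [N2 h2] := resolvent_series Hnu Hz hJ hD r0 hx hy e0.
pose M := maxn N (maxn N1 N2).
have NM : (N <= M)%N by exact: leq_maxl.
have N1M : (N1 <= M)%N by rewrite !leq_max leqnn orbT.
have N2M : (N2 <= M)%N by rewrite !leq_max leqnn !orbT.
(* The Riesz terms vanish from [N] on, so all three sums can be cut at a common, later index. *)
have -> : \sum_(0 <= j < N) riesz d r (s j) * (ps j x * ps j y) = \sum_(0 <= j < M) riesz d r (s j) * (ps j x * ps j y).
  rewrite (big_cat_nat (n := N) (p := M))//= [X in _ + X]big_nat_cond [X in _ + X]big1 ?addr0// => j /andP[/andP[Nj _] _].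
  by rewrite riesz_out ?mul0r// hN.
set G := \sum_k _ in h2.
have -> : \sum_(0 <= j < M) riesz d r (s j) * (ps j x * ps j y) =
  \sum_(0 <= j < M) (riesz d r (s j) - nres D ((s j / r) ^+ 2)) * (ps j x * ps j y) +
  (\sum_(0 <= j < M) nres D ((s j / r) ^+ 2) * (ps j x * ps j y) - G) + G.
  by rewrite addrA subrK -big_split /=; apply: eq_bigr => j _; ring.
apply: (le_trans (ler_normD _ _)); apply: (le_trans (lerD (ler_normD _ _) (hE r x y hx hy r0 a1))).
have := h1 M N1M; have := h2 M N2M; rewrite -/a -/q mulrDl; lra.
Qed.

End KernelBound.

(** * Splitting the kernel into off-diagonal and local parts *)

Section KernelSplit.
Context {R : realType}.
Variables (nu d : R).
Hypothesis Hnu : -1 < nu.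
Hypothesis d0 : 0 < d.
Implicit Types (x y z t b B K e r u : R).
Local Notation kap := (nu + 1 / 2).

Definition mx r x := Num.max x r^-1.

Lemma mx_ge r x : x <= mx r x. Proof. by rewrite le_max lexx. Qed.
Lemma mx_gt0 r x : 0 < x -> 0 < mx r x. Proof. by move=> x0; rewrite lt_max x0. Qed.
Lemma mx_inv r x : 0 < r -> 1 <= r * mx r x.
Proof. by move=> r0; rewrite mulrC -ler_pdivrMr// div1r le_max lexx orbT. Qed.
Lemma mx_mono r x y : x <= y -> mx r x <= mx r y.
Proof. by move=> xy; rewrite ge_max !le_max xy lexx orbT. Qed.

Lemma kw_mx r x y : 0 < r -> 0 < x -> 0 < y -> kw nu r x y = powR (mx r x) (- kap) * powR (mx r y) (- kap).
Proof.
move=> r0 x0 y0; rewrite /kw powRM ?(ltW x0) ?(ltW y0)// -!(wmin_max nu r0)//; ring.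
Qed.

Definition dec r u := powR (1 + r * u) (- (1 + d)).
(** The dependence on [y] of the kernel for [y <= x / 2]. Its norm in the dual space of [L^p] is
    bounded uniformly in [r]. *)
Definition tr r y := powR r (- d) * powR (mx r y) (- kap).
(** For [y >= 2 x] the kernel is bounded, uniformly in [r], by the value of [tr] at [r = 1 / x]. For
    nonpositive [nu + 1 / 2] the exponent is [p = 1] and a constant suffices. *)
Definition tt r x y := if 0 < kap then tr r y + tr x^-1 y else 1.

Lemma dec_far r z u : 0 < r -> 0 < z -> z <= 2 * u ->
  dec r u <= powR 2 (1 + d) * powR (r * mx r z) (- (1 + d)).
Proof.
move=> r0 z0 zu; have u0 : 0 <= u by lra.
have rm : 0 < r * mx r z by rewrite mulr_gt0 ?mx_gt0.
have h : r * mx r z / 2 <= 1 + r * u.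
  rewrite ler_pdivrMr// /mx maxr_pMr ?(ltW r0)// mulfV ?gt_eqF// ge_max; apply/andP; split.
    have := ler_wpM2l (ltW r0) zu; have := mulr_ge0 (ltW r0) u0; lra.
  by have := mulr_ge0 (ltW r0) u0; lra.
have -> : powR 2 (1 + d) * powR (r * mx r z) (- (1 + d)) = powR (r * mx r z / 2) (- (1 + d)).
  rewrite [in RHS]powRM ?invr_ge0 ?(ltW rm)// mulrC; congr (_ * _).
  by rewrite -(@powR_inv1 _ 2)// -powRrM mulN1r opprK.
by apply: powR_leN => //; [move: d0; lra|rewrite divr_gt0].
Qed.

Lemma dec_le1 r u : 0 < r -> 0 <= u -> 0 <= dec r u <= 1.
Proof.
move=> r0 u0; rewrite powR_ge0 /dec powRN invf_le1 ?powR_gt0 ?ltr_pwDl ?mulr_ge0 ?(ltW r0)//.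
have E1 : powR 1 (1 + d) = 1 :> R by rewrite powR1.
rewrite -[leLHS]E1; apply: powR_le => //; first by move: d0; lra.
by rewrite lerDl mulr_ge0// ltW.
Qed.

Lemma off_left r x y : 0 < kap -> 0 < r -> 0 < x -> 0 < y -> 2 * y <= x ->
  r * kw nu r x y * dec r `|x - y| <= powR 2 (1 + d) * (powR x (- (kap + 1 + d)) * tr r y).
Proof.
move=> k0 r0 x0 y0 xy; have m0 := mx_gt0 r x0; have my := mx_gt0 r y0.
have h : dec r `|x - y| <= powR 2 (1 + d) * powR (r * mx r x) (- (1 + d)).
  by apply: dec_far => //; rewrite ger0_norm; lra.
rewrite kw_mx//; apply: (le_trans (ler_wpM2l _ h)).
  by nng.
rewrite powRM ?(ltW r0) ?(ltW m0)// /tr.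
have -> : r * (powR (mx r x) (- kap) * powR (mx r y) (- kap)) * (powR 2 (1 + d) * (powR r (- (1 + d)) * powR (mx r x) (- (1 + d)))) =
  powR 2 (1 + d) * ((powR (mx r x) (- kap) * powR (mx r x) (- (1 + d))) * ((r * powR r (- (1 + d))) * powR (mx r y) (- kap))) by ring.
rewrite -powRD ?(gt_eqF m0) ?implybT// -{1}[r in r * powR r _]powRr1 ?(ltW r0)// -powRD ?(gt_eqF r0) ?implybT//.
have -> : 1 + - (1 + d) = - d by ring.
have -> : - kap + - (1 + d) = - (kap + 1 + d) by ring.
rewrite ler_wpM2l ?powR_ge0// ler_wpM2r ?mulr_ge0 ?powR_ge0//.
by apply: powR_leN => //; [move: k0 d0; lra|exact: mx_ge].
Qed.

(** The factor [r^-d max(x, 1 / r)^-kap] is at most [x^-(kap - d)], as [r max(x, 1 / r) >= 1] and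
    [d <= kap]. This removes [r]. *)
Lemma off_right r x y : 0 < kap -> d <= kap -> 0 < r -> 0 < x -> 0 < y -> 2 * x <= y ->
  r * kw nu r x y * dec r `|x - y| <= powR 2 (1 + d) * (powR x (- (kap + 1 + d)) * tr x^-1 y).
Proof.
move=> k0 dk r0 x0 y0 xy; have m0 := mx_gt0 r x0; have my := mx_gt0 r y0.
have h : dec r `|x - y| <= powR 2 (1 + d) * powR (r * mx r y) (- (1 + d)).
  by apply: dec_far => //; rewrite ler0_norm; lra.
rewrite kw_mx//; apply: (le_trans (ler_wpM2l _ h)).
  by nng.
rewrite powRM ?(ltW r0) ?(ltW my)// /tr.
have -> : r * (powR (mx r x) (- kap) * powR (mx r y) (- kap)) * (powR 2 (1 + d) * (powR r (- (1 + d)) * powR (mx r y) (- (1 + d)))) =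
  powR 2 (1 + d) * (((r * powR r (- (1 + d))) * powR (mx r x) (- kap)) * (powR (mx r y) (- kap) * powR (mx r y) (- (1 + d)))) by ring.
rewrite -powRD ?(gt_eqF my) ?implybT// -{1}[r in r * powR r _]powRr1 ?(ltW r0)// -powRD ?(gt_eqF r0) ?implybT//.
have -> : 1 + - (1 + d) = - d by ring.
have -> : - kap + - (1 + d) = - (kap + 1 + d) by ring.
rewrite ler_wpM2l ?powR_ge0//.
have h1 : powR r (- d) * powR (mx r x) (- kap) <= powR x (- (kap - d)).
  have -> : - kap = - d + - (kap - d) by ring.
  rewrite powRD ?(gt_eqF m0) ?implybT// mulrA -powRM ?(ltW r0) ?(ltW m0)//.
  rewrite -[leRHS]mul1r; apply: ler_pM; rewrite ?powR_ge0//.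
    rewrite powRN invf_le1 ?powR_gt0 ?mulr_gt0//.
    have E1 : powR 1 d = 1 :> R by rewrite powR1.
    by rewrite -[leLHS]E1; apply: powR_le; rewrite ?mx_inv// ltW.
  by apply: powR_leN; rewrite ?mx_ge//; move: dk; lra.
have h2 : powR (mx r y) (- (kap + 1 + d)) <= powR y (- kap) * powR x (- (1 + d)).
  have -> : - (kap + 1 + d) = - kap + - (1 + d) by ring.
  rewrite powRD ?(gt_eqF my) ?implybT//; apply: ler_pM; rewrite ?powR_ge0//.
    by apply: powR_leN; rewrite ?mx_ge//; move: k0; lra.
  apply: powR_leN => //; first by move: d0; lra.
  by apply: le_trans (mx_ge r y); lra.
apply: (le_trans (ler_pM _ _ h1 h2)); rewrite ?mulr_ge0 ?powR_ge0//.
have -> : mx x^-1 y = y by rewrite /mx invrK max_l//; lra.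
have -> : powR x^-1 (- d) = powR x d by rewrite -(powR_inv1 (ltW x0)) -powRrM mulN1r opprK.
have -> : powR x (- (kap - d)) * (powR y (- kap) * powR x (- (1 + d))) = (powR x (- (kap - d)) * powR x (- (1 + d))) * powR y (- kap) by ring.
rewrite mulrA -!powRD ?(gt_eqF x0) ?implybT//; apply: eq_ler; congr (powR x _ * _); ring.
Qed.

(** With [kap <= 0] both weights increase, so they are replaced by their value at the larger of [x]
    and [y]; of the decay only the power [-1] is kept. *)
Lemma off_low r x y : kap <= 0 -> 0 < r -> 0 < x -> 0 < y -> (2 * x <= y) || (2 * y <= x) ->
  r * kw nu r x y * dec r `|x - y| <= powR 2 (1 + d) * powR x (- (2 * nu + 2)).
Proof.
move=> k0 r0 x0 y0 hxy; pose z := Num.max x y.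
have z0 : 0 < z by rewrite lt_max x0.
have m0 := mx_gt0 r z0; have mX := mx_gt0 r x0; have mY := mx_gt0 r y0.
have zu : z <= 2 * `|x - y|.
  by rewrite ge_max; have [h|h] := orP hxy; [rewrite ler0_norm|rewrite ger0_norm]; try (apply/andP; split); lra.
have h := dec_far r0 z0 zu.
have xz : x <= z by rewrite le_max lexx.
have yz : y <= z by rewrite le_max lexx orbT.
rewrite kw_mx//; apply: (le_trans (ler_wpM2l _ h)).
  by nng.
have h1 : powR (mx r x) (- kap) <= powR (mx r z) (- kap) by apply: powR_le; rewrite ?mx_mono ?oppr_ge0// ltW.
have h2 : powR (mx r y) (- kap) <= powR (mx r z) (- kap) by apply: powR_le; rewrite ?mx_mono ?oppr_ge0// ltW.
have h3 : powR (r * mx r z) (- (1 + d)) <= (r * mx r z)^-1.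
  rewrite -powR_inv1 ?mulr_ge0 ?(ltW r0) ?(ltW m0)//; apply: ler_powR; first exact: mx_inv.
  by move: d0; lra.
apply: (@le_trans _ _ (r * (powR (mx r z) (- kap) * powR (mx r z) (- kap)) * (powR 2 (1 + d) * (r * mx r z)^-1))).
  apply: ler_pM; rewrite ?mulr_ge0 ?powR_ge0 ?(ltW r0)//.
    by rewrite ler_wpM2l ?(ltW r0)// ler_pM ?powR_ge0.
  by rewrite ler_wpM2l ?powR_ge0.
rewrite -powRD ?(gt_eqF m0) ?implybT//.
have -> : r * powR (mx r z) (- kap + - kap) * (powR 2 (1 + d) * (r * mx r z)^-1) =
  powR 2 (1 + d) * (powR (mx r z) (- kap + - kap) * (mx r z)^-1).
  by move: m0; move: (mx r z) (powR _ _) (powR 2 _) => M P Q M0; field; rewrite !gt_eqF.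
rewrite ler_wpM2l ?powR_ge0// -powRB1//.
have -> : - kap + - kap - 1 = - (2 * nu + 2) by lra.
apply: powR_leN => //; first by move: Hnu; lra.
by apply: (le_trans xz); exact: mx_ge.
Qed.

Lemma near_high r x y : 0 < kap -> 0 < r -> 0 < x -> 0 < y -> y <= 2 * x ->
  kw nu r x y * weight nu y <= powR 2 kap.
Proof.
move=> k0 r0 x0 y0 yx; rewrite kw_mx//.
have h1 : powR (mx r x) (- kap) <= powR x (- kap) by apply: powR_leN; rewrite ?mx_ge//; move: k0; lra.
have h2 : powR (mx r y) (- kap) <= powR y (- kap) by apply: powR_leN; rewrite ?mx_ge//; move: k0; lra.
apply: (@le_trans _ _ (powR x (- kap) * powR y (- kap) * weight nu y)).
  by rewrite ler_wpM2r ?powR_ge0// ler_pM ?powR_ge0.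
rewrite -mulrA /weight -powRD ?(gt_eqF y0) ?implybT//.
have -> : - kap + (2 * nu + 1) = kap by lra.
apply: (@le_trans _ _ (powR x (- kap) * powR (2 * x) kap)).
  by rewrite ler_wpM2l ?powR_ge0//; apply: powR_le => //; exact: ltW.
by rewrite powRM ?(ltW x0)// mulrCA -powRD ?(gt_eqF x0) ?implybT// addNr powRr0 mulr1.
Qed.

Lemma near_low r x y : kap <= 0 -> 0 < r -> 0 < x -> 0 < y -> x <= 2 * y -> y <= 2 * x -> 1 <= r * x ->
  kw nu r x y * weight nu y <= powR 2 (- (3 * kap)).
Proof.
move=> k0 r0 x0 y0 xy yx rx; rewrite kw_mx//.
have rx' : r^-1 <= x by rewrite -div1r ler_pdivrMr// mulrC.
have -> : mx r x = x by rewrite /mx max_l.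
have my : mx r y <= 2 * x by rewrite ge_max yx/= ; lra.
have mY := mx_gt0 r y0.
have h1 : powR (mx r y) (- kap) <= powR (2 * x) (- kap) by apply: powR_le; rewrite ?oppr_ge0// ltW.
have h2 : weight nu y <= powR (x / 2) (2 * nu + 1) by apply: powR_leN; lra.
apply: (@le_trans _ _ (powR x (- kap) * powR (2 * x) (- kap) * powR (x / 2) (2 * nu + 1))).
  by apply: ler_pM; rewrite ?mulr_ge0 ?powR_ge0// ler_wpM2l ?powR_ge0.
rewrite !powRM ?invr_ge0 ?(ltW x0)//.
have -> : powR 2^-1 (2 * nu + 1) = powR 2 (- (2 * nu + 1)) :> R by rewrite -(@powR_inv1 _ 2)// -powRrM mulN1r.
have -> : powR x (- kap) * (powR 2 (- kap) * powR x (- kap)) * (powR x (2 * nu + 1) * powR 2 (- (2 * nu + 1))) =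
  (powR x (- kap) * powR x (- kap) * powR x (2 * nu + 1)) * (powR 2 (- kap) * powR 2 (- (2 * nu + 1))) by ring.
have t2 : (2 == 0 :> R) = false by rewrite gt_eqF.
rewrite -!powRD ?(gt_eqF x0) ?t2 ?implybT//.
have -> : - kap + - kap + (2 * nu + 1) = 0 by lra.
by rewrite powRr0 mul1r; apply: eq_ler; congr powR; lra.
Qed.

(** When [r x < 1] the diagonal region needs no maximal function: the kernel is already below
    [x^-(2 nu + 2)]. *)
Lemma near_low_small r x y : kap <= 0 -> 0 < r -> 0 < x -> 0 < y -> y <= 2 * x -> r * x < 1 ->
  r * kw nu r x y <= powR 2 (- kap) * powR x (- (2 * nu + 2)).
Proof.
move=> k0 r0 x0 y0 yx rx; rewrite kw_mx//.
have rx' : x < r^-1 by rewrite -div1r ltr_pdivlMr// mulrC.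
have -> : mx r x = r^-1 by rewrite /mx max_r// ltW.
have ri : 0 < r^-1 by nng.
have my : mx r y <= 2 * r^-1 by rewrite ge_max; apply/andP; split; lra.
have mY := mx_gt0 r y0.
have h1 : powR (mx r y) (- kap) <= powR (2 * r^-1) (- kap) by apply: powR_le; rewrite ?oppr_ge0// ltW.
apply: (@le_trans _ _ (r * (powR r^-1 (- kap) * powR (2 * r^-1) (- kap)))).
  by rewrite ler_wpM2l ?(ltW r0)// ler_wpM2l ?powR_ge0.
rewrite powRM ?(ltW ri)//.
have -> : r * (powR r^-1 (- kap) * (powR 2 (- kap) * powR r^-1 (- kap))) = powR 2 (- kap) * (powR r^-1 (- kap) * powR r^-1 (- kap) / r^-1).
  by rewrite invrK; ring.
rewrite -powRD ?(gt_eqF ri) ?implybT// -powRB1// ler_wpM2l ?powR_ge0//.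
have -> : - kap + - kap - 1 = - (2 * nu + 2) by lra.
by apply: powR_leN => //; [move: Hnu; lra|exact: ltW].
Qed.

Variable p : R.
Hypothesis Hp : (kap <= 0 /\ p = 1) \/ [/\ 0 < kap, d <= kap & p = (2 * nu + 2) / (kap + 1 + d)].

Lemma tr_ge0 r y : 0 <= tr r y. Proof. by nng. Qed.

(** In the second case of [Hp], [(2 nu + 2) / p = kap + 1 + d], so the off-diagonal part carries the
    power of [x] that lies in weak [L^p]. Near the diagonal the weight at [y] cancels [kw], which
    leaves a convolution kernel. *)
Lemma kernel_split : exists2 C, 0 < C & forall r x y, 0 < r -> 0 < x -> 0 < y ->
  r * kw nu r x y * dec r `|x - y| * weight nu y <=
  C * (powR x (- ((2 * nu + 2) / p)) * (tt r x y * weight nu y) + (if (x < 2 * y) && (y < 2 * x) then r * dec r `|x - y| else 0)).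
Proof.
pose C := powR 2 (1 + d) + powR 2 (3 * `|kap|) : R.
have c1 : 0 < powR 2 (1 + d) :> R by nng.
have c2 : 0 < powR 2 (3 * `|kap|) :> R by nng.
have two : 1 <= 2 :> R by lra.
have c3 u : u <= 3 * `|kap| -> powR 2 u <= C.
  by move=> hu; apply: le_trans (ler_powR two hu) _; rewrite lerDr ltW.
have c4 : powR 2 (1 + d) <= C by rewrite lerDl ltW.
exists C => [|r x y r0 x0 y0]; first exact: addr_gt0.
have w0 : 0 <= weight nu y := powR_ge0 _ _.
have /andP[D0 D1] := dec_le1 r0 (normr_ge0 (x - y)).
have C0 : 0 <= C by nng.
have kw0 : 0 <= kw nu r x y by rewrite kw_mx// mulr_ge0 ?powR_ge0.
case: Hp => [[k0 pE]|[k0 dk pE]].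
  rewrite pE divr1 /tt ltNge k0 /= mul1r.
  have fin u : 0 <= u -> r * kw nu r x y * dec r `|x - y| <= C * powR x (- (2 * nu + 2)) ->
      r * kw nu r x y * dec r `|x - y| * weight nu y <= C * (powR x (- (2 * nu + 2)) * weight nu y + u).
    move=> u0 h; apply: (le_trans (ler_wpM2r w0 h)); rewrite -mulrA ler_wpM2l// lerDl//.
  case: ifPn => [/andP[xy yx]|].
    have [rx|rx] := leP 1 (r * x).
      rewrite mulrDr; apply: ler_wpDl; first by nng.
      have h := near_low k0 r0 x0 y0 (ltW xy) (ltW yx) rx.
      have -> : r * kw nu r x y * dec r `|x - y| * weight nu y = (kw nu r x y * weight nu y) * (r * dec r `|x - y|) by ring.
      apply: ler_wpM2r; first by nng.
      by apply: (le_trans h); apply: c3; rewrite ler0_norm//; lra.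
    apply: fin; first by nng.
    apply: (@le_trans _ _ (r * kw nu r x y)); first by rewrite ler_piMr// mulr_ge0// ltW.
    apply: (le_trans (near_low_small k0 r0 x0 y0 (ltW yx) rx)); rewrite ler_wpM2r ?powR_ge0// c3// ler0_norm//; lra.
  rewrite negb_and -!leNgt orbC => hxy; rewrite -[X in C * X]addr0; rewrite addr0; apply: fin => //.
  apply: (le_trans (off_low k0 r0 x0 y0 _)); last by rewrite ler_wpM2r ?powR_ge0.
  by [].
have n0 : 0 < 2 * nu + 2 by move: Hnu; lra.
have q0 : 0 < kap + 1 + d by move: d0 k0; lra.
have -> : (2 * nu + 2) / p = kap + 1 + d.
  by rewrite pE invf_div mulrCA mulfV ?mulr1// gt_eqF.
rewrite /tt k0; have t1 := tr_ge0 r y; have t2 := tr_ge0 x^-1 y.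
have fin u T : 0 <= u -> 0 <= T -> T <= tr r y + tr x^-1 y -> r * kw nu r x y * dec r `|x - y| <= powR 2 (1 + d) * (powR x (- (kap + 1 + d)) * T) ->
    r * kw nu r x y * dec r `|x - y| * weight nu y <= C * (powR x (- (kap + 1 + d)) * ((tr r y + tr x^-1 y) * weight nu y) + u).
  move=> u0 T0 hT h; apply: (le_trans (ler_wpM2r w0 h)); rewrite -mulrA; apply: ler_pM; rewrite ?mulr_ge0 ?powR_ge0//.
  by rewrite -mulrA; apply: ler_wpDr => //; rewrite ler_wpM2l ?powR_ge0// ler_wpM2r.
case: ifPn => [/andP[xy yx]|].
  rewrite mulrDr; apply: ler_wpDl; first by nng.
  have h := near_high k0 r0 x0 y0 (ltW yx).
  have -> : r * kw nu r x y * dec r `|x - y| * weight nu y = (kw nu r x y * weight nu y) * (r * dec r `|x - y|) by ring.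
  apply: ler_wpM2r; first by nng.
  by apply: (le_trans h); apply: c3; rewrite gtr0_norm//; lra.
rewrite negb_and -!leNgt => /orP[hxy|hxy].
  by apply: (fin 0 _ (lexx _) t1); [rewrite lerDl|exact: off_left].
by apply: (fin 0 _ (lexx _) t2); [rewrite lerDr|exact: off_right].
Qed.

End KernelSplit.

(** * Weak-type estimates *)

Section WeightedLp.
Context {R : realType}.
Variables (nu d : R).
Hypothesis Hnu : -1 < nu.
Hypothesis d0 : 0 < d.
Implicit Types (x y z t b B K e r u th : R) (f g : R -> R).
Local Notation kap := (nu + 1 / 2).
Local Notation leb := (@lebesgue_measure R).
Local Notation I01 := (`]0, 1[%classic : set R).
Local Notation wint := (wint nu).
Local Notation wi g := (leb.-integrable I01 (EFin \o (fun x : R => g x * weight nu x))).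

Let n1 : 0 < 2 * nu + 2. Proof. by move: Hnu; lra. Qed.
Let w_ge0 x : 0 <= weight nu x. Proof. exact: powR_ge0. Qed.

(** Scaled so that, with [a = |f|] and [th] a bound for the norm of [f], both terms integrate to
    multiples of [th]. *)
Lemma young p t a th : 1 < p -> 0 <= t -> 0 <= a -> 0 < th ->
  t * a <= powR th (1 - p) * powR a p + th * powR t (p / (p - 1)).
Proof.
move=> p1 t0 a0 th0; have p10 : 0 < p - 1 by lra.
have gt0 : 0 <= a / th by nng.
have [h|/ltW h] := leP t (powR (a / th) (p - 1)).
  apply: ler_wpDr; first by nng.
  apply: (le_trans (ler_wpM2r a0 h)).
  rewrite powRM ?invr_ge0 ?(ltW th0)// -(powR_inv1 (ltW th0)) -powRrM mulN1r opprB.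
  rewrite mulrAC [leRHS]mulrC ler_wpM2r ?powR_ge0//.
  move: a0; rewrite le_eqVlt => /orP[/eqP <-|a0].
    by rewrite mulr0 powR_ge0.
  rewrite -{2}[a]powRr1 ?(ltW a0)// -powRD ?(gt_eqF a0) ?implybT// subrK//.
apply: ler_wpDl; first by nng.
have h2 : a <= th * powR t (p - 1)^-1.
  rewrite mulrC -ler_pdivrMr//.
  have -> : a / th = powR (powR (a / th) (p - 1)) (p - 1)^-1.
    by rewrite -powRrM mulfV ?powRr1// gt_eqF.
  by apply: powR_le; rewrite ?invr_ge0 ?powR_ge0 ?(ltW p10).
apply: (le_trans (ler_wpM2l t0 h2)); rewrite mulrCA ler_wpM2l ?(ltW th0)//.
move: t0; rewrite le_eqVlt => /orP[/eqP <-|t0]; first by rewrite mul0r powR_ge0.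
rewrite -{1}[t]powRr1 ?(ltW t0)// -powRD ?(gt_eqF t0) ?implybT//.
by apply: eq_ler; congr powR; field; rewrite gt_eqF.
Qed.

Section Tail.
Variables (n e : R).
Hypothesis nE : n = 2 * nu + 2.
Hypothesis e0 : 0 < e.

(** Against the weight this is a multiple of the derivative of [(1 + (r y)^n)^-e], so its integral
    is explicit and bounded uniformly in [r]. *)
Definition tail r y := powR r n * powR (1 + powR (r * y) n) (- (1 + e)).

Let n0 : 0 < n. Proof. by rewrite nE. Qed.

Lemma bernoulli_neg u : 0 <= u -> 1 - powR (1 + u) (- e) <= e * u.
Proof.
move=> u0.
have h : e * 0 + powR (1 + 0) (- e) <= e * u + powR (1 + u) (- e).
  apply: (@der_nondecr _ 0 u (fun u => e * u + powR (1 + u) (- e)) (fun u => e * (1 - powR (1 + u) (- e - 1)))) => // t /andP[t0 _].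
    have t1 : 0 < 1 + t by lra.
    apply: (der_eq (derD (derM (der_cst e t) (der_id t)) (@der_powR _ (fun u => 1 + u) (- e) _ _ t1 (derD (der_cst 1 t) (der_id t))))).
    ring.
  rewrite mulr_ge0 ?(ltW e0)// subr_ge0.
  have E1 : powR (1 + t) 0 = 1 :> R by rewrite powRr0.
  by rewrite -[leRHS]E1; apply: ler_powR; [lra|move: e0; lra].
by move: h; rewrite mulr0 add0r addr0 powR1; lra.
Qed.

Lemma tail_BC r : 0 < r -> BC (tail r).
Proof.
move=> r0; split.
  have hd x : 0 < x -> exists D, der (tail r) x D.
    move=> x0; have rx : 0 < r * x by nng.
    have u0 : 0 < 1 + powR (r * x) n by rewrite ltr_pwDl ?powR_ge0.
    eexists; apply: (derM (der_cst _ x) (@der_powR _ (fun x => 1 + powR (r * x) n) (- (1 + e)) _ _ u0 (derD (der_cst 1 x) (@der_powR _ (fun x => r * x) n _ _ rx (derM (der_cst r x) (der_id x)))))).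
  by move=> x x0; have [D hD] := hd x x0; exact: der_cont hD.
exists (powR r n) => x /andP[x0 x1]; rewrite ger0_norm ?mulr_ge0 ?powR_ge0// ler_piMr ?powR_ge0//.
have E1 : powR (1 + powR (r * x) n) 0 = 1 :> R by rewrite powRr0.
by rewrite -[leRHS]E1; apply: ler_powR; [rewrite lerDl powR_ge0|move: e0; lra].
Qed.

Lemma tail_int r : 0 < r -> wint (tail r) <= (n * e)^-1.
Proof.
move=> r0; have [cf [B bf]] := tail_BC r0.
have ne : 0 < n * e by nng.
pose F x := - (n * e)^-1 * powR (1 + powR (r * x) n) (- e).
have dF x : 0 < x -> der F x (tail r x * weight nu x).
  move=> x0; have rx : 0 < r * x by nng.
  have u0 : 0 < 1 + powR (r * x) n by rewrite ltr_pwDl ?powR_ge0.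
  apply: (der_eq (derM (der_cst _ x) (@der_powR _ (fun x => 1 + powR (r * x) n) (- e) _ _ u0 (derD (der_cst 1 x) (@der_powR _ (fun x => r * x) n _ _ rx (derM (der_cst r x) (der_id x))))))).
  rewrite /tail.
  have -> : - e - 1 = - (1 + e) by ring.
  have -> : powR r n * powR (1 + powR (r * x) n) (- (1 + e)) * weight nu x = powR (1 + powR (r * x) n) (- (1 + e)) * (powR (r * x) (n - 1) * r).
    have -> : powR (r * x) (n - 1) * r = powR r n * weight nu x.
      rewrite powRM ?(ltW r0) ?(ltW x0)// powRB1// /weight nE.
      have -> : 2 * nu + 2 - 1 = 2 * nu + 1 by ring.
      by rewrite mulrAC divfK// gt_eqF.
    by ring.
  by move: (powR _ _) (powR _ _) => A A'; field; rewrite !gt_eqF.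
have n10 : 0 <= n * powR r n by nng.
rewrite (@wint_FTC _ nu Hnu _ F B (- (n * e)^-1) (n^-1 * powR r n) cf bf dF).
  rewrite /F opprK mulNr gerDr oppr_le0 mulr_ge0 ?powR_ge0// invr_ge0 ltW//.
move=> x /andP[x0 x1]; have rx : 0 <= r * x by nng.
have u0 := powR_ge0 (r * x) n.
rewrite /F opprK.
have -> : - (n * e)^-1 * powR (1 + powR (r * x) n) (- e) + (n * e)^-1 = (n * e)^-1 * (1 - powR (1 + powR (r * x) n) (- e)) by ring.
have h1 : 0 <= 1 - powR (1 + powR (r * x) n) (- e).
  rewrite subr_ge0; have E1 : powR (1 + powR (r * x) n) 0 = 1 :> R by rewrite powRr0.
  by rewrite -[leRHS]E1; apply: ler_powR; [rewrite lerDl|move: e0; lra].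
have ne' : 0 <= (n * e)^-1 by nng.
rewrite ger0_norm; last exact: mulr_ge0.
apply: (le_trans (ler_wpM2l ne' (bernoulli_neg u0))).
rewrite xweight// -nE powRM ?(ltW r0) ?(ltW x0)//.
by apply: eq_ler; field; rewrite !gt_eqF.
Qed.

End Tail.

(** The power is the dual exponent [p / (p - 1)]. It turns [tr] into [r^n] times a power of
    [r max(y, 1 / r)] below [-n], and [tail] is a smooth majorant of that. *)
Lemma tr_pow r y : 0 < r -> 0 < y -> 0 < kap -> d < kap ->
  powR (tr nu d r y) ((2 * nu + 2) / (kap - d)) <= powR 2 (1 + d / (kap - d)) * tail (2 * nu + 2) (d / (kap - d)) r y.
Proof.
move=> r0 y0 k0 dk; set n := 2 * nu + 2; set e := d / (kap - d).
have kd : 0 < kap - d by rewrite subr_gt0.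
have m0 := mx_gt0 r y0; have rm : 0 < r * mx r y by nng.
have e0 : 0 < e by nng.
have -> : tr nu d r y = powR r (kap - d) * powR (r * mx r y) (- kap).
  rewrite powRM ?(ltW r0) ?(ltW m0)// mulrA -powRD ?(gt_eqF r0) ?implybT// /tr; congr (powR _ _ * _); ring.
rewrite powRM ?powR_ge0// -!powRrM.
have -> : (kap - d) * (n / (kap - d)) = n by rewrite mulrCA mulfV ?mulr1// gt_eqF.
have E (m k : R) : 0 < k - d -> - k * (m / (k - d)) = m * - (1 + d / (k - d)) by move=> h; field; rewrite gt_eqF.
rewrite (E n kap kd) -/e.
rewrite /tail mulrCA ler_wpM2l ?powR_ge0// powRrM.
have e1 : - (1 + e) <= 0 by move: e0; lra.
have P0 : 0 < powR (r * mx r y) n by nng.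
apply: (@le_trans _ _ (powR ((1 + powR (r * y) n) / 2) (- (1 + e)))).
  have u0 := powR_ge0 (r * y) n.
  apply: powR_leN => //; first by rewrite divr_gt0// ltr_pwDl.
  rewrite ler_pdivrMr//.
  have a1 : 1 <= powR (r * mx r y) n.
    have E1 : powR 1 n = 1 :> R by rewrite powR1.
    by rewrite -[leLHS]E1; apply: powR_le; [exact: ltW| |exact: mx_inv].
  have a2 : powR (r * y) n <= powR (r * mx r y) n.
    by apply: powR_le; rewrite ?mulr_ge0 ?(ltW r0) ?(ltW y0) ?(ltW n1)// ler_wpM2l ?(ltW r0)// mx_ge.
  by move: a1 a2; lra.
rewrite powRM ?invr_ge0 ?addr_ge0 ?powR_ge0// mulrC -(@powR_inv1 _ 2)// -powRrM mulN1r opprK.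
by [].
Qed.

Lemma tr_posc r : 0 < r -> posc (tr nu d r).
Proof.
move=> r0 x x0; apply: continuousM; first exact: cst_continuous.
apply: (@continuous_comp _ _ _ (mx r) (fun t => powR t (- kap))).
  by apply: (@continuous_max _ _ (fun x => x) (fun=> r^-1)); [exact: cvg_id|exact: cvg_cst].
exact: (der_cont (@der_powR _ (fun t => t) (- kap) _ _ (mx_gt0 r x0) (der_id _))).
Qed.

Lemma normpow_measurable f p : measurable_fun I01 f -> measurable_fun I01 (fun x => powR `|f x| p).
Proof.
move=> mf; apply: (@measurableT_comp _ _ _ _ _ _ (fun x => powR x p)); first exact: measurable_powR.
exact: measurableT_comp.
Qed.

Variable p : R.
Hypothesis Hp : (kap <= 0 /\ p = 1) \/ [/\ 0 < kap, d <= kap & p = (2 * nu + 2) / (kap + 1 + d)].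

Lemma p_ge1 : 1 <= p.
Proof.
case: Hp => [[_ ->]//|[k0 dk ->]]; rewrite ler_pdivlMr; last by move: d0; lra.
by rewrite mul1r; lra.
Qed.

Definition Lpb f th := [/\ measurable_fun I01 f, wi (fun x => powR `|f x| p) &
  wint (fun x => powR `|f x| p) <= powR th p].

Lemma Lpb_wi f th : Lpb f th -> wi (fun x => `|f x|).
Proof.
move=> [mf hf _]; apply: (@wi_dom _ nu _ (fun x => 1 + powR `|f x| p)).
- exact: measurableT_comp.
- move=> x _; rewrite normr_id; have [h|/ltW h] := leP `|f x| 1.
    by apply: (le_trans h); rewrite lerDl powR_ge0.
  apply: ler_wpDl => //; rewrite -{1}[`|f x|]powRr1//; apply: ler_powR => //; exact: p_ge1.
- by apply: wiD hf; exact: (BC_wi Hnu (BC_cst 1)).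
Qed.

(** For [d < kap] Young's inequality is used with the dual exponent; for [d = kap] one has [p = 1]
    and [tr <= 1]. *)
Lemma tr_int : 0 < kap -> d <= kap -> p = (2 * nu + 2) / (kap + 1 + d) ->
  exists2 C, 0 < C & forall r f th, 0 < r -> 0 < th -> Lpb f th ->
  wi (fun y => tr nu d r y * `|f y|) /\ wint (fun y => tr nu d r y * `|f y|) <= C * th.
Proof.
move=> k0 dk pE; have q0 : 0 < kap + 1 + d by move: d0 k0; lra.
have mT r f th : 0 < r -> Lpb f th -> measurable_fun I01 (fun y => tr nu d r y * `|f y|).
  move=> r0 [mf _ _]; apply: measurable_funM; first by apply: posc_measurable; exact: tr_posc.
  exact: measurableT_comp.
have T0 r (f : R -> R) y : `|tr nu d r y * `|f y| | = tr nu d r y * `|f y|.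
  by rewrite ger0_norm// mulr_ge0// tr_ge0.
move: dk; rewrite le_eqVlt => /orP[/eqP dk|dk].
  have p1 : p = 1 by rewrite pE; apply: (mulIf (lt0r_neq0 q0)); rewrite divfK ?gt_eqF// mul1r; move: dk; lra.
  exists 1 => // r f th r0 th0 hf; have hf1 := Lpb_wi hf.
  have tr1 y : 0 < y -> tr nu d r y <= 1.
    move=> y0; have m0 := mx_gt0 r y0.
    rewrite /tr -dk -powRM ?(ltW r0) ?(ltW m0)// powRN invf_le1 ?powR_gt0 ?mulr_gt0//.
    have E1 : powR 1 d = 1 :> R by rewrite powR1.
    by rewrite -[leLHS]E1; apply: powR_le; rewrite ?mx_inv// ltW.
  have hw : wi (fun y => tr nu d r y * `|f y|).
    apply: (wi_dom (mT _ _ _ r0 hf) _ hf1) => x /andP[x0 x1].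
    by rewrite T0 ler_piMl// tr1.
  split => //; have [_ _] := hf; rewrite p1 powRr1 ?(ltW th0)// mul1r; apply: le_trans.
  have E : (fun x => powR `|f x| 1) = (fun x => `|f x|) by apply/funext => x; rewrite powRr1.
  rewrite E; apply: wint_le => // x /andP[x0 x1]; by rewrite ler_piMl// tr1.
have kd : 0 < kap - d by rewrite subr_gt0.
set n := 2 * nu + 2; pose e := d / (kap - d).
have e0 : 0 < e by nng.
have p1 : 1 < p by rewrite pE ltr_pdivlMr// mul1r; lra.
have pp : p / (p - 1) = n / (kap - d).
  have p1' : p - 1 = (kap - d) / (kap + 1 + d).
    rewrite pE; apply: (mulIf (lt0r_neq0 q0)); rewrite mulrBl mul1r !divfK ?gt_eqF//; lra.
  rewrite p1' pE -/n invf_div mulrA divfK ?gt_eqF//.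
pose c2 := powR 2 (1 + e) : R.
have c20 : 0 < c2 by nng.
exists (1 + c2 / (n * e)) => [|r f th r0 th0 hf].
  by rewrite ltr_pwDl// divr_ge0 ?(ltW c20)// mulr_ge0 ?(ltW e0) ?(ltW n1).
have [mf hfp hfN] := hf.
pose g x := powR th (1 - p) * powR `|f x| p + th * c2 * tail n e r x.
have wg1 := wiZ (powR th (1 - p)) hfp.
have wg2 := wiZ (th * c2) (BC_wi Hnu (tail_BC n e0 r0)).
have wg : wi g by apply: wiD wg1 wg2.
have hg x : 0 < x < 1 -> tr nu d r x * `|f x| <= g x.
  move=> /andP[x0 x1]; apply: (le_trans (young p1 (tr_ge0 _ _ _ _) (normr_ge0 _) th0)).
  rewrite /g lerD2l -mulrA ler_wpM2l ?(ltW th0)// pp; exact: tr_pow.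
have hw : wi (fun y => tr nu d r y * `|f y|).
  by apply: (wi_dom (mT _ _ _ r0 hf) _ wg) => x hx; rewrite T0 hg.
split => //; apply: (le_trans (wint_le hw wg hg)).
rewrite /g wintD// (wintZ _ hfp) (wintZ _ (BC_wi Hnu (tail_BC n e0 r0))).
rewrite mulrDl mul1r; apply: lerD.
  apply: (le_trans (ler_wpM2l (powR_ge0 _ _) hfN)).
  by rewrite -powRD ?(gt_eqF th0) ?implybT// subrK powRr1// ltW.
rewrite [leRHS]mulrC [leRHS]mulrA ler_wpM2l ?mulr_ge0 ?(ltW th0) ?(ltW c20)//.
exact: tail_int.
Qed.

Lemma tt_int : exists2 C, 0 < C & forall r x f th, 0 < r -> 0 < x -> 0 < th -> Lpb f th ->
  wi (fun y => tt nu d r x y * `|f y|) /\ wint (fun y => tt nu d r x y * `|f y|) <= C * th.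
Proof.
case: (Hp) => [[k0 pE]|[k0 dk pE]].
  exists 1 => // r x f th r0 x0 th0 hf; have hf1 := Lpb_wi hf.
  have key T : T = (fun y => `|f y|) -> wi T /\ wint T <= 1 * th.
    move=> ->; split => //; have [_ _] := hf; rewrite pE powRr1 ?(ltW th0)// [1 * th]mul1r; congr (_ <= _).
    by apply: eq_wint => y _; rewrite powRr1.
  by apply: key; apply/funext => y; rewrite /tt ltNge k0 /= mul1r.
have [C C0 h] := tr_int k0 dk pE; exists (C + C) => [|r x f th r0 x0 th0 hf]; first exact: addr_gt0.
have xi : 0 < x^-1 by nng.
have [w1 i1] := h r f th r0 th0 hf; have [w2 i2] := h _ f th xi th0 hf.
have key T : T = (fun y => tr nu d r y * `|f y| + tr nu d x^-1 y * `|f y|) -> wi T /\ wint T <= (C + C) * th.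
  move=> ->; split; first exact: wiD w1 w2.
  rewrite (wintD w1 w2); have -> : (C + C) * th = C * th + C * th by ring.
  exact: lerD i1 i2.
by apply: key; apply/funext => y; rewrite /tt k0 mulrDl.
Qed.

End WeightedLp.

(** * The local part and the maximal function *)

Section LocalMaximal.
Context {R : realType}.
Variable d : R.
Hypothesis d0 : 0 < d.
Implicit Types (x y t r u tau p q : R) (f G : R -> R) (i m : nat).
Local Notation leb := (@lebesgue_measure R).
Local Notation I01 := (`]0, 1[%classic : set R).

Lemma geom_le q m : 0 <= q < 1 -> \sum_(0 <= i < m) q ^+ i <= (1 - q)^-1.
Proof.
move=> /andP[q0 q1]; have q10 : 0 < 1 - q by lra.
suff -> : \sum_(0 <= i < m) q ^+ i = (1 - q ^+ m) / (1 - q).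
  by rewrite ler_piMl ?invr_ge0 ?(ltW q10)// gerBl exprn_ge0.
elim: m => [|m ih]; first by rewrite big_nil expr0 subrr mul0r.
rewrite big_nat_recr//= ih exprS; move: (q ^+ m) => Q; field; rewrite gt_eqF//.
Qed.

Definition dcoef i : R := powR (2 ^+ i / 2) (- (1 + d)).

(** The least [i] with [r u < 2^i] has [2^i / 2 <= 1 + r u], so the decay is controlled by constants
    on dyadic balls. *)
Lemma dec_dyadic r u m : 0 < r -> 0 <= u -> r * u < 2 ^+ m ->
  exists2 i, (i <= m)%N & r * u < 2 ^+ i /\ dec d r u <= dcoef i.
Proof.
move=> r0 u0 hm.
have ex : exists i, r * u < 2 ^+ i by exists m.
have [i hi mini] := ex_minnP ex; exists i; first exact: mini.
split => //; have ru : 0 <= r * u by nng.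
apply: powR_leN; [move: d0; lra|by rewrite divr_gt0// exprn_gt0|].
case: i hi mini => [|i] hi mini; first by rewrite expr0; lra.
have : 2 ^+ i <= r * u.
  by rewrite leNgt; apply/negP => /mini; rewrite ltnn.
rewrite exprS; move: (2 ^+ i) => P; lra.
Qed.

Lemma dcoef_sum : exists2 K, 0 < K & forall m, \sum_(0 <= i < m) dcoef i * 2 ^+ i <= K.
Proof.
pose q := powR 2 (- d) : R.
have q0 : 0 <= q by exact: powR_ge0.
have q1 : q < 1.
  rewrite /q powRN invf_lt1 ?powR_gt0//.
  have E1 : powR 1 d = 1 :> R by rewrite powR1.
  by rewrite -[ltLHS]E1; apply: gt0_ltr_powR; rewrite ?nnegrE//; lra.
have c0 : 0 < 2 * powR 2 d :> R by nng.
exists (2 * powR 2 d * (1 - q)^-1) => [|m]; first by rewrite mulr_gt0// invr_gt0 subr_gt0.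
have -> : \sum_(0 <= i < m) dcoef i * 2 ^+ i = 2 * powR 2 d * \sum_(0 <= i < m) q ^+ i.
  rewrite mulr_sumr; apply: eq_bigr => i _.
  have p2 : 0 < 2 ^+ i / 2 :> R by nng.
  have -> : dcoef i * 2 ^+ i = 2 * powR (2 ^+ i / 2) (- d).
    have -> : 2 ^+ i = 2 * (2 ^+ i / 2) :> R by rewrite mulrC divfK.
    rewrite mulrCA /dcoef; congr (_ * _); rewrite [2 * _]mulrC divfK// .
    rewrite -{2}[2 ^+ i / 2]powRr1 ?(ltW p2)// -powRD ?(gt_eqF p2) ?implybT//; congr powR; ring.
  rewrite -mulrA; congr (_ * _).
  rewrite powRM ?invr_ge0 ?exprn_ge0// mulrC -(@powR_inv1 _ 2)// -powRrM mulN1r opprK; congr (_ * _).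
  by rewrite -powR_mulrn// -powRrM mulrC powRrM powR_mulrn.
by rewrite ler_pM2l// geom_le// q0.
Qed.

Lemma ball_avg G x t c : 0 < t -> 0 <= c -> measurable_fun setT G -> (forall y, 0 <= G y) ->
  (HL_maximal G x <= c%:E)%E -> (\int[leb]_(y in ball x t) (G y)%:E <= (t *+ 2 * c)%:E)%E.
Proof.
move=> t0 c0 mG G0 h.
have h1 : (iavg G (ball x t) <= c%:E)%E.
  by apply: le_trans h; apply: ereal_sup_ubound; exists t => //=; rewrite in_itv/= t0.
move: h1; rewrite /iavg lebesgue_measure_ball ?(ltW t0)// inver gt_eqF ?mulrn_wgt0//.
rewrite lee_pdivrMl ?mulrn_wgt0// -EFinM; apply: le_trans.
by under eq_integral do rewrite -[G _]ger0_norm//.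
Qed.

Definition loc r x y := if (x < 2 * y) && (y < 2 * x) then r * dec d r `|x - y| else 0.

Lemma loc_measurable r x : measurable_fun setT (loc r x).
Proof.
apply: measurable_fun_ifT => //.
  by apply: measurable_and; apply: measurable_fun_ltr => //; apply: measurable_funM.
apply: measurable_funM => //; rewrite /dec.
apply: (@measurableT_comp _ _ _ _ _ _ (fun t => powR t (- (1 + d)))); first exact: measurable_powR.
apply: measurable_funD => //; apply: measurable_funM => //.
by apply: measurableT_comp => //; apply: measurable_funB.
Qed.

Lemma loc_ge0 r x y : 0 < r -> 0 <= loc r x y.
Proof. by move=> r0; rewrite /loc; case: ifP => // _; rewrite mulr_ge0 ?powR_ge0// ltW. Qed.

(** The bound [|f| <= tau + tau^(1 - p) |f|^p] linearizes: each dyadic ball contributes [tau] times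
    its mass, once directly and once through the maximal function of [|f|^p]. Thus only the weak
    [(1, 1)] inequality will be needed. [G] stands for [|f|^p] cut to a neighbourhood of [x]. *)
Lemma local_bound : exists2 K, 0 < K & forall r x tau p f G, 0 < r -> 0 < x < 1 -> 0 < tau -> 1 <= p ->
  measurable_fun I01 f -> measurable_fun setT G -> (forall y, 0 <= G y) ->
  (forall y, 0 < y < 1 -> x < 2 * y -> y < 2 * x -> G y = powR `|f y| p) ->
  (HL_maximal G x <= (powR tau p)%:E)%E ->
  (\int[leb]_(y in I01) (loc r x y * `|f y|)%:E <= (K * tau)%:E)%E.
Proof.
have [K K0 hK] := dcoef_sum; exists (4 * K) => [|r x tau p f G r0 /andP[x0 x1] tau0 p1 mf mG G0 GE hG]; first exact: mulr_gt0.
pose m := (Num.bound r).+1.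
have rm : r < 2 ^+ m by apply: upper_nthrootP; rewrite /m.
pose h y := tau + powR tau (1 - p) * G y.
have h0 y : 0 <= h y by nng.
have c0 i : 0 <= r * dcoef i by nng.
pose B i : set R := ball x (2 ^+ i / r).
have rho0 i : 0 < 2 ^+ i / r by nng.
have mB i : measurable (B i : set R) by exact: measurable_ball.
have mh : measurable_fun setT h.
  by apply: measurable_funD => //; apply: measurable_funM.
pose T i := (fun y : R => (r * dcoef i * h y)%:E) \_ (B i).
have mT i : measurable_fun setT (T i).
  apply/(measurable_restrictT _ (mB i)); apply/measurable_EFinP; apply: measurable_funTS.
  by apply: measurable_funM.
have T0 i y : (0 <= T i y)%E.
  by rewrite /T patchE; case: ifP => // _; rewrite lee_fin mulr_ge0.
pose D y := loc r x y * `|f y|.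
have D0 y : 0 <= D y.
  by rewrite /D mulr_ge0// loc_ge0.
have mS : measurable_fun setT (fun y => (\sum_(i <- iota 0 m.+1) T i y)%E).
  by apply: emeasurable_sum => i _; exact: mT.
have DT y : 0 < y < 1 -> ((D y)%:E <= \sum_(i <- iota 0 m.+1) T i y)%E.
  move=> hy; have [y0 y1] := andP hy; rewrite /D /loc; case: ifPn => [/andP[xy yx]|_]; last first.
    by rewrite mul0r; apply: sume_ge0.
  have u1 : `|x - y| < 1 by rewrite ltr_norml; apply/andP; split; lra.
  have ru : r * `|x - y| < 2 ^+ m by apply: le_lt_trans rm; rewrite ler_piMr ?(ltW r0)// ltW.
  have [i im [ui hi]] := dec_dyadic r0 (normr_ge0 (x - y)) ru.
  have iI : i \in iota 0 m.+1 by rewrite mem_iota add0n ltnS im.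
  rewrite (bigD1_seq i iI (iota_uniq _ _)) /=.
  have s0 : (0 <= \sum_(j <- iota 0 m.+1 | j != i) T j y)%E by apply: sume_ge0.
  apply: (le_trans _ (leeDl _ s0)).
  have yB : y \in B i by rewrite inE /B -ball_normE /ball_ /= ltr_pdivlMr// mulrC.
  rewrite /T patchE yB lee_fin; apply: ler_pM => //.
  - by nng.
  - by rewrite ler_wpM2l// ltW.
  rewrite /h GE//; have [ft|/ltW ft] := leP `|f y| tau.
    by apply: (le_trans ft); rewrite lerDl mulr_ge0 ?powR_ge0.
  apply: ler_wpDl; first exact: ltW.
  have f0 : 0 < `|f y| by exact: lt_le_trans ft.
  have -> : powR `|f y| p = `|f y| * powR `|f y| (p - 1).
    by rewrite -{2}[`|f y|]powRr1 ?(ltW f0)// -powRD ?(gt_eqF f0) ?implybT//; congr powR; ring.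
  rewrite mulrCA ler_peMr ?(ltW f0)//.
  have -> : 1 - p = - (p - 1) by ring.
  rewrite powRN mulrC ler_pdivlMr ?powR_gt0// mul1r; apply: powR_le => //; [lra|exact: ltW].
have -> : (4 * K * tau)%:E = ((4 * tau)%:E * K%:E)%E by rewrite -EFinM; congr EFin; ring.
apply: (@le_trans _ _ (\int[leb]_(y in I01) (\sum_(i <- iota 0 m.+1) T i y))%E).
  apply: ge0_le_integral; first exact: measurable_itv.
  - by move=> y _; rewrite lee_fin D0.
  - apply/measurable_EFinP; apply: measurable_funM; last exact: measurableT_comp.
    exact: measurable_funTS (loc_measurable r x).
  - exact: measurable_funTS mS.
  - by move=> y; rewrite /= in_itv/=; exact: DT.
apply: (@le_trans _ _ (\int[leb]_y (\sum_(i <- iota 0 m.+1) T i y))%E).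
  by apply: ge0_subset_integral => // y _; apply: sume_ge0.
rewrite ge0_integral_sum//.
apply: (@le_trans _ _ (\sum_(i <- iota 0 m.+1) (4 * tau * (dcoef i * 2 ^+ i))%:E)%E).
  apply: lee_sum => i _; rewrite /T -integral_mkcond; have mBi := mB i.
  have mBh (g : R -> R) : measurable_fun setT g -> measurable_fun (B i) (EFin \o g).
    by move=> mg; apply/measurable_EFinP; exact: measurable_funTS.
  under eq_integral do rewrite EFinM.
  rewrite ge0_integralZl_EFin//; last 2 first.
  - by move=> y _; rewrite lee_fin.
  - exact: mBh.
  have -> : (\int[leb]_(y in B i) (h y)%:E = \int[leb]_(y in B i) (cst tau%:E y + (powR tau (1 - p) * G y)%:E))%E.
    by apply: eq_integral => y _; rewrite /h EFinD.
  rewrite ge0_integralD//; last 3 first.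
  - by move=> y _; rewrite lee_fin ltW.
  - by move=> y _; rewrite lee_fin mulr_ge0 ?powR_ge0.
  - by apply: mBh; apply: measurable_funM.
  have muB : leb (B i) = (2 ^+ i / r *+ 2)%:E by apply: lebesgue_measure_ball; exact: ltW.
  have -> : (\int[leb]_(y in B i) cst tau%:E y = tau%:E * (2 ^+ i / r *+ 2)%:E)%E by rewrite (integral_cst leb (mB i)); congr (_ * _)%E.
  under [X in (_ + X)%E]eq_integral do rewrite EFinM.
  rewrite ge0_integralZl_EFin ?powR_ge0//; last 2 first.
  - by move=> y _; rewrite lee_fin.
  - exact: mBh.
  have hb := ball_avg (rho0 i) (powR_ge0 tau p) mG G0 hG.
  apply: (@le_trans _ _ ((r * dcoef i)%:E * (tau%:E * (2 ^+ i / r *+ 2)%:E + (powR tau (1 - p))%:E * (2 ^+ i / r *+ 2 * powR tau p)%:E))%E).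
    apply: lee_wpmul2l; first by rewrite lee_fin.
    by apply: leeD2l; apply: lee_wpmul2l; rewrite ?lee_fin ?powR_ge0.
  have tt1 : powR tau (1 - p) * powR tau p = tau.
    by rewrite -powRD ?(gt_eqF tau0) ?implybT// subrK powRr1// ltW.
  set rr := 2 ^+ i / r.
  change ((r * dcoef i * (tau * (rr *+ 2) + powR tau (1 - p) * (rr *+ 2 * powR tau p)))%:E <= (4 * tau * (dcoef i * 2 ^+ i))%:E)%E.
  rewrite lee_fin [powR tau (1 - p) * _]mulrCA tt1 -mulr_natr /rr.
  by apply: eq_ler; field; rewrite gt_eqF.
rewrite sumEFin -EFinM lee_fin -mulr_sumr ler_wpM2l ?mulr_ge0 ?(ltW tau0)//.
exact: (hK m.+1).
Qed.

End LocalMaximal.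

(** * Level sets: neighbourhoods of the origin and dyadic blocks *)

Section LevelSets.
Context {R : realType}.
Variable nu : R.
Hypothesis Hnu : -1 < nu.
Implicit Types (x y t r tau p th b : R) (f G : R -> R) (i k m : nat).
Local Notation leb := (@lebesgue_measure R).
Local Notation I01 := (`]0, 1[%classic : set R).

Let n1 : 0 < 2 * nu + 2. Proof. by move: Hnu; lra. Qed.
Let w_ge0 x : 0 <= weight nu x. Proof. exact: powR_ge0. Qed.
Let mI : measurable I01. Proof. exact: measurable_itv. Qed.

Lemma int_sub (A B : set R) (h : R -> \bar R) : measurable A -> measurable B -> measurable_fun B h ->
  (forall x, (0 <= h x)%E) -> A `<=` B -> (\int[leb]_(x in A) h x <= \int[leb]_(x in B) h x)%E.
Proof. by move=> mA mB mh h0 AB; apply: ge0_subset_integral. Qed.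

Lemma int_le (D : set R) (h g : R -> \bar R) : measurable D -> measurable_fun D h -> measurable_fun D g ->
  (forall x, (0 <= h x)%E) -> (forall x, D x -> (h x <= g x)%E) -> (\int[leb]_(x in D) h x <= \int[leb]_(x in D) g x)%E.
Proof. by move=> mD mh mg h0 hg; apply: ge0_le_integral. Qed.

Lemma int_Z (D : set R) (h : R -> \bar R) t : measurable D -> measurable_fun D h ->
  (forall x, (0 <= h x)%E) -> 0 <= t -> (\int[leb]_(x in D) (t%:E * h x) = t%:E * \int[leb]_(x in D) h x)%E.
Proof. by move=> mD mh h0 t0; apply: ge0_integralZl_EFin. Qed.

Lemma weight_measurable : measurable_fun setT (EFin \o weight nu).
Proof. by apply/measurable_EFinP; exact: measurable_powR. Qed.

Lemma wint_EFin g : leb.-integrable I01 (EFin \o (fun x : R => g x * weight nu x)) ->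
  (\int[leb]_(x in I01) (g x * weight nu x)%:E = (wint nu g)%:E)%E.
Proof. by move=> h; rewrite /wint /Rintegral fineK// integrable_fin_num. Qed.

(** The function [tail] with [e = 1] and [r = 1 / b], multiplied by [4 * powR b n], is at least [1]
    below [b], and its integral is already known. *)
Lemma small_part b : 0 < b ->
  (\int[leb]_(x in I01 `&` [set x | (x < b)%R]) (weight nu x)%:E <= (4 / (2 * nu + 2) * powR b (2 * nu + 2))%:E)%E.
Proof.
move=> b0; set n := 2 * nu + 2; have bi : 0 < b^-1 by nng.
have bt := tail_BC n ltr01 bi.
have hT := BC_wi Hnu bt.
have mA : measurable (I01 `&` [set x : R | x < b]).
  by apply: measurableI => //; rewrite -set_itvNyo; exact: measurable_itv.
pose g x := 4 * powR b n * tail n 1 b^-1 x.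
have hg := wiZ (4 * powR b n) hT.
have g0 x : 0 <= g x by nng.
have mg : measurable_fun I01 (EFin \o (fun x => g x * weight nu x)) by have := measurable_int _ hg.
have mw (D : set R) : measurable_fun D (EFin \o weight nu) by apply: measurable_funTS; exact: weight_measurable.
apply: (@le_trans _ _ (\int[leb]_(x in I01 `&` [set x | (x < b)%R]) (g x * weight nu x)%:E)%E).
  apply: (int_le mA (mw _) (measurable_funS mI _ mg)); [by move=> x []|by move=> x; rewrite lee_fin|].
  move=> x [/= + xb]; rewrite in_itv/= => /andP[x0 x1]; rewrite lee_fin ler_peMl//.
  have q0 : 0 <= b^-1 * x by nng.
  have q1 : b^-1 * x <= 1 by rewrite mulrC ler_pdivrMr// mul1r ltW.
  have q2 : powR (b^-1 * x) n <= 1.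
    have E1 : powR 1 n = 1 :> R by rewrite powR1.
    by rewrite -[leRHS]E1; apply: powR_le => //; exact: ltW.
  rewrite /g /tail.
  have -> : 4 * powR b n * (powR b^-1 n * powR (1 + powR (b^-1 * x) n) (- (1 + 1))) = 4 * powR (1 + powR (b^-1 * x) n) (- (1 + 1)).
    have E : powR b n * powR b^-1 n = 1 by rewrite -powRM ?(ltW b0) ?(ltW bi)// mulfV ?powR1// gt_eqF.
    by rewrite mulrA -[4 * _ * _]mulrA E mulr1.
  have u0 := powR_ge0 (b^-1 * x) n.
  rewrite powRN ler_pdivlMr ?powR_gt0 ?ltr_pwDl// mul1r.
  have -> : 1 + 1 = 2%:R :> R by ring.
  rewrite powR_mulrn ?addr_ge0//; move: u0 q2; move: (powR _ _) => u u0 q2.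
  by rewrite expr2; have := ler_pM (addr_ge0 ler01 u0) (addr_ge0 ler01 u0) (lerD (lexx 1) q2) (lerD (lexx 1) q2); lra.
apply: (@le_trans _ _ (\int[leb]_(x in I01) (g x * weight nu x)%:E)%E).
  by apply: (int_sub mA mI mg) => [x|x []//]; rewrite lee_fin mulr_ge0.
rewrite wint_EFin// lee_fin /g wintZ// -/n.
have := tail_int Hnu (erefl n) ltr01 bi; rewrite mulr1 => h.
apply: (le_trans (ler_wpM2l _ h)); first by nng.
by apply: eq_ler; ring.
Qed.

Lemma weight_ratio x y : 0 < x -> 0 < y -> x <= 4 * y -> y <= 4 * x ->
  weight nu x <= powR 4 `|2 * nu + 1| * weight nu y.
Proof.
move=> x0 y0 xy yx; rewrite /weight; set e := 2 * nu + 1.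
have [h|h] := leP 0 e.
  by rewrite (ger0_norm h) -powRM ?(ltW y0)//; apply: powR_le => //; exact: ltW.
have -> : powR 4 `|e| = powR 4^-1 e.
  by rewrite (ltr0_norm h) -(@powR_inv1 _ 4)// -powRrM mulN1r.
by rewrite -powRM ?(ltW y0)//; apply: powR_leN; [exact: ltW|rewrite mulr_gt0|rewrite mulrC ler_pdivrMr// mulrC].
Qed.

Section Blocks.
Variables (p th : R) (f : R -> R).
Hypothesis p1 : 1 <= p.
Hypothesis th0 : 0 < th.
Hypothesis hf : Lpb nu p f th.

Local Notation pw k := ((2 ^+ k)^-1 : R).

Definition blk k : set R := I01 `&` [set x : R | pw k.+1 <= x < pw k].
(** It contains every [y] with [x / 2 < y < 2 * x] for [x] in [blk k], and the weight is comparable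
    to a constant on it. *)
Definition blk3 k : set R := I01 `&` [set x : R | pw k.+2 < x < 2 * pw k].
Definition blkG k : R -> R := (fun x => powR `|f x| p) \_ (blk3 k).
Let F x : \bar R := (powR `|f x| p * weight nu x)%:E.
Let low k : set R := I01 `&` [set x : R | 2 * pw k <= x].

Let pw_gt0 k : 0 < pw k. Proof. by nng. Qed.
Let pwS k : pw k = 2 * pw k.+1. Proof. by rewrite exprS invfM mulrA mulfV ?mul1r. Qed.

Let mlt (a : R) : measurable [set x : R | a < x]. Proof. by rewrite -set_itvoy; exact: measurable_itv. Qed.
Let mle (a : R) : measurable [set x : R | a <= x]. Proof. by rewrite -set_itvcy; exact: measurable_itv. Qed.
Let mgt (a : R) : measurable [set x : R | x < a]. Proof. by rewrite -set_itvNyo; exact: measurable_itv. Qed.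

Let mblk k : measurable (blk k).
Proof.
apply: measurableI => //; rewrite (_ : [set x : R | _] = [set x | pw k.+1 <= x] `&` [set x | x < pw k]).
  exact: measurableI.
by apply/seteqP; split => x /= => [/andP[]|[-> ->]].
Qed.

Let mblk3 k : measurable (blk3 k).
Proof.
apply: measurableI => //; rewrite (_ : [set x : R | _] = [set x | pw k.+2 < x] `&` [set x | x < 2 * pw k]).
  exact: measurableI.
by apply/seteqP; split => x /= => [/andP[]|[-> ->]].
Qed.

Let mlow k : measurable (low k). Proof. exact: measurableI. Qed.

Let F0 x : (0 <= F x)%E. Proof. by rewrite lee_fin mulr_ge0 ?powR_ge0. Qed.
Let mF : measurable_fun I01 F.
Proof. by have [_ h _] := hf; have := measurable_int _ h. Qed.
Let sub3 k : blk3 k `<=` I01. Proof. by move=> x []. Qed.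
Let subl k : low k `<=` I01. Proof. by move=> x []. Qed.
Let F_int : (\int[leb]_(x in I01) F x <= (powR th p)%:E)%E.
Proof. by have [_ h1 h2] := hf; rewrite /F wint_EFin. Qed.

Let low_le k : (\int[leb]_(x in low k) F x <= (powR th p)%:E)%E.
Proof. exact: le_trans (int_sub (mlow k) mI mF F0 (@subl k)) F_int. Qed.

(** The enlarged block lies in [low k.+3] and misses [low k]; summed over [k] this telescopes to
    three integrals over sets [low], the overlap number of the enlarged blocks. *)
Let blk3_step k : (\int[leb]_(x in blk3 k) F x + \int[leb]_(x in low k) F x <= \int[leb]_(x in low k.+3) F x)%E.
Proof.
have h : blk3 k `|` low k `<=` low k.+3.
  move=> x [[xI /= /andP[h1 h2]]|[xI /= h1]]; split => //=.
    by rewrite -pwS ltW.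
  by apply: le_trans h1; rewrite (pwS k) (pwS k.+1) (pwS k.+2); have := pw_gt0 k.+3; lra.
have hu : blk3 k `|` low k `<=` I01 by move=> x [[]|[]].
have mU := measurableU _ _ (mblk3 k) (mlow k).
have mFU (D : set R) : D `<=` I01 -> measurable_fun D F by move=> DI; exact: measurable_funS mI DI mF.
have dj : [disjoint blk3 k & low k].
  by apply/disj_set2P; apply/seteqP; split => // x [[_ /= /andP[_ h1]] [_ /= h2]]; move: (lt_le_trans h1 h2); rewrite ltxx.
rewrite -(ge0_integral_setU leb (mblk3 k) (mlow k) (mFU _ hu) (fun x _ => F0 x) dj).
exact: int_sub mU (mlow _) (mFU _ (@subl _)) F0 h.
Qed.

Lemma blk3_sum m : (\sum_(0 <= k < m) \int[leb]_(x in blk3 k) F x <= (3 * powR th p)%:E)%E.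
Proof.
apply: (@le_trans _ _ (\int[leb]_(x in low m) F x + \int[leb]_(x in low m.+1) F x + \int[leb]_(x in low m.+2) F x)%E).
  elim: m => [|m ih].
    by rewrite big_nil; apply: adde_ge0; [apply: adde_ge0|]; apply: integral_ge0.
  rewrite big_nat_recr//=.
  apply: (le_trans (leeD2r _ ih)); have := blk3_step m.
  move: (\int[leb]_(x in low m) F x)%E (\int[leb]_(x in low m.+1) F x)%E (\int[leb]_(x in low m.+2) F x)%E (\int[leb]_(x in low m.+3) F x)%E => a0 a1 a2 a3 h.
  rewrite [X in (X <= _)%E]addeC -(addeA a0 a1 a2) (addeA _ a0) [X in (_ <= X)%E]addeC.
  exact: leeD.
have -> : 3 * powR th p = powR th p + powR th p + powR th p by ring.
by rewrite 2!EFinD; apply: leeD; [apply: leeD|]; exact: low_le.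
Qed.

Lemma blkG_measurable k : measurable_fun setT (blkG k).
Proof.
apply/(measurable_restrictT _ (mblk3 k)); have [mf _ _] := hf.
exact: measurable_funS mI (@sub3 k) (normpow_measurable p mf).
Qed.

Lemma blkG_ge0 k x : 0 <= blkG k x.
Proof. by rewrite /blkG patchE; case: ifP => // _; exact: powR_ge0. Qed.

Let c4 : R := powR 4 `|2 * nu + 1|.

Lemma blkG_int k : ((weight nu (pw k.+1))%:E * \int[leb]_x `|(blkG k x)%:E| <= c4%:E * \int[leb]_(x in blk3 k) F x)%E.
Proof.
have wk : 0 <= weight nu (pw k.+1) by [].
have c0 : 0 <= c4 by exact: powR_ge0.
have -> : (\int[leb]_x `|(blkG k x)%:E| = \int[leb]_(x in blk3 k) (powR `|f x| p)%:E)%E.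
  rewrite [RHS]integral_mkcond; apply: eq_integral => x _.
  by rewrite /blkG !patchE; case: ifP => _ /=; rewrite ?normr0// ger0_norm ?powR_ge0.
have [mf _ _] := hf.
have mfp : measurable_fun (blk3 k) (fun x => (powR `|f x| p)%:E).
  by apply/measurable_EFinP; exact: measurable_funS mI (@sub3 k) (normpow_measurable p mf).
have mF3 : measurable_fun (blk3 k) F by exact: measurable_funS mI (@sub3 k) mF.
have fp0 x : (0 <= (powR `|f x| p)%:E)%E by rewrite lee_fin powR_ge0.
rewrite -(int_Z (mblk3 k) mfp fp0 wk) -(int_Z (mblk3 k) mF3 F0 c0).
apply: (int_le (mblk3 k) (measurable_funeM _ mfp) (measurable_funeM _ mF3)).
  by move=> x; rewrite mule_ge0.
move=> x [/= + /andP[h1 h2]]; rewrite in_itv/= => /andP[x0 x1].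
rewrite /F -!EFinM lee_fin [leRHS]mulrCA mulrC ler_wpM2l ?powR_ge0//.
apply: weight_ratio => //; move: (pwS k) (pwS k.+1) h1 h2; have := pw_gt0 k.+2; lra.
Qed.

Lemma blkG_locint k : locally_integrable setT (blkG k).
Proof.
apply: open_integrable_locally; first exact: openT.
apply/integrableP; split; first by apply/measurable_EFinP; exact: blkG_measurable.
have w0 : 0 < weight nu (pw k.+1) by exact: weight_gt0.
have := blkG_int k.
have h3 : (\int[leb]_(x in blk3 k) F x <= (powR th p)%:E)%E.
  exact: le_trans (int_sub (mblk3 k) mI mF F0 (@sub3 k)) F_int.
move=> h; have := le_trans h (lee_wpmul2l _ h3).
rewrite lee_fin powR_ge0 => /(_ isT) h4.
rewrite -(@lte_pmul2l _ (weight nu (pw k.+1))%:E) ?lte_fin//.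
by apply: (le_lt_trans h4); rewrite gt0_muley ?lte_fin// -EFinM ltry.
Qed.

(** The unweighted maximal inequality on one block; freezing the weight at [pw k.+1] costs a factor
    [c4] on each side. *)
Lemma blk_part tau k : 0 < tau ->
  (\int[leb]_(x in blk k `&` [set x | ((powR tau p)%:E < HL_maximal (blkG k) x)%E]) (weight nu x)%:E
   <= (3 * c4 ^+ 2 / powR tau p)%:E * \int[leb]_(x in blk3 k) F x)%E.
Proof.
move=> tau0; have tp : 0 < powR tau p by nng.
have mH : measurable [set x | ((powR tau p)%:E < HL_maximal (blkG k) x)%E].
  rewrite -[X in measurable X]setTI; apply: emeasurable_fun_o_infty => //.
  by apply: measurable_HL_maximal; exact: blkG_locint.
have mS := measurableI _ _ (mblk k) mH.
have c0 : 0 <= c4 by exact: powR_ge0.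
set S := _ `&` _ in mS *.
have wk : 0 <= weight nu (pw k.+1) by [].
apply: (@le_trans _ _ (\int[leb]_(x in S) (cst (c4 * weight nu (pw k.+1))%:E x))%E).
  apply: (int_le mS (measurable_funTS weight_measurable) (measurable_cst _)); first by move=> x; rewrite lee_fin.
  move=> x [[/= + /andP[h1 h2]] _]; rewrite in_itv/= => /andP[x0 x1]; rewrite lee_fin.
  by apply: weight_ratio => //; move: (pwS k) h1 h2; have := pw_gt0 k.+1; lra.
rewrite integral_cst//.
have hS : (leb S <= (3 / powR tau p)%:E * \int[leb]_x `|(blkG k x)%:E|)%E.
  apply: le_trans (maximal_inequality (blkG_locint k) tp).
  by apply: le_measure; rewrite ?inE//; apply: subIsetr.
have cw : (0 <= (c4 * weight nu (pw k.+1))%:E)%E by rewrite lee_fin mulr_ge0.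
apply: (le_trans (lee_wpmul2l cw hS)).
have h := blkG_int k.
have -> : ((c4 * weight nu (pw k.+1))%:E * ((3 / powR tau p)%:E * \int[leb]_x `|(blkG k x)%:E|) =
   (c4 * (3 / powR tau p))%:E * ((weight nu (pw k.+1))%:E * \int[leb]_x `|(blkG k x)%:E|))%E.
  by rewrite !muleA -!EFinM; congr (_%:E * _)%E; ring.
have c3 : (0 <= (c4 * (3 / powR tau p))%:E)%E by rewrite lee_fin !mulr_ge0 ?invr_ge0 ?(ltW tp).
apply: (le_trans (lee_wpmul2l c3 h)); rewrite muleA -EFinM.
by have -> : c4 * (3 / powR tau p) * c4 = 3 * c4 ^+ 2 / powR tau p by ring.
Qed.

Lemma blk_cover x : 0 < x < 1 -> exists k, blk k x.
Proof.
move=> /andP[x0 x1].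
have ex : exists k, pw k.+1 <= x.
  exists (Num.bound x^-1); rewrite -[leRHS]invrK lef_pV2 ?posrE ?exprn_gt0 ?invr_gt0// ltW//.
  by apply: upper_nthrootP.
have [k hk mink] := ex_minnP ex; exists k; split; first by rewrite /= in_itv/= x0.
rewrite /= hk /=; case: k hk mink => [|k] hk mink; first by rewrite expr0 invr1.
by rewrite ltNge; apply/negP => /mink; rewrite ltnn.
Qed.

(** The blocks are disjoint and cover []0, 1[], and their enlargements overlap three times, so the
    bounds of [blk_part] add up. *)
Lemma local_part tau (A : set R) : 0 < tau -> measurable A -> A `<=` I01 ->
  (forall x k, A x -> blk k x -> ((powR tau p)%:E < HL_maximal (blkG k) x)%E) ->
  (\int[leb]_(x in A) (weight nu x)%:E <= (9 * c4 ^+ 2 * (powR th p / powR tau p))%:E)%E.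
Proof.
move=> tau0 mA AI hA; have tp : 0 < powR tau p by nng.
pose S k : set R := blk k `&` [set x | ((powR tau p)%:E < HL_maximal (blkG k) x)%E].
have mS k : measurable (S k).
  apply: measurableI => //; rewrite -[X in measurable X]setTI; apply: emeasurable_fun_o_infty => //.
  by apply: measurable_HL_maximal; exact: blkG_locint.
have AS : A `<=` \bigcup_k S k.
  move=> x Ax; have := AI x Ax; rewrite /= in_itv/= => hx.
  by have [k hk] := blk_cover hx; exists k => //; split => //; exact: hA.
have mw (D : set R) : measurable_fun D (EFin \o weight nu) by apply: measurable_funTS; exact: weight_measurable.
apply: (@le_trans _ _ (\int[leb]_(x in \bigcup_k S k) (weight nu x)%:E)%E).
  by apply: (int_sub mA (bigcup_measurable (fun k _ => mS k)) (mw _)) => // x; rewrite lee_fin.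
have tS : trivIset setT S.
  apply/trivIsetP => i j _ _ ij.
  have dis (a1 a2 : nat) : (a1 < a2)%N -> S a1 `&` S a2 = set0.
    move=> ab; apply/seteqP; split => // x [[[_ /= /andP[h1 h2]] _] [[_ /= /andP[h3 h4]] _]].
    have : pw a2 <= pw a1.+1 by rewrite lef_pV2 ?posrE ?exprn_gt0// ler_weXn2l// ler1n.
    by move=> /(lt_le_trans h4) /(fun h => lt_le_trans h h1); rewrite ltxx.
  case: (ltngtP i j) => h; [exact: dis|by rewrite setIC; exact: dis|].
  by move: ij; rewrite h eqxx.
have w0 x : (\bigcup_k S k) x -> (0 <= (EFin \o weight nu) x)%E by rewrite lee_fin.
rewrite (@ge0_integral_bigcup _ _ _ leb S (EFin \o weight nu) mS (mw _) w0 tS).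
apply: lime_le; first by apply: is_cvg_nneseries => k _ _; apply: integral_ge0 => x _; rewrite lee_fin.
apply: nearW => m.
have c0 : 0 <= 3 * c4 ^+ 2 / powR tau p by apply: divr_ge0; [apply: mulr_ge0 => //; exact: sqr_ge0|exact: ltW].
apply: (@le_trans _ _ ((3 * c4 ^+ 2 / powR tau p)%:E * \sum_(0 <= k < m) \int[leb]_(x in blk3 k) F x)%E).
  rewrite ge0_sume_distrr => [|k _]; last exact: integral_ge0.
  by apply: lee_sum => k _; exact: blk_part.
apply: (le_trans (lee_wpmul2l _ (blk3_sum m))); first by rewrite lee_fin.
by rewrite -EFinM lee_fin; apply: eq_ler; ring.
Qed.

End Blocks.
End LevelSets.

(** * The weak-type inequality *)

Section WeakType.
Context {R : realType}.
Variables (nu delta : R) (s : nat -> R).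
Hypothesis Hnu : -1 < nu.
Hypothesis delta0 : 0 < delta.
Hypothesis Hz : bessel_zeros nu s.
Implicit Types (x y t r tau th lam b : R) (f : R -> R) (i j k m N : nat).
Local Notation leb := (@lebesgue_measure R).
Local Notation I01 := (`]0, 1[%classic : set R).
Local Notation ps := (psi nu s).
Local Notation wi g := (leb.-integrable I01 (EFin \o (fun x : R => g x * weight nu x))).
Local Notation kap := (nu + 1 / 2).

Let n1 : 0 < 2 * nu + 2. Proof. by move: Hnu; lra. Qed.
Let w_ge0 x : 0 <= weight nu x. Proof. exact: powR_ge0. Qed.
Let mI : measurable I01. Proof. exact: measurable_itv. Qed.

Lemma psi_BC j : BC (ps j).
Proof.
have h x : 0 < x -> der (ps j) x (0 * ph nu (s j ^+ 2) x + cj nu s j * ph1 nu (s j ^+ 2) x).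
  move=> x0; apply: (@der_congr_lt _ (fun x => cj nu s j * ph nu (s j ^+ 2) x) (ps j) x _ 0 x0).
    by move=> t t0; rewrite psiE.
  exact: derM (der_cst _ x) (ph_der _ x Hnu).
split; first by move=> x x0; exact: der_cont (h x x0).
have [_ [B hB]] := BC_Z (cj nu s j) (ph_BC Hnu (s j ^+ 2)).
by exists B => x hx; have [x0 _] := andP hx; rewrite psiE//; exact: hB.
Qed.

Lemma zeros_large r : exists N, forall j, (N <= j)%N -> r <= s j.
Proof.
have [c [_ [c0 _ slin _ _]]] := zeros_facts Hnu Hz.
exists (Num.bound (`|r| / c)) => j Nj; apply: le_trans (slin j).
apply: (le_trans (ler_norm r)); rewrite mulrC -ler_pdivrMr// ltW//.
apply: (lt_le_trans (archi_boundP _)); first by nng.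
by rewrite ler_nat; exact: leq_trans Nj _.
Qed.

(** The defining series is a finite sum, since the multiplier vanishes at every zero beyond [r]. *)
Lemma BR_sum r N f x : 0 < r -> (forall j, (N <= j)%N -> r <= s j) ->
  BR nu delta s r f x = \sum_(0 <= j < N) riesz delta r (s j) * coef nu s f j * ps j x.
Proof.
move=> r0 hN; rewrite /BR; apply: cvg_lim => //.
apply: cvg_near_cst; near=> M.
have NM : (N <= M)%N by near: M; exact: nbhs_infty_ge.
rewrite /series /= (big_cat_nat (n := N) (p := M))//= [X in _ + X]big_nat_cond [X in _ + X]big1 ?addr0.
  by apply: eq_bigr => j _; rewrite /riesz expr_div_n.
move=> j /andP[/andP[Nj _] _]; have := riesz_out delta0 r0 (hN j Nj); rewrite /riesz expr_div_n => ->.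
by rewrite !mul0r.
Unshelve. all: by end_near.
Qed.

Lemma wi_sum (F : nat -> R -> R) N : (forall k, wi (F k)) ->
  wi (fun y => \sum_(0 <= k < N) F k y) /\ wint nu (fun y => \sum_(0 <= k < N) F k y) = \sum_(0 <= k < N) wint nu (F k).
Proof.
move=> h; elim: N => [|N [ih1 ih2]].
  have key T : T = (fun y => 0 * F 0%N y) -> wi T /\ wint nu T = 0.
    by move=> ->; split; [exact: wiZ (h 0%N)|rewrite (wintZ _ (h 0%N)) mul0r].
  by rewrite [RHS]big_nil; apply: key; apply/funext => y; rewrite big_nil mul0r.
have key T : T = (fun y => \sum_(0 <= k < N) F k y + F N y) -> wi T /\ wint nu T = \sum_(0 <= k < N) wint nu (F k) + wint nu (F N).
  by move=> ->; split; [exact: wiD ih1 (h N)|rewrite (wintD ih1 (h N)) ih2].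
by rewrite [RHS]big_nat_recr//=; apply: key; apply/funext => y; rewrite big_nat_recr.
Qed.

Definition kern r N x y := \sum_(0 <= j < N) riesz delta r (s j) * (ps j x * ps j y).

Lemma BR_kern r N f x : wi (fun y => `|f y|) -> measurable_fun I01 f -> 0 < r ->
  (forall j, (N <= j)%N -> r <= s j) ->
  wi (fun y => f y * kern r N x y) /\ BR nu delta s r f x = wint nu (fun y => f y * kern r N x y).
Proof.
move=> hf mf r0 hN.
have hj j : wi (fun y => f y * ps j y).
  have [cp [B hB]] := psi_BC j.
  apply: (@wi_dom _ nu _ (fun y => B * `|f y|)); last exact: wiZ.
    by apply: measurable_funM => //; exact: posc_measurable.
  by move=> y hy; rewrite normrM mulrC ler_wpM2r// hB.
have hk j : wi (fun y => riesz delta r (s j) * ps j x * (f y * ps j y)) by exact: wiZ.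
have [h1 h2] := wi_sum N hk.
have key T : T = (fun y => \sum_(0 <= j < N) riesz delta r (s j) * ps j x * (f y * ps j y)) -> wi T /\ BR nu delta s r f x = wint nu T.
  move=> ->; split => //; rewrite h2 (BR_sum f x r0 hN).
  by apply: eq_bigr => j _; rewrite (wintZ _ (hj j)) mulrAC.
by apply: key; apply/funext => y; rewrite /kern mulr_sumr; apply: eq_bigr => j _; ring.
Qed.

Variables (d p : R).
Hypothesis d0 : 0 < d.
Hypothesis dd : d <= delta.
Hypothesis Hp : (kap <= 0 /\ p = 1) \/ [/\ 0 < kap, d <= kap & p = (2 * nu + 2) / (kap + 1 + d)].

(** The decay exponent [delta] of the kernel is weakened to [d], the one from which [p] is computed.
    The off-diagonal part is integrated by [tt_int], the local part is left for the maximal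
    function. *)
Lemma BR_bound : exists2 C, 0 < C & forall f th r x, 0 < th -> Lpb nu p f th -> 0 < r -> 0 < x < 1 ->
  (`|BR nu delta s r f x|%:E <= (C * powR x (- ((2 * nu + 2) / p)) * th)%:E +
     C%:E * \int[leb]_(y in I01) (loc d r x y * `|f y|)%:E)%E.
Proof.
have [C1 C10 hK] := kernel_bound Hnu delta0 Hz.
have [C2 C20 hS] := kernel_split Hnu d0 Hp.
have [C3 C30 hT] := tt_int Hnu d0 Hp.
have C12 : 0 < C1 * C2 by nng.
exists (C1 * C2 * (1 + C3)) => [|f th r x th0 hf r0 hx]; first by nng.
have [x0 x1] := andP hx; have [mf _ _] := hf; have hf1 := Lpb_wi Hnu d0 Hp hf.
have [N hN] := zeros_large r.
have [hk ->] := BR_kern x hf1 mf r0 hN.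
have [htw hti] := hT r x f th r0 x0 th0 hf.
set X := powR x _.
have X0 : 0 <= X by exact: powR_ge0.
rewrite /wint EFin_normr_Rintegral//.
have mk : measurable_fun I01 (fun y => (f y * kern r N x y * weight nu y)%:E) by exact: measurable_int hk.
apply: (le_trans (le_abse_integral leb mI mk)).
have mt : measurable_fun I01 (fun y => (tt nu d r x y * `|f y| * weight nu y)%:E) by exact: measurable_int htw.
have ml : measurable_fun I01 (fun y => (loc d r x y * `|f y|)%:E).
  apply/measurable_EFinP; apply: measurable_funM; first exact: measurable_funTS (loc_measurable d r x).
  exact: measurableT_comp.
have tt0 y : 0 <= tt nu d r x y.
  by rewrite /tt; case: ifP => // _; rewrite addr_ge0 ?tr_ge0.
have t0 y : (0 <= (tt nu d r x y * `|f y| * weight nu y)%:E)%E by rewrite lee_fin !mulr_ge0.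
have l0 y : (0 <= (loc d r x y * `|f y|)%:E)%E by rewrite lee_fin mulr_ge0// loc_ge0.
have c0 : 0 <= C1 * C2 * X by nng.
have mt' := measurable_funeM (C1 * C2 * X)%:E mt.
have ml' := measurable_funeM (C1 * C2)%:E ml.
apply: (@le_trans _ _ (\int[leb]_(y in I01) ((C1 * C2 * X)%:E * (tt nu d r x y * `|f y| * weight nu y)%:E + (C1 * C2)%:E * (loc d r x y * `|f y|)%:E))%E).
  apply: int_le => //.
  - exact: measurableT_comp.
  - exact: emeasurable_funD.
  move=> y; rewrite /= in_itv/= => hy; have [y0 y1] := andP hy.
  change (`|f y * kern r N x y * weight nu y|%:E <= (C1 * C2 * X * (tt nu d r x y * `|f y| * weight nu y) + C1 * C2 * (loc d r x y * `|f y|))%:E)%E.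
  rewrite lee_fin 2!normrM [`|weight _ _|]ger0_norm// -mulrA.
  have k0 : 0 <= r * kw nu r x y by rewrite mulr_ge0 ?(ltW r0)// kw_mx// mulr_ge0 ?powR_ge0.
  have h1 : `|kern r N x y| <= C1 * (r * kw nu r x y * dec d r `|x - y|).
    apply: (le_trans (hK r x y N r0 hx hy hN)); rewrite ler_wpM2l ?(ltW C10)// ler_wpM2l// /dec.
    by apply: ler_powR; [rewrite lerDl mulr_ge0// ltW|rewrite lerN2 lerD2l].
  have h2 := hS r x y r0 x0 y0.
  have h3 : `|kern r N x y| * weight nu y <= C1 * (C2 * (X * (tt nu d r x y * weight nu y) + loc d r x y)).
    by apply: (le_trans (ler_wpM2r (w_ge0 y) h1)); rewrite -[leLHS]mulrA; apply: ler_wpM2l; [exact: ltW|exact: h2].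
  apply: (le_trans (ler_wpM2l (normr_ge0 _) h3)).
  by apply: eq_ler; ring.
rewrite ge0_integralD//; last 2 first.
- by move=> y _; rewrite mule_ge0// lee_fin.
- by move=> y _; rewrite mule_ge0// lee_fin ltW.
rewrite (int_Z mI mt t0 c0) (int_Z mI ml l0 (ltW C12)) wint_EFin//.
apply: leeD.
  rewrite -EFinM lee_fin.
  apply: (le_trans (ler_wpM2l c0 hti)).
  have -> : C1 * C2 * (1 + C3) * X * th = C1 * C2 * X * (C3 * th) + C1 * C2 * X * th by ring.
  by rewrite lerDl mulr_ge0// ltW.
apply: lee_wpmul2r; first by apply: integral_ge0 => y _.
by rewrite lee_fin ler_peMr ?(ltW C12)// lerDl ltW.
Qed.

Definition level f lam : set R := [set x | 0 < x < 1 /\ exists2 r, 0 < r & lam < `|BR nu delta s r f x|].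

(** The supremum runs over uncountably many [r]; measurability is obtained because for each [r] the
    mean is a finite sum of continuous functions of [x]. *)
Lemma level_open f lam : open (level f lam).
Proof.
rewrite openE => x [hx [r r0 hl]]; have [x0 x1] := andP hx.
have [N hN] := zeros_large r.
have cF : {for x, continuous (fun x => `|\sum_(0 <= j < N) riesz delta r (s j) * coef nu s f j * ps j x|)}.
  have bF : BC (fun x => \sum_(0 <= j < N) riesz delta r (s j) * coef nu s f j * ps j x).
    by have [] := @BC_sum _ nu Hnu _ (index_iota 0 N) (fun j x => riesz delta r (s j) * coef nu s f j * ps j x) (fun j => BC_Z _ (psi_BC j)).
  exact: (cvg_norm (bF.1 x x0)).
rewrite /= in hl; rewrite (BR_sum f x r0 hN) in hl.
have h := cvgr_gt _ cF lam hl.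
near=> t; split; last first.
  by exists r => //; rewrite (BR_sum f t r0 hN); near: t; exact: h.
apply/andP; split; near: t; [exact: lt_nbhsr|exact: lt_nbhsl].
Unshelve. all: by end_near.
Qed.

Lemma level_measurable f lam : measurable (level f lam).
Proof. by apply: open_measurable; exact: level_open. Qed.

Lemma Bmax_level f lam : 0 < lam ->
  (I01 `&` [set x | (lam%:E < `|Bmax nu delta s f x|)%E]) `&` I01 = level f lam.
Proof.
move=> lam0; apply/seteqP; split => x /=.
  move=> [[+ h] _]; rewrite in_itv/= => hx; split => //.
  have B0 : (0 <= Bmax nu delta s f x)%E.
    apply: ereal_sup_ge; exists (`|BR nu delta s 1 f x|)%:E; last by rewrite lee_fin.
    by exists 1 => //=; rewrite in_itv/= ltr01.
  rewrite gee0_abs// in h; have [_ [r /= + <-] hr] := ereal_sup_gt h.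
  by rewrite in_itv/= andbT => r0; exists r.
move=> [hx [r r0 hl]]; rewrite in_itv/= hx; split => //; split => //.
apply: (@lt_le_trans _ _ (`|BR nu delta s r f x|)%:E); first by rewrite lte_fin.
apply: le_trans (lee_abs _); apply: ereal_sup_ubound; exists r => //=.
by rewrite in_itv/= r0.
Qed.

Theorem weak_type : exists2 C, 0 < C & forall f th lam, 0 < th -> Lpb nu p f th -> 0 < lam ->
  (\int[leb]_(x in level f lam) (weight nu x)%:E <= (C * powR (th / lam) p)%:E)%E.
Proof.
have [C C0 hB] := BR_bound; have [K K0 hK] := local_bound d0.
have p1 := p_ge1 d0 Hp; have p0 : 0 < p by exact: lt_le_trans p1.
pose c4 := powR 4 `|2 * nu + 1| : R.
have c40 : 0 < c4 by nng.
pose D1 := 4 / (2 * nu + 2) * powR (2 * C) p; pose D2 := 9 * c4 ^+ 2 * powR (2 * (C * K)) p.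
have C2 : 0 < 2 * C by nng.
have CK : 0 < 2 * (C * K) by nng.
have D10 : 0 < D1 by nng.
have D20 : 0 < D2 by nng.
exists (D1 + D2) => [|f th lam th0 hf lam0]; first exact: addr_gt0.
have tl : 0 < th / lam by nng.
have n0 : 0 < 2 * nu + 2 := n1; set n := 2 * nu + 2 in n0 hB *.
(* At [x = b] the off-diagonal bound [C x^-(n / p) th] equals [lam / 2]; below [b] the measure of
   the interval is enough, above it that bound is at most [lam / 2]. *)
pose b := powR (2 * C * (th / lam)) (p / n).
have Ctl : 0 < 2 * C * (th / lam) by nng.
have b0 : 0 < b by nng.
have bn : powR b n = powR (2 * C) p * powR (th / lam) p.
  by rewrite /b -powRrM divfK ?gt_eqF// (@powRM _ (2 * C) (th / lam)) ?(ltW C2) ?(ltW tl).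
have bnp : powR b (- (n / p)) = (2 * C * (th / lam))^-1.
  rewrite powRN /b -powRrM; congr (_^-1).
  have -> : p / n * (n / p) = 1 by rewrite mulrA divfK ?gt_eqF// mulfV// gt_eqF.
  by rewrite powRr1// ltW.
(* With this value the local bound is [C * (K * tau) = lam / 2], so above [b] the level [lam] is
   exceeded only where the maximal function is larger than [tau^p]. *)
pose tau := lam / (2 * (C * K)).
have tau0 : 0 < tau by nng.
have ttau : powR th p / powR tau p = powR (2 * (C * K)) p * powR (th / lam) p.
  have -> : powR th p / powR tau p = powR (th / tau) p.
    rewrite powRM ?invr_ge0 ?(ltW th0) ?(ltW tau0)//; congr (_ * _).
    by rewrite -(powR_inv1 (ltW tau0)) -powRrM mulN1r powRN.
  rewrite -powRM ?(ltW CK) ?(ltW tl)//; congr powR; rewrite /tau; field.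
  by rewrite !gt_eqF.
set E := level f lam.
have mE : measurable E := level_measurable f lam.
have EI : E `<=` I01 by move=> x [hx _]; rewrite /= in_itv/=.
have mb : measurable [set x : R | x < b] by rewrite -set_itvNyo; exact: measurable_itv.
have m1 := measurableI _ _ mE mb; have m2 := measurableD mE mb.
have mw (D : set R) : measurable_fun D (EFin \o weight nu) by apply: measurable_funTS; exact: weight_measurable.
have w0 x : (0 <= (EFin \o weight nu) x)%E by rewrite lee_fin.
have EE : E = (E `&` [set x | x < b]) `|` (E `\` [set x | x < b]) by rewrite setUIDK.
rewrite EE.
have dj : [disjoint E `&` [set x | x < b] & E `\` [set x | x < b]].
  by apply/disj_set2P; apply/seteqP; split => // x [[_ h1] [_ h2]].
rewrite (ge0_integral_setU leb m1 m2 (mw _) (fun x _ => w0 x) dj).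
rewrite mulrDl EFinD; apply: leeD.
  apply: le_trans (_ : (4 / n * powR b n)%:E <= _)%E; last by rewrite lee_fin bn /D1 mulrA.
  apply: le_trans (small_part Hnu b0).
  apply: (int_sub m1 (measurableI _ _ mI mb) (mw _) w0).
  by move=> x [xE xb]; split => //; exact: EI.
have -> : D2 * powR (th / lam) p = 9 * c4 ^+ 2 * (powR th p / powR tau p) by rewrite ttau /D2; ring.
apply: (local_part hf tau0 m2).
  by move=> x [xE _]; exact: EI.
(* The inequality is independent of [r]: the same [tau] serves whichever [r] puts [x] in the level
   set. *)
move=> x k [[hx [r r0 hl]] /= xb] [_ /= /andP[xk1 xk2]]; have [x0 x1] := andP hx.
have bx : b <= x by rewrite leNgt; apply/negP.
rewrite ltNge; apply/negP => hH.
have [mf _ _] := hf.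
have hl2 := hK r x tau p f (blkG p f k) r0 hx tau0 p1 mf (blkG_measurable hf k) (@blkG_ge0 _ p f k) _ hH.
have {hl2} : (\int[leb]_(y in I01) (loc d r x y * `|f y|)%:E <= (K * tau)%:E)%E.
  apply: hl2 => y hy xy yx; rewrite /blkG patchE ifT// inE /blk3; split; first by rewrite /= in_itv/=.
  move: xk1 xk2 => /=; rewrite (exprS 2 k.+1) (exprS 2 k) !invfM => xk1 xk2.
  by apply/andP; split; lra.
move=> hl2.
have h1 := hB f th r x th0 hf r0 hx.
have C0' : (0 <= C%:E)%E by rewrite lee_fin ltW.
have h2 := le_trans h1 (leeD2l _ (lee_wpmul2l C0' hl2)).
have : `|BR nu delta s r f x| <= C * powR x (- (n / p)) * th + C * (K * tau) by rewrite -lee_fin.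
apply/negP; rewrite -ltNge; apply: le_lt_trans hl.
have h3 : powR x (- (n / p)) <= (2 * C * (th / lam))^-1.
  by rewrite -bnp; apply: powR_leN => //; rewrite oppr_le0 divr_ge0 ?ltW.
have h4 : C * powR x (- (n / p)) * th <= lam / 2.
  have -> : lam / 2 = C * (2 * C * (th / lam))^-1 * th by field; rewrite !gt_eqF.
  by rewrite ler_wpM2r ?(ltW th0)// ler_wpM2l ?(ltW C0).
have h5 : C * (K * tau) = lam / 2 by rewrite /tau; field; rewrite !gt_eqF.
by rewrite h5; lra.
Qed.

End WeakType.

Theorem theorem3 (R : realType) (nu delta : R) (s : nat -> R) :
  -1 < nu -> 0 < delta -> bessel_zeros nu s ->
  exists C : R, forall f : R -> R,
    measurable_fun (`]0%R, 1%R[ : set R) f ->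
    (Lp_norm nu (p0 nu delta) f < +oo)%E ->
    (weakL_norm nu (p0 nu delta) (Bmax nu delta s f)
       <= C%:E * Lp_norm nu (p0 nu delta) f)%E.
Proof.
move=> Hnu delta0 Hz; set p := p0 nu delta.
(* [d] is [delta], except for [delta > nu + 1 / 2 > 0], where [d = nu + 1 / 2] makes the formula for
   [p] give [1]. In the remaining case with [nu > - 1 / 2] it agrees with the exponent of the
   statement after cancelling a factor [2]. *)
have [d [d0 dd Hp]] : exists d, [/\ 0 < d, d <= delta &
    (nu + 1 / 2 <= 0 /\ p = 1) \/ [/\ 0 < nu + 1 / 2, d <= nu + 1 / 2 & p = (2 * nu + 2) / (nu + 1 / 2 + 1 + d)]].
  rewrite /p /p0; have [k0|k0] := leP (nu + 1 / 2) 0.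
    exists delta; split => //; left; split => //.
    by rewrite (_ : nu <= - (1 / 2)) ?orbT//; lra.
  rewrite (_ : (nu <= - (1 / 2)) = false) ?orbF; last by apply/negbTE; rewrite -ltNge; lra.
  have [kd|kd] := ltP (nu + 1 / 2) delta.
    exists (nu + 1 / 2); split => //; first exact: ltW.
    right; split => //; have -> : nu + 1 / 2 + 1 + (nu + 1 / 2) = 2 * nu + 2 by lra.
    by rewrite mulfV// gt_eqF//; lra.
  exists delta; split => //; right; split => //.
  have -> : 2 * nu + 3 + 2 * delta = 2 * (nu + 1 / 2 + 1 + delta) by lra.
  have q0 : 0 < nu + 1 / 2 + 1 + delta by lra.
  by apply: (mulIf (lt0r_neq0 q0)); rewrite divfK ?gt_eqF// invfM mulrA divfK ?gt_eqF//; lra.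
have p1 : 1 <= p := p_ge1 d0 Hp; have pp : 0 < p by exact: lt_le_trans p1.
have pi0 : 0 < p^-1 by nng.
have [C C0 hC] := weak_type Hnu delta0 Hz d0 dd Hp.
pose C' := powR C p^-1; have C'0 : 0 < C' by nng.
exists C' => f mf hfin.
have wge0 x : 0 <= weight nu x by exact: powR_ge0.
set I := (\int[lebesgue_measure]_(x in `]0%R, 1%R[) (powR `|f x| p * weight nu x)%:E)%E in hfin *.
have I0 : (0 <= I)%E by apply: integral_ge0 => x _; rewrite lee_fin mulr_ge0 ?powR_ge0.
have Ioo : (I < +oo)%E by apply: lty_poweRy hfin; rewrite gt_eqF.
have mfp : measurable_fun (`]0%R, 1%R[ : set R) (fun x => powR `|f x| p * weight nu x).
  apply: measurable_funM; first exact: normpow_measurable.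
  by apply: measurable_funTS; apply/measurable_EFinP; exact: weight_measurable.
have hw : lebesgue_measure.-integrable (`]0%R, 1%R[ : set R) (EFin \o (fun x : R => powR `|f x| p * weight nu x)).
  apply/integrableP; split; first exact/measurable_EFinP.
  apply: le_lt_trans Ioo; apply: ge0_le_integral => //.
  - by apply: measurableT_comp => //; exact/measurable_EFinP.
  - exact/measurable_EFinP.
  by move=> x _ /=; rewrite lee_fin ger0_norm// mulr_ge0 ?powR_ge0.
have IE : I = (wint nu (fun x => powR `|f x| p))%:E by rewrite /I wint_EFin.
set N := wint nu _ in IE; have N0 : 0 <= N by rewrite -lee_fin -IE.
have LE : Lp_norm nu p f = (powR N p^-1)%:E by rewrite /Lp_norm -/I IE poweR_EFin.
rewrite LE; apply: ge_ereal_sup => _ /= [lam + <-]; rewrite in_itv/= andbT => lam0.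
(* The estimate asks for a positive bound [th] of the norm, so the norm, possibly zero, is enlarged
   by [e / C'], which adds [e] to the final bound. *)
apply/lee_addgt0Pr => e e0; pose th := powR N p^-1 + e / C'.
have th0 : 0 < th by rewrite ltr_wpDl ?powR_ge0// divr_gt0.
have hf : Lpb nu p f th.
  split => //; rewrite -/N.
  have {1}-> : N = powR (powR N p^-1) p by rewrite -powRrM mulVf ?gt_eqF// powRr1.
  by apply: powR_le; rewrite ?(ltW pp) ?powR_ge0// lerDl divr_ge0// ltW.
have hl := hC f th lam th0 hf lam0.
rewrite /mu_nu Bmax_level//.
set J := (\int[_]_(x in _) _)%E.
have J0 : (0 <= J)%E by apply: integral_ge0 => x _; rewrite lee_fin.
have Jle : (J <= (C * powR (th / lam) p)%:E)%E := hl.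
have hp : (poweR J p^-1 <= (C' * (th / lam))%:E)%E.
  have -> : (C' * (th / lam))%:E = poweR (C * powR (th / lam) p)%:E p^-1.
    by rewrite poweR_EFin (@powRM _ C (powR (th / lam) p)) ?powR_ge0 ?(ltW C0)// -powRrM mulfV ?gt_eqF// powRr1// divr_ge0// ltW.
  have K0 : (0 <= (C * powR (th / lam) p)%:E)%E by rewrite lee_fin mulr_ge0 ?powR_ge0 ?(ltW C0).
  by apply: (gt0_ler_poweR (ltW pi0) _ _ Jle); rewrite in_itv/= leey andbT.
apply: (le_trans (lee_wpmul2l _ hp)); first by rewrite lee_fin ltW.
rewrite -!EFinM -EFinD lee_fin; apply: eq_ler; rewrite /th; field; rewrite !gt_eqF//.
Qed.
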